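(* For every $j \in \mathbf{Z}$ and every $u \in \mathbf{Z}_p$ we have $\mathrm{D}_j(u) = \mathrm{D}(V_j(j+(p+1)u))$.
   Context: Let $p$ be a prime. Let $\chi_2 : \operatorname{Gal}(\overline{\mathbf{Q}}_p/\mathbf{Q}_{p^2}) \to \mathbf{Z}_{p^2}^\times$ be the character associated to the Lubin–Tate module over $\mathbf{Z}_{p^2}$ for the uniformizer $p$, and let $\mathbf{Q}_{p^2}^{\mathrm{LT}}$ be the fixed field of its kernel; then $\operatorname{Gal}(\mathbf{Q}_{p^2}^{\mathrm{LT}}/\mathbf{Q}_p) \cong \mathbf{Z}_{p^2}^\times \rtimes \mathbf{Z}/2\mathbf{Z}$, where $\mathbf{Z}/2\mathbf{Z}$ acts through the absolute Frobenius $\sigma$ of $\mathbf{Z}_{p^2}$. Every $x \in \mathbf{Z}_{p^2}^\times$ is uniquely $x = \omega(x)\langle x\rangle$ with $\omega(x)^{p^2-1}=1$ and $\langle x\rangle \in 1+p\mathbf{Z}_{p^2}$. For $r \in \mathbf{Z}/(p^2-1)\mathbf{Z}$ and $s \in \mathbf{Z}_p$ let $\eta_{r,s}(x) = \omega(x)^r\langle x\rangle^s$, where $\langle x\rangle^s = \sum_{k\ge 0}\binom{s}{k}(\langle x\rangle-1)^k$. Fix $d$ with $\mathbf{Z}_{p^2}=\mathbf{Z}_p[\sqrt d]$ and the homomorphism $\mathbf{Z}_{p^2}^\times \rtimes \mathbf{Z}/2\mathbf{Z} \to \mathrm{GL}_2(\mathbf{Z}_p)$ given by $(x+y\sqrt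 d,0)\mapsto \begin{pmatrix} x & dy\\ y & x\end{pmatrix}$, $(x+y\sqrt d,1)\mapsto \begin{pmatrix} x & -dy\\ y & -x\end{pmatrix}$. Composing $\chi_2$ and $\eta_{r,s}$ with it gives $\rho_{r,s} : \operatorname{Gal}(\overline{\mathbf{Q}}_p/\mathbf{Q}_p) \to \mathrm{GL}_2(\mathbf{Z}_p)$ with underlying module $T_r(s)$; put $V_r(s) = \mathbf{Q}_p \otimes_{\mathbf{Z}_p} T_r(s)$. Let $\mathcal{R}$ be the Robba ring over $\mathbf{Q}_p$ (Laurent series $\sum_{k\in\mathbf{Z}} a_kX^k$, $a_k\in\mathbf{Q}_p$, converging on some annulus $r<|X|_p<1$), with $\varphi(f)(X)=f((1+X)^p-1)$ and the action of $\Gamma=\operatorname{Gal}(\mathbf{Q}_p(\mu_{p^\infty})/\mathbf{Q}_p)$ given by $\gamma(f)(X)=f((1+X)^{\chi(\gamma)}-1)$, $\chi$ the cyclotomic character; $\mathcal{O}_{\mathcal{E}}^\dagger \subset \mathcal{R}$ is the subring of series with all $|a_k|_p\le 1$. For $y\in\mathbf{Z}_p^\times$, $\langle y\rangle = y/\omega(y)\in 1+p\mathbf{Z}_p$. Let $Q=\varphi(X)/X$, $Q_2=\varphi(Q)$. For $\gamma\in\Gamma$, let $f_\gamma \in 1+X\mathbf{Z}_p[[X]]$ and $g_\gamma\in 1+pX\mathbf{Z}_p[[X]]$ be the unique series with $\varphi^2(f_\gamma)/f_\gamma = \gamma(Q_2)/Q_2$ and $\varphi^2(g_\gamma)/g_\gamma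 = \gamma(Q_2/Q^p)/(Q_2/Q^p)$. For $j\in\mathbf{Z}$, $u\in\mathbf{Z}_p$, $\mathrm{D}^0_j(u) = \mathcal{O}_{\mathcal{E}}^\dagger e\oplus \mathcal{O}_{\mathcal{E}}^\dagger f$ is the $(\varphi,\Gamma)$-module with $\operatorname{Mat}(\varphi)=\begin{pmatrix}0&1\\ Q_2^j(Q_2/Q^p)^u&0\end{pmatrix}$ and $\operatorname{Mat}(\gamma) = \operatorname{diag}\big(\chi(\gamma)^j\langle\chi(\gamma)\rangle^u\varphi(f_\gamma^jg_\gamma^u),\ \chi(\gamma)^j\langle\chi(\gamma)\rangle^u f_\gamma^jg_\gamma^u\big)$, and $\mathrm{D}_j(u) = \mathcal{R}\otimes_{\mathcal{O}_{\mathcal{E}}^\dagger}\mathrm{D}^0_j(u)$. Finally $V\mapsto \mathrm{D}(V)$ denotes the functor (Fontaine, Cherbonnier–Colmez, Kedlaya) attaching to a $p$-adic representation its étale $(\varphi,\Gamma)$-module over $\mathcal{R}$. *)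

(* Defs.v *)
From HB Require Import structures.
From mathcomp Require Import all_boot all_order all_algebra.
From mathcomp Require Import zify ring lra.
From mathcomp Require Import all_classical all_reals all_analysis.
Set Implicit Arguments.
Unset Strict Implicit.
Unset Printing Implicit Defensive.
Import Order.TTheory GRing.Theory Num.Theory.
Import numFieldNormedType.Exports.
Local Open Scope classical_set_scope.
Local Open Scope ring_scope.

(* Complete ultrametric fields, normalised by |p| = 1/p *)
Record padicField (R : realType) (p : nat) := PadicField {
  pf_sort :> fieldType;
  pnorm : pf_sort -> R;
  pnorm_ge0 : forall x, 0 <= pnorm x;
  pnorm_eq0 : forall x, (pnorm x == 0) = (x == 0);
  pnormM : forall x y, pnorm (x * y) = pnorm x * pnorm y;
  pnormD : forall x y, pnorm (x + y) <= Num.max (pnorm x) (pnorm y);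
  pnorm_p : pnorm p%:R = p%:R^-1;
  pnorm_complete : forall v : nat -> pf_sort,
    (forall e : R, 0 < e ->
       exists M, forall m n, (M <= m)%N -> (M <= n)%N -> pnorm (v m - v n) < e) ->
    exists l, (fun n => pnorm (v n - l)) @ \oo --> (0 : R)
}.

Section Ultrametric.
Context {R : realType} {p : nat} {F : padicField R p}.
Implicit Types (x y : F) (v : nat -> F) (f g : int -> F).

Definition tends v x := (fun n => pnorm (v n - x)) @ \oo --> (0 : R).
Definition ulim v : F := xget 0 [set x | tends v x].

Lemma tendsP v x : tends v x <->
  (forall e : R, 0 < e -> exists M, forall n, (M <= n)%N -> pnorm (v n - x) < e).
Proof.
split=> [/cvgrPdist_lt h e e0|h].
  have [M _ hM] := h e e0; exists M => n Mn.
  by have := hM n Mn; rewrite /= sub0r normrN ger0_norm ?pnorm_ge0.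
apply/cvgrPdist_lt => e e0; have [M hM] := h e e0.
by exists M => // n Mn /=; rewrite sub0r normrN ger0_norm ?pnorm_ge0 ?hM.
Qed.

Lemma pnorm0 : pnorm (0 : F) = 0.
Proof. by apply/eqP; rewrite pnorm_eq0. Qed.

Lemma pnorm1 : pnorm (1 : F) = 1.
Proof.
have h := pnormM (1 : F) 1; rewrite mulr1 in h.
have n0 : pnorm (1 : F) != 0 by rewrite pnorm_eq0 oner_eq0.
by apply: (mulfI n0); rewrite mulr1 -h.
Qed.

Lemma pnormN x : pnorm (- x) = pnorm x.
Proof.
have h : pnorm (-1 : F) = 1.
  have : pnorm (-1 : F) ^+ 2 = 1 by rewrite expr2 -pnormM mulrNN mulr1 pnorm1.
  by move/eqP; rewrite sqrp_eq1 ?pnorm_ge0 // => /eqP.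
by rewrite -mulN1r pnormM h mul1r.
Qed.

Lemma pnormD_le e x y : pnorm x <= e -> pnorm y <= e -> pnorm (x + y) <= e.
Proof. by move=> hx hy; apply: (le_trans (pnormD _ _)); rewrite ge_max hx. Qed.

Lemma pnormB_le e x y : pnorm x <= e -> pnorm y <= e -> pnorm (x - y) <= e.
Proof. by move=> hx hy; apply: pnormD_le; rewrite ?pnormN. Qed.

Lemma pnorm_sum_le (I : eqType) (s : seq I) (P : pred I) (G : I -> F) (e : R) :
  0 <= e -> (forall i, i \in s -> P i -> pnorm (G i) <= e) ->
  pnorm (\sum_(i <- s | P i) G i) <= e.
Proof.
move=> e0 h; rewrite big_seq_cond.
elim/big_ind: _ => [||i /andP[]]; [by rewrite pnorm0| |exact: h].
by move=> *; apply: pnormD_le.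
Qed.

Lemma pnorm_eq x y : (forall e : R, 0 < e -> pnorm (x - y) <= e) -> x = y.
Proof.
move=> h; apply/eqP; rewrite -subr_eq0 -pnorm_eq0 eq_le pnorm_ge0 andbT.
by apply/ler_addgt0Pr => e e0; rewrite add0r; exact: h.
Qed.

Lemma tends_uniq v x y : tends v x -> tends v y -> x = y.
Proof.
move=> /tendsP hx /tendsP hy; apply: pnorm_eq => e e0.
have [M hM] := hx e e0; have [M' hM'] := hy e e0.
have -> : x - y = (v (maxn M M') - y) - (v (maxn M M') - x).
  by ring.
by apply: pnormB_le; apply: ltW; rewrite ?hM ?hM' ?leq_maxl ?leq_maxr.
Qed.

Lemma ulimP v x : tends v x -> ulim v = x.
Proof. by move=> h; apply: xget_unique => // y hy; exact: (tends_uniq hy h). Qed.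

Definition zrange (M : nat) : seq int :=
  [seq Posz i | i <- iota 0 M] ++ [seq Negz i | i <- iota 0 M].
Definition zsum f : F := ulim (fun M => \sum_(k <- zrange M) f k).
Definition summable f :=
  forall e : R, 0 < e -> exists M : nat, forall k : int,
    (M <= `|k|)%N -> pnorm (f k) <= e.

Lemma zrange_uniq M : uniq (zrange M).
Proof.
rewrite cat_uniq !map_inj_uniq ?iota_uniq /=; try by move=> ? ? [].
by rewrite andbT; apply/hasPn => x /mapP[i _ ->]; apply/negP => /mapP[].
Qed.

Lemma zrange_notin M k : k \notin zrange M -> (M <= `|k|)%N.
Proof.
apply: contraR; rewrite -ltnNge mem_cat; case: k => n /= nM; apply/orP.
- by left; apply: map_f; rewrite mem_iota.
- by right; apply: map_f; rewrite mem_iota /=; apply: ltnW.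
Qed.

Lemma sum_close (s t : seq int) f (e : R) : 0 <= e -> uniq s -> uniq t ->
  (forall k, k \notin t -> pnorm (f k) <= e) ->
  (forall k, k \notin s -> pnorm (f k) <= e) ->
  pnorm (\sum_(k <- s) f k - \sum_(k <- t) f k) <= e.
Proof.
move=> e0 us ut ht hs.
rewrite (bigID (mem t)) /= [X in _ - X](bigID (mem s)) /=.
have -> : \sum_(k <- t | k \in s) f k = \sum_(k <- s | k \in t) f k.
  rewrite -[LHS]big_filter -[RHS]big_filter; apply: perm_big; apply: uniq_perm; rewrite ?filter_uniq //.
  by move=> k; rewrite !mem_filter andbC.
rewrite opprD addrACA subrr add0r.
by apply: pnormB_le; apply: pnorm_sum_le => // k _; [exact: ht|exact: hs].
Qed.

Lemma zsum_approx f (e : R) (s : seq int) : summable f -> 0 < e -> uniq s ->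
  (forall k, k \notin s -> pnorm (f k) <= e) ->
  pnorm (zsum f - \sum_(k <- s) f k) <= e.
Proof.
move=> sf e0 us hs.
have [l hl] : exists l, tends (fun M => \sum_(k <- zrange M) f k) l.
  apply: pnorm_complete => d d0; have [|M hM] := sf (d / 2); first by rewrite divr_gt0.
  exists M => m n Mm Mn; apply: (@le_lt_trans _ _ (d / 2)).
    apply: sum_close; rewrite ?zrange_uniq ?divr_ge0 ?(ltW d0) // => k /zrange_notin h;
      apply: hM; exact: leq_trans h.
  by rewrite ltr_pdivrMr // ltr_pMr // ltr1n.
rewrite /zsum (ulimP hl); move/tendsP: hl => /(_ e e0)[M hM].
have [M' hM'] := sf e e0; set N := maxn M M'.
have -> : l - \sum_(k <- s) f k = (\sum_(k <- zrange N) f k - \sum_(k <- s) f k)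
    - (\sum_(k <- zrange N) f k - l) by ring.
apply: pnormB_le; last by apply: ltW; rewrite hM ?leq_maxl.
apply: sum_close; rewrite ?zrange_uniq ?ltW // => k /zrange_notin h; apply: hM'.
by apply: leq_trans h; rewrite leq_maxr.
Qed.

Lemma zsum_eq f x : summable f ->
  (forall e : R, 0 < e -> exists s, [/\ uniq s,
     forall k, k \notin s -> pnorm (f k) <= e & pnorm (x - \sum_(k <- s) f k) <= e]) ->
  zsum f = x.
Proof.
move=> sf h; apply: pnorm_eq => e e0; have [s [us hs hx]] := h e e0.
rewrite -[zsum f](subrK (\sum_(k <- s) f k)) -addrA -[_ + - x]opprB.
by apply: pnormB_le => //; apply: zsum_approx.
Qed.

Lemma summable_reindex f (h h' : int -> int) : cancel h h' -> cancel h' h ->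
  summable f -> summable (f \o h).
Proof.
move=> hK h'K sf e e0; have [M hM] := sf e e0.
exists (\max_(k <- zrange M) `|h' k|).+1 => k hk /=; apply: hM.
apply: zrange_notin; apply/negP => kM; move: hk.
apply/negP; rewrite -ltnNge ltnS -{1}[k]hK.
exact: (@leq_bigmax_seq _ (zrange M) xpredT (fun k => `|h' k|%N)).
Qed.

Lemma zsum_reindex f (h h' : int -> int) : cancel h h' -> cancel h' h ->
  summable f -> zsum (f \o h) = zsum f.
Proof.
move=> hK h'K sf; apply: zsum_eq; first exact: summable_reindex hK h'K sf.
move=> e e0; have [M hM] := sf e e0; exists (map h' (zrange M)); split.
- by rewrite map_inj_uniq ?zrange_uniq //; exact: can_inj h'K.
- move=> k hk /=; apply: hM; apply: zrange_notin; apply: contra hk => hk.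
  by rewrite -[k]hK map_f.
- rewrite big_map; under eq_bigr do rewrite /= h'K.
  apply: zsum_approx; rewrite ?zrange_uniq // => k /zrange_notin; exact: hM.
Qed.

Lemma zsum_le f (e : R) : 0 < e -> summable f -> (forall k, pnorm (f k) <= e) ->
  pnorm (zsum f) <= e.
Proof.
move=> e0 sf h; have := @zsum_approx f e [::] sf e0 isT (fun k _ => h k).
by rewrite big_nil subr0.
Qed.

Lemma summableD f g : summable f -> summable g -> summable (fun k => f k + g k).
Proof.
move=> sf sg e e0; have [M hM] := sf e e0; have [M' hM'] := sg e e0.
by exists (maxn M M') => k; rewrite geq_max => /andP[h h']; apply: pnormD_le; auto.
Qed.

Lemma zsumD f g : summable f -> summable g ->
  zsum (fun k => f k + g k) = zsum f + zsum g.
Proof.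
move=> sf sg; apply: zsum_eq; first exact: summableD.
move=> e e0; have [M hM] := sf e e0; have [M' hM'] := sg e e0.
have a k : k \notin zrange (maxn M M') -> pnorm (f k) <= e.
  by move/zrange_notin; rewrite geq_max => /andP[h _]; exact: hM.
have b k : k \notin zrange (maxn M M') -> pnorm (g k) <= e.
  by move/zrange_notin; rewrite geq_max => /andP[_ h]; exact: hM'.
exists (zrange (maxn M M')); split; rewrite ?zrange_uniq //.
  by move=> k h; apply: pnormD_le; auto.
rewrite big_split /= opprD addrACA.
by apply: pnormD_le; apply: zsum_approx; rewrite ?zrange_uniq.
Qed.

Lemma summableZ x f : summable f -> summable (fun k => x * f k).
Proof.
move=> sf e e0; have [->|x0] := eqVneq x 0.
  by exists 0 => k _; rewrite mul0r pnorm0 ltW.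
have nx : 0 < pnorm x by rewrite lt_neqAle pnorm_ge0 eq_sym pnorm_eq0 x0.
have [M hM] := sf _ (divr_gt0 e0 nx); exists M => k /hM.
by rewrite ler_pdivlMr // mulrC pnormM.
Qed.

Lemma zsumZ x f : summable f -> zsum (fun k => x * f k) = x * zsum f.
Proof.
move=> sf; apply: zsum_eq; first exact: summableZ.
move=> e e0; have [->|x0] := eqVneq x 0.
  exists [::]; split => // [k _|]; rewrite ?mul0r ?big_nil ?subr0 pnorm0 ltW //.
have nx : 0 < pnorm x by rewrite lt_neqAle pnorm_ge0 eq_sym pnorm_eq0 x0.
have [M hM] := sf _ (divr_gt0 e0 nx).
have a k : k \notin zrange M -> pnorm (f k) <= e / pnorm x.
  by move/zrange_notin/hM.
exists (zrange M); split; rewrite ?zrange_uniq //.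
  by move=> k /a; rewrite ler_pdivlMr // mulrC pnormM.
rewrite -mulr_sumr -mulrBr pnormM mulrC -ler_pdivlMr //.
by apply: zsum_approx; rewrite ?zrange_uniq ?divr_gt0.
Qed.

Lemma zsum_single f k0 : (forall k, k != k0 -> f k = 0) -> zsum f = f k0.
Proof.
move=> h.
have h' (e : R) : 0 < e -> forall k, k \notin [:: k0] -> pnorm (f k) <= e.
  by move=> e0 k; rewrite inE => /h ->; rewrite pnorm0 ltW.
apply: zsum_eq => [e e0|e e0].
  exists `|k0|.+1 => k hk; apply: (h' _ e0); rewrite inE.
  by apply: contraL hk => /eqP ->; rewrite ltnn.
exists [:: k0]; split => //; first exact: h'.
by rewrite big_seq1 subrr pnorm0 ltW.
Qed.

Lemma zsum_exchange (G : int -> int -> F) :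
  (forall e : R, 0 < e -> exists M : nat, forall k l : int,
     (M <= `|k|)%N || (M <= `|l|)%N -> pnorm (G k l) <= e) ->
  zsum (fun k => zsum (G k)) = zsum (fun l => zsum (G^~ l)).
Proof.
move=> h.
have sr k : summable (G k).
  by move=> e /h[M hM]; exists M => l Ml; apply: hM; rewrite Ml orbT.
have sc l : summable (G^~ l).
  by move=> e /h[M hM]; exists M => k Mk; apply: hM; rewrite Mk.
have sR : summable (fun k => zsum (G k)).
  move=> e e0; have [M hM] := h e e0; exists M => k Mk.
  by apply: zsum_le => // l; apply: hM; rewrite Mk.
have sC : summable (fun l => zsum (G^~ l)).
  move=> e e0; have [M hM] := h e e0; exists M => l Ml.
  by apply: zsum_le => // k; apply: hM; rewrite Ml orbT.
apply: pnorm_eq => e e0; have [M hM] := h e e0.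
set S := \sum_(k <- zrange M) \sum_(l <- zrange M) G k l.
have a : pnorm (zsum (fun k => zsum (G k)) - S) <= e.
  rewrite -[zsum _](subrK (\sum_(k <- zrange M) zsum (G k))) -addrA.
  apply: pnormD_le.
    apply: zsum_approx; rewrite ?zrange_uniq // => k /zrange_notin Mk.
    by apply: zsum_le => // l; apply: hM; rewrite Mk.
  rewrite /S -sumrB; apply: pnorm_sum_le; first exact: ltW.
  move=> k _ _; apply: zsum_approx; rewrite ?zrange_uniq // => l /zrange_notin Ml.
  by apply: hM; rewrite Ml orbT.
have b : pnorm (zsum (fun l => zsum (G^~ l)) - S) <= e.
  rewrite -[zsum _](subrK (\sum_(l <- zrange M) zsum (G^~ l))) -addrA.
  apply: pnormD_le.
    apply: zsum_approx; rewrite ?zrange_uniq // => l /zrange_notin Ml.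
    by apply: zsum_le => // k; apply: hM; rewrite Ml orbT.
  rewrite /S exchange_big -sumrB; apply: pnorm_sum_le; first exact: ltW.
  move=> l _ _; apply: zsum_approx; rewrite ?zrange_uniq // => k /zrange_notin Mk.
  by apply: hM; rewrite Mk.
set A := zsum _ in a *; set B := zsum _ in b *.
have -> : A - B = (A - S) - (B - S) by ring.
exact: pnormB_le.
Qed.

End Ultrametric.

Section Robba.
Context {R : realType} {p : nat} {K : padicField R p}.
Implicit Types (a b c : int -> K) (rho : R) (k l n : int).

Definition cvg_on_circle a rho := forall e : R, 0 < e ->
  exists M : nat, forall k, (M <= `|k|)%N -> pnorm (a k) * rho ^ k <= e.
Definition is_robba a :=
  exists2 r : R, 0 <= r < 1 & forall rho, r < rho < 1 -> cvg_on_circle a rho.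

Record robba := Robba { rcoef :> int -> K; _ : `[< is_robba rcoef >] }.
HB.instance Definition _ := [isSub for rcoef].
HB.instance Definition _ := [Choice of robba by <:].

Lemma robbaP (a : robba) : is_robba a.
Proof. by case: a => a /= /asboolP. Qed.

Lemma robba_circle2 a b : is_robba a -> is_robba b ->
  exists2 r : R, 0 <= r < 1 & forall rho, r < rho < 1 ->
    cvg_on_circle a rho /\ cvg_on_circle b rho.
Proof.
move=> [r /andP[r0 r1] ha] [s /andP[s0 s1] hb]; exists (Num.max r s).
  by rewrite le_max r0 gt_max r1 s1.
by move=> rho; rewrite gt_max -andbA => /and3P[h1 h2 h3]; split; [apply: ha|apply: hb];
  apply/andP.
Qed.

Lemma robba_circle3 a b c : is_robba a -> is_robba b -> is_robba c ->
  exists rho, [/\ 0 < rho, cvg_on_circle a rho, cvg_on_circle b rho & cvg_on_circle c rho].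
Proof.
move=> ha hb [r /andP[r0 r1] hc]; have [s /andP[s0 s1] hab] := robba_circle2 ha hb.
set t := Num.max r s; have t1 : t < 1 by rewrite gt_max r1.
have t0 : 0 <= t by rewrite le_max r0.
have h : t < (t + 1) / 2 < 1 by rewrite (midf_lt t1).1 (midf_lt t1).2.
have [h1 h2] := andP h; exists ((t + 1) / 2).
have [] := hab ((t + 1) / 2).
  by rewrite h2 andbT; apply: le_lt_trans h1; rewrite le_max lexx orbT.
split=> //; first exact: le_lt_trans h1.
by apply: hc; rewrite h2 andbT; apply: le_lt_trans h1; rewrite le_max lexx.
Qed.

Lemma circle_bounded a rho : 0 < rho -> cvg_on_circle a rho ->
  exists2 B : R, 0 < B & forall k, pnorm (a k) * rho ^ k <= B.
Proof.
move=> rho0 ha; have [M hM] := ha 1 ltr01.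
have w0 k : 0 <= pnorm (a k) * rho ^ k by rewrite mulr_ge0 ?pnorm_ge0 ?exprz_ge0 ?ltW.
exists (1 + \sum_(k <- zrange M) pnorm (a k) * rho ^ k).
  by rewrite ltr_wpDr ?sumr_ge0.
move=> k; have [kM|/zrange_notin/hM h] := boolP (k \in zrange M).
  rewrite (big_rem k) //= addrCA lerDl addr_ge0 ?sumr_ge0 //.
by apply: (le_trans h); rewrite lerDl sumr_ge0.
Qed.

Lemma circleM a b rho k l (x y : R) : 0 < rho ->
  pnorm (a k) * rho ^ k <= x -> pnorm (b l) * rho ^ l <= y ->
  pnorm (a k * b l) * rho ^ (k + l) <= x * y.
Proof.
move=> rho0 hx hy; rewrite pnormM expfzDr ?lt0r_neq0 // mulrACA.
by apply: ler_pM => //; rewrite mulr_ge0 ?pnorm_ge0 ?exprz_ge0 ?ltW.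
Qed.

Definition robba_mul_coef a b n : K := zsum (fun k => a k * b (n - k)).

Lemma summable_conv a b n : is_robba a -> is_robba b ->
  summable (fun k => a k * b (n - k)).
Proof.
move=> ha hb; have [rho [rho0 ca cb _]] := robba_circle3 ha hb hb.
have [B B0 hB] := circle_bounded rho0 cb.
move=> e e0; have rn := exprz_gt0 n rho0.
have [M hM] := ca (e * rho ^ n / B) (divr_gt0 (mulr_gt0 e0 rn) B0).
exists M => k /hM h; rewrite -(ler_pM2r rn).
have := circleM rho0 h (hB (n - k)); rewrite [k + _]addrC subrK.
by rewrite divfK // gt_eqF.
Qed.

Lemma robba_mul_subproof a b : is_robba a -> is_robba b ->
  is_robba (robba_mul_coef a b).
Proof.
move=> ha hb; have [r /andP[r0 r1] h] := robba_circle2 ha hb.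
exists r; first by rewrite r0.
move=> rho hr; have [ca cb] := h rho hr.
have rho0 : 0 < rho by case/andP: hr => hr _; exact: le_lt_trans hr.
have [A A0 hA] := circle_bounded rho0 ca; have [B B0 hB] := circle_bounded rho0 cb.
move=> e e0; have [M hM] := ca (e / B) (divr_gt0 e0 B0).
have [M' hM'] := cb (e / A) (divr_gt0 e0 A0).
exists (M + M')%N => n hn; have rn := exprz_gt0 n rho0.
rewrite -ler_pdivlMr //; apply: zsum_le; rewrite ?divr_gt0 //.
  exact: summable_conv.
move=> k; rewrite ler_pdivlMr //.
have -> : rho ^ n = rho ^ (k + (n - k)) by rewrite addrC subrK.
have [/hM h1|kM] := leqP M `|k|.
  by have := circleM rho0 h1 (hB (n - k)); rewrite divfK // gt_eqF.
have /hM' h2 : (M' <= `|(n - k)%R|)%N by lia.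
by have := circleM rho0 (hA k) h2; rewrite [A * _]mulrC divfK // gt_eqF.
Qed.

Fact robba_add_subproof a b : is_robba a -> is_robba b -> is_robba (fun n => a n + b n).
Proof.
move=> ha hb; have [r /andP[r0 r1] h] := robba_circle2 ha hb.
exists r; first by rewrite r0.
move=> rho hr e e0; have [ca cb] := h rho hr.
have rho0 : 0 < rho by case/andP: hr => hr _; exact: le_lt_trans hr.
have [M hM] := ca e e0; have [M' hM'] := cb e e0; exists (maxn M M') => k.
rewrite geq_max => /andP[/hM h1 /hM' h2]; have rk := exprz_gt0 k rho0.
by rewrite -ler_pdivlMr // pnormD_le // ler_pdivlMr.
Qed.

Fact robba_opp_subproof a : is_robba a -> is_robba (fun n => - a n).
Proof.
move=> [r r01 h]; exists r => // rho hr e e0; have [M hM] := h rho hr e e0.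
by exists M => k /hM; rewrite pnormN.
Qed.

Fact robba_single_subproof (x : K) n0 : is_robba (fun n => if n == n0 then x else 0).
Proof.
exists 0; first by rewrite lexx ltr01.
move=> rho _ e e0; exists `|n0|.+1 => k hk; case: eqP => [kn|_].
  by rewrite kn ltnn in hk.
by rewrite pnorm0 mul0r ltW.
Qed.

Definition robba_add (a b : robba) : robba :=
  Robba (introT (asboolP _) (robba_add_subproof (robbaP a) (robbaP b))).
Definition robba_opp (a : robba) : robba :=
  Robba (introT (asboolP _) (robba_opp_subproof (robbaP a))).
Definition robba_mul (a b : robba) : robba :=
  Robba (introT (asboolP _) (robba_mul_subproof (robbaP a) (robbaP b))).
Definition robba_monomial (x : K) n : robba :=
  Robba (introT (asboolP _) (robba_single_subproof x n)).
Definition robba_zero := robba_monomial 0 0.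
Definition robba_one := robba_monomial 1 0.

Lemma robba_eqP (a b : robba) : (forall n, a n = b n) -> a = b.
Proof. by move=> h; apply: val_inj; apply/funext. Qed.

Fact robba_addA : associative robba_add.
Proof. by move=> a b c; apply: robba_eqP => n /=; rewrite addrA. Qed.
Fact robba_addC : commutative robba_add.
Proof. by move=> a b; apply: robba_eqP => n /=; rewrite addrC. Qed.
Fact robba_add0 : left_id robba_zero robba_add.
Proof. by move=> a; apply: robba_eqP => n /=; case: eqP; rewrite add0r. Qed.
Fact robba_addN : left_inverse robba_zero robba_opp robba_add.
Proof. by move=> a; apply: robba_eqP => n /=; case: eqP; rewrite addNr. Qed.
HB.instance Definition _ :=
  GRing.isZmodule.Build robba robba_addA robba_addC robba_add0 robba_addN.

Fact robba_mulC : commutative robba_mul.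
Proof.
move=> a b; apply: robba_eqP => n; rewrite /= /robba_mul_coef.
have K_ : cancel (fun k => n - k) (fun k => n - k) by move=> k; rewrite subKr.
rewrite -(zsum_reindex K_ K_); last exact: summable_conv (robbaP a) (robbaP b).
by congr zsum; apply/funext => k /=; rewrite subKr mulrC.
Qed.

Fact robba_mul1 : left_id robba_one robba_mul.
Proof.
move=> a; apply: robba_eqP => n; rewrite /= /robba_mul_coef.
by rewrite (@zsum_single _ _ _ _ 0) ?eqxx ?mul1r ?subr0 // => k /negPf ->; rewrite mul0r.
Qed.

Fact robba_mulDl : left_distributive robba_mul robba_add.
Proof.
move=> a b c; apply: robba_eqP => n; rewrite /= /robba_mul_coef.
have sc := fun a b : robba => summable_conv n (robbaP a) (robbaP b).
rewrite -(zsumD (sc a c) (sc b c)).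
by congr zsum; apply/funext => k /=; rewrite mulrDl.
Qed.

Fact robba_mulA : associative robba_mul.
Proof.
move=> a b c; apply: robba_eqP => n; rewrite /= /robba_mul_coef /=.
have [[ra rb] rc] := (robbaP a, robbaP b, robbaP c).
pose G k m := a k * b (m - k) * c (n - m).
transitivity (zsum (fun k => zsum (G k))).
  congr zsum; apply/funext => k; rewrite /robba_mul_coef -zsumZ; last exact: summable_conv.
  have h1 : cancel (fun m : int => m - k) (fun l => l + k) by move=> m; rewrite subrK.
  have h2 : cancel (fun l : int => l + k) (fun m => m - k) by move=> m; rewrite addrK.
  rewrite -(zsum_reindex h1 h2); last by apply: summableZ; exact: summable_conv.
  congr zsum; apply/funext => m /=; rewrite /G mulrA; congr (_ * c _).
  by rewrite opprB addrCA addrC -!addrA [- m + _]addrC !addrA subrK.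
rewrite zsum_exchange.
  congr zsum; apply/funext => m; rewrite /G mulrC -zsumZ; last exact: summable_conv.
  by congr zsum; apply/funext => k; rewrite mulrC.
have [rho [rho0 ca cb cc]] := robba_circle3 ra rb rc.
have [A A0 hA] := circle_bounded rho0 ca; have [B B0 hB] := circle_bounded rho0 cb.
have [C C0 hC] := circle_bounded rho0 cc.
move=> e e0; have rn := exprz_gt0 n rho0.
have e1 := mulr_gt0 e0 rn.
have [M hM] := ca _ (divr_gt0 (divr_gt0 e1 B0) C0).
have [M' hM'] := cc _ (divr_gt0 (divr_gt0 e1 B0) A0).
exists (M + (M' + `|n|))%N => k m h.
have E x y z : pnorm (a k) * rho ^ k <= x -> pnorm (b (m - k)) * rho ^ (m - k) <= y ->
    pnorm (c (n - m)) * rho ^ (n - m) <= z -> pnorm (G k m) * rho ^ n <= x * y * z.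
  move=> hx hy hz; have := circleM (a := fun=> a k * b (m - k)) (b := c) (k := m) rho0 _ hz.
  move=> /(_ (x * y)); rewrite (addrC m (n - m)) subrK; apply.
  by have := circleM rho0 hx hy; rewrite (addrC k (m - k)) subrK.
rewrite -(ler_pM2r rn).
have [B1 C1 A1] : [/\ B != 0, C != 0 & A != 0] by rewrite !gt_eqF.
have [/hM h1|kM] := leqP M `|k|.
  apply: le_trans (E _ _ _ h1 (hB _) (hC _)) _.
  by rewrite -mulrA [B * C]mulrC mulrA !divfK.
have /hM' h2 : (M' <= `|(n - m)%R|)%N by lia.
apply: le_trans (E _ _ _ (hA _) (hB _) h2) _.
by rewrite mulrC [A * B]mulrC mulrA -mulrA [B * A]mulrC mulrA !divfK.
Qed.

Fact robba_one_neq0 : robba_one != robba_zero.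
Proof.
apply/eqP => /(congr1 (fun a : robba => a 0)) /= /eqP.
by rewrite oner_eq0.
Qed.
HB.instance Definition _ := GRing.Zmodule_isComNzRing.Build robba
  robba_mulA robba_mulC robba_mul1 robba_mulDl robba_one_neq0.

Definition robba_unit : pred robba := fun a : robba => `[< exists b : robba, b * a = 1 >].
Definition robba_inv (a : robba) : robba := xget a [set b : robba | b * a = 1].

Fact robba_mulV : {in robba_unit, left_inverse 1 robba_inv *%R}.
Proof.
move=> a /asboolP h; rewrite /robba_inv; exact: (xgetPex a h).
Qed.
Fact robba_unitP (a b : robba) : b * a = 1 -> robba_unit a.
Proof. by move=> h; apply/asboolP; exists b. Qed.
Fact robba_inv_out : {in [predC robba_unit], robba_inv =1 id}.
Proof.
move=> a /asboolPn h; rewrite /robba_inv; case: xgetP => // b _ hb; case: h; by exists b.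
Qed.
HB.instance Definition _ := GRing.ComNzRing_hasMulInverse.Build robba
  robba_mulV robba_unitP robba_inv_out.

End Robba.
Arguments robba {R p} K.

Definition gbinom (F : fieldType) (s : F) (k : nat) : F :=
  (\prod_(i < k) (s - i%:R)) / k`!%:R.

Section Powers.
Context {R : realType} {p : nat} {F : padicField R p}.
Implicit Types x s : F.

Definition zpow x s : F := ulim (fun M => \sum_(k < M) gbinom s k * (x - 1) ^+ k).

Definition omega x : F :=
  xget 0 [set w | w ^+ (p ^ 2 - 1) = 1 /\ pnorm (x / w - 1) <= p%:R^-1].
Definition angle x : F := x / omega x.

End Powers.

Section PhiGamma.
Context {R : realType} {p : nat} {K : padicField R p}.
Implicit Types (f q z : robba K) (c u : K).

(* Junk value 0 when the coefficients do not define an element of the Robba ring. *)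
Definition laurent (a : int -> K) : robba K := insubd (0 : robba K) a.

Definition robbaX : robba K := robba_monomial 1 1.

(* (1 + X)^c for c in Z_p *)
Definition onePlusX_pow c : robba K :=
  laurent (fun n => if n is Posz k then gbinom c k else 0).

(* f(q) = sum over k in Z of f_k q^k, the sum being computed coefficientwise. *)
Definition robba_comp f q : robba K :=
  laurent (fun n => zsum (fun k => f k * (q ^ k : robba K) n)).

Definition phi f := robba_comp f ((1 + robbaX) ^+ p - 1).

(* Gamma is identified with Z_p^* through the cyclotomic character: c stands for
   the gamma such that chi(gamma) = c. *)
Definition gam c f := robba_comp f (onePlusX_pow c - 1).

(* z^u for z in 1 + p O_E^dagger and u in Z_p *)
Definition robba_pow z u : robba K :=
  laurent (fun n => ulim (fun M => \sum_(k < M) gbinom u k * ((z - 1) ^+ k : robba K) n)).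

Definition rQ : robba K := phi robbaX / robbaX.
Definition rQ2 : robba K := phi rQ.

(* f lies in 1 + p^m X Z_p[[X]] *)
Definition one_plus_pX (m : nat) f := forall n : int,
  (n < 0 -> f n = 0) /\ (n = 0 -> f n = 1) /\ (0 < n -> pnorm (f n) <= p%:R ^- m).

Definition f_ c : robba K := xget 1 [set f : robba K |
  one_plus_pX 0 f /\ phi (phi f) / f = gam c rQ2 / rQ2].
Definition g_ c : robba K := xget 1 [set g : robba K |
  one_plus_pX 1 g /\ phi (phi g) / g = gam c (rQ2 / rQ ^+ p) / (rQ2 / rQ ^+ p)].

(* A free (phi, Gamma)-module of rank d over the Robba ring, in a basis: phi acts on
   column vectors by v |-> pg_phi *m phi(v), and gamma by v |-> pg_gam c *m gamma(v). *)
Record pgmod (d : nat) := PGMod {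
  pg_phi : 'M[robba K]_d;
  pg_gam : K -> 'M[robba K]_d
}.

Definition pg_iso d (D D' : pgmod d) : Prop := exists P : 'M[robba K]_d,
  [/\ P \in unitmx,
      P *m pg_phi D = pg_phi D' *m map_mx phi P
    & forall c, pnorm c = 1 -> P *m pg_gam D c = pg_gam D' c *m map_mx (gam c) P].

Definition mx2 (T : Type) (a b c d : T) : 'M[T]_2 :=
  \matrix_(i, j) if i == 0 then if j == 0 then a else b else if j == 0 then c else d.

Definition D_ (j : int) u : pgmod 2 :=
  let m c := f_ c ^ j * robba_pow (g_ c) u in
  let s c := robba_monomial (c ^ j * zpow (angle c) u) 0 in
  PGMod (mx2 0 1 (rQ2 ^ j * robba_pow (rQ2 / rQ ^+ p) u) 0)
        (fun c => mx2 (s c * phi (m c)) 0 0 (s c * m c)).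

(* The bounded elements of the Robba ring: E^dagger, the field of fractions
   of O_E^dagger *)
Definition bounded_series f := exists C : R, forall n, pnorm (f n) <= C.

End PhiGamma.
Arguments pgmod {R p} K d.

(* The fields of p-adic Hodge theory, each characterised up to a unique isomorphism
   (compatible with the previous ones):
   - Qp is the completion of Q;
   - Cp is the completion of an algebraic closure of Qp (itself unique up to an
     isomorphism, which is not unique: this is the choice of an algebraic closure);
   - tilt is the field whose elements are the sequences (x_n) of elements of Cp such
     that x_(n+1)^p = x_n; tcoord x n is x_n;
   - Bt is the field of fractions W(tilt)[1/p] of the Witt vectors of tilt: complete
     for a discrete valuation, with uniformizer p and perfect residue field tilt.
     The residue map res is only meaningful on the unit ball;
   - frob is the Frobenius of W(tilt)[1/p]. *)
Record padicSetup (R : realType) (p : nat) := PadicSetup {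
  Qp : padicField R p;
  Qp_dense : forall (x : Qp) (e : R), 0 < e -> exists q : rat, pnorm (x - ratr q) < e;

  Cp : padicField R p;
  QpCp : {rmorphism Qp -> Cp};
  QpCp_norm : forall x, pnorm (QpCp x) = pnorm x;
  Cp_closed : GRing.closed_field_axiom Cp;
  Cp_dense : forall (x : Cp) (e : R), 0 < e ->
    exists y : Cp, algebraicOver QpCp y /\ pnorm (x - y) < e;

  tilt : fieldType;
  tcoord : tilt -> nat -> Cp;
  tcoord_compat : forall x n, tcoord x n.+1 ^+ p = tcoord x n;
  tcoord_inj : injective tcoord;
  tcoord_surj : forall c : nat -> Cp, (forall n, c n.+1 ^+ p = c n) ->
    exists x, tcoord x = c;
  tcoordM : forall x y n, tcoord (x * y) n = tcoord x n * tcoord y n;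
  tcoordD : forall x y n,
    tends (fun m => (tcoord x (n + m) + tcoord y (n + m)) ^+ (p ^ m)) (tcoord (x + y) n);

  Bt : padicField R p;
  res : Bt -> tilt;
  Bt_discrete : forall x : Bt, pnorm x < 1 -> pnorm x <= p%:R^-1;
  res_surj : forall t, exists x : Bt, pnorm x <= 1 /\ res x = t;
  res_eq0 : forall x : Bt, pnorm x <= 1 -> (res x = 0 <-> pnorm x < 1);
  res1 : res 1 = 1;
  resD : forall x y : Bt, pnorm x <= 1 -> pnorm y <= 1 -> res (x + y) = res x + res y;
  resM : forall x y : Bt, pnorm x <= 1 -> pnorm y <= 1 -> res (x * y) = res x * res y;
  QpBt : {rmorphism Qp -> Bt};
  QpBt_norm : forall x, pnorm (QpBt x) = pnorm x;
  frob : {rmorphism Bt -> Bt};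
  frob_norm : forall x, pnorm (frob x) = pnorm x;
  frob_res : forall x, pnorm x <= 1 -> res (frob x) = res x ^+ p
}.

(* Gal(Qpbar/Qp), seen as the group of isometric automorphisms of Cp over Qp. The
   second component galB is the action on Bt obtained by functoriality: it is uniquely
   determined by galC. *)
Record galois R p (S : padicSetup R p) := Galois {
  galC : {rmorphism Cp S -> Cp S};
  galC_norm : forall x, pnorm (galC x) = pnorm x;
  galC_fix : forall x : Qp S, galC (QpCp S x) = QpCp S x;
  galC_surj : forall y, exists x, galC x = y;
  galB : {rmorphism Bt S -> Bt S};
  galB_norm : forall x, pnorm (galB x) = pnorm x;
  galB_res : forall x, pnorm x <= 1 ->
    forall n, tcoord (res (galB x)) n = galC (tcoord (res x) n)
}.

Section LubinTate.
Context {R : realType} {p : nat} {S : padicSetup R p}.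
Local Notation K := (Qp S).
Local Notation C := (Cp S).
Implicit Types (g h : galois S) (x y a : C).

(* Z_{p^2}, the ring of integers Z_p[mu_{p^2 - 1}] of the unramified quadratic extension *)
Definition Zp2 x := exists (zeta : C) (b c : K),
  [/\ (p ^ 2 - 1).-primitive_root zeta, pnorm b <= 1, pnorm c <= 1
    & x = QpCp S b + QpCp S c * zeta].

Definition fixesQp2 g := `[< forall x, Zp2 x -> galC g x = x >].

(* The Lubin-Tate module attached to the series [p](T) = p T + T^(p^2): c is the
   sequence of coefficients of the unique series [a](T) = a T + ... over Z_{p^2}
   which commutes with [p](T). The composites are compared modulo each T^n. *)
Definition lt_p : {poly C} := p%:R *: 'X + 'X^(p ^ 2).
Definition lt_series a (c : nat -> C) :=
  [/\ c 0%N = 0, c 1%N = a, forall k, Zp2 (c k)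
    & forall n, let cn := \poly_(k < n) c k in
        take_poly n (cn \Po lt_p) = take_poly n (lt_p \Po cn)].

Definition lt_torsion x := pnorm x < 1 /\ exists n, iter n (fun y => lt_p.[y]) x = 0.

(* a = chi_2(g), for g fixing Q_{p^2} *)
Definition is_chi2 g a := [/\ Zp2 a, pnorm a = 1 & exists c, lt_series a c /\
  forall x, lt_torsion x -> tends (fun M => \sum_(k < M) c k * x ^+ k) (galC g x)].

(* g |-> (a g, g restricted to Q_{p^2}) is a group homomorphism from Gal(Qpbar/Qp) to
   the semidirect product of Z_{p^2}^* and Z/2Z = Gal(Q_{p^2}/Qp), extending chi_2, that
   is an isomorphism of Gal(Q_{p^2}^LT/Qp) with this semidirect product. The subgroup
   H^1(Z/2Z, Z_{p^2}^* ) being trivial, two choices are conjugate under Z_{p^2}^*. *)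
Definition lt_iso (a : galois S -> C) :=
  [/\ forall g, Zp2 (a g) /\ pnorm (a g) = 1,
      forall g h gh, (forall x, galC gh x = galC g (galC h x)) ->
        a gh = a g * galC g (a h)
    & forall g, fixesQp2 g -> is_chi2 g (a g)].

(* sd is a square root of d, and Z_{p^2} = Z_p[sd] *)
Definition Zp2_sqrt (d : K) (sd : C) := sd ^+ 2 = QpCp S d /\
  forall x, Zp2 x <-> exists y z : K,
    [/\ pnorm y <= 1, pnorm z <= 1 & x = QpCp S y + QpCp S z * sd].

Definition sqrt_coords (sd x : C) : K * K :=
  xget (0, 0) [set yz | x = QpCp S yz.1 + QpCp S yz.2 * sd].

Definition to_GL2 (d : K) (sd x : C) (twist : bool) : 'M[K]_2 :=
  let: (y, z) := sqrt_coords sd x in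
  if twist then mx2 y (- (d * z)) z (- y) else mx2 y (d * z) z y.

(* The exponent r only matters modulo p^2 - 1. *)
Definition eta (r : int) (s : K) x : C := omega x ^ r * zpow (angle x) (QpCp S s).

Definition rho_ d sd (a : galois S -> C) r s g : 'M[K]_2 :=
  to_GL2 d sd (eta r s (a g)) (~~ fixesQp2 g).

End LubinTate.

Section OverconvergentPeriods.
Context {R : realType} {p : nat} {S : padicSetup R p}.
Local Notation K := (Qp S).
Local Notation C := (Cp S).
Local Notation B := (Bt S).
Implicit Types (x y z w : B) (t : tilt S).

(* The Teichmuller lift [t], the unique lift of t having p^n-th roots for all n *)
Definition teich t : B := xget 0 [set w |
  [/\ pnorm w <= 1, res w = t & forall n, exists v : B, v ^+ (p ^ n) = w]].

(* x = sum of p^i [c_i] in W(tilt) *)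
Definition witt_coords x (c : nat -> tilt S) := forall n,
  pnorm (x - \sum_(i < n) p%:R ^+ i * teich (c i)) <= p%:R ^- n.

Definition tnorm t : R := pnorm (tcoord t 0).

(* The Witt vectors of the ring of integers of tilt *)
Definition Wplus x := exists c, witt_coords x c /\ forall i, tnorm (c i) <= 1.

(* W(tilt)^{dagger,r}[1/p], for some r, is given by the growth condition
   |c_i|^t p^(-i) -> 0 with t = (p - 1) / (p r); it suffices to take t = 1 / m. *)
Definition overconvergent x := exists (N m : nat) (c : nat -> tilt S),
  witt_coords (p%:R ^+ N * x) c /\
  (fun i => tnorm (c i) * (p%:R ^- i) ^+ m) @ \oo --> (0 : R).

(* A compatible system of primitive p^n-th roots of unity *)
Definition is_eps (eps : tilt S) := tcoord eps 0 = 1 /\ tcoord eps 1 <> 1.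

Context (eps : tilt S).
Definition pi_eps : B := teich eps - 1.

(* x is the sum of the series of the a_k pi^k for the weak topology of W(tilt)[1/p],
   for which the p^n W(tilt) + pi^m Wplus are neighbourhoods of 0 in W(tilt). *)
Definition eval_pi (a : int -> K) x := exists N : nat, forall n m : nat,
  exists M0 : nat, forall M, (M0 <= M)%N -> exists y z,
    [/\ pnorm y <= 1, Wplus z
      & p%:R ^+ N * (x - \sum_(k <- zrange M) QpBt S (a k) * pi_eps ^ k)
        = p%:R ^+ n * y + pi_eps ^+ m * z].

(* B_{Q_p}: bounded series with coefficients tending to 0 at -oo *)
Definition BQp x := exists a : int -> K,
  [/\ exists c : R, forall k, pnorm (a k) <= c,
      (fun k : nat => pnorm (a (- k%:Z))) @ \oo --> (0 : R)
    & eval_pi a x].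

(* The maximal unramified extension of B_{Q_p} in Bt: every finite unramified
   extension is generated by an integral y, root of a monic P with integral
   coefficients and such that P'(y) is a unit. *)
Definition BQp_nr x := exists (y : B) (P Q : {poly B}),
  [/\ P \is monic, root P y, pnorm P^`().[y] = 1,
      forall k, BQp P`_k /\ pnorm P`_k <= 1
    & (forall k, BQp Q`_k) /\ x = Q.[y]].

(* Its p-adic completion, and the overconvergent elements of the latter *)
Definition Bnr x := forall e : R, 0 < e -> exists y, BQp_nr y /\ pnorm (x - y) < e.
Definition Bdag x := Bnr x /\ overconvergent x.

(* c = chi(g) is the cyclotomic character *)
Definition is_cyclo (g : galois S) (c : K) := pnorm c = 1 /\
  forall n m : nat, pnorm (c - m%:R) <= p%:R ^- n ->
    galC g (tcoord eps n) = tcoord eps n ^+ m.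

(* D^dagger(V) = (Bdag (x) V)^H, with H the kernel of the cyclotomic character,
   for V = Qp^d with an action rho of the Galois group. *)
Definition Ddag d (rho : galois S -> 'M[K]_d) (v : 'cV[B]_d) :=
  (forall i, Bdag (v i 0)) /\
  forall g, (forall n, galC g (tcoord eps n) = tcoord eps n) ->
    map_mx (QpBt S) (rho g) *m map_mx (galB g) v = v.

(* f in E^dagger is sent to f(pi) in Bdag *)
Definition Edag_image (f : robba K) x := bounded_series f /\ eval_pi f x.

(* D' is D(V) = R (x) D^dagger(V), in a basis given by the columns b of D^dagger(V)
   over the field E^dagger. *)
Definition is_DV_in_basis d (rho : galois S -> 'M[K]_d) (b : 'M[B]_d) (D' : pgmod K d) :=
  [/\ forall i, Ddag rho (col i b),
      forall v, Ddag rho v -> exists! x : 'cV[B]_d,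
        (forall i, exists f, Edag_image f (x i 0)) /\ v = b *m x,
      exists A : 'M[B]_d, (forall i j, Edag_image (pg_phi D' i j) (A i j)) /\
        map_mx (frob S) b = b *m A
    & forall g c, is_cyclo g c ->
      exists A : 'M[B]_d, (forall i j, Edag_image (pg_gam D' c i j) (A i j)) /\
        map_mx (QpBt S) (rho g) *m map_mx (galB g) b = b *m A].

Definition is_DV d (rho : galois S -> 'M[K]_d) (D : pgmod K d) :=
  exists b D', is_DV_in_basis rho b D' /\ pg_iso D D'.

End OverconvergentPeriods.

(* Main.v *)
Require Import Defs.
From HB Require Import structures.
From mathcomp Require Import all_boot all_order all_algebra.
From mathcomp Require Import separable.
From mathcomp Require Import zify ring lra.
From mathcomp Require Import all_classical all_reals all_analysis.
Set Implicit Arguments.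
Unset Strict Implicit.
Unset Printing Implicit Defensive.
Import Order.TTheory GRing.Theory Num.Theory.
Import numFieldNormedType.Exports.
Local Open Scope classical_set_scope.
Local Open Scope ring_scope.

(* On V = Q_{p^2}(eta) the coordinates v0 + v1 sqrt d and v0 - v1 sqrt d are eigenvectors of
Z_{p^2}^*, exchanged by phi, so D(V) has the basis (phi F, F) as soon as F is a period with
phi^2 F = Q2^j (Q2/Q^p)^u F on which g acts by eta(g) up to the Gamma-cocycle of D_j(u). Take
F = X^j h^u, h = X / phi^-1(X)^p, where phi^2 X = Q2 X: since Q2 and p + nu^(p^2-1), for the
Lubin-Tate period nu, generate the same ideal ker(theta phi^-2), X is nu times a unit, up to an
element of Q_{p^2} given by Hilbert 90. This basis spans all of D^dag(V): the coordinates of a fixed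
vector lie in the maximal unramified extension of B_Qp and are fixed by H_Qp, hence are in B_Qp
because the residue field E has no other separable fixed element (Krasner and approximation in
C_p); they are overconvergent because their denominators modulo p^n grow linearly in n. *)

(** The weight j + (p+1)u is forced. For a unit x of Z_{p^2}, the period F is multiplied by x^j (x /
    sigma(x)^p)^u, and after multiplication by sigma(eta(x)) the factor N(x)^j <N(x)>^u written in
    D_j(u) must remain. Since omega(sigma(x))^p = omega(x), x / sigma(x)^p equals <x> /
    sigma(<x>)^p, and eta(x) = x^j <x>^((p+1)u) is what is needed. The norm occurs because X phi(X)
    is phi(pi) up to a constant of Q_p, which makes the cyclotomic character the norm of the
    Lubin-Tate cocycle. Series over Q_p and elements of W(tilt)[1/p] are compared through a relation
    between a series and its value at pi, compatible with ring operations, phi and Gamma. Uniqueness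
    rests on one rigidity fact: among the Witt vectors over the unit ball of the tilt that reduce to
    0 over its residue field, only 0 is fixed by phi^2. Two factorisations of the same element into
    a fixed Witt vector and one reducing to 1 thus have the same fixed factor, so cocycles are read
    off without formulas for f_gamma and g_gamma. *)

Section FrobRoot.
Variables (A : comNzRingType) (p : nat).

(** The integral polynomial ((a + b)^p - a^p - b^p) / p, written out so that it makes sense in every
    ring and visibly stays in any subring that contains a and b. *)
Definition cross (a b : A) := \sum_(i < p.-1) ('C(p, i.+1) %/ p)%:R * a ^+ (p - i.+1) * b ^+ i.+1.

Lemma exprD_cross (a b : A) : prime p -> (a + b) ^+ p = a ^+ p + b ^+ p + p%:R * cross a b.
Proof.
move=> pp; have p0 := prime_gt0 pp.
rewrite exprDn -[in LHS](prednK p0) big_ord_recr big_ord_recl /= (prednK p0).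
rewrite bin0 binn !subn0 subnn mulr1 mul1r !mulr1n -!addrA; congr (_ + _).
rewrite addrC; congr (_ + _); rewrite mulr_sumr; apply: eq_bigr => i _.
rewrite !mulrA -natrM mulnC divnK; first by ring.
by apply: prime_dvd_bin => //; rewrite -ltn_predRL ltn_ord.
Qed.

(** Opposites of p-th powers are p-th powers for odd p only; for p = 2 the identity -a^2 = a^2 - 2
    a^2 supplies the correction. *)
Lemma exprN_cross (a : A) : prime p ->
 - a ^+ p = (if odd p then - a else a) ^+ p + p%:R * (if odd p then 0 else - a ^+ p).
Proof.
move=> pp; case: (even_prime pp) => [->|op] /=; first by ring.
by rewrite op exprNn -signr_odd op expr1 mulN1r mulr0 addr0.
Qed.
End FrobRoot.

Section MatrixTwo.
Variable A : comPzRingType.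

Lemma mx2_mul (a b c d a' b' c' d' : A) :
 mx2 a b c d *m mx2 a' b' c' d' = mx2 (a * a' + b * c') (a * b' + b * d') (c * a' + d * c') (c * b' + d * d').
Proof.
apply/matrixP => i j; rewrite !mxE big_ord_recl big_ord1 !mxE /=.
by case: (i == 0); case: (j == 0).
Qed.

End MatrixTwo.

Lemma map_mx2 (A A' : Type) (f : A -> A') (a b c d : A) : map_mx f (mx2 a b c d) = mx2 (f a) (f b) (f c) (f d).
Proof. by apply/matrixP => i j; rewrite !mxE; case: (i == 0); case: (j == 0). Qed.

(** * Minimal polynomials, and subfields turned into field types *)

Section MinimalPolynomial.
Context (A : comNzRingType) (L : fieldType) (f : {rmorphism A -> L}).
Local Notation "P ^f" := (map_poly f P).

(** A nonzero polynomial of least degree killing x can be made monic, and then division with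
    remainder is available. A is only a ring in which nonzero elements happen to be invertible,
    because it will also be a ring of pairs, the graph of a partial automorphism. *)
Lemma minp_ex (x : L) : (forall a : A, a != 0 -> exists b, b * a = 1) ->
 (exists2 P : {poly A}, P != 0 & P^f.[x] = 0) ->
 exists P : {poly A}, [/\ P \is monic, P^f.[x] = 0 &
  forall Q : {poly A}, Q^f.[x] = 0 -> exists D, Q = D * P].
Proof.
move=> hinv [P0 P00 rP0].
have hn : exists n, `[< exists P : {poly A}, [/\ P != 0, P^f.[x] = 0 & size P = n] >].
 by exists (size P0); apply/asboolP; exists P0.
case: (ex_minnP hn) => n /asboolP[P [P1 rP sP]] hm.
have l0 : lead_coef P != 0 by rewrite lead_coef_eq0.
have [c hc] := hinv _ l0.
have sc : size (c *: P) = n.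
 apply/eqP; rewrite eqn_leq -{1}sP size_scale_leq; apply: hm; apply/asboolP.
 exists (c *: P); split=> //; last by rewrite map_polyZ hornerZ rP mulr0.
 apply/eqP => /(congr1 (fun Q : {poly A} => Q`_(size P).-1)).
 by rewrite coefZ coef0 -lead_coefE hc => /eqP; rewrite oner_eq0.
have mc : c *: P \is monic by rewrite monicE lead_coefE sc -sP coefZ hc.
have rc : (c *: P)^f.[x] = 0 by rewrite map_polyZ hornerZ rP mulr0.
exists (c *: P); split=> // Q rQ; exists (Pdiv.Ring.rdivp Q (c *: P)).
rewrite {1}(Pdiv.RingMonic.rdivp_eq mc Q); set r := Pdiv.Ring.rmodp _ _.
have sr : (size r < n)%N by rewrite -sc Pdiv.Ring.ltn_rmodp monic_neq0.
suff -> : r = 0 by rewrite addr0.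
apply/eqP; apply: contraTT sr => r0; rewrite -leqNgt; apply: hm; apply/asboolP; exists r; split=> //.
move: rQ; rewrite {1}(Pdiv.RingMonic.rdivp_eq mc Q) rmorphD rmorphM /= hornerD hornerM rc mulr0 add0r //.
Qed.

End MinimalPolynomial.

Record subfield (L : fieldType) := Subfield { sf :> {pred L}; sf_closed : divring_closed sf }.

Section SubfieldType.
Context (L : fieldType) (K : subfield L).
HB.instance Definition _ := GRing.isDivringClosed.Build L (sf K) (sf_closed K).
Definition sfT := {x : L | x \in sf K}.
HB.instance Definition _ := SubType.on sfT.
HB.instance Definition _ := Choice.on sfT.
HB.instance Definition _ := [SubChoice_isSubIntegralDomain of sfT by <:].
HB.instance Definition _ := [SubIntegralDomain_isSubField of sfT by <:].
(** The inclusion is sealed behind an opaque proof, so that it is never unfolded to [val]; [sfvE]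
    gives access to it. *)
Fact sfv_key : {f : {rmorphism sfT -> L} | forall x, f x = val x}.
Proof. by exists (val : {rmorphism sfT -> L}). Qed.
Definition sfv : {rmorphism sfT -> L} := sval sfv_key.
Lemma sfvE x : sfv x = val x. Proof. exact: (svalP sfv_key). Qed.
Lemma sfvP x : sfv x \in sf K. Proof. rewrite sfvE; exact: valP. Qed.
Lemma sfv_sub y (h : y \in sf K) : sfv (Sub y h) = y. Proof. by rewrite sfvE SubK. Qed.
End SubfieldType.

(** * Separable elements over a field of characteristic p *)

Section Separable.
Context (L : fieldType) (p : nat) (pL : p \in [pchar L]).

Section OverField.
Context (K : fieldType) (f : {rmorphism K -> L}).
Implicit Types (P Q : {poly K}) (x y z : L).
Local Notation "P ^f" := (map_poly f P).

Definition gen z x := exists Q, x = Q^f.[z].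
(** The criterion K(z) = K(z^p) for separability, taken as definition: it needs no minimal
    polynomial, and it contains algebraicity, since z is then a root of X - Q(X^p). *)
Definition sepel z := gen (z ^+ p) z.

Lemma genD z x y : gen z x -> gen z y -> gen z (x + y).
Proof. by move=> [Q ->] [Q' ->]; exists (Q + Q'); rewrite rmorphD hornerD. Qed.
Lemma genM z x y : gen z x -> gen z y -> gen z (x * y).
Proof. by move=> [Q ->] [Q' ->]; exists (Q * Q'); rewrite rmorphM hornerM. Qed.
Lemma gen_const z a : gen z (f a).
Proof. by exists a%:P; rewrite map_polyC hornerC. Qed.
Lemma gen_id z : gen z z.
Proof. by exists 'X; rewrite map_polyX hornerX. Qed.

Lemma genX z x n : gen z x -> gen z (x ^+ n).
Proof.
move=> h; elim: n => [|n IH]; last by rewrite exprS; exact: genM.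
by rewrite expr0 -(rmorph1 f); exact: gen_const.
Qed.

Lemma genN z x : gen z x -> gen z (- x).
Proof. by move=> [Q ->]; exists (- Q); rewrite rmorphN hornerN. Qed.

Lemma gen_trans z x y : gen z x -> gen x y -> gen z y.
Proof.
move=> h [Q ->]; rewrite horner_coef; elim/big_ind: _ => [|u v|i _].
- by rewrite -(rmorph0 f); exact: gen_const.
- exact: genD.
- by rewrite coef_map; apply: genM; [exact: gen_const|exact: genX].
Qed.

Lemma horner_expp P z : (P^f.[z]) ^+ p = \sum_(i < size P) f (P`_i) ^+ p * z ^+ (p * i).
Proof.
rewrite horner_coef size_map_poly -(pFrobenius_autE pL) rmorph_sum; apply: eq_bigr => i _.
by rewrite rmorphM /= !pFrobenius_autE coef_map -exprM mulnC.
Qed.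

Lemma gen_expp z x : gen z x -> gen (z ^+ p) (x ^+ p).
Proof.
move=> [Q ->]; rewrite horner_expp; elim/big_ind: _ => [|u v|i _].
- by rewrite -(rmorph0 f); exact: gen_const.
- exact: genD.
- by apply: genM; [rewrite -rmorphXn; exact: gen_const|rewrite exprM; apply: genX; exact: gen_id].
Qed.

Lemma gen_subring z (P : L -> Prop) x : (forall a, P (f a)) -> P z ->
 (forall u v, P u -> P v -> P (u + v)) -> (forall u v, P u -> P v -> P (u * v)) -> gen z x -> P x.
Proof.
move=> Pf Pz PD PM [Q ->]; rewrite horner_coef; elim/big_ind: _ => [||i _].
- by rewrite -(rmorph0 f).
- exact: PD.
rewrite coef_map; apply: (PM) => [|]; first exact: Pf; elim: (i : nat) => [|k IH]; last by rewrite exprS; exact: PM.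
by rewrite expr0 -(rmorph1 f).
Qed.

Lemma field_minp x : algebraicOver f x -> exists P, [/\ P \is monic, P^f.[x] = 0 &
  forall Q, Q^f.[x] = 0 -> P %| Q].
Proof.
move=> [Q Q0 /rootP rQ]; have hinv (a : K) : a != 0 -> exists b, b * a = 1.
 by move=> a0; exists a^-1; rewrite mulVf.
have [P [h1 h2 h3]] := minp_ex hinv (ex_intro2 _ _ Q Q0 rQ).
by exists P; split=> // Q' /h3[D ->]; exact: dvdp_mull.
Qed.

Lemma gen_alg z x : algebraicOver f z -> gen z x -> algebraicOver f x.
Proof.
move=> /integral_algebraic hz [Q ->]; apply/integral_algebraic; apply: integral_horner => //.
by apply/integral_poly => i; rewrite coef_map; exact: integral_id.
Qed.

(** Removing the largest power of X from a polynomial that kills x leaves one with nonzero constant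
    term, which expresses the inverse of x as a polynomial in x. *)
Lemma gen_inv z x : algebraicOver f z -> gen z x -> gen z x^-1.
Proof.
move=> hz hx; have [->|x0] := eqVneq x 0.
 by rewrite invr0 -(rmorph0 f); exact: gen_const.
have [Q Q0 /rootP rQ] := gen_alg hz hx.
have [m [Q1 h1 eQ]] := multiplicity_XsubC Q 0; rewrite Q0 /= in h1.
have rQ1 : Q1^f.[x] = 0.
 move/eqP: rQ; rewrite eQ subr0 rmorphM rmorphXn /= map_polyX hornerM horner_exp hornerX.
 by rewrite mulf_eq0 expf_eq0 (negPf x0) andbF orbF => /eqP.
have /factor_theorem[Q2 eQ2] : root (Q1 - (Q1.[0])%:P) 0 by rewrite rootE hornerD hornerN hornerC subrr.
have c0 : f Q1.[0] != 0 by rewrite fmorph_eq0.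
have e : Q2^f.[x] * x = - f Q1.[0].
 have := congr1 (fun P : {poly K} => P^f.[x]) eQ2.
 rewrite subr0 rmorphB rmorphM /= map_polyC map_polyX hornerD hornerN hornerC rQ1 hornerM hornerX sub0r.
 by move=> ->.
suff -> : x^-1 = f (- (Q1.[0])^-1) * Q2^f.[x].
 by apply: genM; [exact: gen_const|apply: (gen_trans hx); exists Q2].
apply: (mulIf x0); rewrite mulVf // -mulrA e rmorphN fmorphV mulrNN mulVf //.
Qed.

Lemma adj_ex z : algebraicOver f z -> exists M : subfield L, forall x, (x \in sf M) <-> gen z x.
Proof.
move=> hz; have cl : divring_closed [pred x | `[< gen z x >]].
 split=> [|x y /asboolP hx /asboolP hy|x y /asboolP hx /asboolP hy]; apply/asboolP.
 - by rewrite -(rmorph1 f); exact: gen_const.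
 - by apply: genD => //; exact: genN.
 - by apply: genM => //; exact: gen_inv.
by exists (Subfield cl) => x; split=> [/asboolP|h] //; exact/asboolP.
Qed.

(** The polynomial is X - Q(X^p): the derivative of X^p vanishes in characteristic p, so the
    derivative is the constant 1. *)
Lemma sepel_poly z : sepel z -> exists g : {poly K}, [/\ separable_poly g, root (g^f) z & g^`() = 1].
Proof.
move=> [Q eQ]; exists ('X - (Q \Po 'X^p)).
have d1 : ('X - (Q \Po 'X^p))^`() = 1.
 rewrite derivB derivX deriv_comp derivXn -mulr_natl -polyC_natr.
 have -> : (p%:R : K) = 0 by apply: (fmorph_inj f); rewrite rmorph_nat rmorph0 (pcharf0 pL).
 by rewrite mul0r mulr0 subr0.
split=> //; first by rewrite separable_poly.unlock d1 coprimep1.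
rewrite rootE rmorphB /= map_polyX map_comp_poly map_polyXn hornerD hornerN hornerX horner_comp.
by rewrite hornerXn {1}eQ subrr.
Qed.

Lemma sepel_alg z : sepel z -> algebraicOver f z.
Proof. by move=> /sepel_poly[g [sg rg _]]; exists g => //; exact: separable_poly_neq0. Qed.

(** If a polynomial Q of degree n < N = deg P killed z^p, every power z^i, being a power of W(z^p),
    would lie in the span of the n elements z^(p k) with k < n. The N powers of z below degree N
    would then be dependent, against the minimality of P. *)
Lemma sep_indep z P Q : P \is monic -> (forall Q, Q^f.[z] = 0 -> P %| Q) -> sepel z ->
 (size Q < size P)%N -> Q^f.[z ^+ p] = 0 -> Q = 0.
Proof.
move=> mP hP [W eW] sQ rQ; apply/eqP/negPn/negP => Q0.
pose N := (size P).-1; pose n := (size Q).-1.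
have sQ0 : (0 < size Q)%N by rewrite size_poly_gt0.
have nN : (n < N)%N by rewrite /n /N; lia.
(* The remainders give the coordinates of z^i on the powers of z^p; a nonzero vector of the left
   kernel of the resulting N x n matrix is the dependence relation. *)
pose g (i : nat) := (W ^+ i) %% Q.
have hg i : z ^+ i = \sum_(k < n) f (g i)`_k * z ^+ (p * k).
 have sg : (size (g i) <= n)%N by rewrite -ltnS prednK // ltn_modp.
 have -> : z ^+ i = (g i)^f.[z ^+ p].
  have := congr1 (fun P : {poly K} => P^f.[z ^+ p]) (divp_eq (W ^+ i) Q).
  by rewrite rmorphD rmorphM rmorphXn /= hornerD hornerM rQ mulr0 add0r horner_exp -eW => ->.
 rewrite (@horner_coef_wide _ n); last by rewrite size_map_poly.
 by apply: eq_bigr => k _; rewrite coef_map exprM.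
pose A := \matrix_(i < N, k < n) (g i)`_k.
have kA : kermx A != 0.
 rewrite kermx_eq0; apply/negP => /eqP h; have := rank_leq_col A; rewrite h leqNgt nN //.
have /rowV0Pn[v /sub_kermxP vA v0] := kA.
pose V := rVpoly v.
have sV : (size V <= N)%N by exact: size_poly.
have rV : V^f.[z] = 0.
 rewrite (@horner_coef_wide _ N); last by rewrite size_map_poly.
 under eq_bigr => i _ do rewrite coef_map coef_rVpoly_ord hg mulr_sumr.
 rewrite exchange_big /= big1 // => k _.
 transitivity (f ((v *m A) 0 k) * z ^+ (p * k)); last by rewrite vA mxE rmorph0 mul0r.
 by rewrite mxE rmorph_sum mulr_suml; apply: eq_bigr => i _; rewrite mxE rmorphM mulrA.
have /(hP _) /dvdp_leq h := rV.
have V0 : V = 0.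
 apply/eqP/negPn/negP => /h hh; move: (leq_trans hh sV) nN; rewrite /N.
 by case: (size P) => //= k; rewrite ltnn.
by rewrite -[v]rVpolyK -/V V0 linear0 eqxx in v0.
Qed.

End OverField.

Lemma lift_sfT (M : subfield L) (P : {poly L}) : (forall i, P`_i \in sf M) ->
 exists Q : {poly sfT M}, map_poly (sfv M) Q = P.
Proof.
move=> h; exists (\poly_(i < size P) (insubd (0 : sfT M) P`_i)); apply/polyP => i.
rewrite coef_map coef_poly; case: ltnP => hi; last by rewrite (raddf0 (sfv M)) nth_default.
by rewrite /= sfvE val_insubd h.
Qed.

Section Extensions.
Context (K : fieldType) (f : {rmorphism K -> L}).
Implicit Types (P Q : {poly K}) (x y z : L).
Local Notation "P ^f" := (map_poly f P).
Lemma gen_up (M : subfield L) z : (forall x, gen f z x -> x \in sf M) -> forall Q,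
 exists Q' : {poly sfT M}, map_poly (sfv M) Q' = Q^f.
Proof. by move=> h Q; apply: lift_sfT => i; rewrite coef_map; apply: h; exact: gen_const. Qed.

(** Over M = K(y^p) the minimal polynomial of y divides X^p - y^p = (X - y)^p, hence is (X - y)^k.
    It also divides P, of which y is a simple root; so k = 1 and y is in M. *)
Lemma etale_sep P y : P^f.[y] = 0 -> (P^`())^f.[y] != 0 -> sepel f y.
Proof.
move=> rP dP; have P0 : P != 0.
 by apply: contraNneq dP => ->; rewrite deriv0 rmorph0 horner0.
have ay : algebraicOver f y by exists P => //; apply/rootP.
have [M hM] := adj_ex (gen_alg ay (genX p (gen_id f y))).
have up := gen_up (fun x h => (hM x).2 h).
have [PM ePM] := up P.
have ypM : y ^+ p \in sf M by apply/hM; exact: gen_id.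
have [XM eXM] : exists Q' : {poly sfT M}, map_poly (sfv M) Q' = 'X^p - (y ^+ p)%:P.
 apply: lift_sfT => i; rewrite coefB coefXn coefC.
 have cl := sf_closed M.
 apply/hM; apply: genD; last apply: genN.
  by rewrite -(rmorph_nat f); exact: gen_const.
 by case: (i == 0%N); [exact: gen_id|rewrite -(rmorph0 f); exact: gen_const].
have aM : algebraicOver (sfv M) y.
 exists PM; last by apply/rootP; rewrite ePM.
 by rewrite -(map_poly_eq0 (sfv M)) ePM map_poly_eq0.
have [r [mr rr hr]] := field_minp aM.
have rX : map_poly (sfv M) r %| ('X - y%:P) ^+ p.
 have e : ('X - y%:P) ^+ p = 'X^p - (y ^+ p)%:P.
  have cL : p \in [pchar {poly L}] by rewrite (pchar_poly L).
  by rewrite -(pFrobenius_autE cL) rmorphB /= !pFrobenius_autE polyC_exp.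
 rewrite e -eXM dvdp_map; apply: hr; rewrite eXM hornerD hornerN hornerC hornerXn subrr //.
have /dvdp_exp_XsubCP[k kp ek] := rX.
have mrv : map_poly (sfv M) r \is monic by exact: monic_map.
have er : map_poly (sfv M) r = ('X - y%:P) ^+ k.
 by apply/eqP; rewrite -eqp_monic // monic_exp // monicXsubC.
have k1 : k = 1%N.
 case: k er {ek kp} => [|[|k]] er //.
  by move: rr; rewrite er expr0 hornerC => /eqP; rewrite oner_eq0.
 have : map_poly (sfv M) r %| P^f by rewrite -ePM dvdp_map; apply: hr; rewrite ePM.
 rewrite er !exprSr => /dvdpP[D eD].
 have dP' : (P^f)^`() = (P^`())^f by rewrite deriv_map.
 have cy : ('X - y%:P).[y] = 0 by rewrite hornerXsubC subrr.
 move: dP; rewrite -dP' eD !mulrA; move: (D * _) => D1.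
 by rewrite derivM hornerD !hornerM cy mulr0 mulr0 mul0r addr0 eqxx.
have : y = sfv M (- r`_0).
 have := congr1 (fun P : {poly L} => P`_0) er; rewrite k1 coef_map coefB coefX coefC sub0r rmorphN.
 by move=> ->; rewrite opprK.
move=> ey; have yM : y \in sf M by rewrite ey; exact: sfvP.
exact/(hM y).
Qed.

(** Over M = K(t^p), write t = r(z) with r of degree smaller than the minimal polynomial of z.
    Raising to the p-th power gives a relation between powers of z^p with coefficients r_i^p, and
    [sep_indep] kills all r_i with i > 0; so t = r_0 is in M. *)
Lemma sepel_gen z t : sepel f z -> gen f z t -> sepel f t.
Proof.
move=> hz [Q0 et0]; have az := sepel_alg hz.
have at_ : algebraicOver f t by apply: (gen_alg az); exists Q0.
have [M hM] := adj_ex (gen_alg at_ (genX p (gen_id f t))).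
have up := gen_up (fun x h => (hM x).2 h).
apply/hM.
have [Q1 eQ1] := up Q0; have [W eW] := hz; have [W1 eW1] := up W.
have hz1 : sepel (sfv M) z by exists W1; rewrite eW1.
have [P [mP rP hP]] := field_minp (sepel_alg hz1).
have tpM : t ^+ p \in sf M by apply/hM; exact: gen_id.
have [b eb] : exists b : sfT M, sfv M b = t ^+ p by exists (Sub (t ^+ p) tpM); exact: sfv_sub.
pose r := Q1 %% P; have r0 : (size r < size P)%N by rewrite ltn_modp monic_neq0.
have er : (map_poly (sfv M) r).[z] = t.
 have := congr1 (fun P : {poly sfT M} => (map_poly (sfv M) P).[z]) (divp_eq Q1 P).
 by rewrite rmorphD rmorphM /= hornerD hornerM rP mulr0 add0r eQ1 -et0 => ->.
have sP : (1 < size P)%N.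
 rewrite ltnNge; apply/negP => /size1_polyC eP; move: rP mP; rewrite eP map_polyC hornerC => /eqP.
 by rewrite fmorph_eq0 => /eqP ->; rewrite monicE lead_coef0 eq_sym oner_eq0.
(* The coefficients of r are raised to the power p, so that h takes the value t^p - b = 0 at z^p. *)
pose h := (\poly_(i < size r) (r`_i ^+ p)) - b%:P.
have rh : (map_poly (sfv M) h).[z ^+ p] = 0.
 rewrite (rmorphB (map_poly (sfv M))) /= map_polyC /= hornerD hornerN hornerC; rewrite eb -er horner_expp.
 rewrite (@horner_coef_wide _ (size r)) ?size_map_poly //.
 apply/eqP; rewrite subr_eq0; apply/eqP/eq_bigr => i _.
 by rewrite !coef_map /= coef_poly ltn_ord exprM; congr (_ * _); exact: rmorphXn.
have sh : (size h < size P)%N.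
 apply: (leq_ltn_trans (size_polyD _ _)); rewrite gtn_max (leq_ltn_trans (size_poly _ _)) //.
 by rewrite size_polyN (leq_ltn_trans (size_polyC_leq1 _)).
have h0 := sep_indep mP hP hz1 sh rh.
have eri : r = (r`_0)%:P.
 apply/polyP => -[|i]; rewrite coefC //=; have := congr1 (fun P : {poly sfT M} => P`_i.+1) h0.
 rewrite coefB coef_poly coefC /= subr0 coef0; case: ltnP => [_|hi _]; last by rewrite nth_default.
 by move/eqP; rewrite expf_eq0 => /andP[_ /eqP].
by rewrite -er eri map_polyC hornerC; exact: sfvP.
Qed.

(* x and z are polynomials in w = c z - x; if x is in the ring generated by z and x^p,
  then w is a polynomial in w^p *)
Lemma sep_trans z x : (forall n, exists s : seq K, uniq s /\ size s = n) -> sepel f z -> algebraicOver f x ->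
 (forall P : L -> Prop, (forall a, P (f a)) -> P z -> P (x ^+ p) ->
  (forall u v, P u -> P v -> P (u + v)) -> (forall u v, P u -> P v -> P (u * v)) -> P x) ->
 exists w, [/\ sepel f w, gen f w z & gen f w x].
Proof.
move=> infK hz [P P0 rP] hx; have [g [sg rg _]] := sepel_poly hz.
have [r r0 hr] := large_field_PET P0 rP rg sg.
have [s [us ss]] := infK (size r).
have [c nc] : exists c, ~~ root r (f c).
 apply: contrapT => h; have : (size [seq f c | c <- s] < size r)%N.
  apply: max_poly_roots => //; last by rewrite map_inj_uniq //; exact: fmorph_inj.
  apply/allP => _ /mapP[c _ ->]; apply/negPn/negP => hc; apply: h; by exists c.
 by rewrite size_map ss ltnn.
have [[X eX] [Z eZ]] := hr c nc; set w := f c * z - x in eX eZ.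
have gx : gen f w x by exists X; rewrite eX.
have gz : gen f w z by exists Z; rewrite eZ.
exists w; split=> //.
have gx' : gen f (w ^+ p) x.
 apply: hx => [a||||].
 - exact: gen_const.
 - by apply: gen_trans hz; exact: gen_expp.
 - exact: gen_expp.
 - by move=> u v; exact: genD.
 - by move=> u v; exact: genM.
rewrite /sepel; apply: genD; last exact: genN.
by apply: genM; [exact: gen_const|apply: gen_trans hz; exact: gen_expp].
Qed.

End Extensions.
End Separable.

Record subring (L : comNzRingType) := Subring { sr :> {pred L}; sr_closed : subring_closed sr }.

Section SubringType.
Context (L : comNzRingType) (K : subring L).
HB.instance Definition _ := GRing.isSubringClosed.Build L (sr K) (sr_closed K).
Definition srT := {x : L | x \in sr K}.
HB.instance Definition _ := SubType.on srT.
HB.instance Definition _ := Choice.on srT.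
HB.instance Definition _ := [SubChoice_isSubComNzRing of srT by <:].
Fact srv_key : {f : {rmorphism srT -> L} | forall x, f x = val x}.
Proof. by exists (val : {rmorphism srT -> L}). Qed.
Definition srv : {rmorphism srT -> L} := sval srv_key.
Lemma srvE x : srv x = val x. Proof. exact: (svalP srv_key). Qed.
Lemma srvP x : srv x \in sr K. Proof. rewrite srvE; exact: valP. Qed.
Lemma srv_ex y : y \in sr K -> exists a, srv a = y.
Proof. by move=> h; exists (Sub y h); rewrite srvE SubK. Qed.
Lemma srv_inj : injective srv.
Proof. by move=> x y; rewrite !srvE; exact: val_inj. Qed.

Lemma lift_srT (P : {poly L}) : (forall i, P`_i \in sr K) -> exists Q : {poly srT}, map_poly srv Q = P.
Proof.
move=> h; exists (\poly_(i < size P) (insubd (0 : srT) P`_i)); apply/polyP => i.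
rewrite coef_map coef_poly; case: ltnP => hi; last by rewrite (raddf0 srv) nth_default.
by rewrite /= srvE val_insubd h.
Qed.
End SubringType.

Lemma poly_choice (A A' : nzRingType) (P : A -> A' -> Prop) (Q : {poly A'}) : P 0 0 ->
 (forall i, exists a, P a Q`_i) -> exists Q' : {poly A}, forall i, P Q'`_i Q`_i.
Proof.
move=> h0 h; have [c hc] := choice h; exists (\poly_(i < size Q) c i) => i.
by rewrite coef_poly; case: ltnP => hi; [exact: hc|rewrite nth_default].
Qed.

Lemma rmorph_ex (A A' : pzRingType) (f : A -> A') : f 1 = 1 -> (forall x y, f (x - y) = f x - f y) ->
 (forall x y, f (x * y) = f x * f y) -> {r : {rmorphism A -> A'} | forall x, r x = f x}.
Proof.
move=> h1 hB hM.
pose fB := GRing.isZmodMorphism.Build _ _ f hB.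
pose fM := GRing.isMonoidMorphism.Build _ _ f (h1, hM).
pose r : {rmorphism _ -> _} := HB.pack f fB fM.
by exists r.
Qed.

Section PhiGammaModules.
Context (R : realType) (p : nat) (p_prime : prime p).
Local Notation padic := (padicField R p).

Lemma p_gt1 : (1 < p)%N. Proof. exact: prime_gt1. Qed.
Lemma p_gt0 : (0 < p)%N. Proof. exact: prime_gt0. Qed.
Lemma pexp_gt0 n : (0 < p ^ n)%N. Proof. by rewrite expn_gt0 p_gt0. Qed.
#[local] Hint Resolve p_gt0 p_gt1 pexp_gt0 : core.

Lemma pr_gt0 : 0 < p%:R :> R.
Proof. by rewrite ltr0n prime_gt0. Qed.
Lemma pr_gt1 : 1 < p%:R :> R.
Proof. by rewrite ltr1n prime_gt1. Qed.
Lemma ppow_gt0 n : 0 < p%:R ^- n :> R.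
Proof. by rewrite invr_gt0 exprn_gt0 // pr_gt0. Qed.
Lemma ppow_ge0 n : 0 <= p%:R ^- n :> R.
Proof. exact: ltW (ppow_gt0 n). Qed.
Lemma ppow0 : p%:R ^- 0 = 1 :> R.
Proof. by rewrite expr0 invr1. Qed.
Lemma ppow1 : p%:R ^- 1 = p%:R^-1 :> R.
Proof. by rewrite expr1. Qed.
Lemma ppowD m n : p%:R ^- (m + n) = p%:R ^- m * p%:R ^- n :> R.
Proof. by rewrite exprD invfM. Qed.
Lemma ppowS n : p%:R ^- n.+1 = p%:R^-1 * p%:R ^- n :> R.
Proof. by rewrite -add1n ppowD ppow1. Qed.

Lemma ppow_le m n : (m <= n)%N -> p%:R ^- n <= p%:R ^- m :> R.
Proof.
move=> mn; rewrite lef_pV2 ?posrE ?exprn_gt0 ?pr_gt0 //.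
by rewrite ler_eXn2l ?pr_gt1.
Qed.

Lemma ppow_le1 n : p%:R ^- n <= 1 :> R.
Proof. by have := ppow_le (leq0n n); rewrite ppow0. Qed.

Lemma ppow_lt1 n : p%:R ^- n.+1 < 1 :> R.
Proof.
by rewrite invf_lt1 ?exprn_gt0 ?pr_gt0 // exprn_egt1 // pr_gt1.
Qed.

Lemma pinv_lt1 : p%:R^-1 < 1 :> R.
Proof. by rewrite -ppow1 ppow_lt1. Qed.
Lemma pinv_le1 : p%:R^-1 <= 1 :> R.
Proof. exact: ltW pinv_lt1. Qed.
Lemma pinv_gt0 : 0 < p%:R^-1 :> R.
Proof. by rewrite invr_gt0 pr_gt0. Qed.
Lemma pinv_ge0 : 0 <= p%:R^-1 :> R.
Proof. exact: ltW pinv_gt0. Qed.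

Lemma pow_small (x e : R) : 0 <= x -> x < 1 -> 0 < e ->
 exists N, forall n, (N <= n)%N -> x ^+ n < e.
Proof.
move=> x0 x1 e0.
have /cvgrPdist_lt/(_ e e0) [N _ hN] : (fun n => x ^+ n) @ \oo --> (0 : R).
 by apply: cvg_expr; rewrite ger0_norm.
exists N => n Nn; have := hN n Nn.
by rewrite /= sub0r normrN ger0_norm // exprn_ge0.
Qed.

Lemma ppow_small (e : R) : 0 < e -> exists n, p%:R ^- n < e.
Proof.
move=> e0; have [N hN] := pow_small pinv_ge0 pinv_lt1 e0.
by exists N; rewrite -exprVn hN.
Qed.

Local Notation "`| x |" := (pnorm x) : ring_scope.
Local Notation W x := (`|x| <= 1).

Local Notation isometric f := (forall x, `|f x| = `|x|).
Local Notation near1 x := (`|x - 1| <= p%:R^-1).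

(** * Ultrametric fields: congruences, p-adic integers and p-adic exponents *)

Section Field.
Context {F : padic}.
Implicit Types (x y z : F) (v a : nat -> F).

Lemma pnormX x n : `|x ^+ n| = `|x| ^+ n.
Proof. by elim: n => [|n IH]; rewrite ?expr0 ?pnorm1 // !exprS pnormM IH. Qed.

Lemma pnormV x : `|x^-1| = (`|x|)^-1.
Proof.
have [->|x0] := eqVneq x 0; first by rewrite invr0 pnorm0 invr0.
have n0 : `|x| != 0 by rewrite pnorm_eq0.
by apply: (mulfI n0); rewrite -pnormM divff // pnorm1 divff.
Qed.

Lemma norm1N0 x : `|x| = 1 -> x != 0.
Proof. by move=> h; rewrite -pnorm_eq0 h oner_eq0. Qed.
Lemma pnorm_pow n : `|(p%:R ^+ n : F)| = p%:R ^- n.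
Proof. by rewrite pnormX pnorm_p exprVn. Qed.
Lemma pF_neq0 : p%:R != 0 :> F.
Proof. by rewrite -pnorm_eq0 pnorm_p gt_eqF // pinv_gt0. Qed.
Lemma pX_neq0 n : p%:R ^+ n != 0 :> F.
Proof. by rewrite expf_neq0 // pF_neq0. Qed.

Lemma W_nat n : W (n%:R : F).
Proof.
elim: n => [|n IH]; first by rewrite pnorm0.
by rewrite -natr1 pnormD_le // pnorm1.
Qed.

Lemma W_M x y : W x -> W y -> W (x * y).
Proof. by move=> hx hy; rewrite pnormM mulr_ile1 ?pnorm_ge0. Qed.

Lemma pnormMl_le x y e : W x -> `|y| <= e -> `|x * y| <= e.
Proof.
move=> hx hy; rewrite pnormM; apply: le_trans hy.
by rewrite ler_piMl ?pnorm_ge0.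
Qed.

Lemma pnormMr_le x y e : W y -> `|x| <= e -> `|x * y| <= e.
Proof. by move=> hx hy; rewrite mulrC pnormMl_le. Qed.
Lemma W_X x n : W x -> W (x ^+ n).
Proof. by move=> hx; rewrite pnormX exprn_ile1 ?pnorm_ge0. Qed.
Lemma pnormD_lt e x y : `|x| < e -> `|y| < e -> `|x + y| < e.
Proof. by move=> hx hy; apply: (le_lt_trans (pnormD _ _)); rewrite gt_max hx. Qed.
Lemma pnormBC x y : `|x - y| = `|y - x|.
Proof. by rewrite -pnormN opprB. Qed.

Lemma pnorm_dom x y : `|x| < `|y| -> `|x + y| = `|y|.
Proof.
move=> h; apply/eqP; rewrite eq_le pnormD_le ?(ltW h) //=.
rewrite leNgt; apply/negP => h2.
by have := pnormD_lt h2 (_ : `|- x| < `|y|); rewrite pnormN addrC addKr ltxx => /(_ h).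
Qed.

Lemma pnorm_close x y : `|x - y| < `|y| -> `|x| = `|y|.
Proof. by move/pnorm_dom; rewrite subrK. Qed.

(** A Bezout relation between p and n would otherwise put 1 in the open unit ball. *)
Lemma pnorm_coprime n : ~~ (p %| n)%N -> `|(n%:R : F)| = 1.
Proof.
move=> pn; have cp : coprime p n by rewrite prime_coprime.
have p0 := p_gt0.
have [km kn e _] := egcdnP n p0.
apply/eqP; rewrite eq_le W_nat leNgt; apply/negP => hlt.
move: (congr1 (fun m => m%:R : F) e); rewrite (eqP cp) natrD !natrM => ee.
have : `|(1 : F)| < 1.
 have -> : (1 : F) = km%:R * p%:R + - (kn%:R * n%:R) by rewrite ee; ring.
 apply: pnormD_lt; rewrite ?pnormN pnormM.
  by apply: le_lt_trans pinv_lt1; rewrite pnorm_p ler_piMl ?pinv_ge0 ?W_nat.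
 by apply: le_lt_trans hlt; rewrite ler_piMl ?pnorm_ge0 ?W_nat.
by rewrite pnorm1 ltxx.
Qed.

Lemma pnorm_dvd k n : (p ^ k %| n)%N -> `|(n%:R : F)| <= p%:R ^- k.
Proof.
move=> /dvdnP[m ->]; rewrite natrM natrX pnormM pnorm_pow.
by rewrite ler_piMl ?ppow_ge0 ?W_nat.
Qed.

Lemma natF_neq0 n : (0 < n)%N -> n%:R != 0 :> F.
Proof.
move=> n0; have := pfactor_coprime p_prime n0 => -[m cm ->].
rewrite natrM natrX mulf_neq0 ?pX_neq0 // -pnorm_eq0 pnorm_coprime ?oner_eq0 //.
by rewrite -prime_coprime.
Qed.

Definition cong n x y := `|x - y| <= p%:R ^- n.

Lemma congxx n x : cong n x x.
Proof. by rewrite /cong subrr pnorm0 ppow_ge0. Qed.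
Lemma congS n x y : cong n x y -> cong n y x.
Proof. by rewrite /cong pnormBC. Qed.

Lemma congT n x y z : cong n x y -> cong n y z -> cong n x z.
Proof.
move=> h1 h2; rewrite /cong; have -> : x - z = (x - y) + (y - z) by ring.
exact: pnormD_le.
Qed.

Lemma cong_le m n x y : (m <= n)%N -> cong n x y -> cong m x y.
Proof. by move=> mn h; apply: le_trans h (ppow_le mn). Qed.
Lemma cong0P n x : cong n x 0 <-> `|x| <= p%:R ^- n.
Proof. by rewrite /cong subr0. Qed.
Lemma congD n x y x' y' : cong n x y -> cong n x' y' -> cong n (x + x') (y + y').
Proof. by move=> h1 h2; rewrite /cong opprD addrACA pnormD_le. Qed.
Lemma congN n x y : cong n x y -> cong n (- x) (- y).
Proof. by rewrite /cong -opprD pnormN. Qed.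
Lemma congB n x y x' y' : cong n x y -> cong n x' y' -> cong n (x - x') (y - y').
Proof. by move=> h1 h2; apply: congD => //; apply: congN. Qed.

Lemma congM n x y x' y' : W x -> W y' ->
 cong n x y -> cong n x' y' -> cong n (x * x') (y * y').
Proof.
move=> nx ny h1 h2; rewrite /cong.
have -> : x * x' - y * y' = x * (x' - y') + (x - y) * y' by ring.
by apply: pnormD_le; [apply: pnormMl_le|apply: pnormMr_le].
Qed.

Lemma congMl n x y z : W z -> cong n x y -> cong n (z * x) (z * y).
Proof. by move=> nz h; rewrite /cong -mulrBr pnormMl_le. Qed.

Lemma congX n x y k : W x -> W y -> cong n x y -> cong n (x ^+ k) (y ^+ k).
Proof.
move=> nx ny h; elim: k => [|k IH]; first exact: congxx.
by rewrite !exprS; apply: congM => //; apply: W_X.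
Qed.

Lemma cong_sum (I : eqType) (s : seq I) (P : pred I) (f g : I -> F) n :
 (forall i, i \in s -> P i -> cong n (f i) (g i)) ->
 cong n (\sum_(i <- s | P i) f i) (\sum_(i <- s | P i) g i).
Proof.
by move=> h; rewrite /cong -sumrB; apply: pnorm_sum_le => //; apply: ppow_ge0.
Qed.

Lemma cong_eq x y : (forall n, cong n x y) -> x = y.
Proof.
move=> h; apply: pnorm_eq => e e0; have [n hn] := ppow_small e0.
exact: le_trans (h n) (ltW hn).
Qed.

Lemma cong_norm n x y : cong n x y -> W y -> W x.
Proof.
move=> h hy; rewrite -[x](subrK y); apply: pnormD_le => //.
exact: le_trans h (ppow_le1 n).
Qed.

Lemma congMp n k x y : cong n x y -> cong (k + n) (p%:R ^+ k * x) (p%:R ^+ k * y).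
Proof.
by move=> h; rewrite /cong -mulrBr pnormM pnorm_pow ppowD ler_pM2l ?ppow_gt0.
Qed.

Lemma congp n k x y : cong (k + n) (p%:R ^+ k * x) (p%:R ^+ k * y) -> cong n x y.
Proof.
by rewrite /cong -mulrBr pnormM pnorm_pow ppowD ler_pM2l ?ppow_gt0.
Qed.

Lemma padic_lim v : (forall n, cong n (v n.+1) (v n)) ->
 exists l, tends v l /\ forall n, cong n l (v n).
Proof.
move=> h.
have hc m n : (m <= n)%N -> cong m (v n) (v m).
 elim: n => [|n IH]; first by rewrite leqn0 => /eqP ->; exact: congxx.
 rewrite leq_eqVlt => /orP[/eqP ->|]; first exact: congxx.
 rewrite ltnS => mn; apply: congT (IH mn); exact: cong_le mn (h n).
have [l hl] : exists l, tends v l.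
 apply: pnorm_complete => e e0; have [M hM] := ppow_small e0.
 exists M => m n Mm Mn; apply: le_lt_trans hM.
 by apply: (@congT M _ (v M)); [apply: hc|apply/congS/hc].
exists l; split=> // n; move/tendsP: hl => /(_ _ (ppow_gt0 n))[M hM].
apply: (@congT n _ (v (maxn M n))).
 by apply: congS; apply: ltW; apply: hM; rewrite leq_maxl.
by apply: hc; rewrite leq_maxr.
Qed.

Lemma padic_tends v l : (forall n, exists N, forall m, (N <= m)%N -> cong n (v m) l) -> tends v l.
Proof.
move=> h; apply/tendsP => e e0; have [n hn] := ppow_small e0.
by have [N hN] := h n; exists N => m Nm; apply: le_lt_trans hn; exact: hN.
Qed.

Lemma padic_series a : (forall k, `|a k| <= p%:R ^- k) ->
 exists l, tends (fun M => \sum_(k < M) a k) l /\ forall M, cong M l (\sum_(k < M) a k).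
Proof.
move=> h; apply: padic_lim => n.
by rewrite big_ord_recr /= /cong addrAC subrr add0r.
Qed.

(** The closure of the natural numbers, that is the image of Z_p, described without a map from Q_p
    so that one theory of exponents serves Q_p, C_p and W(tilt)[1/p]. *)
Definition zint (s : F) := forall n, exists m : nat, cong n s m%:R.

Lemma zint_norm s : zint s -> W s.
Proof. by move=> /(_ 0)[m /cong_norm]; apply; exact: W_nat. Qed.
Lemma zint_nat m : zint m%:R.
Proof. by move=> n; exists m; exact: congxx. Qed.

Lemma zintD s t : zint s -> zint t -> zint (s + t).
Proof.
move=> hs ht n; have [m hm] := hs n; have [m' hm'] := ht n.
by exists (m + m')%N; rewrite natrD; apply: congD.
Qed.

Lemma zintM s t : zint s -> zint t -> zint (s * t).
Proof.
move=> hs ht n; have [m hm] := hs n; have [m' hm'] := ht n.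
exists (m * m')%N; rewrite natrM; apply: congM => //; first exact: zint_norm.
exact: W_nat.
Qed.

Lemma zintN s : zint s -> zint (- s).
Proof.
move=> hs n; have [m hm] := hs n.
(* The natural number m (p^n - 1) is congruent to -m modulo p^n. *)
exists (m * (p ^ n).-1)%N; apply: (@congT n _ (- m%:R)); first exact: congN.
rewrite /cong natrM; have p0 : (0 < p ^ n)%N by rewrite expn_gt0 prime_gt0.
have -> : - m%:R - m%:R * (p ^ n).-1%:R = - (m%:R * (p ^ n)%:R) :> F.
 by rewrite -[in RHS](prednK p0) -[in RHS]natr1; ring.
by rewrite pnormN; apply: pnormMl_le; rewrite ?W_nat // natrX pnorm_pow.
Qed.

Lemma zint_int (k : int) : zint k%:~R.
Proof. by case: k => k; rewrite ?NegzE ?mulrNz -pmulrn; [|apply: zintN]; apply: zint_nat. Qed.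

Lemma gbinom_nat (m k : nat) : gbinom (m%:R : F) k = 'C(m, k)%:R.
Proof.
rewrite /gbinom.
have -> : \prod_(i < k) ((m%:R : F) - i%:R) = (m ^_ k)%:R.
 elim: k => [|k IH]; first by rewrite big_ord0.
 rewrite big_ord_recr /= IH ffactnSr natrM.
 have [km|mk] := leqP k m; first by rewrite natrB.
 by rewrite ffact_small // !mul0r.
by rewrite -bin_ffact natrM mulfK // natF_neq0 // fact_gt0.
Qed.

(** The numerator is a polynomial with integral coefficients in s; dividing by k! costs a fixed
    power of p, which is the N of the proof. Integrality of generalized binomial coefficients
    follows by density of the naturals. *)
Lemma gbinom_cont (s : F) k n : zint s ->
 exists N, forall m : nat, cong N s m%:R -> cong n (gbinom s k) 'C(m, k)%:R.
Proof.
move=> hs; have k0 : (k`!%:R : F) != 0 by rewrite natF_neq0 // fact_gt0.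
have nk0 : 0 < `|(k`!%:R : F)| by rewrite lt_neqAle pnorm_ge0 eq_sym pnorm_eq0 k0.
have [N hN] := ppow_small nk0; exists (N + n)%N => m hm.
rewrite -gbinom_nat /cong -mulrBl pnormM pnormV ler_pdivrMr //.
have sn := zint_norm hs.
have hi i : W (s - i%:R) by apply: pnormB_le => //; apply: W_nat.
have hi' (i : nat) : W (m%:R - i%:R : F) by apply: pnormB_le; apply: W_nat.
have : cong (N + n) (\prod_(i < k) (s - i%:R)) (\prod_(i < k) (m%:R - i%:R)).
 elim: k {k0 nk0 hN} => [|k IH]; first by rewrite !big_ord0; apply: congxx.
 rewrite !big_ord_recr /=; apply: congM => //.
  by elim/big_ind: _ => [|x y hx hy|//]; rewrite ?pnorm1 ?W_M.
 by apply: congB => //; apply: congxx.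
move=> /le_trans; apply; rewrite ppowD mulrC; apply: ler_wpM2l => //.
exact: ltW.
Qed.

Lemma gbinom_le1 (s : F) k : zint s -> W (gbinom s k).
Proof.
move=> hs; have [N hN] := gbinom_cont k 0 hs; have [m hm] := hs N.
exact: cong_norm (hN m hm) (W_nat _).
Qed.

Lemma binom_term_le (s x : F) k : zint s -> near1 x ->
 `|gbinom s k * (x - 1) ^+ k| <= p%:R ^- k.
Proof.
move=> hs hx; apply: pnormMl_le; first exact: gbinom_le1.
by rewrite pnormX -exprVn lerXn2r ?nnegrE ?pnorm_ge0 ?pinv_ge0.
Qed.

Lemma zpow_partial (s x : F) : zint s -> near1 x ->
 forall M, cong M (zpow x s) (\sum_(k < M) gbinom s k * (x - 1) ^+ k).
Proof.
move=> hs hx M.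
have [l [hl hM]] := padic_series (fun k => binom_term_le k hs hx).
by rewrite /zpow (ulimP hl).
Qed.

Lemma expr_partial (m : nat) (x : F) M : near1 x ->
 cong M (x ^+ m) (\sum_(k < M) 'C(m, k)%:R * (x - 1) ^+ k).
Proof.
move=> hx.
have e : x ^+ m = \sum_(k < m.+1) 'C(m, k)%:R * (x - 1) ^+ k.
 rewrite -{1}[x](subrK 1) addrC exprDn; apply: eq_bigr => i _.
 by rewrite expr1n mul1r mulr_natl.
have hb k : `|'C(m, k)%:R * (x - 1) ^+ k| <= p%:R ^- k.
 by rewrite -gbinom_nat binom_term_le //; apply: zint_nat.
pose f k := ('C(m, k)%:R : F) * (x - 1) ^+ k.
rewrite e; change (forall k, `|f k| <= p%:R ^- k) in hb.
have tl n n' : (n <= n')%N -> cong n (\sum_(k < n') f k) (\sum_(k < n) f k).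
 move=> nn; rewrite -(subnK nn) addnC; elim: (n' - n)%N => [|j IH].
  by rewrite addn0; apply: congxx.
 rewrite addnS big_ord_recr /= /cong addrAC; apply: pnormD_le => //.
 by apply: le_trans (hb _) _; apply: ppow_le; rewrite leq_addr.
have [h|h] := leqP M m.+1; first exact: tl.
rewrite (_ : \sum_(k < M) f k = \sum_(k < m.+1) f k); first exact: congxx.
rewrite -(subnK (ltnW h)) addnC big_split_ord /= [X in _ + X]big1 ?addr0 // => i _.
by rewrite /f bin_small ?mul0r // ltn_addr.
Qed.

(** This approximation by natural powers is how the rules for exponents, and the compatibility of
    x^s with maps, are transported from natural to p-adic exponents. Only the n first terms of the
    binomial series count modulo p^n. *)
Lemma zpowP (s x : F) n : zint s -> near1 x ->
 exists N, forall m : nat, cong N s m%:R -> cong n (zpow x s) (x ^+ m).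
Proof.
move=> hs hx.
have [N hN] : exists N, forall m : nat, cong N s m%:R -> forall k, (k < n)%N ->
  cong n (gbinom s k) 'C(m, k)%:R.
 elim: {-2}n => [|n' [N hN]]; first by exists 0 => ? ? [].
 have [N' hN'] := gbinom_cont n' n hs; exists (maxn N N') => m hm k.
 rewrite ltnS leq_eqVlt => /orP[/eqP ->|kn].
  by apply: hN'; apply: cong_le hm; rewrite leq_maxr.
 by apply: hN => //; apply: cong_le hm; rewrite leq_maxl.
exists N => m hm; apply: congT (zpow_partial hs hx n) _.
apply: congT (congS (expr_partial m n hx)).
apply: cong_sum => i _ _; rewrite mulrC [X in cong _ _ X]mulrC; apply: congMl.
 by apply: W_X; apply: le_trans hx pinv_le1.
exact: hN.
Qed.

Lemma near1_norm x : near1 x -> `|x| = 1.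
Proof.
by move=> h; rewrite -(@pnorm1 R p F); apply: pnorm_close; rewrite pnorm1; apply: le_lt_trans pinv_lt1.
Qed.

Lemma near1M x y : near1 x -> near1 y ->
 near1 (x * y).
Proof.
move=> hx hy; have -> : x * y - 1 = x * (y - 1) + (x - 1) by ring.
by apply: pnormD_le => //; apply: pnormMl_le => //; rewrite near1_norm.
Qed.

Lemma near1V x : near1 x -> near1 (x^-1).
Proof.
move=> hx; have x0 : x != 0 by rewrite -pnorm_eq0 near1_norm.
have -> : x^-1 - 1 = - (x^-1 * (x - 1)) by field.
by rewrite pnormN pnormM pnormV near1_norm // invr1 mul1r.
Qed.

Lemma near1X x n : near1 x -> near1 (x ^+ n).
Proof.
move=> hx; elim: n => [|n IH]; first by rewrite subrr pnorm0.
by rewrite exprS near1M.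
Qed.

Lemma zpow_near1 x s : zint s -> near1 x -> near1 (zpow x s).
Proof.
move=> hs hx; have [N hN] := zpowP 1 hs hx; have [m hm] := hs N.
rewrite -[zpow x s](subrK (x ^+ m)) -addrA; apply: pnormD_le; last exact: near1X.
by rewrite -ppow1; exact: hN.
Qed.

Lemma zpow_norm x s : zint s -> near1 x -> `|zpow x s| = 1.
Proof. by move=> hs hx; apply: near1_norm; apply: zpow_near1. Qed.

Lemma zpow_nat x (m : nat) : near1 x -> zpow x m%:R = x ^+ m.
Proof.
move=> hx; apply: cong_eq => n; have [N hN] := zpowP n (zint_nat m) hx.
by apply: hN; apply: congxx.
Qed.

Lemma zpowM x y s : zint s -> near1 x -> near1 y ->
 zpow (x * y) s = zpow x s * zpow y s.
Proof.
move=> hs hx hy; apply: cong_eq => n.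
have [N1 h1] := zpowP n hs hx; have [N2 h2] := zpowP n hs hy.
have [N3 h3] := zpowP n hs (near1M hx hy).
have [m hm] := hs (maxn N1 (maxn N2 N3)).
apply: congT (h3 m _) _; first by apply: cong_le hm; rewrite !leq_max leqnn !orbT.
apply: congS; rewrite exprMn; apply: congM; rewrite ?zpow_norm //.
- by rewrite pnormX near1_norm // expr1n.
- by apply: h1; apply: cong_le hm; rewrite !leq_max leqnn.
- by apply: h2; apply: cong_le hm; rewrite !leq_max leqnn !orbT.
Qed.

Lemma zpowD x s t : zint s -> zint t -> near1 x ->
 zpow x (s + t) = zpow x s * zpow x t.
Proof.
move=> hs ht hx; apply: cong_eq => n.
have [N1 h1] := zpowP n hs hx; have [N2 h2] := zpowP n ht hx.
have [N3 h3] := zpowP n (zintD hs ht) hx.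
have [m hm] := hs (maxn N1 N3); have [m' hm'] := ht (maxn N2 N3).
apply: congT (h3 (m + m')%N _) _.
 by rewrite natrD; apply: congD; [apply: cong_le hm|apply: cong_le hm']; rewrite leq_maxr.
apply: congS; rewrite exprD; apply: congM; rewrite ?zpow_norm //.
- by rewrite pnormX near1_norm // expr1n.
- by apply: h1; apply: cong_le hm; rewrite leq_maxl.
- by apply: h2; apply: cong_le hm'; rewrite leq_maxl.
Qed.

Lemma zpow_natM x s (n : nat) : zint s -> near1 x ->
 zpow x (n%:R * s) = zpow (x ^+ n) s.
Proof.
move=> hs hx; elim: n => [|n IH].
 rewrite mul0r; have := zpow_nat 0 hx; rewrite expr0 => ->.
 apply: cong_eq => n; have h1 : near1 (1 : F).
  by rewrite subrr pnorm0 pinv_ge0.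
 have [N hN] := zpowP n hs h1; have [m hm] := hs N.
 by apply: congS; have := hN m hm; rewrite expr1n.
rewrite -natr1 mulrDl mul1r zpowD //; last by apply: zintM => //; apply: zint_nat.
by rewrite IH exprSr zpowM // near1X.
Qed.

Lemma zpowz x (j : int) s : zint s -> near1 x ->
 zpow x (j%:~R + s) = x ^ j * zpow x s.
Proof.
move=> hs hx; case: j => m.
 by rewrite -pmulrn zpowD ?zpow_nat //; apply: zint_nat.
have x0 : x != 0 by rewrite -pnorm_eq0 near1_norm.
rewrite NegzE mulrNz -pmulrn; set t := - _ + s.
have -> : zpow x s = zpow x (m.+1%:R + t) by congr zpow; rewrite /t; ring.
have ht : zint t.
 by rewrite /t; apply: zintD => //; apply: zintN; apply: zint_nat.
rewrite (zpowD (zint_nat m.+1) ht hx) zpow_nat // mulrA mulVf ?mul1r //.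
by rewrite expf_neq0.
Qed.

(** The cofactor 1 + x + ... + x^(n-1) of x - 1 in x^n - 1 is close to n, hence of norm 1. *)
Lemma root1_near (n : nat) x : ~~ (p %| n)%N -> x ^+ n = 1 -> `|x - 1| < 1 -> x = 1.
Proof.
move=> pn xn hx; apply/eqP; rewrite -subr_eq0; apply/eqP.
have h : (x - 1) * \sum_(i < n) x ^+ i = 0.
 by have := subrX1 x n; rewrite xn subrr.
have nx : `|x| = 1.
 by rewrite -(@pnorm1 R p F); apply: pnorm_close; rewrite pnorm1.
have : `|(\sum_(i < n) x ^+ i)| = 1.
 rewrite -(pnorm_coprime pn); apply: pnorm_close; rewrite (pnorm_coprime pn).
 have -> : (n%:R : F) = \sum_(i < n) 1 by rewrite sumr_const card_ord.
 rewrite -sumrB; apply: (le_lt_trans _ hx); apply: pnorm_sum_le => [|i _ _]; first exact: pnorm_ge0.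
 rewrite subrX1; apply: pnormMr_le => //.
 by apply: pnorm_sum_le => // k _ _; rewrite pnormX nx expr1n.
move=> hn; move/eqP: h; rewrite mulf_eq0 => /orP[/eqP //|/eqP e].
by move: hn; rewrite e pnorm0 => /esym/eqP; rewrite oner_eq0.
Qed.

Lemma p_mod_p2m1 : (p == 1 %[mod p ^ 2 - 1])%N = false.
Proof.
have p1 := p_gt1; have h2 : (2 * p <= p * p)%N by rewrite leq_mul2r p1 orbT.
by rewrite expnS expn1 !modn_small; lia.
Qed.

Lemma p2m1_coprime : ~~ (p %| p ^ 2 - 1)%N.
Proof.
have p0 := p_gt0.
apply/negP => h; have : (p %| 1)%N; last by rewrite Euclid_dvd1.
by rewrite -(@dvdn_addr (p ^ 2 - 1)%N) // subnK ?expn_gt0 ?p0 // dvdn_exp.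
Qed.

Lemma omegaP x w : w ^+ (p ^ 2 - 1) = 1 -> near1 (x / w) -> omega x = w.
Proof.
move=> hw hx; rewrite /omega; apply: xget_unique => // w' [hw' hx'].
have w0 (v : F) : v ^+ (p ^ 2 - 1) = 1 -> v != 0.
 have h : (p ^ 2 - 1 != 0)%N.
  by rewrite subn_eq0 -ltnNge (@leq_ltn_trans (p ^ 1)) ?expn_gt0 ?prime_gt0 // ltn_exp2l ?prime_gt1.
 by move=> e; apply/eqP => v0; move/eqP: e; rewrite v0 expr0n (negPf h) eq_sym oner_eq0.
have [a0 b0] := (w0 _ hw, w0 _ hw').
have x0 : x != 0.
 apply/eqP => x0; move: hx; rewrite x0 mul0r sub0r pnormN pnorm1.
 by rewrite leNgt pinv_lt1.
apply/eqP; rewrite -subr_eq0; apply/eqP.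
suff -> : w' = w by rewrite subrr.
have : w' / w = 1.
 apply: (root1_near p2m1_coprime); first by rewrite expr_div_n hw divr1.
 apply: le_lt_trans pinv_lt1.
 have -> : w' / w = (x / w) * (x / w')^-1.
  by field; rewrite ?a0 ?b0 ?x0.
 by apply: near1M => //; apply: near1V.
by move/(congr1 ( *%R^~ w)); rewrite divfK // mul1r.
Qed.

End Field.

Create HintDb closed.
#[local] Hint Resolve ppow_gt0 ppow_ge0 pinv_gt0 pinv_ge0 pr_gt0 pnorm_ge0 congxx W_nat pF_neq0 pX_neq0 : core.
#[local] Hint Resolve congD congN congB congMl congS zintD zintM zintN zint_nat zint_norm : closed.
#[local] Hint Resolve W_M W_X pnormD_le : closed.
Ltac clo := solve [auto 9 with closed].

Context (S : padicSetup R p).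
Local Notation B := (Bt S).
Local Notation C := (Cp S).
Local Notation K := (Qp S).
Local Notation T := (tilt S).
Local Notation iB := (QpBt S).
Local Notation iC := (QpCp S).
Local Notation fr := (frob S).
Local Notation fr2 x := (fr (fr x)).

(** * The tilt, its p-th roots, and the Teichmuller lifts *)

Section Tilt.
Implicit Types (x y z : B) (s t : T).

(** An element u with all coordinates 1 exists by surjectivity, and 1 * u = u then gives the
    coordinates of 1. *)
Lemma tcoord_one n : tcoord (1 : T) n = 1.
Proof.
have [u hu] := @tcoord_surj _ _ S (fun=> 1) (fun=> expr1n _ _).
have := tcoordM (1 : T) u n; rewrite mul1r hu mulr1.
by move=> <-.
Qed.

Lemma tcoordP s t : (forall n, tcoord s n = tcoord t n) -> s = t.
Proof. by move=> h; apply/tcoord_inj/funext. Qed.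

Lemma tcoord_zero n : tcoord (0 : T) n = 0.
Proof.
have h0 : (0 : C) ^+ p = 0 by rewrite expr0n gtn_eqF.
have [z hz] := @tcoord_surj _ _ S (fun=> 0) (fun=> h0).
suff -> : (0 : T) = z by rewrite hz.
apply: tcoordP => k.
by have := tcoordM z 0 k; rewrite mulr0 hz mul0r.
Qed.

Lemma tcoordX t m n : tcoord (t ^+ m) n = tcoord t n ^+ m.
Proof. by elim: m => [|m IH]; rewrite ?expr0 ?tcoord_one // !exprS tcoordM IH. Qed.

Lemma tcoord_iter t m n : tcoord t (n + m) ^+ (p ^ m) = tcoord t n.
Proof.
elim: m => [|m IH]; first by rewrite addn0.
by rewrite addnS expnS exprM tcoord_compat.
Qed.

(** Perfectness of the tilt: the p-th root is the shift of the sequence of coordinates. *)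
Definition rt t : T := xget 0 [set u | forall n, tcoord u n = tcoord t n.+1].

Lemma tcoord_rt t n : tcoord (rt t) n = tcoord t n.+1.
Proof.
have [u hu] := tcoord_surj (c := fun n => tcoord t n.+1) (fun n => tcoord_compat t n.+1).
have h : [set u | forall n, tcoord u n = tcoord t n.+1] u by move=> k; rewrite hu.
exact: (xgetPex 0 (ex_intro _ u h)).
Qed.

Lemma rtK t : rt t ^+ p = t.
Proof. by apply: tcoordP => n; rewrite tcoordX tcoord_rt tcoord_compat. Qed.

Lemma texpp_inj s t : s ^+ p = t ^+ p -> s = t.
Proof.
move=> h; apply: tcoordP => n.
by rewrite -(tcoord_compat s) -(tcoord_compat t) -!tcoordX h.
Qed.

Lemma rtE t : rt (t ^+ p) = t.
Proof. by apply: texpp_inj; rewrite rtK. Qed.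

Definition rtn n t := iter n rt t.

Lemma rtnK n t : rtn n t ^+ (p ^ n) = t.
Proof.
by elim: n => [|n IH]; rewrite /rtn ?expn0 ?expr1 //= expnS exprM rtK.
Qed.

Lemma tcoord_rtn n t k : tcoord (rtn n t) k = tcoord t (k + n).
Proof.
by elim: n k => [|n IH] k; rewrite ?addn0 //= tcoord_rt IH addnS.
Qed.

Lemma rtM s t : rt (s * t) = rt s * rt t.
Proof. by apply: texpp_inj; rewrite exprMn !rtK. Qed.
Lemma res0 : res (0 : B) = 0.
Proof. by apply/res_eq0; rewrite pnorm0 ?ler01 ?ltr01. Qed.

Lemma resN x : W x -> res (- x) = - res x.
Proof.
move=> h; apply: (addrI (res x)); rewrite -resD ?pnormN //.
by rewrite !subrr res0.
Qed.

Lemma resB x y : W x -> W y -> res (x - y) = res x - res y.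
Proof. by move=> h1 h2; rewrite resD ?pnormN // resN. Qed.

Lemma resX x n : W x -> res (x ^+ n) = res x ^+ n.
Proof.
move=> h; elim: n => [|n IH]; first by rewrite res1.
by rewrite !exprS resM ?IH // W_X.
Qed.

Lemma res_nat n : res (n%:R : B) = n%:R.
Proof.
elim: n => [|n IH]; first exact: res0.
by rewrite -!natr1 resD ?IH ?res1 ?pnorm1 ?W_nat.
Qed.

Lemma res_lt x : W x -> (res x = 0 <-> `|x| <= p%:R^-1).
Proof.
move=> h; split=> [/(res_eq0 h)/Bt_discrete //|h1]; apply/(res_eq0 h).
exact: le_lt_trans h1 pinv_lt1.
Qed.

Lemma res_cong x y : W x -> W y -> (res x = res y <-> cong 1 x y).
Proof.
move=> hx hy; rewrite //; rewrite -res_lt ?pnormB_le // resB //.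
by split=> [->|/eqP]; rewrite ?subrr // subr_eq0 => /eqP.
Qed.

Lemma tilt_p : p%:R = 0 :> T.
Proof. by rewrite -res_nat; apply/res_lt; rewrite ?W_nat // pnorm_p. Qed.
Lemma tilt_pchar : p \in [pchar T].
Proof. by rewrite inE p_prime tilt_p eqxx. Qed.

Lemma texppD n s t : (s + t) ^+ (p ^ n) = s ^+ (p ^ n) + t ^+ (p ^ n).
Proof.
elim: n => [|n IH] //.
by rewrite expnSr !exprM IH -!(pFrobenius_autE tilt_pchar) pFrobenius_autD_comm //; apply: mulrC.
Qed.

Lemma rtD s t : rt (s + t) = rt s + rt t.
Proof. by apply: texpp_inj; have := texppD 1 (rt s) (rt t); rewrite expn1 => ->; rewrite !rtK. Qed.
Lemma rtnD n s t : rtn n (s + t) = rtn n s + rtn n t.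
Proof. by elim: n => //= n IH; rewrite IH rtD. Qed.

Lemma rtN t : rt (- t) = - rt t.
Proof.
apply: (addrI (rt t)); rewrite -rtD !subrr; apply: texpp_inj.
by rewrite rtK expr0n gtn_eqF ?prime_gt0.
Qed.

Lemma B_div n x : `|x| <= p%:R ^- n -> exists2 y, W y & x = p%:R ^+ n * y.
Proof.
move=> h; exists (x / p%:R ^+ n); last by rewrite mulrC divfK.
by rewrite pnormM pnormV pnorm_pow invrK -(@ler_pM2r _ (p%:R ^- n)) ?ppow_gt0 // mulfK ?mul1r // gt_eqF // exprn_gt0 // pr_gt0.
Qed.

Lemma B_disc n x : `|x| < p%:R ^- n -> `|x| <= p%:R ^- n.+1.
Proof.
move=> h; have [y hy e] := B_div (ltW h).
have : `|y| < 1.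
 by move: h; rewrite e pnormM pnorm_pow // -{2}[p%:R ^- n]mulr1 ltr_pM2l ?ppow_gt0.
move/Bt_discrete => hy'.
by rewrite e pnormM pnorm_pow // -addn1 ppowD ppow1 ler_pM2l ?ppow_gt0.
Qed.

(** The integral second order remainder is what Newton iteration and the Krasner argument
    consume. *)
Lemma taylor (F : padic) (P : {poly F}) (x h : F) : (forall i, W P`_i) -> W x -> W h ->
 [/\ W P.[x], `|(P^`()).[x]| <= 1 &
  exists2 e, W e & P.[x + h] = P.[x] + h * (P^`()).[x] + h ^+ 2 * e].
Proof.
move=> hP nx nh; elim/poly_ind: P hP => [|P a IH] hP.
 rewrite deriv0 !horner0 pnorm0; split=> //; exists 0; rewrite ?pnorm0 //; ring.
have [|n1 n2 [e ne E]] := IH; first by move=> i; have := hP i.+1; rewrite coefD coefMX coefC /= addr0.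
have na : W a by have := hP 0%N; rewrite coefD coefMX coefC add0r.
rewrite derivD derivM derivX derivC mulr1 addr0 !hornerMXaddC hornerD hornerMX; split.
- by apply: pnormD_le => //; exact: W_M.
- by apply: pnormD_le => //; exact: W_M.
exists ((P^`()).[x] + e * (x + h)).
 by apply: pnormD_le => //; apply: W_M => //; exact: pnormD_le.
by rewrite E; ring.
Qed.

(** With a = b + e, the power e^p is divisible by e^2 and 2(n+1) >= n+2, while the mixed terms carry
    a factor p and a factor e. *)
Lemma cong_expp (F : padic) n (a b : F) : W a -> W b ->
 cong n.+1 a b -> cong n.+2 (a ^+ p) (b ^+ p).
Proof.
move=> na nb h; have h' : `|a - b| <= p%:R ^- n.+1 by [].
have ne : W (a - b) by apply: pnormB_le.
have ea : a = b + (a - b) by ring.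
have p1 := p_gt1.
move: (a - b) ne ea h' => e ne -> {}h.
rewrite /cong [X in `|X|](_ : _ = e ^+ p + p%:R * cross p b e); last by rewrite exprD_cross //; ring.
apply: pnormD_le.
 rewrite -[X in e ^+ X](@subnKC 2 p) // exprD; apply: pnormMr_le; first by clo.
 rewrite pnormM; apply: (@le_trans _ _ (p%:R ^- n.+1 * p%:R ^- n.+1)).
  by apply: ler_pM; rewrite ?pnorm_ge0.
 by rewrite -ppowD; apply: ppow_le; lia.
rewrite pnormM pnorm_p ppowS ler_wpM2l // /cross.
apply: pnorm_sum_le => [|i _ _] //.
rewrite exprS mulrCA; apply: pnormMr_le => //.
by apply: W_M; [apply: W_M|]; rewrite ?W_nat ?W_X.
Qed.

Lemma cong_pow (F : padic) n (x y : F) : W x -> W y -> cong 1 x y ->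
 cong n.+1 (x ^+ (p ^ n)) (y ^+ (p ^ n)).
Proof.
move=> hx hy h; elim: n => [|n IH] //.
by rewrite expnSr !exprM; apply: cong_expp => //; exact: W_X.
Qed.

Definition is_teich t x :=
 [/\ W x, res x = t & forall n, exists y, y ^+ (p ^ n) = x].

Lemma root_norm_le1 y n : W (y ^+ (p ^ n)) -> W y.
Proof.
rewrite pnormX => h; rewrite leNgt; apply/negP => h1; move: h.
by rewrite leNgt exprn_egt1 // -lt0n expn_gt0 prime_gt0.
Qed.

(** The p^n-th roots of x and y have the same residue because the Frobenius of the tilt is
    injective; raising to the power p^n turns a congruence modulo p into one modulo p^(n+1). *)
Lemma teich_uniq t x y : is_teich t x -> is_teich t y -> x = y.
Proof.
move=> [nx rx hx] [ny ry hy]; apply: cong_eq => n.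
have [u hu] := hx n; have [v hv] := hy n.
have nu : W u by apply: (@root_norm_le1 _ n); rewrite hu.
have nv : W v by apply: (@root_norm_le1 _ n); rewrite hv.
apply: (cong_le (leqnSn n)); rewrite -hu -hv; apply: cong_pow => //.
apply/res_cong => //; rewrite -[LHS](rtE (res u)).
have e k (a b : T) : a ^+ (p ^ k) = b ^+ (p ^ k) -> a = b.
 elim: k => [|k IH] //.
 by rewrite expnSr !exprM => /texpp_inj.
by rewrite rtE; apply: (e n); rewrite -!resX // hu hv rx ry.
Qed.

Lemma lift_ex t : exists x, `|x| <= 1 /\ res x = t.
Proof. exact: res_surj. Qed.

(** The classical limit of the p^n-th powers of arbitrary lifts of the p^n-th roots of t. *)
Lemma teich_ex t : exists x, is_teich t x.
Proof.
have [f hf] := choice lift_ex.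
pose v t n := f (rtn n t) ^+ (p ^ n).
have vn s n : W (v s n) by apply: W_X; case: (hf (rtn n s)).
have vc s n : cong n (v s n.+1) (v s n).
 apply: (cong_le (leqnSn n)); rewrite /v expnS exprM.
 have [h1 r1] := hf (rtn n.+1 s); have [h2 r2] := hf (rtn n s).
 apply: cong_pow => //; first by clo.
 by apply/res_cong; rewrite ?W_X // resX // r1 r2 /= rtK.
have [g hg] := choice (fun s => padic_lim (vc s)).
have gn s : W (g s).
 by apply: (@cong_norm _ 0 _ (v s 0)) => //; apply: (hg s).2.
exists (g t); split=> //.
 rewrite -[RHS](hf t).2; have -> : res (f t) = res (v t 1).
  have [h1 r1] := hf (rtn 1 t); have [h2 r2] := hf t.
  by rewrite /v expn1 resX // r1 r2 /= rtK.
 by apply/res_cong; [exact: gn|exact: vn|exact: (hg t).2].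
move=> n; exists (g (rtn n t)); apply: cong_eq => m.
apply: (congT _ (congS (cong_le (leq_addr n m) ((hg t).2 (m + n)%N)))).
apply: congT (congX (p ^ n) (gn _) (vn _ _) ((hg (rtn n t)).2 m)) _.
by rewrite /v -exprM -expnD /rtn -iterD; apply: congxx.
Qed.

Lemma teichP t : is_teich t (teich t).
Proof. by rewrite /teich; apply: (xgetPex 0 (teich_ex t)). Qed.
Lemma teichE t x : is_teich t x -> teich t = x.
Proof. exact: teich_uniq (teichP t). Qed.
Lemma W_teich t : W (teich t).
Proof. by case: (teichP t). Qed.
Lemma res_teich t : res (teich t) = t.
Proof. by case: (teichP t). Qed.

Lemma teichM s t : teich (s * t) = teich s * teich t.
Proof.
apply: teichE; have [n1 r1 h1] := teichP s; have [n2 r2 h2] := teichP t.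
split; rewrite ?W_M ?resM ?r1 ?r2 // => n.
by have [a <-] := h1 n; have [b <-] := h2 n; exists (a * b); rewrite exprMn.
Qed.

Lemma teich1 : teich (1 : T) = 1.
Proof.
by apply: teichE; split; rewrite ?pnorm1 ?res1 // => n; exists 1; rewrite expr1n.
Qed.

Lemma teich0 : teich (0 : T) = 0.
Proof.
apply: teichE; split; rewrite ?pnorm0 ?res0 // => n; exists 0.
by rewrite expr0n gtn_eqF // expn_gt0 prime_gt0.
Qed.

Lemma teichX t n : teich (t ^+ n) = teich t ^+ n.
Proof. by elim: n => [|n IH]; rewrite ?expr0 ?teich1 // !exprS teichM IH. Qed.

Lemma teich_norm t : t != 0 -> `|teich t| = 1.
Proof.
move=> t0; apply/eqP; rewrite eq_le W_teich leNgt; apply/negP.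
by move/(res_eq0 (W_teich t)); rewrite res_teich; apply/eqP.
Qed.

Lemma teich_neq0 t : t != 0 -> teich t != 0.
Proof. by move=> t0; rewrite -pnorm_eq0 teich_norm ?oner_eq0. Qed.

(** Having p^n-th roots for all n is preserved by ring homomorphisms, and this property
    characterizes Teichmuller lifts. *)
Lemma endo_teich (f : {rmorphism B -> B}) t :
 isometric f -> f (teich t) = teich (res (f (teich t))).
Proof.
move=> hf; apply/esym/teichE; split=> //; first by rewrite hf W_teich.
by move=> n; have [_ _ /(_ n)[y <-]] := teichP t; exists (f y); rewrite rmorphXn.
Qed.

Lemma frob_teich t : frob S (teich t) = teich (t ^+ p).
Proof.
rewrite (endo_teich _ (@frob_norm _ _ S)) frob_res ?W_teich //.
by rewrite res_teich.
Qed.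

Definition gt (g : galois S) t := res (galB g (teich t)).

Lemma gal_teich (g : galois S) t : galB g (teich t) = teich (gt g t).
Proof. exact: (endo_teich _ (@galB_norm _ _ _ g)). Qed.
Lemma tcoord_gt (g : galois S) t n : tcoord (gt g t) n = galC g (tcoord t n).
Proof. by rewrite /gt galB_res ?W_teich // res_teich. Qed.

Lemma res_gal (g : galois S) x : W x -> res (galB g x) = gt g (res x).
Proof.
move=> hx; apply: tcoordP => n.
by rewrite galB_res // tcoord_gt.
Qed.

Lemma saturate (P : B -> Prop) k x : (forall x, W x -> P (p%:R * x) -> P x) ->
 W x -> P (p%:R ^+ k * x) -> P x.
Proof.
move=> h nx; elim: k => [|k IH]; first by rewrite mul1r.
by rewrite exprS -mulrA => /h h'; apply/IH/h'; apply: W_M => //; exact/W_X/W_nat.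
Qed.

Lemma witt_digit x : W x -> exists2 y, W y & x = teich (res x) + p%:R * y.
Proof.
move=> hx; have : cong 1 x (teich (res x)).
 by apply/res_cong; rewrite ?W_teich ?res_teich.
move=> /B_div[y hy e]; exists y => //.
by rewrite -[p%:R]expr1 -e addrC subrK.
Qed.

End Tilt.
#[local] Hint Resolve W_teich : core.

(** * The universal property of Witt vectors *)

Section WittFunctor.
Implicit Types (x y b v : B) (c t : T).

Section Pairs.
Context {F : padic} (O : T -> Prop) (tau : T -> F).
Implicit Types (w u : F).

(** A homomorphism from the Witt vectors of O to F should send [c] to tau(c). Instead of a function,
    the subring of B x F generated by these pairs is considered; that it is the graph of a function,
    even a continuous one, is the content of [TT_norm_le]. *)
Inductive TT : B -> F -> Prop :=
| TT_teich c : O c -> TT (teich c) (tau c)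
| TT_one : TT 1 1
| TT_opp b w : TT b w -> TT (- b) (- w)
| TT_add b w b' w' : TT b w -> TT b' w' -> TT (b + b') (w + w')
| TT_mul b w b' w' : TT b w -> TT b' w' -> TT (b * b') (w * w').

Lemma TT_zero : TT 0 0.
Proof. by have := TT_add TT_one (TT_opp TT_one); rewrite !subrr. Qed.
Lemma TT_nat n : TT n%:R n%:R.
Proof. by elim: n => [|n IH]; [exact: TT_zero|rewrite -!natr1; apply: TT_add => //; exact: TT_one]. Qed.

Lemma TT_exp b w n : TT b w -> TT (b ^+ n) (w ^+ n).
Proof.
by move=> h; elim: n => [|n IH]; rewrite ?expr0 ?exprS; [exact: TT_one|exact: TT_mul].
Qed.

Lemma TT_sum n (f : nat -> B) (g : nat -> F) : (forall i, TT (f i) (g i)) ->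
 TT (\sum_(i < n) f i) (\sum_(i < n) g i).
Proof.
move=> h; elim: n => [|n IH]; rewrite ?big_ord0 ?big_ord_recr /=; first exact: TT_zero.
exact: TT_add.
Qed.

Lemma TT_cross b w b' w' : TT b w -> TT b' w' -> TT (cross p b b') (cross p w w').
Proof.
move=> h h'; apply: (@TT_sum _ (fun i => ('C(p, i.+1) %/ p)%:R * b ^+ (p - i.+1) * b' ^+ i.+1)
 (fun i => ('C(p, i.+1) %/ p)%:R * w ^+ (p - i.+1) * w' ^+ i.+1)) => i.
by apply: TT_mul; [apply: TT_mul; [exact: TT_nat|exact: TT_exp]|exact: TT_exp].
Qed.

(** O is perfect, and tau is multiplicative but additive only modulo p: both Fontaine's map x -> x_0
    to C_p and Teichmuller lifts composed with an endomorphism of the tilt have this form. *)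
Record witt_datum : Prop := WittDatum {
 wd_dom1 : O 1;
 wd_domD : forall s t, O s -> O t -> O (s + t);
 wd_domN : forall s, O s -> O (- s);
 wd_domM : forall s t, O s -> O t -> O (s * t);
 wd_domrt : forall s, O s -> O (rt s);
 wd_0 : tau 0 = 0;
 wd_1 : tau 1 = 1;
 wd_M : forall s t, O s -> O t -> tau (s * t) = tau s * tau t;
 wd_le1 : forall s, O s -> W (tau s);
 wd_D : forall s t, O s -> O t -> cong 1 (tau (s + t)) (tau s + tau t)
}.
Context (wd : witt_datum).
Let O1 := wd_dom1 wd.
Let OD := wd_domD wd.
Let ON := wd_domN wd.
Let OM := wd_domM wd.
Let Ort := wd_domrt wd.
Let tau0 := wd_0 wd.
Let tau1 := wd_1 wd.
Let tauM := wd_M wd.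
Let tau_le1 := wd_le1 wd.
Let tauD := wd_D wd.

Lemma tauX s n : O s -> tau (s ^+ n) = tau s ^+ n /\ O (s ^+ n).
Proof.
move=> h; elim: n => [|n [IH Oh]] => //.
rewrite !exprS; split; last by clo.
by rewrite tauM // IH.
Qed.

(** Modulo p, an element of the generated ring is a p-th power, simultaneously in both components:
    [c] is the p-th power of [c^(1/p)], and sums, opposites and products of p-th powers are p-th
    powers up to p times an element of the ring. *)
Lemma TT_root b w : TT b w -> exists b' w' v u,
 [/\ TT b' w', TT v u, b = b' ^+ p + p%:R * v & w = w' ^+ p + p%:R * u].
Proof.
elim=> {b w}.
- move=> c Oc; exists (teich (rt c)), (tau (rt c)), 0, 0.
 have Or := Ort Oc; split; rewrite ?mulr0 ?addr0; [exact: TT_teich|exact: TT_zero| |].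
  by rewrite -teichX // rtK.
 by rewrite -(tauX p Or).1 rtK.
- exists 1, 1, 0, 0; split; rewrite ?mulr0 ?addr0 ?expr1n //; [exact: TT_one|exact: TT_zero].
- move=> b w _ [b' [w' [v [u [h1 h2 -> ->]]]]].
 exists (if odd p then - b' else b'), (if odd p then - w' else w'),
  ((if odd p then 0 else - b' ^+ p) - v), ((if odd p then 0 else - w' ^+ p) - u).
 split; [| |by rewrite opprD [in LHS]exprN_cross // mulrBr addrA..].
  by case: (odd p) => //; apply: TT_opp.
 by case: (odd p); apply: TT_add; try exact: TT_opp; [exact: TT_zero|apply/TT_opp/TT_exp].
- move=> b w b2 w2 _ [b' [w' [v [u [h1 h2 -> ->]]]]] _ [b2' [w2' [v2 [u2 [h3 h4 -> ->]]]]].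
 exists (b' + b2'), (w' + w2'), (v + v2 - cross p b' b2'), (u + u2 - cross p w' w2').
 split; rewrite ?exprD_cross //; try ring; first exact: TT_add.
 by apply: TT_add; [exact: TT_add|apply/TT_opp/TT_cross].
- move=> b w b2 w2 _ [b' [w' [v [u [h1 h2 -> ->]]]]] _ [b2' [w2' [v2 [u2 [h3 h4 -> ->]]]]].
 exists (b' * b2'), (w' * w2'), (v * b2' ^+ p + v2 * b' ^+ p + p%:R * (v * v2)),
  (u * w2' ^+ p + u2 * w' ^+ p + p%:R * (u * u2)).
 split; rewrite ?exprMn; try ring; first exact: TT_mul.
 apply: TT_add; first by apply: TT_add; apply: TT_mul => //; apply: TT_exp.
 by apply: TT_mul; [exact: TT_nat|exact: TT_mul].
Qed.

Lemma TT_binom n b w v u : TT b w -> TT v u -> exists v' u',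
 [/\ TT v' u', (b + p%:R * v) ^+ n = b ^+ n + p%:R * v'
  & (w + p%:R * u) ^+ n = w ^+ n + p%:R * u'].
Proof.
move=> h h'; elim: n => [|n [v' [u' [h1 e1 e2]]]].
 by exists 0, 0; rewrite !expr0 !mulr0 !addr0; split=> //; exact: TT_zero.
exists (v * b ^+ n + (b + p%:R * v) * v'), (u * w ^+ n + (w + p%:R * u) * u').
split; rewrite ?exprS ?e1 ?e2; try ring.
apply: TT_add; apply: TT_mul => //; first exact: TT_exp.
by apply: TT_add => //; apply: TT_mul => //; exact: TT_nat.
Qed.

Lemma TT_rootn m b w : TT b w -> exists b' w' v u,
 [/\ TT b' w', TT v u, b = b' ^+ (p ^ m) + p%:R * v & w = w' ^+ (p ^ m) + p%:R * u].
Proof.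
move=> h; elim: m => [|m [b' [w' [v [u [h1 h2 -> ->]]]]]].
 by exists b, w, 0, 0; rewrite !expr1 !mulr0 !addr0; split=> //; exact: TT_zero.
have [b2 [w2 [v2 [u2 [h3 h4 -> ->]]]]] := TT_root h1.
have [v3 [u3 [h5 -> ->]]] := TT_binom (p ^ m) (TT_exp p h3) h4.
exists b2, w2, (v3 + v), (u3 + u); split=> //; first exact: TT_add.
 by rewrite expnS exprM; ring.
by rewrite expnS exprM; ring.
Qed.

Lemma TT_base b w : TT b w -> [/\ W b, W w, O (res b) & cong 1 w (tau (res b))].
Proof.
elim=> {b w}.
- by move=> c Oc; split; rewrite ?W_teich ?res_teich //; clo.
- by split; rewrite ?pnorm1 ?res1 //; rewrite tau1; exact: congxx.
- move=> b w _ [h1 h2 h3 h4]; rewrite !pnormN resN //; split=> //; first by clo.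
 have h := tauD h3 (ON h3); rewrite subrr tau0 in h.
 have -> : - w = (0 - (tau (res b) + tau (- res b))) + ((tau (res b) - w) + tau (- res b)) by ring.
 rewrite -[X in cong _ _ X]add0r -[X in cong _ _ (_ + X)]add0r; apply: congD.
  by rewrite /cong subr0.
 apply: congD => //.
 by rewrite /cong subr0; apply: congS.
- move=> b w b' w' _ [h1 h2 h3 h4] _ [h1' h2' h3' h4']; split; rewrite ?pnormD_le ?resD //.
  exact: OD.
 by apply: congT (congD h4 h4') _; apply/congS/tauD.
- move=> b w b' w' _ [h1 h2 h3 h4] _ [h1' h2' h3' h4']; split; rewrite ?W_M ?resM //.
  exact: OM.
 by rewrite tauM //; apply: congM => //; exact: tau_le1.
Qed.

(** Write b = b'^(p^n) + p v and w = w'^(p^n) + p u with the same shape. If p^(n+1) divides b, then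
    b' has residue 0, hence w' is divisible by p; both powers are divisible by p^(p^n), so by
    p^(n+1). The induction hypothesis applies to (v, u). *)
Lemma TT_norm_le n b w : TT b w -> `|b| <= p%:R ^- n -> `|w| <= p%:R ^- n.
Proof.
elim: n b w => [|n IH] b w h hb; first by rewrite ppow0; case: (TT_base h).
have base b' w' : TT b' w' -> `|b'| < 1 -> `|w'| <= p%:R^-1.
 move=> h' hb'; have [k1 k2 k3] := TT_base h'.
 by have -> : res b' = 0 by [apply/res_eq0]; rewrite tau0 /cong subr0 ppow1.
have [b' [w' [v [u [h1 h2 eb ew]]]]] := TT_rootn n h.
have [nb nw _ _] := TT_base h1; have [nv nu _ _] := TT_base h2.
have b1 : `|b' ^+ (p ^ n)| < 1.
 have -> : b' ^+ (p ^ n) = b - p%:R * v by rewrite eb addrK.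
 apply: pnormD_lt; first exact: le_lt_trans hb (ppow_lt1 n).
 rewrite pnormN pnormM pnorm_p; apply: le_lt_trans pinv_lt1.
 by rewrite ler_piMr ?pinv_ge0.
have b2 : `|b'| < 1.
 rewrite ltNge; apply/negP => h3; move: b1; rewrite pnormX ltNge exprn_ege1 //.
have small (G : padic) (a : G) : `|a| <= p%:R^-1 -> `|a ^+ (p ^ n)| <= p%:R ^- n.+1.
 move=> ha; apply: (@le_trans _ _ (p%:R^-1 ^+ (p ^ n))).
  by rewrite pnormX lerXn2r ?nnegrE ?pnorm_ge0 ?pinv_ge0.
 by rewrite exprVn; apply: ppow_le => //; apply: ltn_expl; exact: prime_gt1.
have sb := small _ _ (Bt_discrete b2); have sw := small _ _ (base _ _ h1 b2).
rewrite ew; apply: pnormD_le => //.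
rewrite pnormM pnorm_p ppowS ler_pM2l //; apply: IH h2 _.
rewrite -(@ler_pM2l _ p%:R^-1) // -ppowS -(@pnorm_p _ _ B) -pnormM.
have -> : p%:R * v = b - b' ^+ (p ^ n) by rewrite eb addrAC subrr add0r.
exact: pnormB_le.
Qed.

(* th x w: w is the image of x under the ring homomorphism from the p-adic closure of
  Z[[c], c in O] to F extending tau *)
Definition th x w := forall n, exists b u, [/\ TT b u, cong n x b & cong n w u].

Lemma th_uniq x w w' : th x w -> th x w' -> w = w'.
Proof.
move=> h h'; apply: cong_eq => n.
have [b [u [h1 h2 h3]]] := h n; have [b' [u' [h1' h2' h3']]] := h' n.
apply: congT h3 _; apply: congT (congS h3').
apply: (TT_norm_le (TT_add h1 (TT_opp h1'))).
exact: congT (congS h2) h2'.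
Qed.

Lemma th_norm_le1 x w : th x w -> `|x| <= 1 /\ W w.
Proof.
move=> /(_ 0)[b [u [/TT_base[n1 n2 _ _] h2 h3]]].
by split; [apply: cong_norm h2 n1|apply: cong_norm h3 n2].
Qed.

Lemma th_norm n x w : th x w -> `|x| <= p%:R ^- n -> `|w| <= p%:R ^- n.
Proof.
move=> /(_ n)[b [u [h1 h2 h3]]] hx; rewrite -[w](subrK u); apply: pnormD_le => //.
apply: (TT_norm_le h1); rewrite -[b](subrK x); apply: pnormD_le => //.
exact: congS.
Qed.

Lemma th_TT b w : TT b w -> th b w.
Proof. by move=> h n; exists b, w; split=> //; exact: congxx. Qed.

Lemma thD x w x' w' : th x w -> th x' w' -> th (x + x') (w + w').
Proof.
move=> h h' n; have [b [u [h1 h2 h3]]] := h n; have [b' [u' [h1' h2' h3']]] := h' n.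
by exists (b + b'), (u + u'); split; [exact: TT_add|exact: congD|exact: congD].
Qed.

Lemma thN x w : th x w -> th (- x) (- w).
Proof.
move=> h n; have [b [u [h1 h2 h3]]] := h n.
by exists (- b), (- u); split; [exact: TT_opp|exact: congN|exact: congN].
Qed.

Lemma thB x w x' w' : th x w -> th x' w' -> th (x - x') (w - w').
Proof. by move=> h h'; apply: thD => //; apply: thN. Qed.

Lemma thM x w x' w' : th x w -> th x' w' -> th (x * x') (w * w').
Proof.
move=> h h' n; have [b [u [h1 h2 h3]]] := h n; have [b' [u' [h1' h2' h3']]] := h' n.
have [n1 n2 _ _] := TT_base h1'.
have [n3 n4] := th_norm_le1 h.
by exists (b * b'), (u * u'); split; [exact: TT_mul|exact: congM|exact: congM].
Qed.

Lemma th1 : th 1 1. Proof. exact: th_TT TT_one. Qed.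
Lemma th_nat n : th n%:R n%:R. Proof. exact: th_TT (TT_nat n). Qed.
Lemma th_teich c : O c -> th (teich c) (tau c). Proof. by move=> h; apply/th_TT/TT_teich. Qed.
Lemma thX x w n : th x w -> th (x ^+ n) (w ^+ n).
Proof. by move=> h; elim: n => [|n IH]; rewrite ?expr0 ?exprS; [exact: th1|exact: thM]. Qed.

Lemma th_lim x w : (forall n, exists x' w', [/\ th x' w', cong n x x' & cong n w w']) -> th x w.
Proof.
move=> h n; have [x' [w' [h1 h2 h3]]] := h n; have [b [u [h4 h5 h6]]] := h1 n.
by exists b, u; split=> //; [apply: congT h2 h5|apply: congT h3 h6].
Qed.

Lemma th_ex x : (forall n, exists x', (exists w, th x' w) /\ cong n x x') -> exists w, th x w.
Proof.
move=> h; have [f hf] := choice h.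
have [g hg] := choice (fun n => (hf n).1).
have hc n : cong n (g n.+1) (g n).
 apply: th_norm (thB (hg n.+1) (hg n)) _.
 apply: congT (congS (cong_le (leqnSn n) (hf n.+1).2)) (hf n).2.
have [l [_ hl]] := padic_lim hc; exists l; apply: th_lim => n.
by exists (f n), (g n); split=> //; exact: (hf n).2.
Qed.

Lemma th_res x w : th x w -> O (res x) /\ cong 1 w (tau (res x)).
Proof.
move=> h; have [nx nw] := th_norm_le1 h; have [b [u [h1 h2 h3]]] := h 1.
have [nb nu Ob cb] := TT_base h1.
have -> : res x = res b by apply/res_cong.
by split=> //; apply: congT cb.
Qed.

(** An approximation b of p x has the form b'^(p^n) + p v with b' of residue 0, so v approximates x
    modulo p^n: the domain of the homomorphism is saturated for division by p. *)
Lemma th_divp x w : W x -> th (p%:R * x) w -> exists w', th x w'.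
Proof.
move=> nx h; apply: th_ex => n.
have [b [u [h1 h2 h3]]] := h n.+1.
have [b' [w' [v [u' [k1 k2 eb ew]]]]] := TT_rootn n h1.
exists v; split; first by exists u'; apply: th_TT.
have [nb' _ _ _] := TT_base k1; have [nv _ _ _] := TT_base k2.
have nb : `|b| <= p%:R^-1.
 rewrite -ppow1 -[b](subrK (p%:R * x)); apply: pnormD_le.
  by apply: congS; apply: cong_le h2.
 by apply: pnormMr_le => //; rewrite pnorm_p ppow1.
have b1 : `|b' ^+ (p ^ n)| < 1.
 have -> : b' ^+ (p ^ n) = b - p%:R * v by rewrite eb addrK.
 apply: le_lt_trans pinv_lt1; apply: pnormB_le => //.
 by apply: pnormMr_le => //; rewrite pnorm_p.
have b2 : `|b'| < 1.
 by rewrite ltNge; apply/negP => h4; move: b1; rewrite pnormX ltNge exprn_ege1.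
apply: (@congp _ n 1); rewrite expr1; apply: congT h2 _.
rewrite /cong eb addrK pnormX; apply: (@le_trans _ _ (p%:R^-1 ^+ (p ^ n))).
 by rewrite lerXn2r ?nnegrE ?pnorm_ge0 ?pinv_ge0 // Bt_discrete.
by rewrite exprVn; apply: ppow_le => //; apply: ltn_expl; exact: prime_gt1.
Qed.

End Pairs.
End WittFunctor.

(** * The norm of the tilt and Fontaine's map theta *)

Section Theta.
Implicit Types (x y z : B) (s t : T).

Lemma tnorm_coord t n : tnorm t = `|tcoord t n| ^+ (p ^ n).
Proof. by rewrite /tnorm -(tcoord_iter t n 0) pnormX add0n. Qed.
Lemma tnorm_ge0 t : 0 <= tnorm t. Proof. exact: pnorm_ge0. Qed.
Lemma tnorm0 : tnorm (0 : T) = 0.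
Proof. by rewrite /tnorm tcoord_zero // pnorm0. Qed.
Lemma tnorm1 : tnorm (1 : T) = 1.
Proof. by rewrite /tnorm tcoord_one pnorm1. Qed.
Lemma tnormM s t : tnorm (s * t) = tnorm s * tnorm t.
Proof. by rewrite /tnorm tcoordM pnormM. Qed.
Lemma tnormX t n : tnorm (t ^+ n) = tnorm t ^+ n.
Proof. by rewrite /tnorm tcoordX pnormX. Qed.

Lemma tnorm_eq0 t : (tnorm t == 0) = (t == 0).
Proof.
apply/eqP/eqP => [h|->]; last exact: tnorm0.
apply: tcoordP => n; rewrite tcoord_zero.
apply/eqP; rewrite -pnorm_eq0; move/eqP: h; rewrite (tnorm_coord t n).
by rewrite expf_eq0 => /andP[].
Qed.

Lemma tnorm_gt0 t : t != 0 -> 0 < tnorm t.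
Proof. by move=> t0; rewrite lt_neqAle tnorm_ge0 eq_sym tnorm_eq0 t0. Qed.

Lemma tnormV t : tnorm t^-1 = (tnorm t)^-1.
Proof.
have [->|t0] := eqVneq t 0; first by rewrite invr0 tnorm0 invr0.
have n0 : tnorm t != 0 by rewrite tnorm_eq0.
by apply: (mulfI n0); rewrite -tnormM !divff // tnorm1.
Qed.

Lemma tends_le (F : padic) (v : nat -> F) l e :
 (forall n, `|v n| <= e) -> tends v l -> `|l| <= e.
Proof.
move=> h /tendsP hl; apply/ler_addgt0Pr => d d0; have [M hM] := hl d d0.
rewrite -[l](subrK (v M)); apply: pnormD_le.
 rewrite pnormBC; apply: ltW; apply: lt_le_trans (hM M (leqnn _)) _.
 by rewrite lerDr; apply: le_trans (pnorm_ge0 _) (h 0).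
by apply: le_trans (h M) _; rewrite lerDl ltW.
Qed.

(** The 0-th coordinate of a sum is the limit of (s_m + t_m)^(p^m), whose norms obey the ultrametric
    bound. *)
Lemma tnormD s t : tnorm (s + t) <= Num.max (tnorm s) (tnorm t).
Proof.
apply: tends_le (tcoordD s t 0) => m; rewrite !(tnorm_coord _ m) add0n pnormX.
set a := `|tcoord s m|; set b := `|tcoord t m|.
have := pnormD (tcoord s m) (tcoord t m); rewrite -/a -/b => h.
apply: (@le_trans _ _ (Num.max a b ^+ (p ^ m))).
 by rewrite lerXn2r ?nnegrE ?pnorm_ge0 // le_max pnorm_ge0.
by rewrite le_max /Num.max; case: ltP => _; rewrite lexx ?orbT.
Qed.

Lemma tnormN t : tnorm (- t) = tnorm t.
Proof.
have h : tnorm (-1 : T) = 1.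
 have : tnorm (-1 : T) ^+ 2 = 1 by rewrite -tnormX sqrrN expr1n tnorm1.
 by move/eqP; rewrite sqrp_eq1 ?tnorm_ge0 // => /eqP.
by rewrite -mulN1r tnormM h mul1r.
Qed.

Lemma tnormD_le e s t : tnorm s <= e -> tnorm t <= e -> tnorm (s + t) <= e.
Proof. by move=> hs ht; apply: (le_trans (tnormD _ _)); rewrite ge_max hs. Qed.
Lemma tnormB_le e s t : tnorm s <= e -> tnorm t <= e -> tnorm (s - t) <= e.
Proof. by move=> hs ht; apply: tnormD_le; rewrite ?tnormN. Qed.
Lemma tnormD_lt e s t : tnorm s < e -> tnorm t < e -> tnorm (s + t) < e.
Proof. by move=> hs ht; apply: (le_lt_trans (tnormD _ _)); rewrite gt_max hs. Qed.

Lemma tnorm_dom s t : tnorm s < tnorm t -> tnorm (s + t) = tnorm t.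
Proof.
move=> h; apply/eqP; rewrite eq_le tnormD_le ?(ltW h) //=.
rewrite leNgt; apply/negP => h2.
by have := tnormD_lt h2 (_ : tnorm (- s) < tnorm t); rewrite tnormN addrC addKr ltxx => /(_ h).
Qed.

Lemma tnorm_le1X t n : (0 < n)%N -> (tnorm (t ^+ n) <= 1) = (tnorm t <= 1).
Proof.
move=> n0; rewrite tnormX; apply/idP/idP => h; last by rewrite exprn_ile1 ?tnorm_ge0.
rewrite leNgt; apply/negP => h1; move: h.
by rewrite leNgt exprn_egt1 ?gtn_eqF.
Qed.

Lemma tnorm_rt t : tnorm (rt t) ^+ p = tnorm t.
Proof. by rewrite -tnormX rtK. Qed.

Definition Oi t := tnorm t <= 1.

Lemma Oi0 : Oi 0. Proof. by rewrite /Oi tnorm0 ler01. Qed.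
Lemma Oi1 : Oi 1. Proof. by rewrite /Oi tnorm1. Qed.
Lemma OiD s t : Oi s -> Oi t -> Oi (s + t). Proof. exact: tnormD_le. Qed.
Lemma OiN s : Oi s -> Oi (- s). Proof. by rewrite /Oi tnormN. Qed.
Lemma OiM s t : Oi s -> Oi t -> Oi (s * t).
Proof. by rewrite /Oi tnormM => h1 h2; rewrite mulr_ile1 ?tnorm_ge0. Qed.
Lemma Oirt s : Oi s -> Oi (rt s).
Proof. by rewrite /Oi -{1}(rtK s) tnorm_le1X ?prime_gt0. Qed.
Lemma OiX s n : Oi s -> Oi (s ^+ n).
Proof. by move=> h; rewrite /Oi tnormX exprn_ile1 ?tnorm_ge0. Qed.

Lemma Oi_coord t n : Oi t -> W (tcoord t n).
Proof.
rewrite /Oi (tnorm_coord t n) => h; rewrite leNgt; apply/negP => h1; move: h.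
by rewrite leNgt exprn_egt1 // -lt0n expn_gt0 prime_gt0.
Qed.

Lemma exprD_cong1 (F : padic) (a b : F) m : W a -> W b ->
 cong 1 ((a + b) ^+ (p ^ m)) (a ^+ (p ^ m) + b ^+ (p ^ m)).
Proof.
move=> ha hb; elim: m => [|m IH]; first by rewrite !expr1; exact: congxx.
have hA : W (a ^+ (p ^ m)) by clo.
have hB : W (b ^+ (p ^ m)) by clo.
rewrite expnSr !exprM; set u := a ^+ _ in IH hA *; set v := b ^+ _ in IH hB *.
apply: congT (congX p _ _ IH) _; rewrite ?W_X ?pnormD_le //.
rewrite exprD_cross // /cong addrAC subrr add0r; apply: pnormMr_le; last by rewrite pnorm_p.
apply: pnorm_sum_le => // i _ _.
by do 2 (apply: W_M; rewrite ?W_X //); exact: W_nat.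
Qed.

Lemma tends_cong (F : padic) (v : nat -> F) l m c :
 (forall n, cong m (v n) c) -> tends v l -> cong m l c.
Proof.
move=> h /tendsP hl; have [M hM] := hl _ (ppow_gt0 m).
by apply: congT (h M); apply: congS; apply: ltW; exact: hM.
Qed.

(** In the limit defining the sum, (a + b)^(p^m) and a^(p^m) + b^(p^m) agree modulo p for integral a
    and b. *)
Lemma tcoordD_cong s t n : Oi s -> Oi t ->
 cong 1 (tcoord (s + t) n) (tcoord s n + tcoord t n).
Proof.
move=> hs ht; apply: tends_cong (tcoordD s t n) => m.
apply: congT (exprD_cong1 m (Oi_coord _ hs) (Oi_coord _ ht)) _.
by rewrite !tcoord_iter; exact: congxx.
Qed.

Definition tau0 t : C := tcoord t 0.

Lemma wd0 : witt_datum Oi tau0.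
Proof.
by split; [exact: Oi1|exact: OiD|exact: OiN|exact: OiM|exact: Oirt|exact: tcoord_zero|exact: tcoord_one|
 move=> s t _ _; exact: tcoordM| |move=> s t; exact: tcoordD_cong].
Qed.

Definition thC := th (F := C) Oi tau0.
(** The Witt vectors of the unit ball of the tilt, defined as the domain of theta: this makes them a
    ring at once, which coordinates do not show. [WplusP] identifies them with [Wplus]. *)
Definition Wp x := exists w, thC x w.
Definition theta x := xget 0 [set w | thC x w].

Lemma thetaP x : Wp x -> thC x (theta x).
Proof. by move=> [w hw]; exact: (xgetPex 0 (ex_intro _ w hw)). Qed.
Lemma thetaE x w : thC x w -> theta x = w.
Proof. by move=> h; exact: (th_uniq wd0 (thetaP (ex_intro _ w h)) h). Qed.
Lemma thC_M x w x' w' : thC x w -> thC x' w' -> thC (x * x') (w * w').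
Proof. exact: thM wd0 _ _ _ _. Qed.
Lemma Wp_le1 x : Wp x -> W x.
Proof. by move=> [w /(th_norm_le1 wd0)[]]. Qed.
Lemma WpD x y : Wp x -> Wp y -> Wp (x + y).
Proof. by move=> [w h] [w' h']; exists (w + w'); exact: thD. Qed.
Lemma WpN x : Wp x -> Wp (- x).
Proof. by move=> [w h]; exists (- w); exact: thN. Qed.
Lemma WpB x y : Wp x -> Wp y -> Wp (x - y).
Proof. by move=> h h'; apply: WpD => //; exact: WpN. Qed.
Lemma WpM x y : Wp x -> Wp y -> Wp (x * y).
Proof. by move=> [w h] [w' h']; exists (w * w'); exact: thC_M. Qed.
Lemma Wp1 : Wp 1. Proof. by exists 1; exact: th1. Qed.
Lemma Wp0 : Wp 0. Proof. by exists 0; exact: th_nat 0%N. Qed.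
Lemma Wp_nat n : Wp n%:R. Proof. by exists n%:R; exact: th_nat. Qed.
Lemma WpX x n : Wp x -> Wp (x ^+ n).
Proof. by move=> h; elim: n => [|n IH]; rewrite ?expr0 ?exprS; [exact: Wp1|exact: WpM]. Qed.
Lemma Wp_teich t : Oi t -> Wp (teich t).
Proof. by move=> h; exists (tau0 t); exact: th_teich. Qed.
Lemma Wp_sum (I : eqType) (r : seq I) (P : pred I) (f : I -> B) :
 (forall i, i \in r -> P i -> Wp (f i)) -> Wp (\sum_(i <- r | P i) f i).
Proof.
move=> h; rewrite big_seq_cond; elim/big_ind: _ => [|x y|i /andP[]]; [exact: Wp0|exact: WpD|exact: h].
Qed.

Lemma Wp_res x : Wp x -> Oi (res x).
Proof. by move=> [w /(th_res wd0)[]]. Qed.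
Lemma thetaD x y : Wp x -> Wp y -> theta (x + y) = theta x + theta y.
Proof. by move=> /thetaP h /thetaP h'; apply: thetaE; exact: thD. Qed.
Lemma thetaN x : Wp x -> theta (- x) = - theta x.
Proof. by move=> /thetaP h; apply: thetaE; exact: thN. Qed.
Lemma thetaB x y : Wp x -> Wp y -> theta (x - y) = theta x - theta y.
Proof. by move=> h h'; rewrite thetaD ?thetaN //; exact: WpN. Qed.
Lemma thetaM x y : Wp x -> Wp y -> theta (x * y) = theta x * theta y.
Proof. by move=> /thetaP h /thetaP h'; apply: thetaE; exact: thC_M. Qed.
Lemma theta_nat n : theta n%:R = n%:R.
Proof. by apply: thetaE; exact: th_nat. Qed.
Lemma thetaX x n : Wp x -> theta (x ^+ n) = theta x ^+ n.
Proof.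
move=> h; elim: n => [|n IH]; first by rewrite !expr0; exact: (theta_nat 1).
by rewrite !exprS thetaM ?IH //; exact: WpX.
Qed.
Lemma theta_teich t : Oi t -> theta (teich t) = tcoord t 0.
Proof. by move=> h; apply: thetaE; exact: th_teich. Qed.
Lemma theta_norm n x : Wp x -> `|x| <= p%:R ^- n -> `|theta x| <= p%:R ^- n.
Proof. by move=> /thetaP; exact: (th_norm wd0). Qed.
Lemma theta_cong n x y : Wp x -> Wp y -> cong n x y -> cong n (theta x) (theta y).
Proof. by move=> h h' k; rewrite /cong -thetaB //; apply: theta_norm => //; exact: WpB. Qed.
Lemma theta_le1 x : Wp x -> W (theta x).
Proof. by move=> h; have := @theta_norm 0 x h; rewrite ppow0; apply; exact: Wp_le1. Qed.
Lemma Wp_closed x : (forall n, exists y, Wp y /\ cong n x y) -> Wp x.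
Proof. by move=> h; apply: (th_ex wd0). Qed.

Lemma Wp_divp x : W x -> Wp (p%:R * x) -> Wp x.
Proof. by move=> h [w h']; exact: (th_divp wd0 h h'). Qed.

Lemma Wp_div n x : Wp x -> `|x| <= p%:R ^- n -> exists2 y, Wp y & x = p%:R ^+ n * y.
Proof.
move=> h /(B_div)[y ny e]; exists y => //.
by apply: (saturate (k := n) Wp_divp) => //; rewrite -e.
Qed.

Lemma Wp_ind (P : B -> Prop) :
 (forall t, Oi t -> P (teich t)) -> P 1 -> (forall x, P x -> P (- x)) ->
 (forall x y, P x -> P y -> P (x + y)) -> (forall x y, P x -> P y -> P (x * y)) ->
 (forall x, (forall n, exists y, P y /\ cong n x y) -> P x) -> forall x, Wp x -> P x.
Proof.
move=> Pt P1 PN PD PM Pl x [w h]; apply: Pl => n; have [b [u [h1 h2 _]]] := h n.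
exists b; split=> //; elim: h1; auto.
Qed.

Lemma Wp_endo (f : {rmorphism B -> B}) : isometric f ->
 (forall t, Oi t -> Wp (f (teich t))) -> forall x, Wp x -> Wp (f x).
Proof.
move=> fn ft; apply: Wp_ind => //.
- by rewrite rmorph1; exact: Wp1.
- by move=> x; rewrite rmorphN; exact: WpN.
- by move=> x y; rewrite rmorphD; exact: WpD.
- by move=> x y; rewrite rmorphM; exact: WpM.
- move=> x h; apply: Wp_closed => n; have [y [h1 h2]] := h n.
 by exists (f y); split=> //; rewrite /cong -rmorphB fn.
Qed.

Lemma Wp_frob x : Wp x -> Wp (frob S x).
Proof.
apply: Wp_endo => [y|t ht]; first exact: frob_norm.
by rewrite frob_teich //; apply: Wp_teich; exact: OiX.
Qed.

Lemma tnorm_gt (g : galois S) t : tnorm (gt g t) = tnorm t.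
Proof. by rewrite /tnorm tcoord_gt // galC_norm. Qed.

Lemma Wp_gal (g : galois S) x : Wp x -> Wp (galB g x).
Proof.
apply: Wp_endo => [y|t ht]; first exact: galB_norm.
by rewrite gal_teich //; apply: Wp_teich; rewrite /Oi tnorm_gt.
Qed.

Lemma theta_gal (g : galois S) x : Wp x -> theta (galB g x) = galC g (theta x).
Proof.
move=> h; suff [_] : Wp x /\ theta (galB g x) = galC g (theta x) by [].
move: h; apply: (Wp_ind (P := fun x => Wp x /\ theta (galB g x) = galC g (theta x))) x.
- move=> t ht; split; first exact: Wp_teich.
 by rewrite gal_teich // !theta_teich ?tcoord_gt // /Oi tnorm_gt.
- by split; [exact: Wp1|have t1 : theta 1 = 1 := theta_nat 1; rewrite rmorph1 t1 rmorph1].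
- move=> x [h e]; split; first exact: WpN.
 by rewrite rmorphN !thetaN ?e ?rmorphN //; exact: Wp_gal.
- move=> x y [h e] [h' e']; split; first exact: WpD.
 by rewrite rmorphD !thetaD ?e ?e' ?rmorphD //; exact: Wp_gal.
- move=> x y [h e] [h' e']; split; first exact: WpM.
 by rewrite rmorphM !thetaM ?e ?e' ?rmorphM //; exact: Wp_gal.
- move=> x hx; have h : Wp x by apply: Wp_closed => n; have [y [[]]] := hx n; exists y.
 split=> //; apply: cong_eq => n; have [y [[h1 e] h2]] := hx n.
 apply: congT (theta_cong (Wp_gal g h) (Wp_gal g h1) _) _.
  by rewrite /cong -rmorphB galB_norm.
 by rewrite e /cong -rmorphB galC_norm; apply/congS/theta_cong.
Qed.

(** A rational number of norm at most 1 has a denominator prime to p, which is inverted modulo p^n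
    by a Bezout relation; rationals are dense. *)
Lemma Qp_zint (s : Qp S) : W s -> zint s.
Proof.
move=> hs n; have [q hq] := Qp_dense s (ppow_gt0 n).
have nq : W (ratr q : Qp S).
 by apply: (@cong_norm _ n _ s) => //; rewrite /cong pnormBC ltW.
suff [m hm] : exists m : nat, cong n (ratr q : Qp S) m%:R.
 by exists m; apply: congT hm; apply: ltW.
rewrite /ratr in nq *; have d0 := denq_gt0 q.
have [dn dE] : exists dn : nat, denq q = dn%:Z by exists `|denq q|%N; rewrite gez0_abs.
have pd : ~~ (p %| dn)%N.
 apply/negP => pd; have cnd := coprime_num_den q; move: nq.
 have pnum : ~~ (p %| `|numq q|)%N.
  apply/negP => pn; have : (p %| gcdn `|numq q| `|denq q|)%N by rewrite dvdn_gcd pn dE.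
  by rewrite (eqP cnd) Euclid_dvd1.
 have num1 : `|((numq q)%:~R : Qp S)| = 1.
  rewrite -(pnorm_coprime (F := Qp S) pnum).
  by case: (intP (numq q)) => [|k|k]; rewrite ?absz0 // ?mulrNz ?pnormN -?pmulrn // abszN.
 have dgt : (0 < dn)%N by lia.
 have d1 := pnorm_dvd (F := Qp S) (k := 1) (n := dn); rewrite expn1 in d1.
 have {}d1 := d1 pd.
 rewrite pnormM num1 mul1r pnormV dE -pmulrn leNgt invf_gt1.
  by rewrite (le_lt_trans d1) // ppow1 pinv_lt1.
 by rewrite lt_neqAle pnorm_ge0 eq_sym pnorm_eq0 natF_neq0.
have cop : coprime dn (p ^ n) by rewrite coprime_sym coprimeXl // prime_coprime.
have dgt : (0 < dn)%N by lia.
have [u v e _] := egcdnP (p ^ n) dgt; rewrite (eqP cop) in e.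
have nd := pnorm_coprime (F := Qp S) pd.
have dn0 : (dn%:R : Qp S) != 0 by rewrite natF_neq0.
have [m hm] := zint_int (F := Qp S) (numq q) n.
exists (m * u)%N; rewrite dE -pmulrn.
rewrite /cong; set z := _ - _; have -> : `|z| = `|z * dn%:R| by rewrite pnormM nd mulr1.
rewrite mulrBl divfK // natrM -mulrA -natrM e natrD natrM.
have -> : (numq q)%:~R - m%:R * (v%:R * (p ^ n)%:R + 1%:R) = ((numq q)%:~R - m%:R) - m%:R * v%:R * (p ^ n)%:R :> Qp S.
 by rewrite mulr1n; ring.
apply: pnormB_le => //; apply: pnormMl_le; last by rewrite natrX pnorm_pow.
by rewrite -natrM W_nat.
Qed.

Lemma zint_morph (F : padic) (i : {rmorphism K -> F}) (s : K) : isometric i -> W s -> zint (i s).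
Proof.
move=> ni /Qp_zint h n; have [m hm] := h n; exists m.
by rewrite /cong -(rmorph_nat i) -rmorphB ni.
Qed.

Lemma zint_QpBt (s : Qp S) : W s -> zint (QpBt S s).
Proof. by apply: zint_morph => x; exact: QpBt_norm. Qed.

Lemma Wp_QpBt (s : Qp S) : W s -> Wp (QpBt S s).
Proof.
move=> /zint_QpBt h; apply: Wp_closed => n; have [m hm] := h n.
by exists m%:R; split=> //; exact: Wp_nat.
Qed.

Lemma theta_QpBt (s : Qp S) : W s -> theta (QpBt S s) = QpCp S s.
Proof.
move=> hs; apply: cong_eq => n; have [m hm] := Qp_zint hs n.
apply: (@congT _ _ _ (theta m%:R)).
 apply: theta_cong; [exact: Wp_QpBt|exact: Wp_nat|].
 by rewrite /cong -(rmorph_nat (QpBt S)) -rmorphB QpBt_norm.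
by rewrite theta_nat /cong -(rmorph_nat (QpCp S)) -rmorphB QpCp_norm; apply: congS.
Qed.

Lemma F_scale (F : padic) (x : F) : exists n, W (p%:R ^+ n * x).
Proof.
have e0 : 0 < (1 + `|x|)^-1 by rewrite invr_gt0 ltr_wpDr ?pnorm_ge0.
have [n hn] := ppow_small e0.
exists n; rewrite pnormM pnorm_pow -[X in _ <= X](@mulVf _ (1 + `|x|)); last first.
 by rewrite gt_eqF // ltr_wpDr ?pnorm_ge0.
by apply: ler_pM; rewrite ?ppow_ge0 ?pnorm_ge0 ?(ltW hn) // lerDr.
Qed.

Lemma unit_scale (x : B) : x != 0 -> exists k l : nat, `|p%:R ^+ k * x / p%:R ^+ l| = 1.
Proof.
move=> x0; have [k hk] := F_scale x; set y := _ * x in hk.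
have y0 : 0 < `|y| by rewrite lt_neqAle eq_sym pnorm_eq0 mulf_neq0 ?expf_neq0 ?pF_neq0 ?pnorm_ge0.
have hn := ppow_small y0.
case: (ex_minnP hn) => -[|l] hl hm; first by move: hl; rewrite ppow0 ltNge hk.
exists k, l; rewrite -/y pnormM pnormV pnorm_pow invrK.
have : `|y| = p%:R ^- l.
 apply/eqP; rewrite eq_le; apply/andP; split; rewrite leNgt; apply/negP => h.
  by have := hm _ h; rewrite ltnn.
 have h' : `|y| <= p%:R ^- l.+1 by exact: B_disc.
 by move: h'; rewrite leNgt hl.
by move=> ->; rewrite mulVf // expf_neq0 // gt_eqF ?pr_gt0.
Qed.

(** A ring homomorphism fixes the naturals, an isometric one their closure Z_p, and a power of p
    brings any element of Q_p into Z_p. *)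
Lemma isom_QpBt (f : {rmorphism B -> B}) (s : Qp S) : isometric f ->
 f (QpBt S s) = QpBt S s.
Proof.
move=> fn; have [n hn] := F_scale (QpBt S s).
suff h (a : Qp S) : W a -> f (QpBt S a) = QpBt S a.
 have := h (p%:R ^+ n * s); rewrite -QpBt_norm !rmorphM !rmorphXn !rmorph_nat.
 by move=> /(_ hn)/(mulfI (pX_neq0 n)).
move=> hs; apply: cong_eq => k; have [m hm] := zint_QpBt hs k.
apply: congT (congS hm); rewrite -(rmorph_nat f).
by rewrite /cong -rmorphB fn.
Qed.

End Theta.
#[local] Hint Resolve tnorm_ge0 Oi0 Oi1 Wp0 Wp1 Wp_nat : core.
#[local] Hint Resolve OiD OiN OiM OiX Oirt Wp_le1 WpD WpN WpB WpM WpX Wp_teich Wp_res Wp_frob Wp_QpBt : closed.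

(** * Bijectivity of Frobenius, coordinates of Witt vectors, completeness of the tilt *)

Section WittTopology.
Implicit Types (x y z : B) (s t : T).

Lemma W_approx n x : W x -> exists b, cong n x b /\
 forall (F : padic) (tau : T -> F), exists u, TT (fun=> True) tau b u.
Proof.
elim: n x => [|n IH] x hx.
 exists 0; split=> [|F tau]; last by exists 0; exact: TT_zero.
 by rewrite /cong subr0 ppow0.
have [y hy ->] := witt_digit hx; have [b [h1 h2]] := IH y hy.
exists (teich (res x) + p%:R * b); split=> [|F tau].
 apply: congD => //.
 by pose proof (congMp 1 h1) as e; rewrite add1n expr1 in e.
have [u hu] := h2 F tau; exists (tau (res x) + p%:R * u).
by apply: TT_add; [exact: TT_teich|apply: TT_mul => //; exact: TT_nat].
Qed.

Lemma th_total (F : padic) (tau : T -> F) x : witt_datum (fun=> True) tau ->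
 W x -> exists w, th (fun=> True) tau x w.
Proof.
move=> wd hx; apply: (th_ex wd) => n; have [b [h1 h2]] := W_approx n hx.
by have [u hu] := h2 F tau; exists b; split=> //; exists u; apply: th_TT.
Qed.

(** Functoriality of Witt vectors: an endomorphism of the tilt lifts to W(tilt). It is used for the
    inverse of Frobenius and for Galois actions. *)
Lemma wd_teich_comp (f : T -> T) : f 0 = 0 -> f 1 = 1 ->
 (forall s t, f (s * t) = f s * f t) -> (forall s t, f (s + t) = f s + f t) ->
 witt_datum (fun=> True) (teich \o f : T -> B).
Proof.
move=> f0 f1 fM fD; split=> //=; rewrite ?f0 ?f1 ?teich0 ?teich1 //.
- by move=> s t _ _; rewrite fM teichM.
- move=> s t _ _; apply/res_cong; rewrite ?pnormD_le //.
 by rewrite resD ?W_teich // !res_teich.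
Qed.

Lemma rt0 : rt (0 : T) = 0.
Proof. by apply: texpp_inj => //; rewrite rtK // expr0n gtn_eqF ?prime_gt0. Qed.
Lemma rt1 : rt (1 : T) = 1.
Proof. by apply: texpp_inj => //; rewrite rtK // expr1n. Qed.

Lemma endo_ext (f h : {rmorphism B -> B}) :
 isometric f -> isometric h ->
 (forall t, f (teich t) = h (teich t)) -> forall x, f x = h x.
Proof.
move=> fn hn e x; have [k hk] := F_scale x.
have c n y : W y -> cong n (f y) (h y).
 elim: n y => [|n IH] y hy; first by rewrite /cong ppow0 pnormB_le ?fn ?hn.
 have [z hz ->] := witt_digit hy; rewrite !rmorphD !rmorphM !rmorph_nat e.
 apply: congD => //.
 by pose proof (congMp 1 (IH z hz)) as e1; rewrite add1n expr1 in e1.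
have e' : f (p%:R ^+ k * x) = h (p%:R ^+ k * x) by apply: cong_eq => n; exact: c.
by move: e'; rewrite !rmorphM !rmorphXn !rmorph_nat => /(mulfI (pX_neq0 k)).
Qed.

Lemma frob_gal (g : galois S) x : frob S (galB g x) = galB g (frob S x).
Proof.
apply: (endo_ext (f := frob S \o galB g) (h := galB g \o frob S)) => [y|y|t] /=.
- by rewrite frob_norm galB_norm.
- by rewrite galB_norm frob_norm.
rewrite gal_teich !frob_teich gal_teich; congr teich.
apply: tcoordP => n.
by rewrite tcoordX !tcoord_gt // tcoordX rmorphXn.
Qed.

(** The p-th root map of the tilt lifts to a homomorphism; the image of x under it is a preimage of
    x, as is checked on the Teichmuller generators and passed to the limit. *)
Lemma frob_surj x : exists y, frob S y = x.
Proof.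
have [k hk] := F_scale x.
have wd : witt_datum (fun=> True) (teich \o @rt : T -> B).
 apply: wd_teich_comp; rewrite ?rt0 ?rt1 //; [exact: rtM|exact: rtD].
have [y hy] := th_total wd hk.
suff e : frob S y = p%:R ^+ k * x.
 exists (p%:R ^- k * y); rewrite rmorphM fmorphV rmorphXn rmorph_nat e mulKf //.
apply: cong_eq => n; have [b [u [h1 h2 h3]]] := hy n.
have eu : frob S u = b.
 elim: h1 => [c _|||? ? ? ? _ e1 _ e2|? ? ? ? _ e1 _ e2].
 - by rewrite /= frob_teich // rtK.
 - exact: rmorph1.
 - by move=> ? ? _ e1; rewrite rmorphN e1.
 - by rewrite rmorphD e1 e2.
 - by rewrite rmorphM e1 e2.
apply: (congT _ (congS h2)).
by rewrite -eu /cong -rmorphB frob_norm.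
Qed.

Definition frobV x := xget 0 [set y | frob S y = x].

Lemma frobVK x : frob S (frobV x) = x.
Proof. exact: (@xgetPex _ 0 [set y | frob S y = x] (frob_surj x)). Qed.
Lemma frobV_eq x y : fr y = x -> frobV x = y.
Proof. by move=> <-; apply: (fmorph_inj fr); rewrite frobVK. Qed.
Lemma frobKV x : frobV (frob S x) = x.
Proof. by apply: (fmorph_inj (frob S)); rewrite frobVK. Qed.
Lemma frobVM x y : frobV (x * y) = frobV x * frobV y.
Proof. by apply: frobV_eq; rewrite rmorphM !frobVK. Qed.
Lemma frobVD x y : frobV (x + y) = frobV x + frobV y.
Proof. by apply: frobV_eq; rewrite rmorphD !frobVK. Qed.
Lemma frobVN x : frobV (- x) = - frobV x.
Proof. by apply: frobV_eq; rewrite rmorphN !frobVK. Qed.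
Lemma frobV1 : frobV 1 = 1.
Proof. by apply: frobV_eq; rewrite rmorph1. Qed.
Lemma frobV_nat n : frobV n%:R = n%:R.
Proof. by apply: frobV_eq; rewrite rmorph_nat. Qed.
Lemma frobVX x n : frobV (x ^+ n) = frobV x ^+ n.
Proof. by apply: frobV_eq; rewrite rmorphXn !frobVK. Qed.
Lemma frobVV x : frobV x^-1 = (frobV x)^-1.
Proof. by apply: frobV_eq; rewrite fmorphV !frobVK. Qed.
Lemma frobV_norm x : `|frobV x| = `|x|.
Proof. by rewrite -{2}[x]frobVK frob_norm. Qed.
Lemma frobV_teich t : frobV (teich t) = teich (rt t).
Proof. by apply: frobV_eq; rewrite frob_teich rtK. Qed.
Lemma frobV_gal (g : galois S) x : frobV (galB g x) = galB g (frobV x).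
Proof. by apply: frobV_eq; rewrite frob_gal frobVK. Qed.
Lemma res_frobV x : W x -> res (frobV x) = rt (res x).
Proof.
by move=> h; apply: texpp_inj => //; rewrite -frob_res ?frobV_norm // frobVK rtK.
Qed.

Lemma Wp_frobV x : Wp x -> Wp (frobV x).
Proof.
move: x; apply: (Wp_ind (P := fun x => Wp (frobV x))) => //.
- by move=> t ht; rewrite frobV_teich; apply: Wp_teich; exact: Oirt.
- by rewrite frobV1; exact: Wp1.
- by move=> y; rewrite frobVN; exact: WpN.
- by move=> y z; rewrite frobVD; exact: WpD.
- by move=> y z; rewrite frobVM; exact: WpM.
- move=> y h; apply: Wp_closed => // n; have [z [h1 h2]] := h n.
 by exists (frobV z); split=> //; rewrite /cong -frobVN -frobVD frobV_norm.
Qed.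

(** P will be the unit ball or the integral Witt vectors. Working in the type of elements of P makes
    the successive quotients by p iterate, and remembers that the digits are residues of elements of
    P. *)
Lemma coords_ex (P : B -> Prop) :
 (forall x, P x -> `|x| <= 1 /\ exists2 y, P y & x = teich (res x) + p%:R * y) ->
 forall x, P x -> exists c, witt_coords x c /\ forall i, exists2 y, P y & c i = res y.
Proof.
move=> h x Px.
have /choice[d hd] (y : {y | P y}) : exists z : {y | P y}, sval y = teich (res (sval y)) + p%:R * sval z.
 by case: y => y Py /=; have [_ [z Pz e]] := h y Py; exists (exist _ z Pz).
pose xs i := iter i d (exist _ x Px).
exists (fun i => res (sval (xs i))); split; last by move=> i; exists (sval (xs i)) => //; case: (xs i).
move=> n; have -> : x - \sum_(i < n) p%:R ^+ i * teich (res (sval (xs i))) = p%:R ^+ n * sval (xs n).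
 elim: n => [|n IH]; first by rewrite big_ord0 subr0 mul1r.
 rewrite big_ord_recr /= opprD addrA IH -mulrBr {1}(hd (xs n)) addrC addKr.
 by rewrite mulrA -exprSr.
rewrite pnormM pnorm_pow ler_piMr ?ppow_ge0 //.
by case: (h _ (svalP (xs n))).
Qed.

Lemma Wp_digit x : Wp x -> exists2 y, Wp y & x = teich (res x) + p%:R * y.
Proof.
move=> h; have [y ny e] := witt_digit (Wp_le1 h); exists y => //.
apply: Wp_divp => //; have -> : p%:R * y = x - teich (res x) by rewrite {1}e addrAC subrr add0r.
by apply: WpB => //; apply: Wp_teich; exact: Wp_res.
Qed.

Lemma WplusP x : Wplus x <-> Wp x.
Proof.
split=> [[c [hc ic]]|h].
 apply: Wp_closed => // n; exists (\sum_(i < n) p%:R ^+ i * teich (c i)); split; last exact: hc.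
 apply: Wp_sum => // i _ _; apply: WpM; last by apply: Wp_teich; exact: ic.
 by rewrite -natrX; exact: Wp_nat.
have [|c [h1 h2]] := coords_ex (P := Wp) _ h.
 by move=> y hy; split; [exact: Wp_le1|exact: Wp_digit].
by exists c; split=> // i; have [y hy ->] := h2 i; exact: Wp_res.
Qed.

(** The unit ball of the tilt is the inverse limit of O_C / p along Frobenius: the n-th coordinate
    is the limit over k of the p^k-th powers of y_(n+k). *)
Lemma tilt_construct (y : nat -> C) : (forall n, W (y n)) ->
 (forall n, cong 1 (y n.+1 ^+ p) (y n)) ->
 exists t, Oi t /\ forall n, cong 1 (tcoord t n) (y n).
Proof.
move=> hy hc; pose v n k := y (n + k)%N ^+ (p ^ k).
have vc n k : cong k (v n k.+1) (v n k).
 apply: (cong_le (leqnSn k)); rewrite /v expnS exprM addnS.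
 by apply: cong_pow; rewrite ?W_X.
have [z hz] := choice (fun n => padic_lim (vc n)).
have vn n k : W (v n k) by apply: W_X.
have zn n : W (z n) by apply: (cong_norm ((hz n).2 0)).
have zc n : z n.+1 ^+ p = z n.
 apply: cong_eq => k.
 apply: congT (congX p (zn _) (vn _ _) ((hz n.+1).2 k)) _.
 rewrite -exprM -expnSr addSnnS; apply/congS.
 exact: cong_le (leqnSn k) ((hz n).2 k.+1).
have [t ht] := tcoord_surj zc; exists t.
split=> [|n]; first by rewrite /Oi /tnorm ht.
rewrite ht; apply: congT ((hz n).2 1) _.
by rewrite /v expn1 addn1; exact: hc.
Qed.

(** The norm of an element is the p^n-th power of that of its n-th coordinate, and coordinates are
    additive modulo p. *)
Lemma tcoord_close n s t : Oi s -> Oi t ->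
 (cong 1 (tcoord s n) (tcoord t n) <-> tnorm (s - t) <= p%:R ^- (p ^ n)).
Proof.
move=> hs ht; have hst := OiD hs (OiN ht).
have e : (tnorm (s - t) <= p%:R ^- (p ^ n)) = (`|tcoord (s - t) n| <= p%:R^-1).
 rewrite (tnorm_coord _ n) -exprVn; apply/idP/idP => h; last first.
  by rewrite lerXn2r ?nnegrE ?pnorm_ge0 ?pinv_ge0.
 rewrite leNgt; apply/negP => h1; move: h; rewrite leNgt ltrXn2r ?h1 ?andbT ?pnorm_ge0 ?pinv_ge0 //.
 by rewrite -lt0n expn_gt0 prime_gt0.
rewrite e; pose proof (tcoordD_cong n hst ht) as h; rewrite subrK in h.
rewrite -ppow1; split=> k.
 have -> : tcoord (s - t) n = - (tcoord s n - (tcoord (s - t) n + tcoord t n)) + (tcoord s n - tcoord t n) by ring.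
 by apply: pnormD_le; rewrite ?pnormN.
rewrite /cong; have -> : tcoord s n - tcoord t n = (tcoord s n - (tcoord (s - t) n + tcoord t n)) + tcoord (s - t) n by ring.
exact: pnormD_le.
Qed.

Lemma tilt_complete (u : nat -> T) : (forall i, Oi (u i)) ->
 (forall e : R, 0 < e -> exists M0, forall M, (M0 <= M)%N -> tnorm (u M - u M0) <= e) ->
 exists t, Oi t /\ forall e : R, 0 < e -> exists M0, forall M, (M0 <= M)%N -> tnorm (t - u M) <= e.
Proof.
move=> hu hc.
have /choice[i hi] : forall n, exists M0, forall M, (M0 <= M)%N ->
  tnorm (u M - u M0) <= p%:R ^- (p ^ n) by clo.
have [] := @tilt_construct (fun n => tcoord (u (i n)) n).
- by move=> n; exact: Oi_coord.
- move=> n; rewrite tcoord_compat; apply/tcoord_close => //.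
 set M := maxn (i n) (i n.+1).
 have -> : u (i n.+1) - u (i n) = - (u M - u (i n.+1)) + (u M - u (i n)) by ring.
 apply: tnormD_le; last by apply: hi; rewrite leq_maxl.
 rewrite tnormN; apply: le_trans (hi n.+1 M _) _; first by lia.
 by apply: ppow_le => //; rewrite leq_exp2l ?prime_gt1.
move=> t [ot ht]; exists t; split=> // e e0.
have [n hn] := ppow_small e0.
have hn' : p%:R ^- (p ^ n) <= e.
 by apply: le_trans (ltW hn); apply: ppow_le => //; apply/ltnW/ltn_expl/prime_gt1.
exists (i n) => M hM; apply: le_trans hn'.
have -> : t - u M = (t - u (i n)) - (u M - u (i n)) by ring.
by apply: tnormB_le; [apply/tcoord_close|exact: hi].
Qed.

End WittTopology.

Context (eps : T) (eps_ok : is_eps eps).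
Local Notation pe := (pi_eps eps).
Local Notation zeta := (tcoord eps).
Local Notation fixes_cyclo g := (forall n, galC g (zeta n) = zeta n).

(** * The element pi, the weak topology, and the Witt vectors with zero residual reduction *)

Section WittPi.
Implicit Types (x y z : B) (s t : T).
Definition pb : T := eps - 1.

Lemma Oi_eps : Oi eps.
Proof. by rewrite /Oi /tnorm eps_ok.1 pnorm1. Qed.
Lemma res_pe : res pe = pb.
Proof. by rewrite resB ?W_teich ?pnorm1 // res_teich // res1. Qed.

Lemma pb_neq0 : pb != 0.
Proof.
rewrite subr_eq0; apply/eqP => e; case: eps_ok => _; apply.
by rewrite e tcoord_one.
Qed.

Lemma tnorm_pb_lt1 : tnorm pb < 1.
Proof.
apply: le_lt_trans pinv_lt1; rewrite -ppow1.
have := tcoord_close 0 Oi_eps Oi1; rewrite expn0 => -[h _]; apply: h.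
by rewrite eps_ok.1 tcoord_one; exact: congxx.
Qed.

Lemma tnorm_pb_gt0 : 0 < tnorm pb.
Proof. by rewrite tnorm_gt0 // pb_neq0. Qed.
Lemma Oi_pb : Oi pb. Proof. exact: ltW tnorm_pb_lt1. Qed.
Lemma Wp_pe : Wp pe.
Proof. by apply: WpB; [apply/Wp_teich/Oi_eps|exact: Wp1]. Qed.
Lemma pe_le1 : W pe. Proof. exact: Wp_le1 Wp_pe. Qed.

Lemma pe_norm : `|pe| = 1.
Proof.
apply/eqP; rewrite eq_le pe_le1 leNgt; apply/negP => /(res_eq0 pe_le1).
by rewrite res_pe; apply/eqP/pb_neq0.
Qed.

Lemma pe_neq0 : pe != 0.
Proof. by rewrite -pnorm_eq0 pe_norm oner_eq0. Qed.
Lemma peX_neq0 n : pe ^+ n != 0.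
Proof. by rewrite expf_neq0 // pe_neq0. Qed.

(** The basic neighbourhoods of 0 for the weak topology of W(tilt). *)
Definition wk n m x := exists y z, [/\ W y, Wp z & x = p%:R ^+ n * y + pe ^+ m * z].

Lemma wkD n m x y : wk n m x -> wk n m y -> wk n m (x + y).
Proof.
move=> [a [b [h1 h2 ->]]] [c [d [h3 h4 ->]]]; exists (a + c), (b + d).
by split; [exact: pnormD_le|exact: WpD|ring].
Qed.

Lemma wkN n m x : wk n m x -> wk n m (- x).
Proof.
move=> [a [b [h1 h2 ->]]]; exists (- a), (- b).
by split; [rewrite pnormN|exact: WpN|ring].
Qed.

Lemma wkB n m x y : wk n m x -> wk n m y -> wk n m (x - y).
Proof. by move=> h1 h2; apply: wkD => //; apply: wkN. Qed.

Lemma wkMl n m z x : Wp z -> wk n m x -> wk n m (z * x).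
Proof.
move=> hz [a [b [h1 h2 ->]]]; exists (z * a), (z * b).
by split; [apply: W_M => //; exact: Wp_le1|exact: WpM|ring].
Qed.

Lemma wk_norm_le n m x : `|x| <= p%:R ^- n -> wk n m x.
Proof.
move=> /(B_div)[y hy ->]; exists y, 0.
by split; [by []|exact: Wp0|rewrite mulr0 addr0].
Qed.

Lemma wk_pe n m z : Wp z -> wk n m (pe ^+ m * z).
Proof. by move=> h; exists 0, z; split; rewrite ?pnorm0 ?ler01 // mulr0 add0r. Qed.

Lemma wk_le n m n' m' x : (n' <= n)%N -> (m' <= m)%N -> wk n m x -> wk n' m' x.
Proof.
move=> hn hm [a [b [h1 h2 ->]]]; exists (p%:R ^+ (n - n') * a), (pe ^+ (m - m') * b).
split; first by apply: W_M => //; apply/W_X/W_nat.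
- by apply: WpM => //; apply/WpX/Wp_pe.
- by rewrite !mulrA -!exprD !subnKC.
Qed.

Lemma res_peM m z : W z -> res (pe ^+ m * z) = pb ^+ m * res z.
Proof. by move=> h; rewrite resM ?W_X ?pe_le1 // resX ?pe_le1 // res_pe. Qed.

(** Since pi has nonzero residue, pi^m z divisible by p forces z to have residue 0, and then p
    divides z among the integral Witt vectors. *)
Lemma wk_divp n m x : W x -> wk n.+1 m (p%:R * x) -> wk n m x.
Proof.
move=> hx [y [z [h1 h2 e]]].
have p0 : p%:R != 0 :> B by [].
have nz := Wp_le1 h2.
have e2 : pe ^+ m * z = p%:R * (x - p%:R ^+ n * y) by rewrite mulrBr e exprS; ring.
have rz : res z = 0.
 have : res (pe ^+ m * z) = 0.
  have n1 : W (pe ^+ m * z).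
   by apply: W_M => //; apply: W_X; exact: pe_le1.
  apply: (proj2 (res_lt n1)); rewrite e2; apply: pnormMr_le; last by rewrite pnorm_p.
  by apply: pnormB_le => //; apply: W_M => //; apply/W_X/W_nat.
 rewrite res_peM // => /eqP; rewrite mulf_eq0 expf_eq0 (negPf pb_neq0) andbF /=.
 by move/eqP.
have := Wp_div (n := 1) h2; rewrite ppow1 expr1 => -[|z' hz' ez].
 by apply/res_lt.
exists y, z'; split=> //; apply: (mulfI p0); rewrite e ez exprS; ring.
Qed.

Lemma tnorm_pbX_small (e : R) : 0 < e -> exists k, forall m, (k <= m)%N -> tnorm pb ^+ m <= e.
Proof.
move=> e0; have [k hk] := pow_small (tnorm_ge0 _) tnorm_pb_lt1 e0.
by exists k => m /hk/ltW.
Qed.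

Lemma tilt_eq0 t : (forall m, tnorm t <= tnorm pb ^+ m) -> t = 0.
Proof.
move=> h; apply/eqP; rewrite -tnorm_eq0 eq_le tnorm_ge0 andbT.
apply/ler_addgt0Pr => e e0; rewrite add0r.
by have [k hk] := tnorm_pbX_small e0; apply: le_trans (h k) (hk k _).
Qed.

(** The residue of x is smaller than every power of the residue of pi, so it vanishes; dividing by p
    lowers n. *)
Lemma wk_sep n x : (forall m, wk n m x) -> `|x| <= p%:R ^- n.
Proof.
elim: n x => [|n IH] x h.
 have [y [z [h1 h2 ->]]] := h 0; rewrite ppow0 !mul1r.
 by apply: pnormD_le => //; exact: Wp_le1.
have nx : W x.
 have [y [z [h1 h2 ->]]] := h 0; apply: pnormD_le; apply: W_M; rewrite ?W_X ?pe_le1 //.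
 exact: Wp_le1 h2.
have rx : res x = 0.
 apply: tilt_eq0 => m; have [y [z [h1 h2 ->]]] := h m.
 have nz := Wp_le1 h2.
 have np : `|p%:R ^+ n.+1 * y| <= p%:R^-1.
  apply: pnormMr_le => //; rewrite pnorm_pow // -ppow1; exact: ppow_le.
 have np1 := le_trans np pinv_le1.
 rewrite resD ?res_peM //; last by apply: W_M => //; apply: W_X; exact: pe_le1.
 rewrite (proj2 (res_lt np1) np) add0r tnormM tnormX.
 by rewrite ler_piMr ?exprn_ge0 ?tnorm_ge0 //; exact: Wp_res.
have := B_div (n := 1) (x := x); rewrite ppow1 expr1 => -[|y hy e].
 by apply/res_lt.
rewrite e pnormM pnorm_p ppowS ler_pM2l //; apply: IH => m.
by apply: wk_divp => //; rewrite -e.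
Qed.

Lemma wk_peW m x : (forall n, wk n m x) -> exists2 z, Wp z & x = pe ^+ m * z.
Proof.
move=> h; exists (x / pe ^+ m); last by rewrite mulrC divfK // peX_neq0.
apply: Wp_closed => // n; have [y [z [h1 h2 ->]]] := h n; exists z; split=> //.
rewrite /cong mulrDl [pe ^+ m * z]mulrC mulfK ?peX_neq0 // addrK.
by rewrite !pnormM pnormV !pnormX pe_norm expr1n invr1 mulr1 pnorm_p exprVn ler_piMr ?ppow_ge0.
Qed.

(** It lets pi be exchanged for the Teichmuller lift of its residue, two elements that differ by a
    multiple of p: a high power of one is a power of the other up to p^n. *)
Lemma pow_split (a b : B) m n : Wp a -> Wp b -> exists u v,
 [/\ Wp u, Wp v & (a + p%:R * b) ^+ (m + n) = a ^+ m * u + p%:R ^+ n * v].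
Proof.
move=> ha hb; have hab : Wp (a + p%:R * b) by apply: WpD => //; apply: WpM => //; exact: Wp_nat.
move: {2}(m + n)%N (leqnn (m + n)%N) => N; elim: N m n => [|N IH] m n.
 rewrite leqn0 addn_eq0 => /andP[/eqP -> /eqP ->]; exists 0, 1.
 by split; [exact: Wp0|exact: Wp1|rewrite !expr0; ring].
case: m => [|m] h.
 by exists ((a + p%:R * b) ^+ n), 0; split; [exact: WpX|exact: Wp0|rewrite add0n expr0; ring].
case: n h => [|n] h.
 exists 0, ((a + p%:R * b) ^+ m.+1); split; [exact: Wp0|exact: WpX|].
 by rewrite addn0 expr0; ring.
have [u [v [h1 h2 e1]]] := IH m n.+1 ltac:(lia).
have [u' [v' [h1' h2' e2]]] := IH m.+1 n ltac:(lia).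
exists (u + p%:R * b * u'), (a * v + b * v'); split.
- by apply: WpD => //; do 2 apply: WpM => //; exact: Wp_nat.
- by apply: WpD; apply: WpM.
rewrite addSn exprS mulrDl {1}e1 -addSnnS e2 !exprS; ring.
Qed.

Lemma teich_pb : exists2 w, Wp w & teich pb = pe + p%:R * w.
Proof.
have [y hy e] := Wp_digit Wp_pe; exists (- y); first by clo.
have e' : pe = teich pb + p%:R * y by rewrite -res_pe.
by rewrite e'; ring.
Qed.

Lemma wk_teich_pb n m z : Wp z -> wk n m (teich pb ^+ (m + n) * z).
Proof.
move=> hz; have [w hw ->] := teich_pb; rewrite mulrC; apply: wkMl => //.
have [u [v [h1 h2 ->]]] := pow_split m n Wp_pe hw.
apply: wkD; first exact: wk_pe.
apply: wk_norm_le; rewrite pnormM pnorm_pow // ler_piMr ?ppow_ge0 //; exact: Wp_le1.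
Qed.

Lemma tnorm_divr s t : t != 0 -> tnorm s <= tnorm t -> Oi (s / t).
Proof.
by move=> t0 h; rewrite /Oi tnormM tnormV // ler_pdivrMr ?mul1r // tnorm_gt0.
Qed.

Lemma tnorm_rtn n t : tnorm (rtn n t) ^+ (p ^ n) = tnorm t.
Proof. by rewrite -tnormX rtnK. Qed.
Lemma Oi_rtn n t : Oi t -> Oi (rtn n t).
Proof. by move=> h; elim: n => //= n IH; exact: Oirt. Qed.

(** Additivity of Teichmuller lifts holds modulo p for the p^n-th roots of s, t and w; raising to
    the power p^n makes it a congruence modulo p^n, and the difference with [t] is divisible by
    [w^(1/p^n)]. *)
Lemma teich_shift n s t w : Oi s -> Oi t -> s = t + w ->
 exists y z, [/\ W y, Wp z &
  teich s - teich t = p%:R ^+ n * y + teich (rtn n w) * z].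
Proof.
move=> hs ht e; set s' := rtn n s; set t' := rtn n t; set w' := rtn n w.
have [os ot] : Oi s' /\ Oi t' by split; exact: Oi_rtn.
have e' : s' = t' + w' by rewrite /s' e rtnD.
have ow : Oi w' by have -> : w' = s' - t' by [rewrite e' addrC addKr]; exact: OiD os (OiN ot).
have c : cong 1 (teich s') (teich t' + teich w').
 apply/res_cong; rewrite ?pnormD_le //.
 by rewrite resD ?W_teich // !res_teich.
have n1 : W (teich t' + teich w') by clo.
pose proof (cong_pow n (W_teich s') n1 c) as c2; move: c2.
rewrite -teichX // rtnK // => c2.
have [z hz ez] : exists2 z, Wp z & (teich t' + teich w') ^+ (p ^ n) = teich t + teich w' * z.
 exists (\sum_(i < p ^ n) (teich t' + teich w') ^+ ((p ^ n).-1 - i) * teich t' ^+ i).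
  have [ws wt ww] : [/\ Wp (teich s'), Wp (teich t') & Wp (teich w')] by split; exact: Wp_teich.
  by apply: Wp_sum => i _ _; apply: WpM; apply: WpX => //; exact: WpD.
 have := subrXX (teich t' + teich w') (teich t') (p ^ n).
 have -> : teich t' + teich w' - teich t' = teich w' :> B by ring.
 by rewrite -[teich t' ^+ (p ^ n)]teichX // rtnK // => <-; rewrite [RHS]addrC subrK.
have [y hy ey] := B_div (cong_le (leqnSn n) c2).
by exists y, z; split=> //; rewrite -ey ez; ring.
Qed.

Lemma teich_cont n m : exists k, forall s t, Oi s -> Oi t ->
 tnorm (s - t) <= tnorm pb ^+ k -> wk n m (teich s - teich t).
Proof.
(* The p^n-th root of s - t must be divisible by the power m + n of the residue of pi, because
   [wk_teich_pb] loses n when it passes from the Teichmuller lift of this residue to pi. *)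
exists ((m + n) * p ^ n)%N => s t hs ht h.
have [y [z [h1 h2 ->]]] := @teich_shift n s t (s - t) hs ht (ltac:(by rewrite addrC subrK)).
apply: wkD; first by apply: wk_norm_le; rewrite pnormM pnorm_pow // ler_piMr ?ppow_ge0.
set r := rtn n (s - t).
have hr : tnorm r <= tnorm (pb ^+ (m + n)).
 rewrite leNgt; apply/negP => h3; move: h; rewrite -(tnorm_rtn n (s - t)) exprM -[tnorm pb ^+ _]tnormX.
 by rewrite leNgt ltrXn2r ?h3 ?andbT ?tnorm_ge0 // -lt0n expn_gt0 prime_gt0.
have pn0 : pb ^+ (m + n) != 0 by rewrite expf_neq0 // pb_neq0.
have -> : teich r = teich pb ^+ (m + n) * teich (r / pb ^+ (m + n)).
 by rewrite -teichX // -teichM // mulrC divfK.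
rewrite -mulrA; apply: wk_teich_pb; apply: WpM => //; apply: Wp_teich.
exact: tnorm_divr.
Qed.

Lemma wk_res n m x : wk n.+1 m x -> `|x| <= 1 /\ tnorm (res x) <= tnorm pb ^+ m.
Proof.
move=> [y [z [h1 h2 ->]]]; have nz : W z by exact: Wp_le1 h2.
have np : `|p%:R ^+ n.+1 * y| <= p%:R^-1.
 by apply: pnormMr_le => //; rewrite pnorm_pow // -ppow1; exact: ppow_le.
have np1 := le_trans np pinv_le1.
have nq : W (pe ^+ m * z) by apply: W_M => //; apply: W_X; exact: pe_le1.
split; first by clo.
rewrite resD ?res_peM // (proj2 (res_lt np1) np) add0r tnormM tnormX.
by rewrite ler_piMr ?exprn_ge0 ?tnorm_ge0 //; exact: Wp_res.
Qed.

Definition wk_cauchy (x : nat -> B) :=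
 forall n m, exists M0, forall M, (M0 <= M)%N -> wk n m (x M - x M0).

(** The residues converge in the complete tilt; subtracting the Teichmuller lifts and dividing by p
    gives another weakly Cauchy sequence. This yields a limit modulo p^n for each n, and these
    limits converge p-adically. *)
Lemma wk_complete (x : nat -> B) : (forall M, Wp (x M)) -> wk_cauchy x ->
 exists2 l, Wp l & forall n m, exists M0, forall M, (M0 <= M)%N -> wk n m (l - x M).
Proof.
have stage n : forall x : nat -> B, (forall M, Wp (x M)) -> wk_cauchy x ->
  exists2 l, Wp l & forall m, exists M0, forall M, (M0 <= M)%N -> wk n m (l - x M).
 elim: n => [|n IH] {}x hx hc.
  exists 0 => //.
  move=> m; exists 0 => M _; apply: wk_norm_le; rewrite ppow0 pnormB_le ?pnorm0 //.
  exact: Wp_le1.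
 have [t [ot ht]] : exists t, Oi t /\ forall e : R, 0 < e ->
   exists M0, forall M, (M0 <= M)%N -> tnorm (t - res (x M)) <= e.
  apply: tilt_complete => [i|e e0]; first by clo.
  have [k hk] := tnorm_pbX_small e0; have [M0 hM] := hc 1 k; exists M0 => M /hM h.
  rewrite -resB ?(Wp_le1) //; apply: le_trans (hk k _) => //.
  by case: (wk_res h).
 have ht' n' m : exists M0, forall M, (M0 <= M)%N -> wk n' m (teich t - teich (res (x M))).
  have [k hk] := teich_cont n' m.
  have [M0 hM] := ht (tnorm pb ^+ k) (exprn_gt0 _ tnorm_pb_gt0).
  by exists M0 => M /hM h; apply: hk => //; exact: Wp_res.
 have /choice[y hy] M : exists y, Wp y /\ x M = teich (res (x M)) + p%:R * y.
  by have [y h1 h2] := Wp_digit (hx M); exists y.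
 have yc : wk_cauchy y.
  move=> n' m; have [M1 h1] := hc n'.+1 m; have [M2 h2] := ht' n'.+1 m.
  exists (maxn M1 M2) => M; rewrite geq_max => /andP[l1 l2].
  have ny i : W (y i) by apply: Wp_le1; case: (hy i).
  apply: wk_divp; first exact: pnormB_le.
  set M0 := maxn M1 M2.
  have -> : p%:R * (y M - y M0) = ((x M - x M1) - (x M0 - x M1)) +
    ((teich t - teich (res (x M))) - (teich t - teich (res (x M0)))).
   by rewrite {1}(hy M).2 {1}(hy M0).2; ring.
  by apply: wkD; apply: wkB; [apply: h1|apply: h1|apply: h2|apply: h2]; rewrite ?leq_maxl ?leq_maxr.
 have [l hl hM] := IH y (fun M => (hy M).1) yc.
 exists (teich t + p%:R * l).
  by apply: WpD; [exact: Wp_teich|apply: WpM => //; exact: Wp_nat].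
 move=> m; have [M1 h1] := hM m; have [M2 h2] := ht' n.+1 m.
 exists (maxn M1 M2) => M; rewrite geq_max => /andP[l1 l2].
 have -> : teich t + p%:R * l - x M = (teich t - teich (res (x M))) + p%:R * (l - y M).
  by rewrite {1}(hy M).2; ring.
 apply: wkD; first by clo.
 have [a [b [k1 k2 ->]]] := h1 M l1; exists a, (p%:R * b).
 by split=> //; [apply: WpM => //; exact: Wp_nat|rewrite exprS; ring].
move=> hx hc; have /choice[l hl] n : exists l, Wp l /\
  forall m, exists M0, forall M, (M0 <= M)%N -> wk n m (l - x M).
 by have [l h1 h2] := stage n x hx hc; exists l.
have lc n : cong n (l n.+1) (l n).
 apply: wk_sep => m; have [M1 h1] := (hl n.+1).2 m; have [M2 h2] := (hl n).2 m.
 have -> : l n.+1 - l n = (l n.+1 - x (maxn M1 M2)) - (l n - x (maxn M1 M2)) by ring.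
 apply: wkB; last by apply: h2; rewrite leq_maxr.
 by apply: wk_le (h1 _ (leq_maxl _ _)).
have [y [_ hy]] := padic_lim lc; exists y.
 by apply: Wp_closed => // n; exists (l n); split=> //; case: (hl n).
move=> n m; have [M0 h] := (hl n).2 m; exists M0 => M /h h'.
by rewrite -[y](subrK (l n)) -addrA; apply: wkD => //; apply: wk_norm_le; exact: hy.
Qed.

(* The kernel of the reduction from the Witt vectors of the unit ball of tilt to the Witt
  vectors of its residue field *)
Definition Wm x := forall n, exists w y z,
 [/\ tnorm w < 1, W y, Wp z & x = p%:R ^+ n * y + teich w * z].

Lemma Wm_Wp x : Wm x -> Wp x.
Proof.
move=> h; apply: Wp_closed => // n; have [w [y [z [h1 h2 h3 ->]]]] := h n.
exists (teich w * z); split; first by apply: WpM => //; apply: Wp_teich => //; exact: ltW.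
by rewrite /cong addrK pnormM pnorm_pow // ler_piMr ?ppow_ge0.
Qed.

Lemma WmD x y : Wm x -> Wm y -> Wm (x + y).
Proof.
move=> hx hy n; have [w [a [b [h1 h2 h3 ->]]]] := hx n.
have [w' [a' [b' [h1' h2' h3' ->]]]] := hy n.
have key (u v : T) (c d : B) : tnorm u <= tnorm v -> Wp c -> Wp d ->
  exists2 e, Wp e & teich u * c + teich v * d = teich v * e.
 move=> uv hc hd; have [v0|v0] := eqVneq v 0.
  exists 0 => //.
  have -> : u = 0 by apply/eqP; rewrite -tnorm_eq0 eq_le tnorm_ge0 andbT; apply: le_trans uv _; rewrite v0 tnorm0.
  by rewrite v0 teich0 // !mul0r addr0.
 exists (teich (u / v) * c + d).
  by apply: WpD => //; apply: WpM => //; apply: Wp_teich; exact: tnorm_divr.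
 by rewrite mulrDr mulrA -teichM // [v * _]mulrC divfK.
have [h|h] := leP (tnorm w) (tnorm w').
 have [e he ee] := key _ _ _ _ h h3 h3'; exists w', (a + a'), e.
 by split; rewrite ?pnormD_le // -ee; ring.
have [e he ee] := key _ _ _ _ (ltW h) h3' h3; exists w, (a + a'), e.
by split; rewrite ?pnormD_le // -ee; ring.
Qed.

Lemma WmMl x z : Wp z -> Wm x -> Wm (z * x).
Proof.
move=> hz hx n; have [w [a [b [h1 h2 h3 ->]]]] := hx n.
exists w, (z * a), (z * b); split=> //; [|exact: WpM|ring].
by apply: W_M => //; exact: Wp_le1.
Qed.

Lemma WmMr x z : Wp z -> Wm x -> Wm (x * z).
Proof. by rewrite mulrC; exact: WmMl. Qed.
Lemma WmN x : Wm x -> Wm (- x).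
Proof. by rewrite -mulN1r; apply: WmMl; apply/WpN/Wp1. Qed.
Lemma WmB x y : Wm x -> Wm y -> Wm (x - y).
Proof. by move=> h1 h2; apply: WmD => //; apply: WmN. Qed.

Lemma Wm_res x : Wm x -> tnorm (res x) < 1.
Proof.
move=> /(_ 1)[w [y [z [h1 h2 h3 ->]]]]; have nz : W z by exact: Wp_le1 h3.
have np : `|p%:R ^+ 1 * y| <= p%:R^-1 by apply: pnormMr_le => //; rewrite pnorm_p.
have np1 := le_trans np pinv_le1.
have nq : W (teich w * z) by clo.
rewrite (resD np1 nq) (proj2 (res_lt np1) np) add0r.
rewrite resM // res_teich tnormM; apply: le_lt_trans h1.
by rewrite ler_piMr ?tnorm_ge0 //; exact: Wp_res.
Qed.

Lemma Wm_divp x : W x -> Wm (p%:R * x) -> Wm x.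
Proof.
move=> hx h n; have [w [y [z [h1 h2 h3 e]]]] := h n.+1.
have p0 : p%:R != 0 :> B by [].
have nz := Wp_le1 h3.
have nw : W (teich w : B) by [].
have [w0|w0] := eqVneq w 0.
 exists w, y, 0; split=> //.
 by apply: (mulfI p0); rewrite e w0 teich0 // exprS; ring.
have e2 : teich w * z = p%:R * (x - p%:R ^+ n * y) by rewrite mulrBr e exprS; ring.
have rz : res z = 0.
 have : res (teich w * z) = 0.
  have n1 : W (teich w * z) by clo.
  apply: (proj2 (res_lt n1)); rewrite e2; apply: pnormMr_le; rewrite ?pnorm_p //.
  by apply: pnormB_le => //; apply: W_M => //; apply/W_X/W_nat.
 rewrite resM // res_teich // => /eqP; rewrite mulf_eq0 (negPf w0) /=.
 by move/eqP.
have := Wp_div (n := 1) h3; rewrite ppow1 expr1 => -[|z' hz' ez].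
 by apply/res_lt.
exists w, y, z'; split=> //; apply: (mulfI p0); rewrite e ez exprS; ring.
Qed.

(** The rigidity argument of the whole proof. The residue r satisfies r^(p^2) = r and has norm less
    than 1, so it is 0; then x is divisible by p within the ideal, the quotient is again fixed, and
    the argument repeats. *)
Lemma Wm_fix0 x : Wm x -> frob S (frob S x) = x -> x = 0.
Proof.
move=> hx ex; apply: cong_eq => n; apply/cong0P.
elim: n x hx ex => [|n IH] x hx ex; first by rewrite ppow0; apply/Wp_le1/Wm_Wp.
have nx := Wp_le1 (Wm_Wp hx).
have rx : res x = 0.
 have e : res x ^+ (p ^ 2) = res x by rewrite -{2}ex frob_res ?frob_norm // frob_res // -exprM.
 apply/eqP/negPn/negP => r0; have := Wm_res hx; have r1 : 0 < tnorm (res x) by exact: tnorm_gt0.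
 apply/negP; rewrite -leNgt -(ler_pM2l r1) mulr1 -{1}e tnormX.
 have p1 := p_gt1.
 have -> : (p ^ 2 = (p ^ 2).-2.+2)%N by lia.
 rewrite exprS ler_pM2l // exprS ler_piMr ?tnorm_ge0 //.
 by rewrite exprn_ile1 ?tnorm_ge0 // ltW // Wm_res.
have := B_div (n := 1) (x := x); rewrite ppow1 expr1 => -[|y hy e].
 by apply/res_lt.
rewrite e pnormM pnorm_p ppowS ler_pM2l //; apply: IH.
 by apply: Wm_divp => //; rewrite -e.
apply: (mulfI (pF_neq0 (F := B))); rewrite -e -[RHS]ex e !rmorphM !rmorph_nat //.
Qed.

Lemma Wm_frob x : Wm x -> Wm (frob S x).
Proof.
move=> h n; have [w [y [z [h1 h2 h3 ->]]]] := h n.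
exists (w ^+ p), (frob S y), (frob S z); split; rewrite ?frob_norm //; last 2 first.
- exact: Wp_frob.
- by rewrite rmorphD !rmorphM rmorphXn rmorph_nat frob_teich.
by rewrite tnormX exprn_ilt1 ?tnorm_ge0 // -lt0n prime_gt0.
Qed.

Lemma Wm_frobV x : Wm x -> Wm (frobV x).
Proof.
move=> h n; have [w [y [z [h1 h2 h3 ->]]]] := h n.
exists (rt w), (frobV y), (frobV z); split; rewrite ?frobV_norm //; last 2 first.
- exact: Wp_frobV.
- by rewrite frobVD !frobVM frobVX frobV_nat frobV_teich.
rewrite ltNge; apply/negP => h4; move: h1; rewrite -(tnorm_rt w) ltNge.
by rewrite exprn_ege1.
Qed.

Lemma Wm_gal (g : galois S) x : Wm x -> Wm (galB g x).
Proof.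
move=> h n; have [w [y [z [h1 h2 h3 ->]]]] := h n.
exists (gt g w), (galB g y), (galB g z); split; rewrite ?galB_norm //; last 2 first.
- exact: Wp_gal.
- by rewrite rmorphD !rmorphM rmorphXn rmorph_nat gal_teich.
by rewrite tnorm_gt.
Qed.

Lemma Wm_teichB s t : Oi s -> Oi t -> tnorm (s - t) < 1 -> Wm (teich s - teich t).
Proof.
move=> hs ht h n.
have [y [z [h1 h2 ->]]] := @teich_shift n s t (s - t) hs ht (ltac:(by rewrite addrC subrK)).
exists (rtn n (s - t)), y, z; split=> //.
rewrite ltNge; apply/negP => h3; move: h; rewrite -(tnorm_rtn n) ltNge.
by rewrite exprn_ege1.
Qed.

Lemma Wm_pe : Wm pe.
Proof.
rewrite /pi_eps -(teich1).
apply: Wm_teichB; [exact: Oi_eps|exact: Oi1|exact: tnorm_pb_lt1].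
Qed.

(** After division by the Teichmuller lift of its residue, which is invertible over the unit ball, x
    becomes congruent to 1 modulo p and is inverted by a geometric series. *)
Lemma Wp_unit x : Wp x -> tnorm (res x) = 1 -> Wp x^-1.
Proof.
move=> hx rx; have r0 : res x != 0 by rewrite -tnorm_eq0 rx.
have ov : Oi (res x)^-1 by rewrite /Oi tnormV rx invr1.
have nx := Wp_le1 hx.
set u := x * teich (res x)^-1.
have hu : Wp u by apply: WpM => //; exact: Wp_teich.
have nu : `|1 - u| <= p%:R^-1.
 rewrite -/(cong 1 1 u); apply/res_cong; rewrite ?pnorm1 ?W_M //.
 by rewrite res1 resM ?W_teich // res_teich // divff.
have nu1 : `|u| = 1 by apply: near1_norm => //; rewrite pnormBC.
have u0 : u != 0 by rewrite -pnorm_eq0 nu1.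
have x0 : x != 0 by apply: contra u0 => /eqP e; rewrite /u e mul0r.
suff hv : Wp u^-1.
 have -> : x^-1 = u^-1 * teich (res x)^-1.
  by rewrite /u invfM -mulrA mulVf ?mulr1 // teich_neq0 // invr_neq0.
 by apply: WpM => //; exact: Wp_teich.
apply: Wp_closed => // n; exists (\sum_(i < n) (1 - u) ^+ i); split.
 by apply: Wp_sum => i _ _; apply: WpX; apply: WpB => //; exact: Wp1.
have := subrX1 (1 - u) n; rewrite addrAC subrr add0r => e.
have -> : \sum_(i < n) (1 - u) ^+ i = u^-1 * (1 - (1 - u) ^+ n).
 by apply: (mulfI u0); rewrite mulVKf // -[RHS]opprB e mulNr opprK.
rewrite /cong mulrBr mulr1 opprB addrC subrK pnormM pnormV nu1 invr1 mul1r pnormX.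
by rewrite -exprVn lerXn2r ?nnegrE ?pnorm_ge0 ?pinv_ge0.
Qed.

End WittPi.
#[local] Hint Resolve Oi_eps Oi_pb tnorm_pb_lt1 tnorm_pb_gt0 Wp_pe pe_le1 pe_neq0 peX_neq0 Wm_pe : core.
#[local] Hint Resolve Wm_Wp WmD WmN WmB WmMl WmMr Wp_frobV : closed.

(** * Power series in pi with coefficients in Z_p *)

Section PowerSeries.
Implicit Types (x y z : B) (a : K) (b c : nat -> K).

Lemma Qp_disc a : `|a| < 1 -> `|a| <= p%:R^-1.
Proof. by rewrite -(QpBt_norm a); exact: Bt_discrete. Qed.

(* y is the sum of the power series with integral coefficients b at pi *)
Definition PS b y := (forall k, W (b k)) /\
 forall M, exists2 z, Wp z & y = \sum_(k < M) iB (b k) * pe ^+ k + pe ^+ M * z.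

Definition Rp y := exists b, PS b y.

Lemma Wp_pesum b M : (forall k, W (b k)) -> Wp (\sum_(k < M) iB (b k) * pe ^+ k).
Proof.
move=> hb; apply: Wp_sum => i _ _; apply: WpM; [exact: Wp_QpBt|apply: WpX; exact: Wp_pe].
Qed.

Lemma PS_Wp b y : PS b y -> Wp y.
Proof. by move=> [_ /(_ 0)[z hz ->]]; rewrite big_ord0 add0r expr0 mul1r. Qed.
Lemma Rp_Wp y : Rp y -> Wp y.
Proof. by move=> [b /PS_Wp]. Qed.
Lemma wk_all_eq x y : (forall n m, wk n m (x - y)) -> x = y.
Proof. by move=> h; apply: cong_eq => n; apply: wk_sep => m. Qed.

Lemma peM_eq x y : (forall m, exists2 z, Wp z & x - y = pe ^+ m * z) -> x = y.
Proof.
move=> h; apply: wk_all_eq => n m; have [z hz ->] := h m; exact: wk_pe.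
Qed.

Lemma PS_uniq b y y' : PS b y -> PS b y' -> y = y'.
Proof.
move=> [_ h] [_ h']; apply: peM_eq => m; have [z hz ->] := h m; have [z' hz' ->] := h' m.
by exists (z - z'); [exact: WpB|ring].
Qed.

Lemma PS_ex b : (forall k, W (b k)) -> exists y, PS b y.
Proof.
move=> hb; pose s M := \sum_(k < M) iB (b k) * pe ^+ k.
have tail m M : (m <= M)%N -> exists2 z, Wp z & s M - s m = pe ^+ m * z.
 elim: M => [|M IH]; first by rewrite leqn0 => /eqP ->; exists 0; [exact: Wp0|rewrite subrr mulr0].
 rewrite leq_eqVlt => /orP[/eqP ->|]; first by exists 0; [exact: Wp0|rewrite subrr mulr0].
 rewrite ltnS => mM; have [z hz e] := IH mM; exists (z + iB (b M) * pe ^+ (M - m)).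
  apply: WpD => //; apply: WpM; [exact: Wp_QpBt|apply: WpX; exact: Wp_pe].
 rewrite /s big_ord_recr /= -/(s M) addrAC e mulrDr mulrCA -exprD subnKC //.
have [|n m|l hl hM] := wk_complete (x := s).
- by move=> M; exact: Wp_pesum.
- by exists m => M /tail[z hz ->]; exact: wk_pe.
exists l; split=> // M.
have [n|z hz e] := wk_peW (m := M) (x := l - s M).
 have [M0 h] := hM n M; set N := maxn M0 M.
 have -> : l - s M = (l - s N) + (s N - s M) by ring.
 apply: wkD; first by apply: h; rewrite leq_maxl.
 by have [|z hz ->] := tail M N; [rewrite leq_maxr|exact: wk_pe].
by exists z => //; rewrite -e addrC subrK.
Qed.

Lemma PS_D b c y y' : PS b y -> PS c y' -> PS (fun k => b k + c k) (y + y').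
Proof.
move=> [h1 h2] [h1' h2']; split=> [k|M]; first by clo.
have [z hz ->] := h2 M; have [z' hz' ->] := h2' M; exists (z + z'); first by clo.
under [in RHS]eq_bigr do rewrite rmorphD mulrDl.
by rewrite big_split /=; ring.
Qed.

Lemma PS_Z a b y : W a -> PS b y -> PS (fun k => a * b k) (iB a * y).
Proof.
move=> ha [h1 h2]; split=> [k|M]; first by clo.
have [z hz ->] := h2 M; exists (iB a * z); first by apply: WpM => //; exact: Wp_QpBt.
under [in RHS]eq_bigr do rewrite rmorphM -mulrA.
by rewrite -mulr_sumr; ring.
Qed.

Lemma PS_C a : W a -> PS (fun k => if k == 0 then a else 0) (iB a).
Proof.
move=> ha; split=> [k|M]; first by case: ifP => // _; rewrite pnorm0 ler01.
case: M => [|M]; first by exists (iB a); [exact: Wp_QpBt|rewrite big_ord0 expr0; ring].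
exists 0 => //.
rewrite big_ord_recl /= big1; first by ring.
by move=> i _; rewrite /= rmorph0 mul0r.
Qed.

Lemma PS_shift b y : PS b y -> PS (fun k => if k is k'.+1 then b k' else 0) (pe * y).
Proof.
move=> hy; have [h1 h2] := hy; split=> [[|k]|[|M]] //; first by rewrite pnorm0.
 exists (pe * y); last by rewrite big_ord0 expr0; ring.
 by apply: WpM; [exact: Wp_pe|exact: PS_Wp hy].
have [z hz ->] := h2 M; exists z => //.
rewrite big_ord_recl /= rmorph0 mul0r add0r mulrDr mulr_sumr exprS mulrA; congr (_ + _).
by apply: eq_bigr => i _; rewrite /bump /= add1n exprS mulrCA.
Qed.

Lemma PS_tail b y : PS b y -> exists2 y', PS (fun k => b k.+1) y' & y = iB (b 0) + pe * y'.
Proof.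
move=> hy; have [y' hy'] := PS_ex (fun k => hy.1 k.+1); exists y' => //.
apply: (PS_uniq hy).
have h := PS_D (PS_C (hy.1 0)) (PS_shift hy').
have eb : (fun k => (if k == 0 then b 0 else 0) + (if k is k'.+1 then b k'.+1 else 0)) = b.
 by apply/funext => -[|k] /=; rewrite ?addr0 ?add0r.
by rewrite eb in h.
Qed.

Lemma pesum_split i k b z : (forall j, W (b j)) -> Wp z -> (i <= k)%N ->
 exists2 z', Wp z' & \sum_(j < k) iB (b j) * pe ^+ j + pe ^+ k * z =
  \sum_(j < i) iB (b j) * pe ^+ j + pe ^+ i * z'.
Proof.
move=> hb hz; elim: k z hz => [|k IH] z hz.
 by rewrite leqn0 => /eqP ->; exists z.
rewrite leq_eqVlt => /orP[/eqP ->|]; first by exists z.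
rewrite ltnS => ik; have hz1 : Wp (iB (b k) + pe * z).
 by apply: WpD; [exact: Wp_QpBt|apply: WpM => //; exact: Wp_pe].
have [z' hz' e] := IH _ hz1 ik.
by exists z' => //; rewrite -e big_ord_recr /= exprS; ring.
Qed.

(** Consider the first coefficient that is a unit. Earlier terms are divisible by p, so after
    division by a power of pi the unit plus a multiple of pi would have residue 0; but a unit has
    residue of norm 1 and pi one of norm less than 1. Hence a value at pi determines the
    coefficients, with norms. *)
Lemma pesum_disc k b z : (forall j, W (b j)) -> Wp z ->
 `|(\sum_(j < k) iB (b j) * pe ^+ j + pe ^+ k * z)| <= p%:R^-1 ->
 forall i, (i < k)%N -> `|b i| <= p%:R^-1.
Proof.
move=> h1 hz0 ny k'; elim/ltn_ind: k' => k' IH k'k; apply: Qp_disc.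
rewrite lt_neqAle h1 andbT; apply/eqP => bk.
have [z1 hz e] := pesum_split h1 hz0 k'k; move: ny; rewrite {}e big_ord_recr /=.
set y := _ + _ => ny; have e : y = y by [].
rewrite {2}/y in e.
have nz := Wp_le1 hz.
have n0 : `|(\sum_(i < k') iB (b i) * pe ^+ i)| <= p%:R^-1.
 apply: pnorm_sum_le => [|i _ _] //.
 apply: pnormMr_le; rewrite ?W_X // QpBt_norm IH //.
 exact: ltn_trans k'k.
have n1 : W (iB (b k')) by clo.
have r1 : tnorm (res (iB (b k'))) = 1.
 apply/eqP; rewrite eq_le; apply/andP; split; first by apply: Wp_res; exact: Wp_QpBt.
 rewrite -(ler_pM2r (ltr01 : 0 < (1 : R))) !mulr1 -[X in X <= _](tnorm1).
 have b0 : b k' != 0 by rewrite -pnorm_eq0 bk.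
 have nV : W ((b k')^-1) by rewrite pnormV bk invr1.
 have <- : res (iB (b k')) * res (iB (b k')^-1) = 1.
  by rewrite -resM ?QpBt_norm // -rmorphM divff // rmorph1 res1.
 rewrite tnormM ler_piMr ?tnorm_ge0 //; apply: Wp_res; exact: Wp_QpBt.
have e1 : iB (b k') * pe ^+ k' + pe ^+ k'.+1 * z1 = y - \sum_(i < k') iB (b i) * pe ^+ i.
 by rewrite e; ring.
have e2 : pe ^+ k' * (iB (b k') + pe * z1) = y - \sum_(i < k') iB (b i) * pe ^+ i.
 by rewrite -e1 exprS; ring.
have npz : W (pe * z1) by clo.
have n2 : W (iB (b k') + pe * z1) by clo.
have n3 : `|iB (b k') + pe * z1| <= p%:R^-1.
 have -> : `|iB (b k') + pe * z1| = `|pe ^+ k' * (iB (b k') + pe * z1)|.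
  by rewrite pnormM pnormX pe_norm // expr1n mul1r.
 by rewrite e2; apply: pnormB_le.
have : res (iB (b k') + pe * z1) = 0 by apply/(res_lt n2).
rewrite resD // => /eqP; rewrite addr_eq0 => /eqP h.
have : tnorm (res (pe * z1)) < 1.
 rewrite resM // res_pe tnormM; apply: le_lt_trans tnorm_pb_lt1.
 by rewrite ler_piMr ?tnorm_ge0 //; exact: Wp_res.
by rewrite -tnormN -h r1 ltxx.
Qed.

Lemma pesum_norm n k b z : (forall j, W (b j)) -> Wp z ->
 `|(\sum_(j < k) iB (b j) * pe ^+ j + pe ^+ k * z)| <= p%:R ^- n ->
 forall i, (i < k)%N -> `|b i| <= p%:R ^- n.
Proof.
elim: n b z => [|n IH] b z hb hz ny; first by move=> i _; rewrite ppow0.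
have n1 : `|(\sum_(j < k) iB (b j) * pe ^+ j + pe ^+ k * z)| <= p%:R^-1.
 by apply: le_trans ny _; rewrite -ppow1; exact: ppow_le.
have hd := pesum_disc hb hz n1.
have p0 : p%:R != 0 :> K by [].
have p0B : p%:R != 0 :> B by [].
have [z' hz' ez] : exists2 z', Wp z' & z = p%:R * z'.
 rewrite -(expr1 p%:R); apply: Wp_div => //; rewrite ppow1.
 have -> : `|z| = `|pe ^+ k * z| by rewrite pnormM pnormX pe_norm expr1n mul1r.
 rewrite -[pe ^+ k * z](addKr (\sum_(j < k) iB (b j) * pe ^+ j)) addrC.
 apply: pnormB_le => //; apply: pnorm_sum_le => [|i _ _] //.
 by apply: pnormMr_le; rewrite ?W_X ?pe_le1 // QpBt_norm hd.
pose c i := if (i < k)%N then p%:R^-1 * b i else 0.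
have hc i : W (c i).
 rewrite /c; case: ifP => [/hd|_]; last by rewrite pnorm0.
 rewrite pnormM pnormV pnorm_p invrK -(ler_pM2l pr_gt0).
 by rewrite mulfV // gt_eqF // pr_gt0.
have bc i : (i < k)%N -> b i = p%:R * c i by move=> ik; rewrite /c ik mulVKf.
move=> i ik; rewrite bc // pnormM pnorm_p ppowS ler_pM2l ?pinv_gt0 //.
apply: (IH c z') => //; rewrite -(ler_pM2l pinv_gt0) -ppowS -(pnorm_p B) -pnormM.
rewrite mulrDr mulr_sumr mulrCA -ez.
rewrite (eq_bigr (fun j : 'I_k => iB (b j) * pe ^+ j)) // => j _.
by rewrite mulrA bc // rmorphM rmorph_nat.
Qed.

Lemma PS_norm n b y : PS b y -> `|y| <= p%:R ^- n -> forall k, `|b k| <= p%:R ^- n.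
Proof.
move=> [hb h] ny k; have [z hz e] := h k.+1; rewrite e in ny.
exact: (pesum_norm hb hz ny).
Qed.

(** Subtracting the multiple of pi^k only alters the remainder after the first k terms, so the
    estimate for truncated sums applies to it. *)
Lemma PS_low n k b y w : PS b y -> Wp w -> cong n y (pe ^+ k * w) ->
 forall i, (i < k)%N -> `|b i| <= p%:R ^- n.
Proof.
move=> [hb h] hw ny; have [z hz e] := h k.
apply: (pesum_norm (z := z - w) hb); first by clo.
by rewrite mulrBr addrA -e.
Qed.

Lemma PS_N b y : PS b y -> PS (fun k => - b k) (- y).
Proof.
move=> h; have h1 : W (-1 : K) by rewrite pnormN pnorm1.
have := PS_Z h1 h; rewrite rmorphN1 mulN1r.
by rewrite (_ : (fun k => _) = fun k => - b k) //; apply/funext => k; rewrite mulN1r.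
Qed.

Lemma PS_cong n b c y y' : PS b y -> PS c y' -> cong n y y' -> forall k, cong n (b k) (c k).
Proof. by move=> h h' hn k; exact: (PS_norm (PS_D h (PS_N h')) hn). Qed.

Lemma PS_inj b c y : PS b y -> PS c y -> b = c.
Proof.
move=> h h'; apply/funext => k; apply: cong_eq => n.
by apply: (PS_cong h h'); exact: congxx.
Qed.

Definition conv b c n := \sum_(i < n.+1) b i * c (n - i)%N.

(** Truncations multiply as polynomials: the part below degree M is the truncated convolution, and
    the part above joins the remainders. *)
Lemma PS_M b c y y' : PS b y -> PS c y' -> PS (conv b c) (y * y').
Proof.
move=> hb hc; have [h1 h2] := hb; have [h1' h2'] := hc; split=> [k|M].
 by apply: pnorm_sum_le => // i _ _; exact: W_M.
have [z hz ez] := h2 M; have [z' hz' ez'] := h2' M.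
pose P := \poly_(k < M) b k; pose Q := \poly_(k < M) c k.
have hE (f : nat -> K) : \sum_(k < M) iB (f k) * pe ^+ k = (map_poly iB (\poly_(k < M) f k)).[pe].
 rewrite (@horner_coef_wide _ M) ?size_map_poly //.
 by apply: eq_bigr => i _; rewrite coef_map coef_poly ltn_ord.
have eT : take_poly M (P * Q) = \poly_(k < M) conv b c k.
 apply/polyP => k; rewrite coef_take_poly coef_poly; case: ltnP => // kM.
 rewrite coefM; apply: eq_bigr => i _; rewrite !coef_poly.
 have ik : (i <= k)%N by rewrite -ltnS.
 by rewrite (leq_ltn_trans ik kM) (leq_ltn_trans (leq_subr _ _) kM).
pose D := drop_poly M (P * Q).
have ePQ : (\sum_(k < M) iB (b k) * pe ^+ k) * (\sum_(k < M) iB (c k) * pe ^+ k) =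
  \sum_(k < M) iB (conv b c k) * pe ^+ k + pe ^+ M * (map_poly iB D).[pe].
 rewrite !hE -hornerM -rmorphM -{1}(poly_take_drop M (P * Q)) eT rmorphD rmorphM.
 by rewrite hornerD hornerM /= map_polyXn hornerXn [X in _ + X]mulrC.
have hD : Wp (map_poly iB D).[pe].
 rewrite horner_coef; apply: Wp_sum => i _ _; apply: WpM; last by apply: WpX; exact: Wp_pe.
 rewrite coef_map; apply: Wp_QpBt; rewrite coef_drop_poly coefM.
 apply: pnorm_sum_le => // k _ _; apply: W_M; rewrite coef_poly; case: ifP => _ //;
 by rewrite pnorm0.
exists ((map_poly iB D).[pe] + y * z' + z * \sum_(k < M) iB (c k) * pe ^+ k).
 apply: WpD; last by apply: WpM => //; exact: Wp_pesum.
 by apply: WpD => //; apply: WpM => //; exact: PS_Wp hb.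
rewrite {1}ez' mulrDr {1}ez mulrDl ePQ; ring.
Qed.

Lemma RpD x y : Rp x -> Rp y -> Rp (x + y).
Proof. by move=> [b hb] [c hc]; eexists; exact: PS_D hb hc. Qed.
Lemma RpN x : Rp x -> Rp (- x).
Proof. by move=> [b hb]; eexists; exact: PS_N hb. Qed.
Lemma RpB x y : Rp x -> Rp y -> Rp (x - y).
Proof. by move=> h1 h2; apply: RpD => //; exact: RpN. Qed.
Lemma RpM x y : Rp x -> Rp y -> Rp (x * y).
Proof. by move=> [b hb] [c hc]; eexists; exact: PS_M hb hc. Qed.
Lemma Rp_QpBt a : W a -> Rp (iB a).
Proof. by move=> h; eexists; exact: PS_C. Qed.
Lemma Rp_nat n : Rp n%:R.
Proof. by rewrite -(rmorph_nat iB); apply: Rp_QpBt; exact: W_nat. Qed.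
Lemma Rp0 : Rp 0. Proof. exact: (Rp_nat 0). Qed.
Lemma Rp1 : Rp 1. Proof. exact: (Rp_nat 1). Qed.
Lemma Rp_peM y : Rp y -> Rp (pe * y).
Proof. by move=> [b hb]; eexists; exact: PS_shift hb. Qed.
Lemma Rp_pe : Rp pe. Proof. by rewrite -[pe]mulr1; apply: Rp_peM; exact: Rp1. Qed.
Lemma RpX x n : Rp x -> Rp (x ^+ n).
Proof. by move=> h; elim: n => [|n IH]; rewrite ?expr0 ?exprS; [exact: Rp1|exact: RpM]. Qed.
Lemma Rp_sum (I : eqType) (r : seq I) (P : pred I) (f : I -> B) :
 (forall i, i \in r -> P i -> Rp (f i)) -> Rp (\sum_(i <- r | P i) f i).
Proof.
move=> h; rewrite big_seq_cond; elim/big_ind: _ => [|x y|i /andP[]]; [exact: Rp0|exact: RpD|exact: h].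
Qed.

Lemma Rp_tail y : Rp y -> exists a y', [/\ W a, Rp y' & y = iB a + pe * y'].
Proof.
move=> [b hb]; have [y' hy' e] := PS_tail hb; exists (b 0), y'.
by split=> //; [exact: hb.1|exists (fun k => b k.+1)].
Qed.

Lemma Rp_div n y : Rp y -> `|y| <= p%:R ^- n -> exists2 y', Rp y' & y = p%:R ^+ n * y'.
Proof.
move=> [b hb] ny; have h := PS_norm hb ny.
have p0 : p%:R ^+ n != 0 :> K by [].
have hc k : W (p%:R ^- n * b k).
 rewrite pnormM pnormV pnorm_pow invrK -[X in _ <= X](@mulfV _ (p%:R ^+ n)).
  by rewrite ler_pM2l ?exprn_gt0 ?pr_gt0.
 by rewrite expf_neq0 // gt_eqF // pr_gt0.
have [y' hy'] := PS_ex hc; exists y'; first by exists (fun k => p%:R ^- n * b k).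
have npp : W (p%:R ^+ n : K) by clo.
have h' := PS_Z npp hy'; rewrite rmorphXn rmorph_nat in h'; apply: (PS_uniq hb).
rewrite (_ : b = fun k => p%:R ^+ n * (p%:R ^- n * b k)) //; apply/funext => k.
by rewrite mulVKf.
Qed.

(** Successive approximation. As f multiplies pi^N by a unit constant plus a multiple of pi, the
    constant term of what remains at level N can be removed by choosing the N-th coefficient of
    y. *)
Lemma Rp_solve (f : B -> B) (tau : nat -> K) :
 (forall x y, f (x + y) = f x + f y) -> (forall a x, f (iB a * x) = iB a * f x) ->
 (forall N y, Wp y -> exists2 z, Wp z & f (pe ^+ N * y) = pe ^+ N * z) ->
 (forall N, `|tau N| = 1 /\ exists2 r, Rp r & f (pe ^+ N) = pe ^+ N * (iB (tau N) + pe * r)) ->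
 forall r, Rp r -> exists2 y, Rp y & f y = r.
Proof.
move=> fD fZ fW ft r hr.
(* The pair holds the level N and the current remainder e; the result is the new coefficient with
   the next remainder. Arbitrary values are returned when e is not a power series, so that the
   choice is total. *)
have step (u : nat * B) : exists v : K * B, Rp u.2 ->
  [/\ W v.1, Rp v.2 & pe ^+ u.1 * u.2 = f (iB v.1 * pe ^+ u.1) + pe ^+ u.1.+1 * v.2].
 case: u => N e /=; have [he|he] := pselect (Rp e); last by exists (0, 0).
 have [a [e' [ha he' ->]]] := Rp_tail he; have [nt [s hs es]] := ft N.
 have t0 : tau N != 0 by rewrite -pnorm_eq0 nt.
 exists (a / tau N, e' - iB (a / tau N) * s) => _ /=.
 have na : W (a / tau N) by rewrite pnormM pnormV nt invr1 mulr1.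
 split=> //; first by apply: RpB => //; apply: RpM => //; exact: Rp_QpBt.
 have et : iB a = iB (a / tau N) * iB (tau N) by rewrite -rmorphM divfK.
 by rewrite fZ es et exprS; ring.
have [g hg] := choice step.
pose st := fix st n := if n is n'.+1 then (n, (g (st n')).2) else (0, r).
have st1 n : (st n).1 = n by case: n.
have st2 n : Rp (st n).2.
 by elim: n => // n IH; have [] := hg (st n) IH.
pose b n := (g (st n)).1.
have hb n : W (b n) by have [] := hg (st n) (st2 n).
have eN N : r = f (\sum_(k < N) iB (b k) * pe ^+ k) + pe ^+ N * (st N).2.
 elim: N => [|N IH]; first by have := fZ 0 0; rewrite rmorph0 !mul0r big_ord0 expr0 mul1r => ->; rewrite add0r.
 rewrite IH big_ord_recr /= fD -addrA; congr (_ + _).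
 by have [_ _] := hg (st N) (st2 N); rewrite st1.
have [y hy] := PS_ex hb; exists y; first by exists b.
apply: peM_eq => M; have [z hz ey] := hy.2 M; have [w hw ew] := fW M z hz.
exists (w - (st M).2); first by apply: WpB => //; apply: Rp_Wp; exact: st2.
by rewrite {1}(eN M) ey fD ew; ring.
Qed.

Lemma Rp_unit y a y' : y = iB a + pe * y' -> `|a| = 1 -> Rp y' -> Rp y^-1.
Proof.
move=> e na hy'.
have hy : Rp y by rewrite e; apply: RpD; [apply: Rp_QpBt; rewrite na|exact: Rp_peM].
have [|||N|x hx ex] := Rp_solve (f := fun x => y * x) (tau := fun=> a) _ _ _ _ Rp1.
- by move=> u v; rewrite mulrDr.
- by move=> u v; rewrite mulrCA.
- by move=> N z hz; exists (y * z); [apply: WpM => //; exact: Rp_Wp|ring].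
- by split=> //; exists y' => //; rewrite {1}e; ring.
have y0 : y != 0 by apply/eqP => y0; move/eqP: ex; rewrite y0 mul0r eq_sym oner_eq0.
by have -> : y^-1 = x by apply: (mulfI y0); rewrite ex divff.
Qed.

(* Substitution of pi * v for pi, the effect of frob and of the Galois group on series in pi *)
Definition pe_endo (f : {rmorphism B -> B}) := [/\ isometric f,
 forall x, Wp x -> Wp (f x) & exists2 v, Rp v & f pe = pe * v].

(** f(pi)^k is divisible by pi^k, so the matrix of coefficients c is triangular and every
    coefficient of f(y) is a finite sum. *)
Lemma PS_comp (f : {rmorphism B -> B}) b y (c : nat -> nat -> K) : pe_endo f -> PS b y ->
 (forall k, PS (c k) (f pe ^+ k)) ->
 (forall k n, (n < k)%N -> c k n = 0) /\ PS (fun n => \sum_(k < n.+1) b k * c k n) (f y).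
Proof.
move=> [fn fW [v hv ev]] hb hc.
have c0 k n : (n < k)%N -> c k n = 0.
 move=> nk; have [d hd] := RpX k hv.
 have e : forall j, PS (fun i => if (i < j)%N then 0 else d (i - j)%N) (pe ^+ j * v ^+ k).
  elim=> [|j IH]; first by rewrite expr0 mul1r (_ : (fun i => _) = d) //; apply/funext => i; rewrite subn0.
  rewrite exprS -mulrA; have := PS_shift IH.
  rewrite (_ : (fun i => _) = fun i => if (i < j.+1)%N then 0 else d (i - j.+1)%N) //.
  by apply/funext => -[|i].
 have := PS_inj (hc k); rewrite ev exprMn => /(_ _ (e k)) ->.
 by rewrite nk.
split=> //; split=> [n|M].
 apply: pnorm_sum_le => // i _ _; apply: W_M; [exact: hb.1|exact: (hc _).1].
have [z hz ->] := hb.2 M.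
have /choice[w hw] k : exists w, Wp w /\ f pe ^+ k = \sum_(n < M) iB (c k n) * pe ^+ n + pe ^+ M * w.
 by have [w h1 h2] := (hc k).2 M; exists w.
rewrite rmorphD rmorphM rmorphXn rmorph_sum /=.
exists (\sum_(k < M) iB (b k) * w k + v ^+ M * f z).
 apply: WpD; last by apply: WpM; [apply: WpX; exact: Rp_Wp|exact: fW].
 apply: Wp_sum => i _ _; apply: WpM; last exact: (hw i).1.
 by apply: Wp_QpBt; exact: hb.1.
have -> : \sum_(k < M) f (iB (b k) * pe ^+ k) =
  \sum_(k < M) iB (b k) * \sum_(n < M) iB (c k n) * pe ^+ n + pe ^+ M * \sum_(k < M) iB (b k) * w k.
 rewrite mulr_sumr -big_split /=; apply: eq_bigr => k _.
 by rewrite rmorphM rmorphXn isom_QpBt // (hw k).2; ring.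
have -> : \sum_(k < M) iB (b k) * \sum_(n < M) iB (c k n) * pe ^+ n =
  \sum_(n < M) iB (\sum_(k < n.+1) b k * c k n) * pe ^+ n.
 under eq_bigr do rewrite mulr_sumr.
 rewrite exchange_big /=; apply: eq_bigr => n _.
 have nM : (n.+1 <= M)%N by [].
 rewrite rmorph_sum mulr_suml (big_ord_widen M (fun k => iB (b k * c k n) * pe ^+ n) nM).
 rewrite [RHS]big_mkcond; apply: eq_bigr => k _.
 rewrite mulrA -rmorphM; case: ltnP => // /c0 ->.
 by rewrite mulr0 rmorph0 mul0r.
by rewrite ev exprMn; ring.
Qed.

Lemma Rp_endo (f : {rmorphism B -> B}) y : pe_endo f -> Rp y -> Rp (f y).
Proof.
move=> hf [b hb]; have [_ _ [v hv ev]] := hf.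
have /choice[c hc] k : exists c, PS c (f pe ^+ k).
 by apply: RpX; rewrite ev; exact: Rp_peM.
by eexists; exact: (PS_comp hf hb hc).2.
Qed.

Lemma frob_pe : frob S pe = (1 + pe) ^+ p - 1.
Proof. by rewrite /pi_eps rmorphB rmorph1 frob_teich teichX [1 + _]addrC subrK. Qed.

Lemma pe_endo_frob : pe_endo (frob S).
Proof.
split; [exact: frob_norm|exact: Wp_frob|].
exists (\sum_(i < p) (1 + pe) ^+ i).
 by apply: Rp_sum => i _ _; apply: RpX; apply: RpD; [exact: Rp1|exact: Rp_pe].
by rewrite frob_pe subrX1 addrAC subrr add0r.
Qed.

Lemma PS_binom (m : nat) : PS (fun k => 'C(m, k)%:R) ((1 + pe) ^+ m).
Proof.
split=> [k|M] //.
have e : (1 + pe) ^+ m = \sum_(k < m.+1) 'C(m, k)%:R * pe ^+ k.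
 by rewrite exprDn; apply: eq_bigr => i _; rewrite expr1n mul1r mulr_natl.
set N := (M + m.+1)%N.
have e2 : (1 + pe) ^+ m = \sum_(k < N) 'C(m, k)%:R * pe ^+ k.
 rewrite e /N addnC big_split_ord /= [X in _ = _ + X]big1 ?addr0 // => i _.
 by rewrite bin_small ?mul0r // ltn_addr.
exists (\sum_(k < m.+1) 'C(m, M + k)%:R * pe ^+ k).
 apply: Wp_sum => i _ _; apply: WpM; [exact: Wp_nat|apply: WpX; exact: Wp_pe].
rewrite e2 big_split_ord /= mulr_sumr; congr (_ + _).
 by apply: eq_bigr => i _; rewrite rmorph_nat.
by apply: eq_bigr => i _; rewrite exprD; ring.
Qed.

(** For a natural number i close to c, eps^i is close to g(eps) in the tilt, and (1 + pi)^i has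
    coefficients close to those of (1 + pi)^c. Both approximations are compared in the weak
    topology. *)
Lemma gal_eps_PS (g : galois S) (c : K) : is_cyclo eps g c ->
 PS (gbinom c) (teich (gt g eps)).
Proof.
move=> [nc hc]; have zc : zint c by apply: Qp_zint; rewrite nc.
have [y hy] := PS_ex (fun k => gbinom_le1 k zc).
suff -> : teich (gt g eps) = y by [].
apply/esym/wk_all_eq => n m.
have [k hk] := teich_cont n m.
have [N1 h1] : exists N, forall i, cong N c i%:R -> forall k, (k < m)%N -> cong n (gbinom c k) 'C(i, k)%:R.
 elim: m {hk} => [|m' [N hN]]; first by exists 0.
 have [N' hN'] := gbinom_cont m' n zc; exists (maxn N N') => i hi k'.
 rewrite ltnS leq_eqVlt => /orP[/eqP ->|kn].
  by apply: hN'; apply: cong_le hi; rewrite leq_maxr.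
 by apply: hN => //; apply: cong_le hi; rewrite leq_maxl.
have [N2 h2] := pow_small pinv_ge0 pinv_lt1 (exprn_gt0 k tnorm_pb_gt0).
set N := maxn N1 N2; have [i hi] := zc N.
have oe : Oi eps by [].
have -> : y - teich (gt g eps) = (y - (1 + pe) ^+ i) + (teich (eps ^+ i) - teich (gt g eps)).
 by rewrite teichX /pi_eps [1 + _]addrC subrK; ring.
apply: wkD; last first.
 apply: hk; [exact: OiX|by rewrite /Oi tnorm_gt|].
 apply: (@le_trans _ _ (p%:R ^- (p ^ N))).
  apply/tcoord_close; [exact: OiX|by rewrite /Oi tnorm_gt|].
  by rewrite tcoordX tcoord_gt (hc N i hi); exact: congxx.
 rewrite -exprVn; apply: ltW; apply: h2; apply: leq_trans (ltnW (ltn_expl _ p_gt1)).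
 by rewrite leq_maxr.
have [z hz ->] := hy.2 m; have [z' hz' ->] := (PS_binom i).2 m.
rewrite opprD addrACA -mulrBr; apply: wkD; last by apply: wk_pe; exact: WpB.
apply: wk_norm_le; apply: cong_sum => j _ _; rewrite mulrC [X in cong _ _ X]mulrC.
apply: congMl; first by apply: W_X; exact: pe_le1.
rewrite /cong -rmorphB QpBt_norm; apply: h1 => //.
by apply: cong_le hi; rewrite leq_maxl.
Qed.

Lemma gal_pe (g : galois S) : galB g pe = teich (gt g eps) - 1.
Proof. by rewrite /pi_eps rmorphB rmorph1 gal_teich. Qed.

Lemma gal_pe_PS (g : galois S) (c : K) : is_cyclo eps g c ->
 exists2 v, PS (fun k => gbinom c k.+1) v & galB g pe = pe * v.
Proof.
move=> /gal_eps_PS h; have [v hv e] := PS_tail h; exists v => //.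
rewrite gal_pe e /gbinom big_ord0 fact0 divr1 rmorph1; ring.
Qed.

Lemma pe_endo_gal (g : galois S) (c : K) : is_cyclo eps g c -> pe_endo (galB g).
Proof.
move=> /gal_pe_PS[v hv e]; split; [exact: galB_norm|exact: Wp_gal|].
by exists v => //; exists (fun k => gbinom c k.+1).
Qed.

End PowerSeries.
#[local] Hint Resolve Rp0 Rp1 Rp_nat Rp_pe : core.
#[local] Hint Resolve Rp_Wp RpD RpN RpB RpM RpX Rp_peM Rp_QpBt PS_Wp : closed.

(** * Integral overconvergent series in pi *)

Section Overconvergent.
Implicit Types (x y z : B).

Lemma Rp_divp x : Rp x -> `|x| <= p%:R^-1 -> exists2 y, Rp y & x = p%:R * y.
Proof. by move=> hx; rewrite -ppow1 => /(Rp_div hx); rewrite expr1. Qed.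

Definition pe_s k : B := p%:R / pe ^+ k.

Lemma pe_sE k : p%:R = pe_s k * pe ^+ k.
Proof. by rewrite divfK // peX_neq0. Qed.
Lemma pe_s_norm k : `|pe_s k| = p%:R^-1.
Proof. by rewrite pnormM pnormV pnormX pe_norm // expr1n invr1 mulr1 pnorm_p. Qed.
Lemma pe_s_neq0 k : pe_s k != 0.
Proof. by rewrite -pnorm_eq0 pe_s_norm gt_eqF // pinv_gt0. Qed.
Lemma pe_s_cong n k x y : cong n x y -> cong n.+1 (pe_s k * x) (pe_s k * y).
Proof. by move=> h; rewrite /cong -mulrBr pnormM pe_s_norm ppowS ler_pM2l ?pinv_gt0. Qed.
Lemma pe_s_cancel n k x y : cong n.+1 (pe_s k * x) (pe_s k * y) -> cong n x y.
Proof. by rewrite /cong -mulrBr pnormM pe_s_norm ppowS ler_pM2l ?pinv_gt0. Qed.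

(** The ring Z_p[[pi]][p / pi^k]. Its p-adic closure [G k] consists of sums of Laurent series whose
    coefficient of pi^(-j) is divisible by p^q as soon as k q <= j. *)
Inductive GS (k : nat) : B -> Prop :=
| GS_L x : Rp x -> GS k x
| GS_s : GS k (pe_s k)
| GS_D x y : GS k x -> GS k y -> GS k (x + y)
| GS_M x y : GS k x -> GS k y -> GS k (x * y).

Definition G k x := forall n, exists2 y, GS k y & cong n x y.

Lemma GS_coef k x : GS k x -> exists z y, [/\ Rp z, GS k y & x = z + pe_s k * y].
Proof.
elim=> {x}.
- by move=> x h; exists x, 0; split; rewrite ?mulr0 ?addr0 //; apply: GS_L; exact: Rp0.
- exists 0, 1; split; [exact: Rp0|apply: GS_L; exact: Rp1|by rewrite add0r mulr1].
- move=> x y _ [z [w [h1 h2 ->]]] _ [z' [w' [h1' h2' ->]]]; exists (z + z'), (w + w').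
 by split; [exact: RpD|exact: GS_D|ring].
- move=> x y _ [z [w [h1 h2 ->]]] _ [z' [w' [h1' h2' ->]]].
 exists (z * z'), (z * w' + w * z' + pe_s k * (w * w')); split; [exact: RpM| |ring].
 apply: GS_D; last by apply: GS_M; [exact: GS_s|exact: GS_M].
 by apply: GS_D; apply: GS_M => //; exact: GS_L.
Qed.

Lemma GS_le1 k x : GS k x -> W x.
Proof.
elim=> [y /Rp_Wp|||]; first by clo.
- by rewrite pe_s_norm pinv_le1.
- by move=> *; exact: pnormD_le.
- by move=> *; exact: W_M.
Qed.

Lemma G_le1 k x : G k x -> W x.
Proof. by move=> /(_ 0)[y /GS_le1 h1 h2]; exact: cong_norm h2 h1. Qed.
Lemma G_GS k x : GS k x -> G k x.
Proof. by move=> h n; exists x => //; exact: congxx. Qed.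
Lemma G_L k x : Rp x -> G k x. Proof. by move=> h; apply/G_GS/GS_L. Qed.
Lemma G_s k : G k (pe_s k). Proof. exact/G_GS/GS_s. Qed.
Lemma G_D k x y : G k x -> G k y -> G k (x + y).
Proof.
move=> h h' n; have [a h1 h2] := h n; have [b h3 h4] := h' n.
by exists (a + b); [exact: GS_D|exact: congD].
Qed.
Lemma G_M k x y : G k x -> G k y -> G k (x * y).
Proof.
move=> h h' n; have [a h1 h2] := h n; have [b h3 h4] := h' n.
by exists (a * b); [exact: GS_M|apply: congM => //; [exact: G_le1 h|exact: GS_le1 h3]].
Qed.
Lemma G_N k x : G k x -> G k (- x).
Proof. by move=> h; rewrite -mulN1r; apply: G_M => //; apply/G_L/RpN; exact: Rp1. Qed.
Lemma G_X k x n : G k x -> G k (x ^+ n).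
Proof. by move=> h; elim: n => [|n IH]; rewrite ?expr0 ?exprS; [apply: G_L; exact: Rp1|exact: G_M]. Qed.
Lemma G_sum k (I : eqType) (r : seq I) (P : pred I) (f : I -> B) :
 (forall i, i \in r -> P i -> G k (f i)) -> G k (\sum_(i <- r | P i) f i).
Proof.
move=> h; rewrite big_seq_cond; elim/big_ind: _ => [|x y|i /andP[]]; [|exact: G_D|exact: h].
by apply: G_L; exact: Rp0.
Qed.
Lemma G_closed k x : (forall n, exists2 y, G k y & cong n x y) -> G k x.
Proof.
move=> h n; have [y hy c] := h n; have [z hz c'] := hy n.
by exists z => //; exact: congT c c'.
Qed.

Lemma G_mono k k' x : (k <= k')%N -> G k x -> G k' x.
Proof.
move=> kk h; apply: G_closed => n; have [y hy c] := h n; exists y => //.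
elim: hy => [z hz||? ? _ h1 _ h2|? ? _ h1 _ h2]; [exact: G_L| |exact: G_D|exact: G_M].
have -> : pe_s k = pe ^+ (k' - k) * pe_s k'.
 rewrite /pe_s -{2}(subnK kk) exprD; field.
 by rewrite !expf_neq0 ?pe_neq0.
by apply: G_M; [apply: G_L; apply: RpX; exact: Rp_pe|exact: G_s].
Qed.

(** For generators this is division by p / pi^k. In the closure, the power series parts of two
    approximations differ by a multiple of p = (p / pi^k) pi^k, which is absorbed in the second
    term. *)
Lemma G_digit k x : G k x -> exists z y, [/\ Rp z, G k y & x = z + pe_s k * y].
Proof.
move=> h; have [x1 /GS_coef[z [y1 [hz hy1 e1]]] c1] := h 1.
have c0 : cong 1 x z.
 apply: congT c1 _; rewrite e1 /cong addrAC subrr add0r ppow1.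
 by apply: pnormMr_le; [exact: GS_le1 hy1|rewrite pe_s_norm].
exists z, ((x - z) / pe_s k); split=> //; last by rewrite mulrC divfK ?pe_s_neq0 // addrC subrK.
apply: G_closed => n; have [xn /GS_coef[zn [yn [hzn hyn en]]] cn] := h n.+1.
have czn : `|zn - z| <= p%:R^-1.
 rewrite -ppow1; apply: congT _ c0; apply: congS.
 apply: congT (cong_le (ltn0Sn n) cn) _; rewrite en /cong addrAC subrr add0r ppow1.
 by apply: pnormMr_le; [exact: GS_le1 hyn|rewrite pe_s_norm].
have [w hw ew] := Rp_divp (RpD hzn (RpN hz)) czn.
exists (pe ^+ k * w + yn).
 apply: G_D; last exact: G_GS.
 by apply: G_L; apply: RpM => //; apply: RpX; exact: Rp_pe.
apply: (@pe_s_cancel _ k); rewrite mulrC divfK ?pe_s_neq0 // mulrDr mulrA -pe_sE -ew.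
have -> : zn - z + pe_s k * yn = xn - z by rewrite en; ring.
by apply: congB => //; exact: congxx.
Qed.

Lemma G_series k (a : nat -> B) y x : (forall i, Rp (a i)) -> G k y ->
 (forall n, cong n x (\sum_(i < n) a i * (pe_s k * y) ^+ i)) -> G k x.
Proof.
move=> ha hy h; apply: G_closed => n; eexists; last by clo.
apply: G_sum => i _ _; apply: G_M; first exact: G_L.
by apply/G_X/G_M => //; exact: G_s.
Qed.

Lemma G_geom k y : G k y -> G k (1 - pe_s k * y)^-1.
Proof.
move=> hy; apply: (G_series (a := fun=> 1) (y := y)) => // n.
have nt : `|pe_s k * y| <= p%:R^-1.
 by apply: pnormMr_le; [exact: G_le1 hy|rewrite pe_s_norm].
set t := pe_s k * y in nt *.
have n1 : `|1 - t| = 1.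
 by apply: near1_norm; rewrite addrAC subrr add0r pnormN.
have u0 : 1 - t != 0 by rewrite -pnorm_eq0 n1.
under eq_bigr do rewrite mul1r.
have -> : \sum_(i < n) t ^+ i = (1 - t)^-1 * (1 - t ^+ n).
 have e := subrX1 t n; have -> : 1 - t ^+ n = (1 - t) * \sum_(i < n) t ^+ i.
  by rewrite -(opprB (t ^+ n)) e; ring.
 by rewrite mulKf.
rewrite /cong mulrBr mulr1 opprB addrC subrK pnormM pnormV n1 invr1 mul1r pnormX.
by rewrite -exprVn lerXn2r ?nnegrE ?pnorm_ge0 ?pinv_ge0.
Qed.

Lemma G_zpow k y (u : K) : G k y -> W u -> G k (zpow (1 + pe_s k * y) (iB u)).
Proof.
move=> hy hu; have zu : zint (iB u) by exact: zint_QpBt.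
have nt : near1 (1 + pe_s k * y).
 by rewrite addrAC subrr add0r; apply: pnormMr_le; [exact: G_le1 hy|rewrite pe_s_norm].
apply: (G_series (a := fun i => gbinom (iB u) i) (y := y)) => // [i|n].
 have -> : gbinom (iB u) i = iB (gbinom u i).
  rewrite rmorphM fmorphV rmorph_nat rmorph_prod; congr (_ / _).
  by apply: eq_bigr => j _; rewrite rmorphB rmorph_nat.
 by apply: Rp_QpBt; apply: gbinom_le1; exact: Qp_zint.
pose proof (zpow_partial zu nt n) as e; move: e.
by have -> : 1 + pe_s k * y - 1 = pe_s k * y by ring.
Qed.

(** The ring of integers of E^dagger, seen inside W(tilt): poles at pi of finite order are allowed
    in addition to the ring G k. *)
Definition Adag x := exists N k, G k (pe ^+ N * x).

Lemma Adag_up N k N' k' x : (N <= N')%N -> (k <= k')%N -> G k (pe ^+ N * x) -> G k' (pe ^+ N' * x).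
Proof.
move=> NN kk /(G_mono kk) h; rewrite -(subnK NN) exprD -mulrA; apply: G_M => //.
by apply: G_L; apply: RpX; exact: Rp_pe.
Qed.

Lemma Adag_G k x : G k x -> Adag x.
Proof. by move=> h; exists 0, k; rewrite mul1r. Qed.
Lemma Adag_Rp x : Rp x -> Adag x.
Proof. by move=> h; apply: (Adag_G (k := 0)); exact: G_L. Qed.
Lemma Adag_D x y : Adag x -> Adag y -> Adag (x + y).
Proof.
move=> [N [k h]] [N' [k' h']]; exists (N + N')%N, (k + k')%N; rewrite mulrDr.
by apply: G_D; [apply: Adag_up h|apply: Adag_up h']; rewrite ?leq_addr ?leq_addl.
Qed.
Lemma Adag_M x y : Adag x -> Adag y -> Adag (x * y).
Proof.
move=> [N [k h]] [N' [k' h']]; exists (N + N')%N, (k + k')%N.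
rewrite exprD mulrACA; apply: G_M.
 by apply: G_mono h; rewrite leq_addr.
by apply: G_mono h'; rewrite leq_addl.
Qed.
Lemma Adag_X x n : Adag x -> Adag (x ^+ n).
Proof. by move=> h; elim: n => [|n IH]; rewrite ?expr0 ?exprS; [apply: Adag_Rp; exact: Rp1|exact: Adag_M]. Qed.
Lemma Adag_N x : Adag x -> Adag (- x).
Proof. by move=> h; rewrite -mulN1r; apply: Adag_M => //; apply/Adag_Rp/RpN; exact: Rp1. Qed.
Lemma Adag_peV : Adag pe^-1.
Proof. by exists 1, 0; rewrite expr1 divff ?pe_neq0 //; apply: G_L; exact: Rp1. Qed.
Lemma Adag_le1 x : Adag x -> W x.
Proof. by move=> [N [k /G_le1]]; rewrite pnormM pnormX pe_norm // expr1n mul1r. Qed.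

(** The right-hand side is pi^k (1 + (p / pi^k) w), whose second factor is inverted by a geometric
    series. *)
Lemma Adag_inv k x z w : Rp z -> Rp w -> z * x = pe ^+ k + p%:R * w -> Adag x^-1.
Proof.
move=> hz hw e; have hk : pe ^+ k != 0 by exact: peX_neq0.
exists k, k.
have e2 : z * x = pe ^+ k * (1 - pe_s k * (- w)).
 by rewrite e mulrN opprK mulrDr mulr1 mulrA [pe ^+ k * _]mulrC -pe_sE.
have [x0|x0] := eqVneq x 0.
 by rewrite x0 invr0 mulr0; apply: G_L; exact: Rp0.
have hg := G_geom (G_N (G_L k hw)).
have -> : pe ^+ k * x^-1 = z * (1 - pe_s k * (- w))^-1.
 have u0 : 1 - pe_s k * - w != 0.
  rewrite -pnorm_eq0 near1_norm // addrAC subrr add0r pnormN.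
  apply: pnormMr_le; last by rewrite pe_s_norm.
  by rewrite pnormN; apply: Wp_le1; exact: Rp_Wp.
 by apply: (mulIf u0); rewrite divfK // mulrAC -e2 mulfK.
by apply: G_M => //; exact: G_L.
Qed.

Lemma Adag_zpow x m (u : K) : Adag x -> Rp m -> W u -> Adag (zpow (1 + p%:R * m * x) (iB u)).
Proof.
move=> [N [k h]] hm hu; apply: (Adag_G (k := k + N)).
have -> : p%:R * m * x = pe_s (k + N) * (pe ^+ k * m * (pe ^+ N * x)).
 by rewrite {1}(pe_sE (k + N)) exprD; ring.
apply: G_zpow => //; apply: G_M; last by apply: G_mono h; rewrite leq_addr.
by apply: G_L; apply: RpM => //; apply: RpX; exact: Rp_pe.
Qed.

(** Weierstrass preparation in weak form. If b_k is the first unit coefficient, then x = p w + pi^k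
    y with y an invertible power series, and x / y = pi^k + p w / y falls under [Adag_inv]. *)
Lemma Rp_Adag_inv x : Rp x -> `|x| = 1 -> Adag x^-1.
Proof.
move=> hx nx; have [b hb] := hx.
have [k bk kmin] : exists2 k, `|b k| = 1 & forall i, (i < k)%N -> `|b i| <= p%:R^-1.
 have [h|] := pselect (exists k, `|b k| == 1).
  exists (ex_minn h); first by case: ex_minnP => k /eqP.
  case: ex_minnP => k _ hmin i ik; apply: Qp_disc.
  rewrite lt_neqAle hb.1 andbT; apply/negP => /hmin; by rewrite leqNgt ik.
 move=> h; exfalso.
 have hb1 k : `|b k| <= p%:R^-1.
  apply: Qp_disc; rewrite lt_neqAle hb.1 andbT; apply/negP => e; by apply: h; exists k.
 have [z hz ez] := hb.2 0.
 have p0 : p%:R != 0 :> K by [].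
 have hc k : W (p%:R^-1 * b k).
  rewrite pnormM pnormV pnorm_p invrK -(ler_pM2l pinv_gt0) mulrA mulr1.
  by rewrite mulVf ?mul1r // gt_eqF // pr_gt0.
 have [y hy] := PS_ex hc.
 have npp : W (p%:R : K) by [].
 pose proof (PS_Z npp hy) as h'; rewrite rmorph_nat in h'.
 have bb : (fun k => p%:R * (p%:R^-1 * b k)) = b by apply/funext => k; rewrite mulVKf.
 rewrite bb in h'.
 have ex := PS_uniq hb h'.
 have : `|x| <= p%:R^-1.
  by rewrite ex; apply: pnormMr_le; [apply: Wp_le1; exact: PS_Wp hy|rewrite pnorm_p].
 by rewrite nx leNgt pinv_lt1.
have [w hw ew] : exists2 w, Rp w & \sum_(i < k) iB (b i) * pe ^+ i = p%:R * w.
 apply: Rp_divp.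
  apply: Rp_sum => // i _ _; apply: RpM => //; first by apply: Rp_QpBt => //; exact: hb.1.
  by apply: RpX => //; exact: Rp_pe.
 apply: pnorm_sum_le => [|i _ _] //.
 by apply: pnormMr_le; rewrite ?W_X ?pe_le1 // QpBt_norm kmin.
have tl : forall j, exists2 y, PS (fun i => b (j + i)%N) y &
  x = \sum_(i < j) iB (b i) * pe ^+ i + pe ^+ j * y.
 elim=> [|j [y hy e]]; first by exists x => //; rewrite big_ord0 expr0; ring.
 have [y' hy' ey] := PS_tail hy.
 exists y'; last by rewrite e ey big_ord_recr /= addn0 exprS; ring.
 by rewrite (_ : (fun i => _) = fun i => b (j + i.+1)%N) //; apply/funext => i; rewrite addnS.
have [y hy ey] := tl k; have [y' hy' ey'] := PS_tail hy; rewrite addn0 in ey'.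
have hu : Rp y^-1 by apply: (Rp_unit ey' bk); eexists; exact: hy'.
have y0 : y != 0.
 apply/eqP => y0; move: ey; rewrite y0 mulr0 addr0 ew => ex.
 have : `|x| <= p%:R^-1.
  rewrite ex; apply: pnormMr_le; last by rewrite pnorm_p.
  by apply: Wp_le1; exact: Rp_Wp hw.
 by rewrite nx leNgt pinv_lt1.
apply: (Adag_inv hu (w := y^-1 * w) (k := k)); first by clo.
by rewrite ey ew; field.
Qed.

(** The image of p / pi^k is p / f(pi)^k; since f(pi) is a power series of norm 1, its inverse is
    overconvergent, at the cost of a larger k. *)
Lemma Adag_endo (f : {rmorphism B -> B}) x : pe_endo f -> Adag x -> Adag (f x).
Proof.
move=> hf; have [fn fW [v hv ev]] := hf.
have nfe : `|f pe| = 1 by rewrite fn pe_norm.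
have hfe : Rp (f pe) by rewrite ev; exact: Rp_peM.
have hV : Adag (f pe)^-1 by exact: Rp_Adag_inv.
have fe0 : f pe != 0 by rewrite -pnorm_eq0 nfe.
move=> [N [k h]].
suff hk : Adag (f (pe ^+ N * x)).
 have -> : f x = (f pe)^-1 ^+ N * f (pe ^+ N * x).
  by rewrite rmorphM rmorphXn mulrA -exprMn mulVf // expr1n mul1r.
 by apply: Adag_M => //; exact: Adag_X.
move: (pe ^+ N * x) h => {}x h.
have [N' [k' hs]] : Adag ((f pe)^-1 ^+ k) by exact: Adag_X.
apply: (Adag_G (k := k' + N')); apply: G_closed => // n; have [y hy c] := h n.
exists (f y); last by rewrite /cong -rmorphB fn.
elim: hy => [z hz||a b _ h1 _ h2|a b _ h1 _ h2].
- by apply: G_L; exact: Rp_endo.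
- have -> : f (pe_s k) = pe_s (k' + N') * (pe ^+ k' * (pe ^+ N' * (f pe)^-1 ^+ k)).
  rewrite /pe_s rmorphM fmorphV rmorphXn exprD exprVn; field.
  by rewrite !expf_neq0 ?pe_neq0.
 apply: G_M; first exact: G_s.
 apply: G_M; last by apply: G_mono hs; rewrite leq_addr.
 by apply: G_L; apply: RpX => //; exact: Rp_pe.
- by rewrite rmorphD; exact: G_D.
- by rewrite rmorphM; exact: G_M.
Qed.

End Overconvergent.
#[local] Hint Resolve Adag_peV : core.
#[local] Hint Resolve Adag_Rp Adag_le1 Adag_D Adag_N Adag_M Adag_X Rp_Adag_inv G_L G_le1 : closed.

(** * Evaluation at pi of elements of the Robba ring *)

Section Evaluation.
Implicit Types (x y z : B) (b : nat -> K) (a : int -> K) (f g q : robba K).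

(** Coefficients of the Laurent series pi^(-N) times the power series with coefficients b. *)
Definition lz (N : nat) b : int -> K := fun i => if i + N%:Z is Posz k then b k else 0.

Lemma lz_pos N b i k : i + N%:Z = k%:Z -> lz N b i = b k.
Proof. by rewrite /lz => ->. Qed.
Lemma lz_neg N b i : i + N%:Z < 0 -> lz N b i = 0.
Proof. by rewrite /lz; case: (i + _). Qed.

Lemma lz_shift N b i : lz N.+1 (fun k => if k is k'.+1 then b k' else 0) i = lz N b i.
Proof.
have e : i + N.+1%:Z = (i + N%:Z) + 1 by lia.
rewrite /lz e; case: (i + N%:Z) => [k|[|k]]; first by rewrite -PoszD addn1.
 by [].
by have -> : Negz k.+1 + 1 = Negz k by lia.
Qed.

(* x is the sum at pi of the Laurent series a, with integral coefficients tending to 0 at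
  -oo: modulo each p^n, it is a Laurent series with finite principal part *)
Definition LE a x := forall n, exists N b y,
 [/\ PS b y, forall i, cong n (a i) (lz N b i) & cong n x (y / pe ^+ N)].

Lemma peV_norm N : `|(pe ^+ N)^-1| = 1.
Proof. by rewrite pnormV pnormX pe_norm // expr1n invr1. Qed.

Lemma LE_at a x n N0 : LE a x -> exists N b y,
 [/\ (N0 <= N)%N, PS b y, forall i, cong n (a i) (lz N b i) & cong n x (y / pe ^+ N)].
Proof.
move=> /(_ n)[N [b [y [h1 h2 h3]]]].
suff [b' [y' [k1 k2 k3]]] : exists b' y', [/\ PS b' y', forall i, lz (N + N0) b' i = lz N b i &
  y' / pe ^+ (N + N0) = y / pe ^+ N].
 exists (N + N0)%N, b', y'; rewrite leq_addl k3; split=> // i; rewrite k2 //.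
elim: N0 => [|N0 [b' [y' [k1 k2 k3]]]]; first by exists b, y; rewrite addn0.
exists (fun k => if k is k'.+1 then b' k' else 0), (pe * y'); split; first exact: PS_shift.
 by move=> i; rewrite addnS lz_shift.
by rewrite addnS exprS invfM mulrACA divff ?pe_neq0 // mul1r.
Qed.

Lemma LE_lz N b y : PS b y -> LE (lz N b) (y / pe ^+ N).
Proof. by move=> h n; exists N, b, y; split=> // [i|]; exact: congxx. Qed.

Lemma LE_norm n a x : LE a x -> `|x| <= p%:R ^- n -> forall i, `|a i| <= p%:R ^- n.
Proof.
move=> /(_ n)[N [b [y [h1 h2 h3]]]] nx i.
have ny : `|y| <= p%:R ^- n.
 have -> : `|y| = `|y / pe ^+ N| by rewrite pnormM peV_norm mulr1.
 by rewrite -[y / _](subrK x); apply: pnormD_le => //; exact: congS.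
rewrite -[a i](subrK (lz N b i)); apply: pnormD_le; first exact: h2.
rewrite /lz; case: (i + _) => k; first exact: (PS_norm h1 ny).
by rewrite pnorm0 ppow_ge0.
Qed.

Lemma LE_D a x a' x' : LE a x -> LE a' x' -> LE (fun i => a i + a' i) (x + x').
Proof.
move=> h h' n; have [N0 [b0 [y0 [h1 h2 h3]]]] := h n.
have [N [b [y [k0 k1 k2 k3]]]] := LE_at n N0 h'.
have [N1 [b1 [y1 [l0 l1 l2 l3]]]] := LE_at n N h.
have [N2 [b2 [y2 [m0 m1 m2 m3]]]] := LE_at n N1 h'.
have [b3 [y3 [e1 e2 e3]]] : exists b3 y3, [/\ PS b3 y3, forall i, lz N2 b3 i = lz N1 b1 i & y3 / pe ^+ N2 = y1 / pe ^+ N1].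
 rewrite -(subnKC m0); elim: (N2 - N1)%N => [|j [b' [y' [j1 j2 j3]]]].
  by exists b1, y1; rewrite addn0.
 exists (fun k => if k is k'.+1 then b' k' else 0), (pe * y'); split; first exact: PS_shift.
  by move=> i; rewrite addnS lz_shift.
 by rewrite addnS exprS invfM mulrACA divff ?pe_neq0 // mul1r.
exists N2, (fun k => b3 k + b2 k), (y3 + y2); split; first exact: PS_D.
 move=> i; have -> : lz N2 (fun k => b3 k + b2 k) i = lz N2 b3 i + lz N2 b2 i.
  by rewrite /lz; case: (i + _) => // k; rewrite addr0.
 by apply: congD => //; rewrite e2.
by rewrite mulrDl; apply: congD => //; rewrite e3.
Qed.

Lemma LE_Z c a x : W c -> LE a x -> LE (fun i => c * a i) (iB c * x).
Proof.
move=> hc h n; have [N [b [y [h1 h2 h3]]]] := h n.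
exists N, (fun k => c * b k), (iB c * y); split; first exact: PS_Z.
 move=> i; have -> : lz N (fun k => c * b k) i = c * lz N b i.
  by rewrite /lz; case: (i + _) => // k; rewrite mulr0.
 exact: congMl.
by rewrite -mulrA; apply: congMl => //; rewrite QpBt_norm.
Qed.

Lemma LE_N a x : LE a x -> LE (fun i => - a i) (- x).
Proof.
have h1 : W (-1 : K) by rewrite pnormN pnorm1.
move=> /(LE_Z h1); rewrite rmorphN1 mulN1r.
by rewrite (_ : (fun i => -1 * a i) = fun i => - a i) //; apply/funext => i; rewrite mulN1r.
Qed.

Lemma LE_lim a x : (forall n, exists a' x', [/\ LE a' x', forall i, cong n (a i) (a' i) & cong n x x']) -> LE a x.
Proof.
move=> h n; have [a' [x' [/(_ n)[N [b [y [h1 h2 h3]]]] k1 k2]]] := h n.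
exists N, b, y; split=> // [i|]; [exact: congT (k1 i) (h2 i)|exact: congT k2 h3].
Qed.

Lemma LE_cong n a x a' x' : LE a x -> LE a' x' -> cong n x x' -> forall i, cong n (a i) (a' i).
Proof. by move=> h h' c i; exact: (LE_norm (LE_D h (LE_N h')) c). Qed.

Lemma LE_inj a a' x : LE a x -> LE a' x -> a = a'.
Proof.
move=> h h'; apply/funext => i; apply: cong_eq => n.
by apply: (LE_cong h h'); exact: congxx.
Qed.

Lemma PS_small n b y : PS b y -> (forall k, `|b k| <= p%:R ^- n) -> `|y| <= p%:R ^- n.
Proof.
move=> h hb; apply: wk_sep => M; have [z hz ->] := h.2 M.
apply: wkD; last exact: wk_pe.
apply: wk_norm_le; apply: pnorm_sum_le => [|i _ _] //.
by apply: pnormMr_le; rewrite ?W_X ?pe_le1 // QpBt_norm.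
Qed.

Lemma LE_uniq a x x' : LE a x -> LE a x' -> x = x'.
Proof.
move=> h h'; apply: cong_eq => n; have [N [b [y [h1 h2 h3]]]] := LE_D h (LE_N h') n.
apply: (@congT _ _ _ (x' + y / pe ^+ N)).
 by rewrite -{1}[x](addrNK x') [x - x' + _]addrC; apply: congD => //; exact: congxx.
rewrite /cong addrAC subrr add0r pnormM peV_norm mulr1.
apply: (PS_small h1) => k; have := h2 (k%:Z - N%:Z); rewrite subrr (@lz_pos N b _ k) ?subrK //.
by move/congS/cong0P.
Qed.

Definition ev f x := LE f x.

Lemma ev_le1 f x i : ev f x -> W x -> W (f i).
Proof. by move=> h hx; have := LE_norm (n := 0) h; rewrite ppow0; apply. Qed.
Lemma ev_D f x g y : ev f x -> ev g y -> ev (f + g) (x + y).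
Proof. exact: LE_D. Qed.
Lemma ev_N f x : ev f x -> ev (- f) (- x).
Proof. exact: LE_N. Qed.
Lemma ev_B f x g y : ev f x -> ev g y -> ev (f - g) (x - y).
Proof. by move=> h h'; apply: ev_D => //; exact: ev_N. Qed.

(** Modulo p^n both series have finite principal parts, so only finitely many terms of the
    convolution matter and they are those of a product of two power series. *)
Lemma ev_M f x g y : W x -> W y -> ev f x -> ev g y -> ev (f * g) (x * y).
Proof.
move=> nx ny hf hg n.
have [N [b [u [h1 h2 h3]]]] := hf n; have [N' [b' [u' [h1' h2' h3']]]] := hg n.
have ba k : W (f k) by exact: ev_le1 hf nx.
have bb k : W (g k) by exact: ev_le1 hg ny.
exists (N + N')%N, (conv b b'), (u * u'); split; first exact: PS_M; last first.
 rewrite exprD invfM mulrACA; apply: congM => //.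
 rewrite pnormM peV_norm mulr1; apply: Wp_le1; exact: PS_Wp h1'.
move=> i; have sm := summable_conv i (robbaP f) (robbaP g).
have out k : (k + N%:Z < 0) || (i - k + N'%:Z < 0) -> `|f k * g (i - k)| <= p%:R ^- n.
 case/orP => hk.
  by apply: pnormMr_le => //; have := h2 k; rewrite (lz_neg b hk) => /cong0P.
 by apply: pnormMl_le => //; have := h2' (i - k); rewrite (lz_neg b' hk) => /cong0P.
have cz : cong n ((f * g) i) (zsum (fun k => f k * g (i - k))) by [].
apply: congT cz _.
case E : (i + (N + N')%N%:Z) => [m|m]; last first.
 rewrite lz_neg ?E //; apply/cong0P; apply: zsum_le => // k.
 by apply: out; lia.
rewrite (lz_pos _ E).
pose s := [seq j%:Z - N%:Z | j <- iota 0 m.+1].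
have us : uniq s by rewrite map_inj_uniq ?iota_uniq // => j j' /= h; lia.
apply: (@congT _ _ _ (\sum_(k <- s) f k * g (i - k))).
 apply: zsum_approx => //.
 move=> k ks; apply: out; apply/negPn/negP => hk; case/negP: ks.
 apply/mapP; exists (absz (k + N%:Z)); last by lia.
 by rewrite mem_iota; lia.
rewrite big_map -/(index_iota 0 m.+1) big_mkord.
apply: cong_sum => j _ _; have jm : (j <= m)%N by rewrite -ltnS.
have b'1 k : W (b' k) by exact: h1'.1.
apply: congM => //.
 by rewrite -(@lz_pos N b (j%:Z - N%:Z) j) ?subrK.
by rewrite -(@lz_pos N' b' (i - (j%:Z - N%:Z)) (m - j)%N) //; lia.
Qed.

(** The overconvergence of the value is recorded as well: by [Adag_ev] it makes inverses, powers and
    substitutions come from actual elements of the Robba ring. *)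
Definition eva f x := ev f x /\ Adag x.

Lemma eva_M f x g y : eva f x -> eva g y -> eva (f * g) (x * y).
Proof.
move=> [h1 h2] [h3 h4]; split; last by clo.
by apply: ev_M => //; exact: Adag_le1.
Qed.

Lemma eva_D f x g y : eva f x -> eva g y -> eva (f + g) (x + y).
Proof.
by move=> [h1 h2] [h3 h4]; split; [exact: ev_D|exact: Adag_D].
Qed.

Lemma eva_N f x : eva f x -> eva (- f) (- x).
Proof. by move=> [h1 h2]; split; [exact: ev_N|exact: Adag_N]. Qed.
Lemma eva_B f x g y : eva f x -> eva g y -> eva (f - g) (x - y).
Proof. by move=> h1 h2; apply: eva_D => //; exact: eva_N. Qed.
Lemma eva_inj f g x : eva f x -> eva g x -> f = g.
Proof. by move=> [h _] [h' _]; apply: robba_eqP => i; rewrite (LE_inj h h'). Qed.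
Lemma ev_lz f N b y : PS b y -> (forall i, f i = lz N b i) -> ev f (y / pe ^+ N).
Proof. by move=> h e n; exists N, b, y; split=> // i; rewrite e. Qed.

Lemma eva_const c : W c -> eva (robba_monomial c 0) (iB c).
Proof.
move=> hc; split; last by apply: Adag_Rp; exact: Rp_QpBt.
rewrite -[iB c]divr1 -(expr0 pe); apply: (ev_lz (PS_C hc)) => i.
by rewrite /lz addr0 /=; case: i.
Qed.

Lemma eva_1 : eva 1 1.
Proof.
have h1 : W (1 : K) by rewrite pnorm1.
by have := eva_const h1; rewrite rmorph1.
Qed.

Lemma eva_X : eva robbaX pe.
Proof.
have h1 : W (1 : K) by rewrite pnorm1.
split; last by apply: Adag_Rp; exact: Rp_pe.
rewrite -[pe]divr1; apply: (@ev_lz _ 0 (fun k => if k is k'.+1 then if k' == 0 then 1 else 0 else 0)).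
 by rewrite -[X in PS _ X]mulr1 -(rmorph1 iB); apply: PS_shift => //; exact: PS_C.
by move=> i; rewrite /lz addr0 /=; case: i => // -[|[|k]].
Qed.

Lemma eva_XV : eva (robba_monomial 1 (-1)) pe^-1.
Proof.
have h1 : W (1 : K) by rewrite pnorm1.
split => //.
rewrite -div1r -[X in _ / X]expr1 -(rmorph1 iB); apply: (ev_lz (PS_C h1)) => i /=.
rewrite /lz; case: i => [k|[|k]] //=.
by rewrite addn1.
Qed.

Lemma eva_exp f x n : eva f x -> eva (f ^+ n) (x ^+ n).
Proof.
by move=> h; elim: n => [|n IH]; rewrite ?expr0 ?exprS; [exact: eva_1|exact: eva_M].
Qed.

Lemma bernoulli (t : R) n : 0 <= t <= 1 -> 1 - n%:R * t <= (1 - t) ^+ n.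
Proof.
move=> /andP[t0 t1]; elim: n => [|n IH]; first by lra.
rewrite exprS; apply: (@le_trans _ _ ((1 - t) * (1 - n%:R * t))); last first.
 by rewrite ler_wpM2l // subr_ge0.
rewrite -subr_ge0 -natr1; set u := n%:R.
have -> : (1 - t) * (1 - u * t) - (1 - (u + 1) * t) = u * t ^+ 2 by ring.
by rewrite mulr_ge0 ?exprn_ge0.
Qed.

Lemma decay_robba a k : (0 < k)%N -> (forall i, W (a i)) ->
 (forall q j : nat, (k * q <= j)%N -> `|a (- j%:Z)| <= p%:R ^- q) -> is_robba a.
Proof.
move=> k0 ha hd; have kr : 0 < k%:R :> R by rewrite ltr0n.
(* The radius r = 1 - t satisfies r^k >= 1 - k t = 1/p by Bernoulli's inequality, so p^(-1) rho^(-k)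
   < 1 for rho > r, and the principal part converges there. *)
pose t : R := (1 - p%:R^-1) / k%:R; pose r := 1 - t.
have t0 : 0 < t by rewrite divr_gt0 // subr_gt0 pinv_lt1.
have t1 : t <= 1.
 rewrite ler_pdivrMr // mul1r; apply: (@le_trans _ _ 1); last by rewrite ler1n.
 by rewrite lerBlDr lerDl pinv_ge0.
exists r; first by rewrite subr_ge0 t1 gtrBl.
move=> rho /andP[r1 r2] e e0.
have r0 : 0 <= r by rewrite subr_ge0.
have rho0 : 0 < rho by lra.
have hl : p%:R^-1 * (rho^-1) ^+ k < 1.
 rewrite exprVn ltr_pdivrMr ?exprn_gt0 // mul1r.
 apply: (@le_lt_trans _ _ (r ^+ k)); last by rewrite ltrXn2r -?lt0n.
 apply: le_trans (bernoulli k _); last by rewrite ltW.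
 by rewrite /t mulrC divfK ?gt_eqF // opprB addrC subrK.
set l := _ * _ in hl.
have l0 : 0 <= l by rewrite mulr_ge0 // exprn_ge0 // invr_ge0 ltW.
have rk0 : 0 < (rho^-1) ^+ k by rewrite exprn_gt0 // invr_gt0.
have [M1 h1] := pow_small (ltW rho0) r2 e0.
have [M2 h2] := pow_small l0 hl (divr_gt0 e0 rk0).
exists (maxn M1 (k * M2)) => i; rewrite geq_max => /andP[l1 l2].
have [[j ei]|[j ei]] : (exists j : nat, i = j%:Z) \/ (exists j : nat, i = - j%:Z).
- by case: i {l1 l2} => j; [left; exists j|right; exists j.+1; rewrite NegzE].
- rewrite {}ei in l1 *; rewrite -exprnP; apply: (@le_trans _ _ (1 * rho ^+ j)).
  by rewrite ler_wpM2r // exprn_ge0 // ltW.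
 by rewrite mul1r ltW // h1.
rewrite {}ei abszN absz_nat in l2 *.
pose qt := (j %/ k)%N.
have jq : (k * qt <= j)%N by rewrite mulnC leq_divM.
have M2q : (M2 <= qt)%N by rewrite leq_divRL // mulnC.
have rr : 1 <= rho^-1 by rewrite invf_ge1 // ltW.
apply: (@le_trans _ _ (p%:R ^- qt * (rho^-1) ^+ (k * qt.+1))).
 apply: ler_pM; rewrite ?pnorm_ge0 ?exprz_ge0 ?(ltW rho0) //; first by clo.
 rewrite -exprnN -exprVn; apply: ler_weXn2l => //.
 by rewrite mulnC ltnW // ltn_ceil.
rewrite mulnS exprD exprM mulrCA -exprVn -exprMn -/l mulrC -ler_pdivlMr //.
by apply: ltW; exact: h2.
Qed.

(** Iterating [G_digit] writes pi^N x as the sum of (p / pi^k)^j z_j with power series z_j. The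
    coefficients converge p-adically and decay at -oo in the way that [decay_robba] asks for. *)
Lemma Adag_ev x : Adag x -> exists f, eva f x.
Proof.
(* The decay criterion needs a positive k, whence the successor. *)
move=> hx; have [N [k0 h0]] := hx; set k := k0.+1.
have {}h0 : G k (pe ^+ N * x) by exact: (G_mono (leqnSn k0) h0).
suff [f hf] : exists f, ev f (pe ^+ N * x).
 exists (robba_monomial 1 (-1) ^+ N * f); split=> //.
 have -> : x = pe^-1 ^+ N * (pe ^+ N * x) by rewrite mulrA -exprMn mulVf // expr1n mul1r.
 have [h1 _] := eva_exp N eva_XV.
 apply: ev_M => //; first by clo.
 exact: (G_le1 h0).
move: (pe ^+ N * x) h0 => {hx}x h0.
have /choice[d hd] (y : {y | G k y}) : exists v : {y | G k y} * (nat -> K) * B,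
  PS v.1.2 v.2 /\ sval y = v.2 + pe_s k * sval v.1.1.
 case: y => y Py /=; have [z [w [[b hb] h2 e]]] := G_digit Py.
 by exists (exist _ w h2, b, z).
pose xs i := iter i (fun v => (d v).1.1) (exist _ x h0).
pose be i := (d (xs i)).1.2; pose z i := (d (xs i)).2.
have hb i : PS (be i) (z i) by exact: (hd (xs i)).1.
pose A n (i : int) := \sum_(j < n) p%:R ^+ j * lz (k * j) (be j) i.
pose X n := \sum_(j < n) pe_s k ^+ j * z j.
have npX j : W (p%:R ^+ j : K) by clo.
have hA n : LE (A n) (X n).
 elim: n => [|n IH].
  have h00 : W (0 : K) by rewrite pnorm0.
  have : LE (lz 0 (fun k => if k == 0 then 0 else 0)) (iB 0 / pe ^+ 0) by apply: LE_lz; exact: PS_C.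
  rewrite rmorph0 mul0r.
  have -> : lz 0 (fun k1 => if k1 == 0 then 0 else 0) = A 0.
   by apply/funext => i; rewrite /lz /A big_ord0; case: (i + _) => // j; case: ifP.
  by rewrite /X big_ord0.
 have -> : A n.+1 = fun i => A n i + p%:R ^+ n * lz (k * n) (be n) i.
  by apply/funext => i; rewrite /A big_ord_recr.
 rewrite /X big_ord_recr /=; apply: LE_D => //.
 have -> : pe_s k ^+ n * z n = iB (p%:R ^+ n) * (z n / pe ^+ (k * n)).
  by rewrite /pe_s expr_div_n -exprM rmorphXn rmorph_nat mulrAC mulrA.
 by apply: LE_Z => //; exact: LE_lz.
have cX n : cong n x (X n).
 have -> : x = X n + pe_s k ^+ n * sval (xs n).
  elim: n => [|n IH]; first by rewrite /X big_ord0 add0r mul1r.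
  by rewrite {1}IH /X big_ord_recr /= {1}(hd (xs n)).2 -/(z n) exprSr; ring.
 rewrite /cong addrAC subrr add0r; apply: pnormMr_le.
  by have := svalP (xs n); exact: (G_le1).
 by rewrite pnormX pe_s_norm // exprVn.
have cA n i : cong n (A n.+1 i) (A n i).
 rewrite /A big_ord_recr /= /cong addrAC subrr add0r; apply: pnormMr_le.
  by rewrite /lz; case: (i + _) => j; [exact: (hb n).1|rewrite pnorm0 ler01].
 by rewrite pnorm_pow.
have [a ha] := choice (fun i => padic_lim (cA^~ i)).
have hLE : LE a x.
 by apply: LE_lim => n; exists (A n), (X n); split=> // i; exact: (ha i).2.
have nx := G_le1 h0.
have ra : is_robba a.
 apply: (@decay_robba _ k) => // [i|qt j hj].
  by have := LE_norm (n := 0) hLE; rewrite ppow0; apply.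
 apply/cong0P; apply: congT ((ha _).2 qt) _.
 rewrite /A big1 => [|m _] //.
 rewrite lz_neg ?mulr0 //; have mq := ltn_ord m.
 have : (k * m < j)%N by apply: leq_trans hj; rewrite ltn_pmul2l.
 by lia.
by exists (Robba (introT (asboolP _) ra)).
Qed.

(** The coefficients a are those of the element of the Robba ring with value x, so the default value
    of [laurent] is not reached. *)
Lemma laurent_eva a x : LE a x -> Adag x -> eva (laurent a) x.
Proof.
move=> h hx; split=> //; have [f [hf _]] := Adag_ev hx.
have e := LE_inj h hf.
have -> : laurent a = f => //.
apply: val_inj; rewrite val_insubd e /=.
by have := valP f => /= ->.
Qed.

Lemma eva_unit f x : eva f x -> x != 0 -> Adag x^-1 -> f \is a GRing.unit /\ eva f^-1 x^-1.
Proof.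
move=> hf x0 /Adag_ev[g hg].
have e : g * f = 1.
 by apply: (eva_inj (eva_M hg hf)); rewrite mulVf //; exact: eva_1.
have uf : f \is a GRing.unit by apply/unitrP; exists g; rewrite e mulrC.
split=> //; have -> : f^-1 = g => //.
by apply: (mulIr uf); rewrite mulVr // e.
Qed.

Lemma eva_expz f x (n : int) : eva f x -> x != 0 -> Adag x^-1 -> eva (f ^ n) (x ^ n).
Proof.
move=> hf x0 hV; case: n => n; first exact: eva_exp.
rewrite !NegzE -!exprnN -!exprVn; apply: eva_exp.
by case: (eva_unit hf x0 hV).
Qed.

Lemma eva_div f x g y : eva f x -> eva g y -> y != 0 -> Adag y^-1 -> eva (f / g) (x / y).
Proof. by move=> hf hg y0 hV; apply: eva_M => //; case: (eva_unit hg y0 hV). Qed.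

Lemma ev_low f k w : ev f (pe ^+ k * w) -> Wp w -> forall i : int, i < k%:Z -> f i = 0.
Proof.
move=> hf hw i ik; apply: cong_eq => n; have [N [b [y [h1 h2 h3]]]] := hf n.
apply: congT (h2 i) _; apply/cong0P.
case E : (i + N%:Z) => [m|m]; last by rewrite lz_neg ?E // pnorm0.
rewrite (lz_pos _ E); apply: (PS_low h1 (k := k + N) (w := w)) => //; last by lia.
have nN : W (pe ^+ N) by clo.
have := congMl nN (congS h3); rewrite mulrC divfK ?peX_neq0 //.
by rewrite exprD mulrA [pe ^+ N * _]mulrC.
Qed.

Lemma robba_monE c f i : (robba_monomial c 0 * f) i = c * f i.
Proof.
rewrite /= /robba_mul_coef (@zsum_single _ _ _ _ 0) /= ?eqxx ?subr0 //.
by move=> k /negPf k0; rewrite k0 mul0r.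
Qed.

Lemma robba_sumE (I : Type) (r : seq I) (F : I -> robba K) i :
 (\sum_(j <- r) F j) i = \sum_(j <- r) F j i.
Proof.
elim/big_rec2: _ => [|j u v _ <-] //=.
by case: eqP.
Qed.

Section Comp.
Context (h : {rmorphism B -> B}) (hh : pe_endo h) (q : robba K) (hq : ev q (h pe)).

Lemma endo_Adag : Adag (h pe) /\ Adag (h pe)^-1.
Proof.
have hR : Rp (h pe) by apply: Rp_endo => //; exact: Rp_pe.
split; first by clo.
by apply: Rp_Adag_inv => //; case: hh => hn _ _; rewrite hn pe_norm.
Qed.

Lemma endo_neq0 : h pe != 0.
Proof. by rewrite fmorph_eq0 pe_neq0. Qed.
Lemma eva_qz (k : int) : eva (q ^ k) (h pe ^ k).
Proof. by have [h1 h2] := endo_Adag; apply: eva_expz => //; exact: endo_neq0. Qed.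

(** Substituting q for X corresponds to applying the endomorphism h that sends pi to the value of q.
    Modulo p^n and for one coefficient at a time, the substitution reduces to a finite Laurent sum,
    whose value is known. *)
Lemma comp_eva f x : eva f x -> eva (robba_comp f q) (h x).
Proof.
move=> [hf ax]; have [hn hW [v hv evp]] := hh.
have ahx : Adag (h x) by exact: Adag_endo.
apply: laurent_eva => //.
have nx := Adag_le1 ax.
have f1 k : W (f k) by exact: ev_le1 hf nx.
have qk1 k i : W ((q ^ k : robba K) i).
 by have [e1 e2] := eva_qz k; apply: (ev_le1 _ e1); exact: Adag_le1.
have low (k : nat) (i : int) : i < k%:Z -> (q ^ k%:Z : robba K) i = 0.
 move=> ik; have [e1 _] := eva_qz k%:Z; apply: (ev_low (k := k) (w := v ^+ k)) => //.
  by rewrite -exprMn -evp.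
 by apply: WpX; exact: Rp_Wp hv.
have sm i : Defs.summable (fun k => f k * (q ^ k : robba K) i).
 move=> e e0; have [n hN] := ppow_small e0; have [N [b [y [h1 h2 h3]]]] := hf n.
 exists (N + `|i|).+1 => k hk; apply: le_trans (ltW hN).
 case: k hk => k hk.
  by rewrite low ?mulr0 ?pnorm0 ?ppow_ge0 //; lia.
 apply: pnormMr_le => //; have := h2 (Negz k); rewrite lz_neg; last by lia.
 by move/cong0P.
apply: LE_lim => n; have [N [b [y [h1 h2 h3]]]] := hf n.
have ay : Adag (h (y / pe ^+ N)).
 apply: Adag_endo => //; apply: Adag_M; first by apply: Adag_Rp; exists b.
 rewrite -exprVn; apply: Adag_X.
 exact: Adag_peV.
have [D [hD _]] := Adag_ev ay.
exists D, (h (y / pe ^+ N)); split=> //; last by rewrite /cong -rmorphB hn.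
move=> i.
(* With a pole of order at most N modulo p^n, the terms left out are those with k > |i|, and the
   i-th coefficient of q^k vanishes for them. *)
pose L := (`|i|.+1 + N)%N.
pose E : robba K := \sum_(m <- iota 0 L) robba_monomial (b m) 0 * q ^ (m%:Z - N%:Z).
pose s := [seq m%:Z - N%:Z | m <- iota 0 L].
have us : uniq s by rewrite map_inj_uniq ?iota_uniq // => j j' /= ?; lia.
apply: (@congT _ _ _ (E i)).
 apply: (@congT _ _ _ (\sum_(k <- s) f k * (q ^ k : robba K) i)).
  apply: zsum_approx => //.
  move=> k ks; have [kN|kN] := ltP (k + N%:Z) 0.
   by apply: pnormMr_le => //; have := h2 k; rewrite lz_neg // => /cong0P.
  have [ki|ki] := ltP i k; last first.
   case/negP: ks; apply/mapP; exists (absz (k + N%:Z)); last by lia.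
   by rewrite mem_iota /L; lia.
  have [k'|k'] := leP 0 k; last first.
   case/negP: ks; apply/mapP; exists (absz (k + N%:Z)); last by lia.
   by rewrite mem_iota /L; lia.
  have ek : k = `|k|%N%:Z by lia.
  by rewrite ek low ?mulr0 ?pnorm0 ?ppow_ge0 //; lia.
 rewrite robba_sumE big_map; apply: cong_sum => m _ _.
 rewrite robba_monE mulrC [X in cong _ _ X]mulrC; apply: congMl => //.
 by rewrite -(@lz_pos N b (m%:Z - N%:Z) m) ?subrK.
suff -> : E i = D i by exact: congxx.
have evE : ev E (\sum_(m <- iota 0 L) iB (b m) * h pe ^ (m%:Z - N%:Z)).
 rewrite /E; elim/big_ind2: _ => [|? ? ? ? e1 e2|m _]; last 2 first.
 - exact: ev_D.
 - by have [] := eva_M (eva_const (h1.1 m)) (eva_qz (m%:Z - N%:Z)).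
 have h00 : W (0 : K) by rewrite pnorm0.
 have [] := eva_const h00; rewrite rmorph0 //.
have [z hz ez] := h1.2 L.
have e : h (y / pe ^+ N) - \sum_(m <- iota 0 L) iB (b m) * h pe ^ (m%:Z - N%:Z)
  = h pe ^ (L%:Z - N%:Z) * h z.
 have hN : h pe ^ (- N%:Z) = (h pe ^+ N)^-1 by rewrite -exprnN.
 have hm (m : nat) : h pe ^ (m%:Z - N%:Z) = h pe ^+ m / h pe ^+ N.
  by rewrite expfzDr ?endo_neq0 // hN.
 rewrite rmorphM fmorphV rmorphXn {1}ez rmorphD rmorph_sum rmorphM rmorphXn hm.
 rewrite -/(index_iota 0 L) big_mkord.
 have -> : \sum_(i0 < L) iB (b i0) * h pe ^ (i0%:Z - N%:Z) =
   (\sum_(i0 < L) h (iB (b i0) * pe ^+ i0)) / h pe ^+ N.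
  rewrite mulr_suml; apply: eq_bigr => m _.
  by rewrite hm rmorphM rmorphXn isom_QpBt // mulrA.
 by rewrite mulrDl addrAC subrr add0r mulrAC.
have evD := ev_B hD evE; rewrite e in evD.
apply/esym/eqP; rewrite -subr_eq0; apply/eqP.
have -> : D i - E i = (D - E) i by [].
have eL : L%:Z - N%:Z = `|i|.+1%:Z by rewrite PoszD addrK.
rewrite eL -exprnP evp exprMn -mulrA in evD.
apply: (ev_low evD); last by lia.
apply: WpM; last by clo.
by apply: WpX; exact: Rp_Wp hv.
Qed.

End Comp.
End Evaluation.
#[local] Hint Resolve eva_1 eva_X : core.
#[local] Hint Resolve eva_D eva_N eva_B eva_M eva_exp eva_const : closed.

(** * Values at pi of phi, Gamma, Q, Q2, f_gamma and g_gamma *)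

Section PhiGammaEval.
Implicit Types (x y z : B) (b : nat -> K) (f : robba K).

Lemma gbinom_QpBt (u : K) k : gbinom (iB u) k = iB (gbinom u k).
Proof.
rewrite rmorphM fmorphV rmorph_nat rmorph_prod; congr (_ / _).
by apply: eq_bigr => i _; rewrite rmorphB rmorph_nat.
Qed.

Lemma eva_0 : eva 0 0.
Proof.
have h : eva (1 - 1) (1 - 1) by clo.
by rewrite !subrr in h.
Qed.

(** The partial sums of the binomial series are elements of the Robba ring with known values, and
    both sides are within p^(-M) of the M-th one. *)
Lemma robba_pow_eva f x (u : K) : eva f x -> near1 x -> W u ->
 Adag (zpow x (iB u)) -> eva (robba_pow f u) (zpow x (iB u)).
Proof.
move=> hf nx hu ha; apply: laurent_eva => //.
have zu := Qp_zint hu.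
have hk k : eva ((f - 1) ^+ k) ((x - 1) ^+ k).
 by apply: eva_exp => //; apply: eva_B => //; exact: eva_1.
pose P M : robba K := \sum_(k < M) robba_monomial (gbinom u k) 0 * (f - 1) ^+ k.
pose X M := \sum_(k < M) iB (gbinom u k) * (x - 1) ^+ k.
have g1 k : W (gbinom u k) by exact: gbinom_le1.
have hP M : eva (P M) (X M).
 rewrite /P /X; elim: M => [|M IH]; last first.
  rewrite !big_ord_recr /=; apply: eva_D => //; apply: eva_M => //; exact: eva_const.
 rewrite !big_ord0 -(subrr (1 : robba K)) -(subrr (1 : B)).
 by apply: eva_B => //; exact: eva_1.
apply: LE_lim => M; exists (P M), (X M); split; [exact: (hP M).1| |].
 move=> i; have [|l [tl cl]] := @padic_series _ (fun k => gbinom u k * ((f - 1) ^+ k : robba K) i).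
  move=> k; apply: pnormMl_le => //; apply: (LE_norm (hk k).1).
  rewrite pnormX -exprVn; apply: lerXn2r; rewrite ?nnegrE ?pnorm_ge0 //.
 rewrite (ulimP tl) robba_sumE; apply: congT (cl M) _.
 by under [X in cong _ _ X]eq_bigr => k _ do rewrite robba_monE; exact: congxx.
have : cong M (zpow x (iB u)) (\sum_(k < M) gbinom (iB u) k * (x - 1) ^+ k).
 by apply: zpow_partial => //; exact: zint_QpBt.
by under eq_bigr => k _ do rewrite gbinom_QpBt.
Qed.

Lemma LE0_PS b y : PS b y -> LE (fun i => if i is Posz k then b k else 0) y.
Proof.
move=> h; rewrite -[y]divr1 -(expr0 pe).
by rewrite (_ : (fun i : int => _) = lz 0 b) ; [exact: LE_lz|by apply/funext => i; rewrite /lz addr0].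
Qed.

Lemma eva_phi f x : eva f x -> eva (phi f) (fr x).
Proof.
apply: comp_eva => //; first exact: pe_endo_frob.
rewrite frob_pe; suff h : eva ((1 + robbaX) ^+ p - 1) ((1 + pe) ^+ p - 1) by case: h.
apply: eva_B => //.
by apply: eva_exp; exact: eva_D.
Qed.

Lemma eva_gam (g : galois S) (c : K) f x : is_cyclo eps g c -> eva f x -> eva (gam c f) (galB g x).
Proof.
move=> gc; apply: comp_eva => //; first exact: (pe_endo_gal gc).
rewrite gal_pe; suff h : eva (onePlusX_pow c - 1) (teich (gt g eps) - 1) by case: h.
apply: eva_B => //.
have h := gal_eps_PS gc.
by apply: laurent_eva => //; [exact: LE0_PS|apply: Adag_Rp; exists (gbinom c)].
Qed.

Lemma robba_comp_const (c : K) q : robba_comp (robba_monomial c 0) q = robba_monomial c 0.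
Proof.
apply: val_inj; rewrite val_insubd.
have -> : (fun n => zsum (fun k => (robba_monomial c 0 : robba K) k * (q ^ k : robba K) n))
  = robba_monomial c 0.
 apply/funext => n; rewrite (@zsum_single _ _ _ _ 0) /=; last first.
  by move=> k /negPf ->; rewrite mul0r.
 by case: eqP; rewrite ?mulr1 ?mulr0.
by have := valP (robba_monomial c 0 : robba K) => /= ->.
Qed.

(** Substitution of any q fixes constants, since only the term k = 0 contributes; the identity
    matrix is thus fixed also where [gam c] has no meaning. *)
Lemma pg_iso_refl n (D : pgmod K n) : pg_iso D D.
Proof.
have h q : map_mx (fun f => robba_comp f q) (1%:M : 'M[robba K]_n) = 1%:M.
 apply/matrixP => i j; rewrite !mxE; case: (i == j); exact: robba_comp_const.
by exists 1%:M; split=> [||c _]; rewrite ?unitmx1 // mul1mx h mulmx1.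
Qed.

Lemma mem_zrange (M : nat) (k : int) : (k \in zrange M) = (- M%:Z <= k < M%:Z).
Proof.
rewrite mem_cat; case: k => k.
- rewrite mem_map ?mem_iota; last by move=> ? ? [].
 rewrite add0n /=; have -> : (Posz k \in [seq Negz i | i <- iota 0 M]) = false.
  by apply/mapP => -[].
 by rewrite orbF; lia.
have -> : (Negz k \in [seq Posz i | i <- iota 0 M]) = false by apply/mapP => -[].
by rewrite mem_map ?mem_iota ?add0n /=; [lia|move=> ? ? []].
Qed.

Definition eQ : B := fr pe / pe.
Definition eQ2 : B := fr eQ.

Lemma eva_rQ : eva rQ eQ.
Proof.
by apply: eva_div => //; exact: eva_phi.
Qed.

Lemma eva_rQ2 : eva rQ2 eQ2.
Proof. by apply: eva_phi; exact: eva_rQ. Qed.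

Lemma eQ_PS : Rp eQ.
Proof.
have [_ _ [v hv e]] := pe_endo_frob.
by rewrite /eQ e mulrAC divff ?mul1r // pe_neq0.
Qed.

Lemma Rp_fr x : Rp x -> Rp (fr x).
Proof. by apply: Rp_endo => //; exact: pe_endo_frob. Qed.

Lemma eQ_const : exists2 r, Rp r & eQ = p%:R + pe * r.
Proof.
pose proof (PS_binom p) as h0; have [y1 h1 e1] := PS_tail h0.
have [y2 h2 e2] := PS_tail h1; exists y2; first by exists (fun k => 'C(p, k.+2)%:R).
rewrite /eQ frob_pe e1 bin0 rmorph1 addrAC subrr add0r mulrAC divff // mul1r.
by rewrite e2 bin1 rmorph_nat.
Qed.

Lemma eQ_norm : `|eQ| = 1.
Proof. by rewrite pnormM pnormV frob_norm pe_norm // mul1r invr1. Qed.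
Lemma eQ2_norm : `|eQ2| = 1.
Proof. by rewrite frob_norm eQ_norm. Qed.
Lemma Adag_unit x : Rp x -> `|x| = 1 -> Adag x /\ Adag x^-1.
Proof. by move=> h1 h2; split; [exact: Adag_Rp|exact: Rp_Adag_inv]. Qed.

Definition eQr : B := eQ2 / eQ ^+ p.

Lemma eQr_Adag : Adag eQr /\ Adag eQr^-1.
Proof.
have [h1 h2] := Adag_unit eQ_PS eQ_norm.
have [h3 h4] := Adag_unit (Rp_fr eQ_PS) eQ2_norm.
split; first by apply: Adag_M => //; rewrite -exprVn; exact: Adag_X.
by rewrite /eQr invf_div; apply: Adag_M => //; exact: Adag_X.
Qed.

Lemma eva_rQr : eva (rQ2 / rQ ^+ p) eQr.
Proof.
have [h1 h2] := Adag_unit eQ_PS eQ_norm.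
apply: eva_div => //; first exact: eva_rQ2.
- by apply: eva_exp => //; exact: eva_rQ.
- by rewrite expf_neq0 ?norm1N0 ?eQ_norm.
- by rewrite -exprVn; exact: Adag_X.
Qed.

Lemma frob_cong x : W x -> cong 1 (fr x) (x ^+ p).
Proof.
move=> nx; apply/res_cong; rewrite ?frob_norm ?W_X //.
by rewrite frob_res // resX.
Qed.

Lemma near1_div x y : `|y| = 1 -> cong 1 x y -> near1 (x / y).
Proof.
move=> ny h; have y0 := norm1N0 ny.
by rewrite -[X in _ - X](divff y0) -mulrBl pnormM pnormV ny invr1 mulr1 -ppow1.
Qed.

(** Q2 = phi(Q) is congruent to Q^p modulo p, which is why the quotient by Q^p can be raised to the
    power u. *)
Lemma eQr_near1 : near1 eQr.
Proof.
apply: near1_div; first by rewrite pnormX eQ_norm expr1n.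
by apply: frob_cong; rewrite eQ_norm.
Qed.

(** Writing the solution as 1 + p^n pi y turns the multiplicative equation into a linear one for y,
    namely w phi^2(y) - A y = r with phi^2(pi) = pi w, to which successive approximation applies. *)
Lemma frob2_solve (A : B) n r : A = 1 + p%:R ^+ n * (pe * r) -> Rp r ->
 exists2 y, Rp y & fr (fr (1 + p%:R ^+ n * (pe * y))) = A * (1 + p%:R ^+ n * (pe * y)).
Proof.
move=> eA hr; set P := p%:R ^+ n in eA *.
have hA : Rp A.
 rewrite eA; apply: RpD => //.
 by apply: RpM => //; [rewrite /P -natrX; exact: Rp_nat|exact: Rp_peM].
have frP : fr P = P by rewrite rmorphXn rmorph_nat.
pose w := eQ * fr eQ.
have hw : fr2 pe = pe * w.
 have e2 : fr pe = pe * eQ by rewrite mulrCA divff ?mulr1 // pe_neq0.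
 by rewrite e2 rmorphM e2 /w mulrA.
have Rw : Rp w by apply: RpM => //; [exact: eQ_PS|apply: Rp_fr; exact: eQ_PS].
have wc : exists2 r', Rp r' & w = iB (p ^ 2)%:R + pe * r'.
 have [s hs es] := eQ_const; exists (s * fr eQ + p%:R * (eQ * fr s)).
  have hQ := eQ_PS; have hfs := Rp_fr hs; have hfQ := Rp_fr hQ; pose proof (Rp_nat p) as hn.
  by apply: RpD; apply: RpM => //; apply: RpM.
 rewrite rmorph_nat natrX; set q := (p%:R : B).
 have e1 : fr eQ = q + fr pe * fr s by rewrite es rmorphD rmorph_nat rmorphM.
 have e2 : fr pe = pe * eQ by rewrite mulrCA divff ?mulr1 // pe_neq0.
 rewrite /w; have -> : eQ * fr eQ = (q + pe * s) * fr eQ by rewrite -es.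
 rewrite mulrDl {1}e1 e2; ring.
pose F y := w * fr2 y - A * y.
(* The constant term of w is p^2, so this operator multiplies pi^N by p^(2(N+1)) - 1, a unit, modulo
   higher powers of pi. *)
have [||||y hy ey] := @Rp_solve F (fun N => (p ^ (2 * N.+1))%:R - 1) _ _ _ _ r hr.
- by move=> x y; rewrite /F !rmorphD !mulrDr opprD addrACA.
- by move=> a x; rewrite /F !rmorphM !isom_QpBt ?frob_norm //; [ring|exact: frob_norm..].
- move=> N y hy; exists (w ^+ N.+1 * fr2 y - A * y).
  apply: WpB; apply: WpM => //; try by apply: Rp_Wp; eassumption.
   by apply: WpX; apply: Rp_Wp; eassumption.
  by do 2!apply: Wp_frob.
 by rewrite /F !rmorphM !rmorphXn hw exprMn exprS; ring.
- move=> N; split.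
  rewrite -pnormN opprB; have : `|((p ^ (2 * N.+1))%:R : K)| < `|(1 : K)|.
   by rewrite pnorm1 natrX pnorm_pow mulnS; exact: ppow_lt1.
  by rewrite -pnormN => /pnorm_dom; rewrite pnorm1 addrC.
 have [r' hr' ew] := wc.
 have [r2 hr2 e2] : exists2 r2, Rp r2 & w ^+ N.+1 = iB (p ^ (2 * N.+1))%:R + pe * r2.
  elim: N => [|N [r2 hr2 e2]] => //; rewrite ?expr1 ?muln1.
  exists (r2 * w + iB (p ^ (2 * N.+1))%:R * r').
   by apply: RpD; apply: RpM => //; rewrite rmorph_nat; exact: Rp_nat.
  have -> : (2 * N.+2 = 2 * N.+1 + 2)%N by lia.
  by rewrite exprSr e2 mulrDl {1}ew expnD natrM rmorphM; ring.
 exists (r2 - P * r).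
  by apply: RpB => //; apply: RpM => //; rewrite /P -natrX; exact: Rp_nat.
 rewrite /F !(rmorphXn fr) hw exprMn rmorphB rmorph1 eA.
 have -> : w * (pe ^+ N * w ^+ N) = pe ^+ N * w ^+ N.+1 by rewrite exprS; ring.
 by rewrite e2; ring.
exists y => //; rewrite !rmorphD !rmorphM !rmorph1 !frP hw.

have e3 : P * (pe * w * fr2 y) = P * pe * (A * y + r) by rewrite -ey /F; ring.
by rewrite e3 eA; ring.
Qed.

Section Gamma.
Context (g : galois S) (c : K) (gc : is_cyclo eps g c).
Local Notation gB := (galB g).

Definition egs : B := gB pe / pe.

Lemma egs_const : Rp egs /\ exists2 r, Rp r & egs = iB c + pe * r.
Proof.
have [v hv e] := gal_pe_PS gc.
have -> : egs = v by rewrite /egs e mulrAC divff ?mul1r // pe_neq0.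
split; first by exists (fun k => gbinom c k.+1).
have [y hy ->] := PS_tail hv; exists y; first by exists (fun k => gbinom c k.+2).
by rewrite /gbinom big_ord1 subr0 divr1.
Qed.

Lemma egs_norm : `|egs| = 1.
Proof. by rewrite pnormM pnormV galB_norm pe_norm // mul1r invr1. Qed.

Lemma gal_eQ : gB eQ = eQ * (fr egs / egs).
Proof.
rewrite /eQ /egs !rmorphM !fmorphV /= frob_gal.
by field; rewrite !fmorph_eq0 pe_neq0.
Qed.

Lemma gal_eQ2 : gB eQ2 = eQ2 * (fr2 egs / fr egs).
Proof. by rewrite /eQ2 -frob_gal gal_eQ rmorphM; congr (_ * _); exact: fmorph_div. Qed.

Lemma const_unit x y a r r' : x = iB a + pe * r -> y = iB a + pe * r' -> `|a| = 1 ->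
 Rp r -> Rp r' -> exists2 r2, Rp r2 & x / y = 1 + pe * r2.
Proof.
move=> ex ey na hr hr'.
have yV : Rp y^-1 by exact: (Rp_unit ey).
have y0 : y != 0.
 apply/eqP => y0; have /PS_low h : PS (fun k => if k == 0 then a else 0) (iB a) by apply: PS_C; rewrite na.
 have : `|a| <= p%:R ^- 1.
  apply: (h 1%N 1%N (- r') _ _ 0%N) => //; first by apply: WpN; exact: (Rp_Wp hr').
  rewrite expr1 mulrN; have -> : iB a = - (pe * r') by apply/eqP; rewrite -addr_eq0 -ey y0.
  exact: congxx.
 by rewrite na ppow1 leNgt pinv_lt1.
exists ((r - r') * y^-1); first by apply: RpM => //; exact: RpB.
have -> : x = y + pe * (r - r') by rewrite ex ey; ring.
by rewrite mulrDl divff // mulrA.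
Qed.

Lemma fr_const x a r : Rp r -> x = iB a + pe * r -> exists2 r', Rp r' & fr x = iB a + pe * r'.
Proof.
move=> hr ->; exists (eQ * fr r); first by apply: RpM => //; [exact: eQ_PS|exact: Rp_fr].
rewrite rmorphD rmorphM isom_QpBt; last exact: frob_norm.
by rewrite mulrA /eQ [pe * _]mulrC divfK // pe_neq0.
Qed.

(** With gamma(pi) = pi s, where s is [egs], the elements [eA1] and [eA2] are gamma(Q2)/Q2 and
    gamma(Q2/Q^p)/(Q2/Q^p) expressed through s. *)
Definition eA1 : B := fr2 egs / fr egs.
Definition eA2 : B := eA1 * (egs / fr egs) ^+ p.

Lemma eA1_spec : exists2 r, Rp r & eA1 = 1 + pe * r.
Proof.
have [_ [r hr e]] := egs_const; have [r1 hr1 e1] := fr_const hr e.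
have [r2 hr2 e2] := fr_const hr1 e1.
by apply: (const_unit e2 e1) => //; case: gc.
Qed.

(** The constant terms cancel, so [eA2] is 1 modulo pi; it is 1 modulo p because phi(x) is congruent
    to x^p. For power series the two together give 1 modulo p pi. *)
Lemma eA2_spec : exists2 r, Rp r & eA2 = 1 + p%:R * (pe * r).
Proof.
have [_ [r hr e]] := egs_const; have [r1 hr1 e1] := fr_const hr e.
have [r2 hr2 e2] := eA1_spec; have nc : `|c| = 1 by case: gc.
have [r3 hr3 e3] := const_unit e e1 nc hr hr1.
have [r4 hr4 e4] : exists2 r4, Rp r4 & eA2 = 1 + pe * r4.
 suff h k : exists2 r4, Rp r4 & (1 + pe * r2) * (1 + pe * r3) ^+ k = 1 + pe * r4.
  by rewrite /eA2 e2 e3.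
 elim: k => [|k [r4 hr4 e4]]; first by exists r2; rewrite ?mulr1.
 exists (r4 + r3 + pe * (r3 * r4)).
  by apply: RpD; [exact: RpD|apply: Rp_peM => //; exact: RpM].
 by rewrite exprSr mulrA e4; ring.
have n1 : near1 eA2.
 have h x : `|x| = 1 -> near1 (fr x / x ^+ p).
  move=> nx; apply: near1_div; rewrite ?pnormX ?nx ?expr1n //.
  by apply: frob_cong; rewrite nx.
 have -> : eA2 = (fr2 egs / fr egs ^+ p) * (fr egs / egs ^+ p)^-1.
  rewrite /eA2 /eA1; have x0 := norm1N0 egs_norm.
  have : fr egs ^+ p != 0 by rewrite expf_neq0 // fmorph_eq0.
  have : egs ^+ p != 0 by rewrite expf_neq0.
  have : fr egs != 0 by rewrite fmorph_eq0.
  move: (fr2 egs) (fr egs) (egs) x0 => a b s x0 h0 h1 h2; rewrite expr_div_n.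
  by field; rewrite h0 h1 h2.
 apply: near1M; last by apply: near1V; apply: h; exact: egs_norm.
 by apply: h; rewrite frob_norm egs_norm.
have nr : `|r4| <= p%:R^-1.
 by move: n1; rewrite e4 addrAC subrr add0r pnormM pe_norm // mul1r.
have [r5 hr5 e5] := Rp_div (n := 1) hr4 (nr : `|r4| <= p%:R ^- 1).
by exists r5 => //; rewrite e4 e5 expr1; ring.
Qed.

Lemma eva_onePlus n y : Rp y -> exists f, [/\ eva f (1 + p%:R ^+ n * (pe * y)), one_plus_pX n f
 & eva f^-1 (1 + p%:R ^+ n * (pe * y))^-1].
Proof.
move=> hy; set x := 1 + _.
have [b hb] := hy.
have np : W (p%:R ^+ n : K) by clo.
have n1 : W (1 : K) by rewrite pnorm1.
have hx : PS (fun k => (if k == 0 then 1 else 0) + (if k is k'.+1 then p%:R ^+ n * b k' else 0)) x.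
 rewrite /x; have -> : 1 + p%:R ^+ n * (pe * y) = iB 1 + pe * (iB (p%:R ^+ n) * y).
  by rewrite rmorph1 rmorphXn rmorph_nat; ring.
 apply: PS_D => //; first exact: PS_C.
 by apply: PS_shift => //; apply: PS_Z.
have Rx : Rp x by eexists; exact: hx.
have RxV : Rp x^-1.
 apply: (@Rp_unit _ 1 (p%:R ^+ n * y)); rewrite ?pnorm1 //.
  by rewrite /x rmorph1; ring.
 by apply: RpM => //; rewrite -natrX; exact: Rp_nat.
have [f hf] := Adag_ev (Adag_Rp Rx); exists f.
have x0 : x != 0.
 apply/eqP => x0; move: hx; rewrite x0 => /LE0_PS h0.
 pose proof (LE_inj h0 eva_0.1) as e0.
 have := congr1 (fun F : int -> K => F 0) e0.
 by rewrite /= addr0 => /eqP; rewrite oner_eq0.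
split=> //; last by case: (eva_unit hf x0) => //; exact: Adag_Rp.
have fE i := congr1 (fun F : int -> K => F i) (LE_inj hf.1 (LE0_PS hx)).
move=> i; split; [|split].
- by rewrite fE; case: i.
- by move=> ->; rewrite fE /= addr0.
- rewrite fE; case: i => // -[|k] //= _; rewrite add0r pnormM pnorm_pow ler_piMr ?ppow_ge0 //.
 exact: hb.1.
Qed.

Lemma onePlus_eva n f : one_plus_pX n f -> exists2 y, Rp y & eva f (1 + p%:R ^+ n * (pe * y)) /\
 eva f^-1 (1 + p%:R ^+ n * (pe * y))^-1.
Proof.
move=> hf; pose b k := f (k.+1%:Z) / p%:R ^+ n.
have hb k : W (b k).
 rewrite pnormM pnormV pnorm_pow invrK; have [_ [_ /(_ isT)]] := hf k.+1%:Z.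
 by rewrite -ler_pdivlMr ?exprn_gt0 ?pr_gt0 // mul1r.
have [y hy] := PS_ex hb; have Ry : Rp y by exists b.
exists y => //; have [f' [h1 h2 h3]] := eva_onePlus n Ry.
suff -> : f = f' by [].
have n1 : W (1 : K) by rewrite pnorm1.
have np : W (p%:R ^+ n : K) by clo.
have hx : PS (fun k => (if k == 0 then 1 else 0) + (if k is k'.+1 then p%:R ^+ n * b k' else 0)) (1 + p%:R ^+ n * (pe * y)).
 have -> : 1 + p%:R ^+ n * (pe * y) = iB 1 + pe * (iB (p%:R ^+ n) * y).
  by rewrite rmorph1 rmorphXn rmorph_nat; ring.
 apply: PS_D => //; first exact: PS_C.
 by apply: PS_shift => //; apply: PS_Z.
apply: robba_eqP => i; rewrite (LE_inj h1.1 (LE0_PS hx)).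
have [k1 [k2 _]] := hf i; case: i k1 k2 => [[|k]|k] k1 k2; last by clo.
 by rewrite k2 // addr0.
by rewrite add0r /b mulrC divfK // expf_neq0 // pF_neq0.
Qed.

Lemma gam_div f x : eva f x -> x != 0 -> Adag x^-1 -> eva (gam c f / f) (gB x / x).
Proof. by move=> h1 h2 h3; apply: eva_div => //; exact: eva_gam. Qed.

Lemma onePlus_phi n f y : eva f (1 + p%:R ^+ n * (pe * y)) -> eva f^-1 (1 + p%:R ^+ n * (pe * y))^-1 ->
 eva (phi (phi f) / f) (fr (fr (1 + p%:R ^+ n * (pe * y))) / (1 + p%:R ^+ n * (pe * y))).
Proof. by move=> h1 h2; apply: eva_M => //; do 2!apply: eva_phi. Qed.

Lemma onePlus_neq0 n y : Rp y -> 1 + p%:R ^+ n * (pe * y) != 0.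
Proof.
move=> hy; have [f [h1 h2 h3]] := eva_onePlus n hy; apply/eqP => x0.
have [_ [/(_ erefl) f0 _]] := h2 0; rewrite x0 in h1.
by move: f0; rewrite (eva_inj h1 eva_0) /= => /esym/eqP; rewrite oner_eq0.
Qed.

(** The series f_gamma and g_gamma are defined by choice. Solvability guarantees that the chosen one
    satisfies its equation, and evaluation at pi transfers this equation to W(tilt). *)
Lemma fg_spec n (A : B) q r : A = 1 + p%:R ^+ n * (pe * r) -> Rp r -> eva q A ->
 exists2 y, Rp y & [/\ eva (xget 1 [set f | one_plus_pX n f /\ phi (phi f) / f = q]) (1 + p%:R ^+ n * (pe * y)),
  eva (xget 1 [set f | one_plus_pX n f /\ phi (phi f) / f = q])^-1 (1 + p%:R ^+ n * (pe * y))^-1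
  & fr (fr (1 + p%:R ^+ n * (pe * y))) = A * (1 + p%:R ^+ n * (pe * y))].
Proof.
move=> eA hr hq; have [y hy e] := frob2_solve eA hr.
have [f [h1 h2 h3]] := eva_onePlus n hy.
have : exists f, one_plus_pX n f /\ phi (phi f) / f = q.
 exists f; split=> //; have := onePlus_phi h1 h3; rewrite e mulfK ?onePlus_neq0 // => h.
 exact: (eva_inj h).
move=> /(xgetPex 1); set F := xget _ _ => -[k1 k2].
have [y' hy' [l1 l2]] := onePlus_eva k1; exists y' => //; split=> //.
have := onePlus_phi l1 l2; rewrite k2 => l3.
by rewrite -(LE_uniq l3.1 hq.1) divfK // onePlus_neq0.
Qed.

Lemma f_spec : exists2 y, Rp y & [/\ eva (f_ c) (1 + pe * y), eva (f_ c)^-1 (1 + pe * y)^-1,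
 1 + pe * y != 0 & fr2 (1 + pe * y) = eA1 * (1 + pe * y)].
Proof.
have [r hr e] := eA1_spec.
have [|||y hy] := @fg_spec 0 eA1 (gam c rQ2 / rQ2) r.
- by rewrite expr0 mul1r.
- exact: hr.
- have [h1 h2] := Adag_unit (Rp_fr eQ_PS) eQ2_norm.
 have -> : eA1 = gB eQ2 / eQ2 by rewrite gal_eQ2 mulrAC divff ?mul1r // norm1N0 ?eQ2_norm.
 by apply: gam_div => //; [exact: eva_rQ2|rewrite norm1N0 ?eQ2_norm].
rewrite expr0 mul1r => -[h1 h2 h3]; exists y => //; split=> //.
by have := onePlus_neq0 0 hy; rewrite expr0 mul1r.
Qed.

Lemma g_spec : exists2 y, Rp y & [/\ eva (g_ c) (1 + p%:R * (pe * y)), eva (g_ c)^-1 (1 + p%:R * (pe * y))^-1,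
 1 + p%:R * (pe * y) != 0 & fr (fr (1 + p%:R * (pe * y))) = eA2 * (1 + p%:R * (pe * y))].
Proof.
have [r hr e] := eA2_spec.
have [|||y hy] := @fg_spec 1 eA2 (gam c (rQ2 / rQ ^+ p) / (rQ2 / rQ ^+ p)) r.
- by rewrite expr1.
- exact: hr.
- have [h1 h2] := eQr_Adag.
 have n0 : eQr != 0 by rewrite norm1N0 // (near1_norm eQr_near1).
 have -> : eA2 = gB eQr / eQr.
  have q0 := norm1N0 eQ_norm; have q20 := norm1N0 eQ2_norm; have s0 := norm1N0 egs_norm.
  have -> : gB eQr = gB eQ2 / gB eQ ^+ p by rewrite fmorph_div rmorphXn.
  rewrite /eA2 /eA1 /eQr gal_eQ2 gal_eQ.
  move: eQ eQ2 (egs) q0 q20 s0 => q q2 s q0 q20 s0.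
  rewrite !expr_div_n exprMn expr_div_n.
  have [a1 a2 a3] : [/\ q ^+ p != 0, s ^+ p != 0 & fr s ^+ p != 0].
   by rewrite !expf_neq0 ?fmorph_eq0.
  by field; rewrite a1 a2 a3 q20 fmorph_eq0.
 by apply: gam_div => //; exact: eva_rQr.
rewrite expr1 => -[h1 h2 h3]; exists y => //; split=> //.
by have := onePlus_neq0 1 hy; rewrite expr1.
Qed.

End Gamma.
End PhiGammaEval.
#[local] Hint Resolve eva_0 eQ_PS eQ_norm eQ2_norm norm1N0 : core.
#[local] Hint Resolve Rp_fr eva_phi : closed.

(** * Norms of cyclotomic units, the kernel of theta, and Witt vectors fixed by phi or phi^2 *)

Section Unramified.
Implicit Types (x y z : B) (s t : T).

Lemma cross1 (F : padic) (x : F) : W x ->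
 exists2 e, W e & cross p x 1 = x * (1 + x * e).
Proof.
move=> nx; have p1 := p_gt1.
rewrite /cross; have [k ek] : exists k, p = k.+2 by exists (p - 2)%N; lia.
have -> : p.-1 = k.+1 by lia.
rewrite big_ord_recr /=.
exists (\sum_(i < k) ('C(p, i.+1) %/ p)%:R * x ^+ (k - i.+1)).
 apply: pnorm_sum_le => // i _ _; apply: W_M => //.
 exact: W_X.
have -> : (p - k.+1 = 1)%N by lia.
have -> : ('C(p, k.+1) %/ p = 1)%N.
 by rewrite {1}ek binSn ek divnn.
rewrite mul1r expr1n addrC mulrDr; congr (_ + _).
rewrite !mulr_sumr; apply: eq_bigr => i _; rewrite expr1n mulr1.
have -> : (p - i.+1 = (k - i.+1).+2)%N by have := ltn_ord i; lia.
by rewrite !exprS; ring.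
Qed.

(** In (1 + b)^p = 1 + b^p + p b (1 + b e) the last term is smaller than 1/p, so b^p alone accounts
    for the norm of a. *)
Lemma pow1D_norm (F : padic) (a b : F) : p%:R^-1 <= `|a| -> `|b| < 1 ->
 (1 + b) ^+ p = 1 + a -> `|b| ^+ p = `|a|.
Proof.
move=> na nb e; have [e' ne' ec] := cross1 (ltW nb).
move: e; rewrite addrC exprD_cross // expr1n ec addrAC addrC => /addrI e.
have lt : `|p%:R * (b * (1 + b * e'))| < `|a|.
 apply: lt_le_trans na; rewrite pnormM pnorm_p gtr_pMr // pnormM.
 apply: (le_lt_trans _ nb); rewrite ler_piMr ?pnorm_ge0 //.
 by apply: pnormD_le; [by rewrite pnorm1|apply: W_M => //; exact: ltW].
rewrite -pnormX; have -> : b ^+ p = - (p%:R * (b * (1 + b * e'))) + a by rewrite -e; ring.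
by apply: pnorm_dom; rewrite pnormN.
Qed.

Lemma tcoord_epsX n : zeta n ^+ (p ^ n) = 1.
Proof. by rewrite -[n in zeta n]add0n tcoord_iter; case: eps_ok. Qed.

Lemma eps_cong n : cong 1 (zeta n - 1) (tcoord pb n).
Proof.
have h : cong 1 (tcoord (pb + 1) n) (tcoord pb n + tcoord 1 n).
 by apply: tcoordD_cong; [exact: Oi_pb|exact: Oi1].
rewrite subrK tcoord_one in h.
have -> : tcoord pb n = tcoord pb n + 1 - 1 by rewrite addrK.
by apply: congB => //; exact: congxx.
Qed.

Lemma pb_coord_lt1 n : `|tcoord pb n| < 1.
Proof.
have p0 : (p ^ n != 0)%N by clo.
have h : tnorm pb < 1 by [].
move: h; rewrite (tnorm_coord _ n) => h; rewrite ltNge; apply/negP => h1.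
by move: h; rewrite ltNge exprn_ege1.
Qed.

Lemma eps_lt1 n : `|zeta n - 1| < 1.
Proof.
rewrite -[_ - 1](subrK (tcoord pb n)); apply: pnormD_lt; last exact: pb_coord_lt1.
by apply: le_lt_trans pinv_lt1; rewrite -ppow1; exact: eps_cong.
Qed.

Lemma eps1_norm : `|zeta 1 - 1| ^+ p.-1 = p%:R^-1.
Proof.
set l := _ - 1; have l1 : `|l| < 1 by exact: eps_lt1.
have l0 : l != 0 by rewrite subr_eq0; apply/eqP; case: eps_ok.
have [e ne ec] := cross1 (ltW l1).
have : (l + 1) ^+ p = 1 by have := tcoord_epsX 1; rewrite expn1 subrK.
rewrite exprD_cross // expr1n ec addrAC => /(canRL (addrK _)); rewrite subrr.
rewrite -[p in l ^+ p]prednK // exprS mulrCA -mulrDr => /eqP.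
rewrite mulf_eq0 (negPf l0) /= addr_eq0 => /eqP h.
rewrite -pnormX h pnormN pnormM pnorm_p.
have -> : `|1 + l * e| = 1; last by rewrite mulr1.
rewrite addrC pnorm_dom ?pnorm1 // pnormM.
by apply: le_lt_trans l1; rewrite ler_piMr ?pnorm_ge0.
Qed.

Lemma eps_norm_ge n : p%:R^-1 <= `|zeta n.+1 - 1| /\
 `|zeta n.+1 - 1| ^+ (p ^ n) = `|zeta 1 - 1|.
Proof.
elim: n => [|n [h1 h2]].
 split => //.
 rewrite -eps1_norm; have p1 := p_gt1.
 have [k ->] : exists k, p.-1 = k.+1 by exists p.-2; lia.
 rewrite exprS ler_piMr ?pnorm_ge0 // exprn_ile1 ?pnorm_ge0 // ltW //; exact: eps_lt1.
have e : `|zeta n.+2 - 1| ^+ p = `|zeta n.+1 - 1|.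
 by apply: pow1D_norm => //; [exact: eps_lt1|rewrite ![1 + _]addrC !subrK tcoord_compat].
split; last by rewrite expnS exprM e.
apply: le_trans h1 _; rewrite -e -[X in _ ^+ X](@prednK p) // exprS ler_piMr ?pnorm_ge0 // exprn_ile1 ?pnorm_ge0 //.
by apply: ltW; exact: eps_lt1.
Qed.

(** phi^-1(Q) phi^-1(pi) = pi, where theta kills pi but sends phi^-1(pi) to zeta_1 - 1, which is
    nonzero. *)
Lemma theta_Qinv : theta (frobV eQ) = 0.
Proof.
have We : Wp eQ by clo.
have Wv : Wp (frobV pe) by clo.
have Oe : Oi eps by [].
have ep : frobV eQ * frobV pe = pe.
 rewrite -frobVM /eQ divfK ?frobKV //; exact: pe_neq0.
have e1 : theta pe = 0.
 rewrite thetaB ?theta_teich //; last by clo.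
 by have := theta_nat 1; case: eps_ok => -> _; rewrite mulr1n => ->; rewrite subrr.
have e2 : theta (frobV pe) = zeta 1 - 1.
 rewrite frobVD frobVN frobV1 frobV_teich thetaB; last 2 first.
 - by apply: Wp_teich; exact: Oirt.
 - exact: Wp1.
 rewrite theta_teich ?tcoord_rt; last by clo.
 by have := theta_nat 1; rewrite mulr1n => ->.
have := congr1 theta ep; rewrite thetaM ?e1 ?e2 //; last by clo.
move/eqP; rewrite mulf_eq0 => /orP[/eqP //|]; rewrite subr_eq0 => /eqP h.
by case: eps_ok.
Qed.

Lemma theta1 : theta (1 : B) = 1.
Proof. by rewrite -[X in theta X]/(1%:R) theta_nat. Qed.

Definition frobV2 n x := iter n (fun y => frobV (frobV y)) x.

Lemma Wp_frobV2 n x : Wp x -> Wp (frobV2 n x).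
Proof. by move=> h; elim: n => //= n IH; do 2!apply: Wp_frobV. Qed.
Lemma frobV2D n x y : frobV2 n (x + y) = frobV2 n x + frobV2 n y.
Proof. by elim: n => //= n ->; rewrite !frobVD. Qed.
Lemma frobV2N n x : frobV2 n (- x) = - frobV2 n x.
Proof. by elim: n => //= n ->; rewrite !frobVN. Qed.
Lemma frobV2M n x y : frobV2 n (x * y) = frobV2 n x * frobV2 n y.
Proof. by elim: n => //= n ->; rewrite !frobVM. Qed.
Lemma frobV2_p n : frobV2 n p%:R = p%:R.
Proof. by elim: n => //= n ->; rewrite !frobV_nat. Qed.
Lemma frobV2X n x k : frobV2 n (x ^+ k) = frobV2 n x ^+ k.
Proof. by elim: n => //= n ->; rewrite !frobVX. Qed.
Lemma frobV2_fix n x : fr2 x = x -> frobV2 n x = x.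
Proof. by move=> h; elim: n => //= n ->; rewrite -{1}h !frobKV. Qed.
Lemma frobV2_gal n (g : galois S) x : frobV2 n (galB g x) = galB g (frobV2 n x).
Proof. by elim: n => //= n ->; rewrite !frobV_gal. Qed.

Lemma frobV2_teich n t : frobV2 n (teich t) = teich (rtn (2 * n) t).
Proof.
elim: n => [|n IH] //; have -> : (2 * n.+1 = (2 * n).+2)%N by lia.
by rewrite /frobV2 iterS -/(frobV2 n _) IH !frobV_teich.
Qed.

(** Vanishing of theta(phi^(-2n)(x)) makes the 2n-th coordinate of the residue divisible by p, so
    its norm is at most p^(-p^(2n)). The residue is therefore 0, and one divides by p. *)
Lemma theta_ker x : Wp x -> (forall n, theta (frobV2 n x) = 0) -> x = 0.
Proof.
move=> Wx hx; apply: cong_eq => N; apply/cong0P.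
elim: N x Wx hx => [|N IH] x Wx hx; first by rewrite ppow0; exact: Wp_le1.
have [y Wy e] := Wp_digit Wx.
have r0 : res x = 0.
 have hn n : tnorm (res x) <= p%:R ^- (p ^ (2 * n)).
  have := hx n; rewrite {1}e frobV2D frobV2M frobV2_p frobV2_teich thetaD; last 2 first.
  - by apply: Wp_teich; apply: Oi_rtn; exact: Wp_res.
  - by apply: WpM; [exact: Wp_nat|exact: Wp_frobV2].
  rewrite theta_teich ?tcoord_rtn ?add0n; last by apply: Oi_rtn; exact: Wp_res.
  rewrite thetaM ?theta_nat; [|exact: Wp_nat|exact: Wp_frobV2].
  move/eqP; rewrite addr_eq0 => /eqP h.
  rewrite (tnorm_coord _ (2 * n)) h pnormN pnormM pnorm_p -exprVn.
  apply: lerXn2r; rewrite ?nnegrE ?mulr_ge0 ?pnorm_ge0 //.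
  by rewrite ler_piMr ?pinv_ge0 //; apply: theta_le1; exact: Wp_frobV2.
 apply/eqP; rewrite -tnorm_eq0 eq_le tnorm_ge0 andbT.
 apply/ler_addgt0Pr => d d0; rewrite add0r; have [n hn'] := ppow_small d0.
 apply: le_trans (hn n) _; apply: ltW; apply: le_lt_trans hn'; apply: ppow_le.
 apply: (@leq_trans (2 * n)); first by lia.
 by apply: ltnW; apply: ltn_expl; exact: prime_gt1.
move: e; rewrite r0 teich0 add0r => e.
rewrite e pnormM pnorm_p ppowS ler_wpM2l //; apply: IH => // n.
apply: (mulfI (pF_neq0 (F := C))); rewrite mulr0 -theta_nat -thetaM; last 2 first.
- exact: Wp_nat.
- exact: Wp_frobV2.
by rewrite -{1}(frobV2_p n) -frobV2M -e.
Qed.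

(** A kernel element has residue of norm at most 1/p, hence divisible by that of xi. Subtracting xi
    times a Teichmuller lift and dividing by p stays in the kernel; the digits obtained sum to the
    quotient. *)
Lemma theta_div (xi y : B) : Wp xi -> theta xi = 0 -> tnorm (res xi) = p%:R^-1 ->
 Wp y -> theta y = 0 -> exists2 y', Wp y' & y = xi * y'.
Proof.
move=> Wxi txi nxi Wy ty.
have step x : Wp x -> theta x = 0 -> exists t y1, [/\ Oi t, Wp y1, theta y1 = 0 & x = xi * teich t + p%:R * y1].
 move=> Wx tx; have [x1 Wx1 e] := Wp_digit Wx.
 have nx : tnorm (res x) <= p%:R^-1.
  move: tx; rewrite {1}e thetaD; last 2 first.
  - by apply: Wp_teich; exact: Wp_res.
  - by apply: WpM => //; exact: Wp_nat.
  rewrite theta_teich ?thetaM ?theta_nat //; last by clo.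
  move/eqP; rewrite addr_eq0 /tnorm => /eqP ->; rewrite pnormN pnormM pnorm_p.
  by rewrite ler_piMr ?pinv_ge0 //; exact: theta_le1.
 have r0 : res xi != 0 by rewrite -tnorm_eq0 nxi gt_eqF // pinv_gt0.
 pose t := res x / res xi; have Ot : Oi t by apply: tnorm_divr; rewrite ?nxi.
 have Wt : Wp (teich t) by clo.
 have WM : Wp (xi * teich t) by clo.
 have : `|x - xi * teich t| <= p%:R ^- 1.
  have : cong 1 x (xi * teich t).
   apply/res_cong; rewrite ?Wp_le1 // resM ?Wp_le1 // res_teich /t mulrC divfK //.
  by [].
 move=> /(Wp_div (WpB Wx WM))[y1 Wy1 e1]; exists t, y1; split=> //; last first.
  by rewrite -[p%:R]expr1 -e1 addrC subrK.
 apply: (mulfI (pF_neq0 (F := C))); rewrite mulr0 -theta_nat -thetaM //.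
 rewrite -[p%:R]expr1 -e1 thetaB // thetaM // txi mul0r tx subr0 //.
have /choice[d hd] (x : {x | Wp x /\ theta x = 0}) : exists v : T * {x | Wp x /\ theta x = 0},
  Oi v.1 /\ sval x = xi * teich v.1 + p%:R * sval v.2.
 case: x => x [h1 h2] /=; have [t [y1 [k1 k2 k3 k4]]] := step x h1 h2.
 by exists (t, exist _ y1 (conj k2 k3)).
pose ys i := iter i (fun v => (d v).2) (exist (fun x => Wp x /\ theta x = 0) y (conj Wy ty)).
pose c i := (d (ys i)).1.
have Oc i : Oi (c i) by exact: (hd (ys i)).1.
have e n : y = xi * (\sum_(i < n) p%:R ^+ i * teich (c i)) + p%:R ^+ n * sval (ys n).
 elim: n => [|n IH]; first by rewrite big_ord0 mulr0 add0r mul1r.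
 by rewrite {1}IH big_ord_recr /= {1}(hd (ys n)).2 -/(c n) exprSr; ring.
have [|l [tl cl]] := @padic_series B (fun i => p%:R ^+ i * teich (c i)).
 by move=> k; rewrite pnormM pnorm_pow ler_piMr ?ppow_ge0 // W_teich.
have Wl : Wp l.
 apply: Wp_closed => n; eexists; split; last by clo.
 by apply: Wp_sum => i _ _; apply: WpM; [rewrite -natrX; exact: Wp_nat|exact: Wp_teich].
exists l => //; apply: cong_eq => n; rewrite {1}(e n).
have : cong n (xi * (\sum_(i < n) p%:R ^+ i * teich (c i)) + 0) (xi * l + 0).
 by rewrite !addr0; apply: congMl; [exact: Wp_le1|exact: congS].
rewrite addr0 [X in cong _ _ X]addr0; apply: congT.
rewrite /cong addrAC subrr add0r pnormM pnorm_pow ler_piMr // Wp_le1 //.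
by case: (svalP (ys n)).
Qed.

Lemma tilt_prime_field t : t ^+ p = t -> exists m : nat, t = m%:R.
Proof.
move=> ht; apply: contrapT => nt.
pose P : {poly T} := 'X^p - 'X.
have p1 := p_gt1.
have sP : size P = p.+1 by rewrite size_polyDl ?size_polyXn ?size_polyN ?size_polyX.
pose rs := t :: [seq m%:R | m <- iota 0 p].
have : (size rs < size P)%N.
 apply: max_poly_roots.
 - by rewrite -size_poly_eq0 sP.
 - apply/allP => x; rewrite inE => /orP[/eqP ->|/mapP[m _ ->]].
   by rewrite rootE !hornerE ht subrr.
  by rewrite rootE !hornerE -(pFrobenius_autE tilt_pchar) pFrobenius_aut_nat subrr.
 - rewrite cons_uniq; apply/andP; split.
   by apply/negP => /mapP[m _ em]; apply: nt; exists m.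
  have inj m m' : (m < m')%N -> (m' < p)%N -> (m%:R : T) != m'%:R.
   move=> h1 h2; rewrite eq_sym -subr_eq0 -natrB ?(ltnW h1) // -(dvdn_pcharf tilt_pchar).
   by rewrite gtnNdvd //; lia.
  rewrite map_inj_in_uniq ?iota_uniq // => m m'; rewrite !mem_iota => h1 h2 e.
  have [hm hm'] : (m < p)%N /\ (m' < p)%N by [].
  by case: (ltngtP m m') => // h; [move: (inj _ _ h hm')|move: (inj _ _ h hm)]; rewrite e eqxx.
by rewrite sP /= size_map size_iota ltnn.
Qed.

(** The residue lies in the prime field, so an integer can be subtracted and the difference divided
    by p; integers converging to x produce an element of Z_p. *)
Lemma frob_fix x : fr x = x -> exists a, x = iB a.
Proof.
move=> fx; have [k hk] := F_scale x; set y := _ * x in hk.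
have fy : fr y = y by rewrite rmorphM rmorphXn rmorph_nat fx.
suff [a ea] : exists a, y = iB a.
 exists (a / p%:R ^+ k); rewrite fmorph_div -ea rmorphXn rmorph_nat mulrAC divff ?mul1r //.
have zy : zint y.
 move=> n; clearbody y; elim: n y hk fy {fx} => [|n IH] y ny fy.
  by exists 0%N; rewrite /cong subr0 ppow0.
 have rp : res y ^+ p = res y by rewrite -frob_res // fy.
 have [m hm] := tilt_prime_field rp.
 have : `|y - m%:R| <= p%:R ^- 1.
  have : cong 1 y m%:R by apply/res_cong; rewrite ?W_nat // hm res_nat.
  by [].
 move=> /B_div[z nz]; rewrite expr1 => ez.
 have fz : fr z = z.
  apply: (mulfI (pF_neq0 (F := B))); rewrite -{1}(rmorph_nat fr) -rmorphM -ez.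
  by rewrite rmorphB rmorph_nat fy.
 have [m' hm'] := IH z nz fz; exists (m + p * m')%N.
 have -> : y = m%:R + p%:R ^+ 1 * z by rewrite -ez addrC subrK.
 rewrite natrD natrM -[p%:R in X in cong _ _ X]expr1; apply: congD => //.
 exact: congMp.
have [m hm] := choice zy.
have [|a [_ ha]] := @padic_lim K (fun n => (m n)%:R).
 move=> n; have : cong n ((m n.+1)%:R : B) (m n)%:R.
  apply: congT (hm n); apply: congS; exact: cong_le (leqnSn n) (hm n.+1).
 by rewrite /cong -!(rmorph_nat iB) -rmorphB QpBt_norm.
exists a; apply: cong_eq => n; apply: congT (hm n) _; apply: congS.
by rewrite /cong -(rmorph_nat iB) -rmorphB QpBt_norm; exact: ha.
Qed.

(** The residue is fixed by the p^2-power map, hence of norm at most 1, and its Teichmuller lift is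
    fixed by phi^2; the next digit is treated in the same way. *)
Lemma fix2_Wp x : fr2 x = x -> W x -> Wp x.
Proof.
move=> fx nx; apply: Wp_closed => n; elim: n x fx nx => [|n IH] x fx nx.
 by exists 0; split; [exact: Wp0|rewrite /cong subr0 ppow0].
have [y ny ey] := witt_digit nx.
have rx : res x ^+ (p ^ 2) = res x by rewrite -[in RHS]fx exprM !frob_res ?frob_norm.
have Or : Oi (res x).
 rewrite /Oi leNgt; apply/negP => h; have := congr1 tnorm rx.
 rewrite tnormX => /eqP; rewrite gt_eqF // ltr_eXnr //.
 by have := p_gt1; rewrite expnS expn1; nia.
have ft : fr (fr (teich (res x))) = teich (res x) by rewrite !frob_teich -exprM -{2}rx.
have fy : fr2 y = y.
 apply: (mulfI (pF_neq0 (F := B))); apply: (addrI (teich (res x))).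
 by rewrite -{1}ft -{1}(rmorph_nat fr p) -rmorphM -{1}(rmorph_nat fr p) -!(rmorphM fr) -!rmorphD -ey fx.
have [z [Wz hz]] := IH y fy ny; exists (teich (res x) + p%:R * z); split.
 by apply: WpD; [exact: Wp_teich|apply: WpM => //; exact: Wp_nat].
rewrite {1}ey; apply: congD => //.
by rewrite -[p%:R]expr1; exact: (congMp 1 hz).
Qed.

(** On elements fixed by phi^2 all the maps theta phi^(-2n) coincide, so theta is injective there.
    Identities about Z_{p^2} inside W(tilt) are thereby checked in C_p. *)
Lemma theta_fix2_inj x y : fr2 x = x -> fr2 y = y -> W x -> W y ->
 theta x = theta y -> x = y.
Proof.
move=> fx fy nx ny e; apply/eqP; rewrite -subr_eq0; apply/eqP.
have [Wx Wy] := (fix2_Wp fx nx, fix2_Wp fy ny).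
apply: theta_ker; first by clo.
by move=> n; rewrite frobV2_fix ?thetaB ?e ?subrr // !rmorphB fx fy.
Qed.

End Unramified.

(** * The Lubin-Tate period nu, and equations phi^2(w) = v w *)

Section LubinTatePeriod.
Local Notation q := (p ^ 2)%N.
Implicit Types (x y z : B) (s : T).

Lemma cong_expq (F : padic) n (a b : F) : W a -> W b ->
 cong n.+1 a b -> cong n.+2 (a ^+ q) (b ^+ q).
Proof.
move=> na nb h; rewrite expnS expn1 !exprM; apply: cong_le (leqnSn _) _.
by do 2?apply: cong_expp; rewrite ?W_X.
Qed.

Lemma q_gt : (2 * p <= q)%N.
Proof. by rewrite expnS expn1 leq_mul2r p_gt1 orbT. Qed.

Lemma lt_root (y : C) : `|y| < 1 -> exists2 x, `|x| < 1 & p%:R * x + x ^+ q = y.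
Proof.
move=> ny; have q0 : (0 < q)%N by rewrite expn_gt0 prime_gt0.
have [x ex] := Cp_closed (fun i => if i == 0 then y else if i == 1 then - p%:R else 0) q0.
have q1 : (1 < q)%N by have := q_gt; have := p_gt1; lia.
have e : x ^+ q = y - p%:R * x.
 rewrite ex (bigD1 (Ordinal q0)) //= mulr1 (bigD1 (Ordinal q1)) //= expr1 mulNr.
 rewrite big1 ?addr0 // => i /andP[i0 i1].
 have -> : (i == 0 :> nat) = false by apply: contraNF i0 => /eqP i0; apply/eqP/val_inj.
 have -> : (i == 1 :> nat) = false by apply: contraNF i1 => /eqP i1; apply/eqP/val_inj.
 by rewrite mul0r.
exists x; last by rewrite e addrC subrK.
rewrite ltNge; apply/negP => x1.
have : `|x| <= `|x ^+ q| by rewrite pnormX ler_eXnr.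
rewrite e leNgt => /negP; apply; apply: pnormD_lt; first exact: lt_le_trans x1.
rewrite pnormN pnormM pnorm_p gtr_pMl ?pinv_lt1 //; exact: lt_le_trans x1.
Qed.

(** A generator of the Tate module of the Lubin-Tate group: a nonzero p-torsion point t_1, with
    t_1^(q-1) = -p, and compatible preimages under pT + T^q. *)
Lemma lt_seq : exists t : nat -> C, [/\ t 0%N = 0, t 1%N ^+ (q - 1) = - p%:R, forall n, `|t n| < 1
 & forall n, p%:R * t n.+1 + t n.+1 ^+ q = t n].
Proof.
have p1 := p_gt1.
have q1 : (0 < q - 1)%N by lia.
have [t1 et1] := Cp_closed (fun i => if i == 0 then - p%:R else 0 : C) q1.
have {}et1 : t1 ^+ (q - 1) = - p%:R.
 rewrite et1 (bigD1 (Ordinal q1)) //= expr0 mulr1 big1 ?addr0 // => i i0.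
 have -> : (i == 0 :> nat) = false by apply: contraNF i0 => /eqP i0; apply/eqP/val_inj.
 by rewrite mul0r.
have nt1 : `|t1| < 1.
 have : `|t1| ^+ (q - 1) < 1 by rewrite -pnormX et1 pnormN pnorm_p pinv_lt1.
 by move=> h; rewrite ltNge; apply/negP => h1; move: h; rewrite ltNge exprn_ege1.
have /choice[f hf] (y : {y : C | `|y| < 1}) : exists x : {y : C | `|y| < 1},
  p%:R * sval x + sval x ^+ q = sval y.
 by case: y => y ny; have [x nx ex] := lt_root ny; exists (exist _ x nx).
pose t n := if n is k.+1 then sval (iter k f (exist _ t1 nt1)) else 0.
exists t; split=> // [[|n]|[|n]].
- by rewrite /= pnorm0.
- exact: (svalP (iter n f (exist _ t1 nt1))).
- rewrite /= -[in t1 ^+ q](@subnK 1 q) //.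
 by rewrite exprD et1 expr1 mulNr subrr.
- by rewrite /= hf.
Qed.

Lemma t1_norm (t1 : C) : t1 ^+ (q - 1) = - p%:R ->
 [/\ p%:R^-1 < `|t1|, `|t1| < 1 & `|t1| ^+ (q - 1) = p%:R^-1].
Proof.
move=> e; have n1 : `|t1| ^+ (q - 1) = p%:R^-1 by rewrite -pnormX e pnormN pnorm_p.
have p1 := p_gt1; have q1 := q_gt.
split=> //; rewrite ltNge; apply/negP => h; move/eqP: n1; apply/negP.
 have [k ->] : exists k, (q - 1 = k.+2)%N by exists (q - 3)%N; lia.
 rewrite lt_eqF //; apply: (@le_lt_trans _ _ (p%:R^-1 ^+ k.+2)).
  by apply: lerXn2r; rewrite ?nnegrE ?pnorm_ge0 ?pinv_ge0.
 by rewrite exprS gtr_pMr ?pinv_gt0 // exprn_ilt1 ?pinv_ge0 ?pinv_lt1.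
rewrite gt_eqF //; apply: (lt_le_trans pinv_lt1); exact: exprn_ege1.
Qed.

(** The sequence t defines an element s of the tilt, because t_(n+1)^q is t_n modulo p. The lift of
    s satisfying the Lubin-Tate equation is the fixed point of a contraction. *)
Lemma lt_nu (t : nat -> C) : t 0%N = 0 -> (forall n, `|t n| < 1) ->
 (forall n, p%:R * t n.+1 + t n.+1 ^+ q = t n) ->
 exists nu, [/\ Wp nu, fr2 nu = p%:R * nu + nu ^+ q, forall n, theta (frobV2 n nu) = t n
   & cong 1 (tcoord (res nu) 2) (t 1%N)].
Proof.
move=> t0 nt et.
have p1 := p_gt1.
have nt1 n : W (t n) by clo.
(* Only q-th powers relate the t_n, whereas coordinates of the tilt are related by p-th powers: the
   terms t_(n+1)^p are inserted at odd places. *)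
pose y n := if odd n then t n./2.+1 ^+ p else t n./2.
have [n|n|s [Os hs]] := @tilt_construct y.
- by rewrite /y; case: ifP => _; rewrite ?W_X.
- rewrite /y /=; case: ifP => on /=.
  rewrite uphalf_half (negPf on) add0n.
  rewrite -exprM -(et n./2) /cong [X in _ - X]addrC opprD addrA subrr add0r pnormN pnormM.
  by rewrite pnorm_p ppow1 ler_piMr ?pinv_ge0.
 by move/negbFE: on => on; rewrite on uphalf_half on add1n; exact: congxx.
have teven k : cong 1 (tcoord s (2 * k)) (t k).
 by have := hs (2 * k)%N; rewrite /y mul2n odd_double doubleK.
(* Fixed points of F are the solutions of phi^2(x) = p x + x^q. F gains a factor p on congruences,
   since p x and x^q both do. *)
pose F x := frobV (frobV (p%:R * x + x ^+ q)).
have FW x : Wp x -> Wp (F x).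
 move=> Wx; do 2!apply: Wp_frobV; apply: WpD; last by clo.
 by apply: WpM => //; exact: Wp_nat.
have Fc n x x' : Wp x -> Wp x' -> cong n.+1 x x' -> cong n.+2 (F x) (F x').
 move=> /Wp_le1 nx /Wp_le1 nx' h; rewrite /cong -!frobVN -!frobVD !frobV_norm.
 apply: congD; last exact: cong_expq.
 by rewrite -[p%:R]expr1; exact: (congMp 1 h).
pose x n := iter n F (teich s).
have Wx n : Wp (x n) by elim: n => [|n IH]; [exact: Wp_teich|exact: FW].
have c1 : cong 1 (F (teich s)) (teich s).
 have Ws := Wx 0%N; have ns : W (teich s) by exact: W_teich.
 apply/res_cong => //; first by clo.
 have nq : W (teich s ^+ q) by clo.
 have np : W (p%:R * teich s) by clo.
 rewrite !res_frobV ?frobV_norm ?pnormD_le // resD // resM // res_nat tilt_p mul0r add0r.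
 by rewrite resX // res_teich expnS expn1 exprM !rtE.
have cx n : cong n.+1 (x n.+1) (x n) by elim: n => [|n IH]; [exact: c1|exact: (Fc n _ _ (Wx n.+1) (Wx n) IH)].
have [|nu [_ hnu]] := @padic_lim B x.
 by move=> n; exact: cong_le (leqnSn n) (cx n).
have Wnu : Wp nu by apply: Wp_closed => n; exists (x n); split.
have hnu1 n : cong n.+1 nu (x n).
 by apply: congT (hnu n.+1) (cx n).
have Fnu : F nu = nu.
 apply: cong_eq => n; apply: (@congT _ _ _ (x n.+1)).
  by apply: (cong_le (n := n.+2)); [lia|apply: Fc => //; exact: hnu1].
 by apply: congS; exact: cong_le (leqnSn n) (hnu n.+1).
have fnu : fr2 nu = p%:R * nu + nu ^+ q by rewrite -{1}Fnu !frobVK.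
exists nu; split=> //; last first.
 have -> : res nu = s.
  have := hnu1 0%N; rewrite /x /= => /(res_cong (Wp_le1 Wnu) (Wp_le1 (Wx 0%N))).
  by rewrite res_teich.
 exact: (teven 1%N).
pose u n := theta (frobV2 n nu).
have Wn n : Wp (frobV2 n nu) by exact: Wp_frobV2.
have frn n : frobV2 n.+1 (fr2 nu) = frobV2 n nu.
 by elim: n => [|n IH]; [rewrite /frobV2 /= !frobKV|rewrite /frobV2 iterS -/(frobV2 n.+1 _) IH].
have eu n : p%:R * u n.+1 + u n.+1 ^+ q = u n.
 rewrite /u -[in RHS](frn n) fnu frobV2D frobV2M frobV2_p frobV2X.
 rewrite thetaD ?thetaM ?thetaX ?theta_nat //.
 - by apply: WpM => //; exact: Wp_nat.
 - exact: WpX.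
(* Both sequences satisfy the same recursion from n+1 to n, and this recursion gains a factor p;
   agreement modulo p for all n thus improves indefinitely. *)
have cut k n : cong k.+1 (u n) (t n).
 elim: k n => [|k IH] n; last first.
  rewrite -eu -et; apply: congD; first by rewrite -[p%:R]expr1; exact: (congMp 1 (IH n.+1)).
  by apply: cong_expq; rewrite ?theta_le1.
 apply: congT (teven n).
 have -> : tcoord s (2 * n) = theta (frobV2 n (teich s)).
  by rewrite frobV2_teich theta_teich ?tcoord_rtn ?add0n //; exact: Oi_rtn.
 apply: theta_cong => //; first by apply: Wp_frobV2; exact: Wp_teich.
 rewrite /cong -frobV2N -frobV2D; have := hnu1 0%N; rewrite /= /cong.
 by elim: n => //= n IH /IH; rewrite !frobV_norm.
move=> n; apply: cong_eq => k; exact: cong_le (leqnSn k) (cut k n).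
Qed.

Section Weak.

Lemma Wm_pow_small x : Wm x -> forall n m, exists k0, forall k, (k0 <= k)%N -> wk n m (x ^+ k).
Proof.
move=> hx n m; have Wx : Wp x by exact: Wm_Wp.
have [w [y [z [w1 ny Wz e]]]] := hx 1%N; rewrite expr1 in e.
have Ot : Oi w by exact: ltW.
have Wt : Wp (teich w * z) by clo.
have Wy : Wp y by apply: Wp_divp => //; rewrite -[_ * _](addrK (teich w * z)) -e; exact: WpB.
have d0 : 0 < tnorm pb ^+ (m + n) by rewrite exprn_gt0 //; exact: tnorm_pb_gt0.
have [M hM] := pow_small (tnorm_ge0 w) w1 d0.
exists (M + n)%N => k hk; have -> : k = (k - n + n)%N by lia.
have [u [v [Wu Wv ->]]] : exists u v, [/\ Wp u, Wp v & x ^+ (k - n + n) = (teich w * z) ^+ (k - n) * u + p%:R ^+ n * v].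
 by rewrite e addrC; exact: pow_split.
apply: wkD; last by apply: wk_norm_le; rewrite pnormM pnorm_pow ler_piMr ?ppow_ge0 // Wp_le1.
have Mk : (M <= k - n)%N by lia.
have b0 : pb ^+ (m + n) != 0 by rewrite expf_neq0 // pb_neq0.
have -> : (teich w * z) ^+ (k - n) * u = teich pb ^+ (m + n) * (teich (w ^+ (k - n) / pb ^+ (m + n)) * (z ^+ (k - n) * u)).
 by rewrite exprMn -!teichX -mulrA [RHS]mulrA -teichM [pb ^+ _ * _]mulrC divfK.
apply: wk_teich_pb => //; apply: WpM; last by apply: WpM => //; exact: WpX.
apply: Wp_teich; apply: tnorm_divr => //; rewrite !tnormX; apply: ltW; exact: hM.
Qed.

(** All the tails b_j + b_(j+1) x + ... are constructed at once, so that factors x can be taken out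
    of the sum without rearranging limits. *)
Lemma weak_series x (b : nat -> B) : Wm x -> (forall k, Wp (b k)) ->
 exists N : nat -> B, forall j, Wp (N j) /\ N j = b j + x * N j.+1.
Proof.
move=> hx Wb; have Wx : Wp x by exact: Wm_Wp.
pose P j M := \sum_(k < M) b (j + k)%N * x ^+ k.
have WP j M : Wp (P j M) by apply: Wp_sum => k _ _; apply: WpM => //; exact: WpX.
have small n m : exists M0, forall j M, (M0 <= M)%N -> wk n m (P j M - P j M0).
 have [k0 hk0] := Wm_pow_small hx n m; exists k0 => j M h; rewrite -(subnKC h).
 elim: (M - k0)%N => [|i IH]; first by rewrite addn0 subrr; apply: wk_norm_le; rewrite pnorm0 ppow_ge0.
 rewrite addnS /P big_ord_recr /= addrAC; apply: wkD => //.
 by apply: wkMl => //; apply: hk0; rewrite leq_addr.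
have /choice[N hN] (j : nat) : exists l, Wp l /\ forall n m, exists M0, forall M, (M0 <= M)%N -> wk n m (l - P j M).
 have [||l Wl hl] := @wk_complete (P j) => //.
  by move=> n m; have [M0 h] := small n m; exists M0 => M; exact: h.
 by exists l.
exists N => j; split; first exact: (hN j).1.
apply: wk_all_eq => n m.
have [M1 h1] := (hN j).2 n m; have [M2 h2] := (hN j.+1).2 n m.
pose M := (maxn M1 M2).
have e : P j M.+1 = b j + x * P j.+1 M.
 rewrite /P big_ord_recl mulr1 addn0 mulr_sumr; congr (_ + _); apply: eq_bigr => k _.
 by rewrite /= /bump /= add1n exprS addSnnS mulrCA.
have -> : N j - (b j + x * N j.+1) = (N j - P j M.+1) - x * (N j.+1 - P j.+1 M) by rewrite e; ring.
apply: wkB; first by apply: h1; rewrite (leq_trans (leq_maxl M1 M2)).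
by apply: wkMl => //; apply: h2; rewrite leq_maxr.
Qed.

Lemma frob2_wk n m x : wk n m x -> wk n m (fr2 x).
Proof.
have h y : wk n m y -> wk n m (fr y).
 move=> [y1 [z [ny Wz ->]]]; have [v hv ev] := let: And3 _ _ h := pe_endo_frob in h.
 rewrite rmorphD !rmorphM !rmorphXn rmorph_nat ev exprMn -mulrA; exists (fr y1), (v ^+ m * fr z).
 split=> //; first by rewrite frob_norm.
 by apply: WpM; [apply: WpX; exact: Rp_Wp hv|exact: Wp_frob].
by move=> /h/h.
Qed.

Lemma Wm_lim x : Wp x -> (forall n, exists2 y, Wm y & wk n 1 (x - y)) -> Wm x.
Proof.
move=> Wx h n; have [y hy [y1 [z [ny Wz e]]]] := h n.
have : Wm (y + pi_eps eps * z) by apply: WmD => //; apply: WmMr => //; exact: Wm_pe.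
move=> /(_ n)[w [y2 [z2 [k1 k2 k3 k4]]]]; exists w, (y1 + y2), z2; split=> //; first by clo.
by rewrite -[x](subrK y) e expr1 mulrDr -!addrA [_ * z + y]addrC k4 addrA.
Qed.

Lemma Wm_unit x : Wp x -> Wm (x - 1) -> Wp x^-1 /\ tnorm (res x) = 1.
Proof.
move=> Wx hx; have n1 : W (x - 1) by apply: Wp_le1; exact: Wm_Wp.
have e : tnorm (res x) = 1.
 have -> : x = (x - 1) + 1 by rewrite subrK.
 rewrite resD ?pnorm1 // res1 tnorm_dom ?tnorm1 //; exact: Wm_res.
by split=> //; exact: Wp_unit.
Qed.

Lemma Wm_inv x : Wp x -> Wm (x - 1) -> Wm (x^-1 - 1).
Proof.
move=> Wx hx; have [WV e] := Wm_unit Wx hx.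
have x0 : x != 0 by apply: contra_eq_neq e => ->; rewrite res0 tnorm0 eq_sym.
have -> : x^-1 - 1 = x^-1 * - (x - 1) by field.
by apply: WmMl => //; exact: WmN.
Qed.

(** The solution is the product over k of phi^(2k)(v^-1). It converges weakly because phi^2 raises
    the small residual factor of v^-1 - 1 to the power p^2. *)
Lemma frob2_unit_solve v : Wp v -> Wm (v - 1) ->
 exists w, [/\ Wp w, Wm (w - 1) & fr2 w = v * w].
Proof.
move=> Wv hv; have [WV ev] := Wm_unit Wv hv; have hV := Wm_inv Wv hv.
have v0 : v != 0 by apply: contra_eq_neq ev => ->; rewrite res0 tnorm0 eq_sym.
pose f2 x := fr2 x; pose vn n := iter n f2 v^-1; pose x n := \prod_(k < n) vn k.
have Wvn n : Wp (vn n) by elim: n => //= n IH; do 2!apply: Wp_frob.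
have Wx n : Wp (x n).
 by rewrite /x; elim: n => [|n IH]; rewrite ?big_ord0 ?big_ord_recr /=; [exact: Wp1|exact: WpM].
have hvn n m : exists M0, forall M, (M0 <= M)%N -> wk n m (vn M - 1).
 have [w [y [z [w1 ny Wz e]]]] := hV n.
 have e' M : vn M - 1 = p%:R ^+ n * iter M f2 y + teich (w ^+ (p ^ (2 * M))) * iter M f2 z.
  elim: M => [|M IH] //.
  have -> : vn M.+1 - 1 = fr2 (vn M - 1) by ring.
  rewrite IH !rmorphD !rmorphM !rmorphXn !rmorph_nat !frob_teich -!exprM; congr (_ + teich (w ^+ _) * _).
  by rewrite mulnn -expnD; congr (_ ^ _)%N; lia.
 have d0 : 0 < tnorm pb ^+ (m + n) by rewrite exprn_gt0 //; exact: tnorm_pb_gt0.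
 have [M hM] := pow_small (tnorm_ge0 w) w1 d0; exists M => k Mk; rewrite e'.
 have ni : W (iter k f2 y) by elim: k {Mk e'} => //= k IH; rewrite !frob_norm.
 have Wi : Wp (iter k f2 z) by elim: k {Mk e' ni} => //= k IH; do 2!apply: Wp_frob.
 apply: wkD; first by apply: wk_norm_le; rewrite pnormM pnorm_pow ler_piMr ?ppow_ge0.
 have b0 : pb ^+ (m + n) != 0 by rewrite expf_neq0 // pb_neq0.
 rewrite -[w ^+ _](divfK b0) mulrC teichM [teich _ * _]mulrC teichX mulrCA.
 apply: wk_teich_pb => //; apply: WpM => //; apply: Wp_teich; apply: tnorm_divr => //.
 rewrite !tnormX; apply: ltW; apply: hM; apply: (leq_trans Mk).
 apply: ltnW; apply: (@leq_trans (p ^ k)); first exact/ltn_expl/prime_gt1.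
 by rewrite leq_exp2l ?prime_gt1 // leq_pmull.
have wc : wk_cauchy x.
 move=> n m; have [M0 h0] := hvn n m; exists M0 => M h; rewrite -(subnKC h).
 elim: (M - M0)%N => [|i IH]; first by rewrite addn0 subrr; apply: wk_norm_le; rewrite pnorm0 ppow_ge0.
 rewrite addnS /x big_ord_recr /= -/(x _).
 have -> : x (M0 + i)%N * vn (M0 + i)%N - x M0 = x (M0 + i)%N * (vn (M0 + i)%N - 1) + (x (M0 + i)%N - x M0) by ring.
 by apply: wkD => //; apply: wkMl => //; apply: h0; rewrite leq_addr.
have [w Ww hw] := wk_complete Wx wc; exists w; split=> //.
 apply: Wm_lim => [|n]; first by apply: WpB => //; exact: Wp1.
 have [M0 /(_ M0 (leqnn _)) h0] := hw n 1%N; exists (x M0 - 1); last by rewrite opprB addrA subrK.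
 rewrite /x; elim: M0 {h0} => [|M IH]; first by rewrite big_ord0 subrr -(mul0r (pi_eps eps)); apply: WmMl; [exact: Wp0|exact: Wm_pe].
 rewrite big_ord_recr /= -/(x M).
 have -> : x M * vn M - 1 = x M * (vn M - 1) + (x M - 1) by ring.
 apply: WmD => //; apply: WmMl => //.
 elim: M {IH} => // M IH; have -> : vn M.+1 - 1 = fr2 (vn M - 1) by rewrite !rmorphB !rmorph1.
 by do 2!apply: Wm_frob.
apply: wk_all_eq => n m; have [M0 h0] := hw n m.
have e : f2 (x M0) = v * x M0.+1.
 rewrite /x big_ord_recl mulrA divff // mul1r /f2 !rmorph_prod; apply: eq_bigr => k _ //.
have -> : fr2 w - v * w = fr2 (w - x M0) - v * (w - x M0.+1).
 by rewrite !rmorphB -/(f2 (x M0)) e; ring.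
apply: wkB; first by apply: frob2_wk; exact: h0.
by apply: wkMl => //; exact: h0.
Qed.

End Weak.
End LubinTatePeriod.

(** * The ring A_{Q_p} and its residue field E *)

Section IntegralBase.
Implicit Types (x y z : B) (a : int -> K).

Lemma pe_expz (k : int) : `|pe ^ k| = 1.
Proof. by case: k => k; rewrite ?NegzE -?exprnN ?pnormV pnormX pe_norm // expr1n ?invr1. Qed.

Lemma zsum_PS n a N b y M : PS b y -> (N <= M)%N -> (forall i, cong n (a i) (lz N b i)) ->
 exists2 z, Wp z & cong n (y / pe ^+ N - \sum_(k <- zrange M) iB (a k) * pe ^ k) (pe ^+ M * z).
Proof.
move=> h1 NM h2; have [z hz ey] := h1.2 (N + M)%N; exists z => //.
apply: (@congT _ _ _ (y / pe ^+ N - \sum_(k <- zrange M) iB (lz N b k) * pe ^ k)).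
 apply: congB => //.
 apply: cong_sum => k _ _; rewrite mulrC [X in cong _ _ X]mulrC.
 by apply: congMl; rewrite ?pe_expz // /cong -rmorphB QpBt_norm; exact: h2.
suff -> : y / pe ^+ N - \sum_(k <- zrange M) iB (lz N b k) * pe ^ k = pe ^+ M * z by exact: congxx.
pose s := [seq j%:Z - N%:Z | j <- iota 0 (N + M)].
have us : uniq s by rewrite map_inj_uniq ?iota_uniq // => j j' /= ?; lia.
have -> : \sum_(k <- zrange M) iB (lz N b k) * pe ^ k = \sum_(k <- s) iB (lz N b k) * pe ^ k.
 rewrite (bigID (fun k : int => 0 <= k + N%:Z)) /= addrC big1 ?add0r => [|k hk]; last first.
  by rewrite lz_neg ?rmorph0 ?mul0r // ltNge.
 rewrite -big_filter; apply: perm_big; apply: uniq_perm; rewrite ?filter_uniq ?zrange_uniq //.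
 move=> k; rewrite mem_filter mem_zrange; apply/idP/mapP => [|[j]].
  by move=> h'; exists (absz (k + N%:Z)); rewrite ?mem_iota; lia.
 by rewrite mem_iota => h' ->; lia.
have -> : \sum_(k <- s) iB (lz N b k) * pe ^ k =
  \sum_(j < N + M) iB (lz N b (j%:Z - N%:Z)) * pe ^ (j%:Z - N%:Z).
 by rewrite big_map -[X in iota _ X]subn0 big_mkord.
have hm (j : nat) : pe ^ (j%:Z - N%:Z) = pe ^+ j / pe ^+ N.
 by rewrite expfzDr ?pe_neq0 // -exprnN.
under eq_bigr => j _ do rewrite (@lz_pos N b _ j) ?subrK // hm mulrA.
rewrite -mulr_suml -mulrBl ey addrAC subrr add0r exprD -mulrA mulrAC divff ?mul1r //.
Qed.

Lemma LE_eval_pi a x : LE a x -> eval_pi eps a x.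
Proof.
move=> h; exists 0%N => n m; have [N [b [y [h1 h2 h3]]]] := h n.
exists (maxn N m) => M; rewrite geq_max => /andP[NM mM].
have [z hz c1] := zsum_PS h1 NM h2.
suff : cong n (x - \sum_(k <- zrange M) iB (a k) * pe ^ k) (pe ^+ M * z).
 rewrite /cong => /B_div[y' ny' e]; exists y', (pe ^+ (M - m) * z); split=> //.
  by apply/WplusP; apply: WpM => //; apply: WpX; exact: Wp_pe.
 by rewrite expr0 mul1r mulrA -exprD subnKC // -e subrK.
apply: (congT _ c1); apply: congB => //; exact: congxx.
Qed.

Lemma eva_Edag f x : eva f x -> Edag_image eps f x.
Proof.
case=> h1 h2; split; last exact: LE_eval_pi.
by exists 1 => n; apply: (ev_le1 _ h1); exact: (Adag_le1 h2).
Qed.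

(** The ring A_{Q_p}, p-adic completion of Z_p[[pi]][1/pi], as limits of finite Laurent series;
    [AA_BQp] and [BQp_AA] compare it with [BQp]. *)
Definition AA x := forall n, exists N y, Rp y /\ cong n x (y / pe ^+ N).

Lemma AA_LE x : AA x -> exists a, LE a x.
Proof.
move=> h; have [N hN] := choice h; have [y hy] := choice hN.
have [b hb] := choice (fun n => (hy n).1).
pose v n := lz (N n) (b n).
have hv n i : cong n (v n.+1 i) (v n i).
 apply: (LE_cong (LE_lz _ (hb n.+1)) (LE_lz _ (hb n))).
 by apply: congT (hy n).2; apply: congS; exact: cong_le (hy n.+1).2.
have h3 i : exists l, forall n, cong n l (v n i).
 by have [l [_ hl]] := padic_lim (fun n => hv n i); exists l.
have [a ha] := choice h3.
exists a => n; exists (N n), (b n), (y n); split=> [//|i|]; [exact: ha|exact: (hy n).2].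
Qed.

Lemma AA_cl x : (forall n, exists y, AA y /\ cong n x y) -> AA x.
Proof.
move=> h n; have [y [/(_ n)[N [z [hz c]]] c']] := h n.
by exists N, z; split=> //; exact: congT c.
Qed.

Lemma AA_Rp y : Rp y -> AA y.
Proof. by move=> hy n; exists 0%N, y; rewrite expr0 divr1. Qed.
Lemma divpe_le1 N y : Rp y -> W (y / pe ^+ N).
Proof. by move=> h; rewrite pnormM peV_norm // mulr1; exact: (Wp_le1 (Rp_Wp h)). Qed.
Lemma AA_le1 x : AA x -> W x.
Proof. by move=> /(_ 0)[N [y [hy c]]]; apply: cong_norm c _; exact: divpe_le1. Qed.

Lemma AA_D x y : AA x -> AA y -> AA (x + y).
Proof.
move=> h h' n; have [N [z [hz c]]] := h n; have [N' [z' [hz' c']]] := h' n.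
exists (N + N')%N, (z * pe ^+ N' + z' * pe ^+ N); split.
 by apply: RpD => //; apply: RpM => //; apply: RpX => //; exact: Rp_pe.
suff -> : (z * pe ^+ N' + z' * pe ^+ N) / pe ^+ (N + N') = z / pe ^+ N + z' / pe ^+ N' by exact: congD.
have h1 : pe ^+ N != 0 by [].
have h2 : pe ^+ N' != 0 by [].
by rewrite exprD; field; apply/andP.
Qed.

Lemma AA_N x : AA x -> AA (- x).
Proof.
move=> h n; have [N [z [hz c]]] := h n; exists N, (- z); split; first by clo.
by rewrite mulNr; exact: congN.
Qed.

Lemma AA_M x y : AA x -> AA y -> AA (x * y).
Proof.
move=> h h' n; have [N [z [hz c]]] := h n; have [N' [z' [hz' c']]] := h' n.
exists (N + N')%N, (z * z'); split; first by clo.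
rewrite exprD invfM mulrACA; apply: congM => //; [exact: AA_le1|exact: divpe_le1].
Qed.

Lemma AA_1 : AA 1. Proof. by apply: AA_Rp; exact: Rp1. Qed.
Lemma AA_QpBt (c : K) : W c -> AA (iB c).
Proof. by move=> h; apply: AA_Rp; exact: Rp_QpBt. Qed.
Lemma AA_X x n : AA x -> AA (x ^+ n).
Proof. by move=> h; elim: n => [|n IH]; rewrite ?expr0 ?exprS; [exact: AA_1|exact: AA_M]. Qed.

Lemma AA_sat x : W x -> AA (p%:R * x) -> AA x.
Proof.
move=> nx h n; have [N [y [hy c]]] := h n.+1; have hp : pe ^+ N != 0 by exact: peX_neq0.
have ny : `|y| <= p%:R ^- 1.
 have -> : y = pe ^+ N * (p%:R * x) - pe ^+ N * (p%:R * x - y / pe ^+ N) by field.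
 rewrite -mulrBr; apply: pnormMl_le; first by clo.
 apply: pnormB_le; last by apply: (le_trans c); exact: ppow_le.
 by rewrite pnormM pnorm_p ppow1 ler_piMr // pinv_ge0.
have [y' hy' ey] := Rp_div hy ny; exists N, y'; split=> //.
by apply: (@congp _ n 1); rewrite expr1 add1n; move: c; rewrite ey expr1 mulrA.
Qed.

Lemma AA_Adag x : Adag x -> AA x.
Proof. by move=> /Adag_ev[f [h _]] n; have [N [b [y [h1 _ h2]]]] := h n; exists N, y; split=> //; exists b. Qed.

Lemma AA_geom x : AA x -> AA (1 + p%:R * x)^-1.
Proof.
move=> hx; have h (n : nat) : `|(- (p%:R * x)) ^+ n| <= p%:R ^- n.
 rewrite pnormX pnormN pnormM pnorm_p exprMn -exprVn ler_piMr ?exprn_ge0 ?pinv_ge0 //.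
 by rewrite exprn_ile1 ?pnorm_ge0 //; exact: AA_le1.
have n1 : `|1 + p%:R * x| = 1.
 by rewrite addrC pnorm_dom ?pnorm1 // -pnormN -[- _]expr1 (le_lt_trans (h 1)) // ppow_lt1.
have n0 := norm1N0 n1.
apply: AA_cl => n; exists (\sum_(i < n) (- (p%:R * x)) ^+ i); split.
 elim: n => [|n IH]; first by rewrite big_ord0 -(subrr 1); apply: AA_D; [exact: AA_1|exact: (AA_N AA_1)].
 rewrite big_ord_recr; apply: AA_D => //; apply: AA_X; apply: AA_N; apply: AA_M => //.
 by apply: AA_Rp; exact: Rp_nat.
have e : (1 + p%:R * x) * (\sum_(i < n) (- (p%:R * x)) ^+ i) = 1 - (- (p%:R * x)) ^+ n.
 by have := subrX1 (- (p%:R * x)) n; set X := _ ^+ n; set s := \sum_(i < n) _ => e; rewrite -[1 - X]opprB e; ring.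
rewrite /cong; set s := \sum_(i < n) _ in e *.
have -> : (1 + p%:R * x)^-1 - s = (1 + p%:R * x)^-1 * (- (p%:R * x)) ^+ n.
 by apply: (mulfI n0); rewrite mulrBr e mulrA divff // mul1r opprB addrC subrK.
by rewrite pnormM pnormV n1 invr1 mul1r.
Qed.

(** A quotient y / pi^N approximates x modulo p and is invertible by Weierstrass preparation; x
    differs from it by a factor 1 + p s, inverted by a geometric series. *)
Lemma AA_V x : AA x -> `|x| = 1 -> AA x^-1.
Proof.
move=> hx nx; have [N [y [hy c]]] := hx 1%N; have hp : pe ^+ N != 0 by exact: peX_neq0.
have ny : `|y| = 1.
 have -> : `|y| = `|y / pe ^+ N| by rewrite pnormM peV_norm mulr1.
 rewrite -nx; apply: pnorm_close; rewrite pnormBC nx; apply: le_lt_trans c _; exact: ppow_lt1.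
have y0 := norm1N0 ny; have x0 := norm1N0 nx.
have hc : AA (pe ^+ N * y^-1).
 apply: AA_M; first by apply: AA_Rp; apply: RpX => //; exact: Rp_pe.
 by apply: AA_Adag; have [_] := Adag_unit hy ny.
have nc : `|pe ^+ N * y^-1| = 1 by rewrite pnormM pnormX pnormV pe_norm ny expr1n invr1 mul1r.
have [|s ns es] := @B_div 1 (x * (pe ^+ N * y^-1) - 1).
 have -> : x * (pe ^+ N * y^-1) - 1 = (x - y / pe ^+ N) * (pe ^+ N * y^-1) by field; apply/andP.
 by rewrite pnormM nc mulr1.
rewrite expr1 in es.
have hs : AA s.
 by apply: AA_sat => //; rewrite -es; apply: AA_D; [exact: AA_M|exact: (AA_N AA_1)].
have -> : x^-1 = pe ^+ N * y^-1 * (1 + p%:R * s)^-1.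
 by rewrite -es addrC subrK invfM invfM invrK; field; rewrite x0 y0 hp.
by apply: AA_M => //; exact: AA_geom.
Qed.

Lemma AA_fr x : AA x -> AA (fr x).
Proof.
move=> hx; apply: AA_cl => n; have [N [y [hy c]]] := hx n; exists (fr (y / pe ^+ N)); split; last first.
 by rewrite /cong -rmorphB frob_norm.
rewrite rmorphM fmorphV rmorphXn; apply: AA_M; first by apply: AA_Rp; exact: (Rp_fr hy).
have nQ := eQ_norm.
have -> : fr pe = eQ * pe by rewrite divfK // pe_neq0.
apply: AA_V; last by rewrite pnormX pnormM nQ pe_norm mulr1 expr1n.
by apply: AA_X; apply: AA_M; apply: AA_Rp; [exact: eQ_PS|exact: Rp_pe].
Qed.

Lemma AA_gal_fix (g : galois S) x : fixes_cyclo g -> AA x -> galB g x = x.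
Proof.
move=> hg hx; have gpe : galB g pe = pe.
 rewrite gal_pe; congr (teich _ - 1); apply: tcoordP => n.
 by rewrite tcoord_gt hg.
have gR y : Rp y -> galB g y = y.
 move=> [b hb]; apply: (PS_uniq (b := b)) => //; split; first exact: hb.1.
 move=> M; have [z hz ->] := hb.2 M; exists (galB g z); first exact: Wp_gal.
 rewrite rmorphD rmorphM rmorphXn rmorph_sum /= gpe; congr (_ + _); apply: eq_bigr => i _.
 by rewrite rmorphM rmorphXn /= gpe isom_QpBt //; exact: galB_norm.
apply: cong_eq => n; have [N [y [hy c]]] := hx n.
apply: congT (congS c).
have -> : y / pe ^+ N = galB g (y / pe ^+ N) by rewrite rmorphM fmorphV rmorphXn gpe gR.
by rewrite /cong -rmorphB galB_norm.
Qed.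

Lemma AA_BQp x : AA x -> BQp eps x.
Proof.
move=> hx; have [a ha] := AA_LE hx; exists a; split; last exact: LE_eval_pi.
 exists 1 => k; rewrite -[1]ppow0; apply: (LE_norm ha).
 by rewrite ppow0; exact: AA_le1.
apply/cvgrPdist_lt => e e0; have [n hn] := ppow_small e0.
have [N [b [y [_ h2 _]]]] := ha n; exists N.+1 => // k /= hk.
rewrite sub0r normrN ger0_norm ?pnorm_ge0 //; apply: le_lt_trans hn.
have := h2 (- k%:Z); rewrite lz_neg; last by lia.
by move/cong0P.
Qed.

Lemma scale_ge (F : padic) (c : R) : exists k, forall x : F, `|x| <= c -> W (p%:R ^+ k * x).
Proof.
have [k hk] : exists k, c * p%:R ^- k <= 1.
 have [c0|c0] := leP c 0.
  by exists 0%N; rewrite ppow0 mulr1 (le_trans c0).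
 have [n hn] := ppow_small (divr_gt0 ltr01 c0); exists n.
 by rewrite mulrC -ler_pdivlMr // ltW.
by exists k => x hx; rewrite pnormM pnorm_pow mulrC (le_trans _ hk) // ler_wpM2r // ppow_ge0.
Qed.

(** One power of p makes the coefficients integral and another removes the denominator allowed in
    [eval_pi]. Modulo p^n the principal part is then finite, and weak convergence identifies the two
    values. *)
Lemma BQp_AA x : BQp eps x -> exists k, AA (p%:R ^+ k * x).
Proof.
move=> [a [[c hc] /cvgrPdist_lt ht [N0 he]]].
have [k0 hk0] := scale_ge K c; pose k := (k0 + N0)%N; exists k => n.
pose a' i := p%:R ^+ k * a i.
have na i : W (a' i).
 by rewrite /a' /k addnC exprD -mulrA; apply: W_M; [rewrite pnorm_pow ppow_le1|exact: hk0].
have [N1 _ hN1] := ht _ (ppow_gt0 n).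
have {}hN1 (j : nat) : (N1 <= j)%N -> `|a (- j%:Z)| <= p%:R ^- n.
 by move=> /hN1 /=; rewrite sub0r normrN ger0_norm ?pnorm_ge0 // => /ltW.
pose b i := a' (i%:Z - N1%:Z).
have [y hy] : exists y, PS b y by apply: PS_ex => i; exact: na.
exists N1, y; split; first by exists b.
have ab i : cong n (a' i) (lz N1 b i).
 have [h|h] := leP 0 (i + N1%:Z).
  rewrite (@lz_pos _ _ _ (absz (i + N1%:Z))); last by lia.
  rewrite /b; have -> : (absz (i + N1%:Z))%:Z - N1%:Z = i by lia.
  exact: congxx.
 rewrite lz_neg //; apply/cong0P; have -> : i = - (absz i)%:Z by lia.
 apply: pnormMl_le; first by clo.
 by apply: hN1; lia.
apply: wk_sep => m; have [M0 hM0] := he n m.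
pose M := maxn M0 (maxn N1 m).
have [y1 [z1 [ny1 /WplusP hz1 e1]]] := hM0 M (leq_maxl _ _).
have [z2 hz2 c2] := zsum_PS hy (leq_trans (leq_maxl _ _) (leq_maxr M0 _) : N1 <= M)%N ab.
set s := \sum_(i <- zrange M) iB (a i) * pe ^ i in e1.
set s' := \sum_(i <- zrange M) _ in c2.
have es : s' = p%:R ^+ k * s.
 by rewrite /s' /s mulr_sumr; apply: eq_bigr => i _; rewrite /a' rmorphM rmorphXn rmorph_nat mulrA.
have -> : p%:R ^+ k * x - y / pe ^+ N1 = p%:R ^+ k0 * (p%:R ^+ N0 * (x - s)) - (y / pe ^+ N1 - s' - pe ^+ M * z2) - pe ^+ M * z2.
 by rewrite es /k exprD; ring.
apply: wkB; last first.
 have hw : wk n M (pe ^+ M * z2) by exact: wk_pe.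
 by apply: wk_le hw => //; rewrite /M !leq_max leqnn !orbT.
apply: wkB; last exact: wk_norm_le c2.
apply: wkMl; first by apply: WpX; exact: Wp_nat.
by rewrite e1; exists y1, z1.
Qed.

Lemma AA_closed : subring_closed [pred x | `[< AA x >]].
Proof.
split=> [|x y /asboolP hx /asboolP hy|x y /asboolP hx /asboolP hy]; apply/asboolP.
- exact: AA_1.
- by apply: AA_D => //; exact: AA_N.
- exact: AA_M.
Qed.
Definition AAr : subring B := Subring AA_closed.
Lemma AArP x : (x \in sr AAr) <-> AA x. Proof. by split=> [/asboolP|h] //; exact/asboolP. Qed.

Lemma resfield_closed : divring_closed [pred t | `[< exists2 x, AA x & res x = t >]].
Proof.
have n1 := fun x (h : AA x) => AA_le1 h.
split=> [|s t /asboolP[x hx <-] /asboolP[y hy <-]|s t /asboolP[x hx <-] /asboolP[y hy <-]]; apply/asboolP.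
- by exists 1; [exact: AA_1|exact: res1].
- by exists (x - y); [apply: AA_D => //; exact: AA_N|rewrite resB; auto].
have [r0|r0] := eqVneq (res y) 0.
 exists 0; last by rewrite r0 invr0 mulr0 res0.
 by rewrite -(subrr 1); apply: AA_D; [exact: AA_1|exact: (AA_N AA_1)].
have ny : `|y| = 1.
 apply/eqP; rewrite eq_le n1 //=; apply: contraNT r0; rewrite -ltNge => h.
 by apply/eqP/res_eq0 => //; exact: n1.
exists (x / y); first by apply: AA_M => //; exact: AA_V.
have y0 := norm1N0 ny; have hv := AA_V hy ny.
rewrite resM; auto; congr (_ * _); apply: (mulfI r0).
by rewrite -resM; auto; rewrite !divff // res1.
Qed.
(** The residue field of A_{Q_p}, that is F_p((eps - 1)) inside the tilt. *)
Definition EE : subfield T := Subfield resfield_closed.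
Lemma EEP t : (t \in sf EE) <-> exists2 x, AA x & res x = t.
Proof. by split=> [/asboolP|h] //; exact/asboolP. Qed.

End IntegralBase.
#[local] Hint Resolve AA_1 : core.
#[local] Hint Resolve AA_Rp AA_le1 AA_D AA_N AA_M AA_X AA_QpBt AA_fr AA_Adag : closed.

Local Notation eE := (sfv EE).

(** * Unramified extensions of A_{Q_p} and their completed union *)

Section Unramified.
Local Notation A := (srT AAr).
Local Notation vA := (srv AAr).
Local Notation E := (sfT EE).
Implicit Types (x y z h : B) (t w : T) (P Q : {poly A}) (a : A).
Local Notation "P ^v" := (map_poly vA P) (at level 2, format "P ^v").

Lemma vA_AA a : AA (vA a).
Proof. by apply/AArP; exact: srvP. Qed.
Lemma vA_le1 a : W (vA a).
Proof. by apply: AA_le1; exact: vA_AA. Qed.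
Lemma vA_ex x : AA x -> exists a, vA a = x.
Proof. by move=> h; apply: srv_ex; apply/AArP. Qed.

Fact rE_key : {r : {rmorphism A -> E} | forall a, eE (r a) = res (vA a)}.
Proof.
have h a : res (vA a) \in sf EE by apply/EEP; exists (vA a) => //; exact: vA_AA.
pose r a : E := Sub (res (vA a)) (h a).
have er a : eE (r a) = res (vA a) by exact: sfv_sub.
have [|||f hf] := @rmorph_ex _ _ r.
- by apply: (fmorph_inj eE); rewrite er !rmorph1 res1.
- by move=> a b; apply: (fmorph_inj eE); rewrite rmorphB !er rmorphB resB // vA_le1.
- by move=> a b; apply: (fmorph_inj eE); rewrite rmorphM !er rmorphM resM // vA_le1.
by exists f => a; rewrite hf er.
Qed.
Definition rE : {rmorphism A -> E} := sval rE_key.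
Lemma rEP a : eE (rE a) = res (vA a). Proof. exact: (svalP rE_key). Qed.
Local Notation "P ^r" := (map_poly rE P) (at level 2, format "P ^r").
Local Notation "P ^e" := (map_poly eE P) (at level 2, format "P ^e").

Lemma rE_surj (b : E) : exists a, rE a = b.
Proof.
have /EEP[x hx ex] := sfvP b; have [a ea] := vA_ex hx.
by exists a; apply: (fmorph_inj eE); rewrite rEP ea.
Qed.

Lemma rE_eq0 a : rE a = 0 -> exists b, a = p%:R * b.
Proof.
move=> h; have /res_lt h1 : res (vA a) = 0 by rewrite -rEP h rmorph0.
have [|y ny ey] := @B_div 1 (vA a); first by rewrite ppow1; apply: h1; exact: vA_le1.
rewrite expr1 in ey; have [b eb] : exists b, vA b = y.
 by apply: vA_ex; apply: AA_sat => //; rewrite -ey; exact: vA_AA.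
by exists b; apply: (@srv_inj _ AAr); rewrite rmorphM rmorph_nat eb.
Qed.

Lemma vA_poly P i : W (P^v)`_i.
Proof. by rewrite coef_map; exact: vA_le1. Qed.
Lemma horner_le1 P y : W y -> W P^v.[y].
Proof. by move=> ny; case: (taylor (vA_poly P) ny ny). Qed.

Lemma res_horner P y : W y -> res P^v.[y] = P^r^e.[res y].
Proof.
move=> ny; elim/poly_ind: P => [|P a IH]; first by rewrite !rmorph0 !horner0 res0.
rewrite !rmorphD !rmorphM /= !map_polyX !map_polyC !hornerMXaddC.
have h := horner_le1 P ny.
rewrite resD ?vA_le1 ?W_M // resM // IH; congr (_ + _); exact/esym/rEP.
Qed.

Lemma lift_poly (Q : {poly E}) : exists P, P^r = Q.
Proof.
have [P hP] := @poly_choice A E (fun a b => rE a = b) Q (rmorph0 rE) (fun i => rE_surj Q`_i).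
by exists P; apply/polyP => i; rewrite coef_map; exact: hP.
Qed.

Lemma lift_monic (Q : {poly E}) : Q \is monic -> exists2 P, P \is monic & P^r = Q.
Proof.
move=> mQ; have [P eP] := lift_poly Q; pose n := (size Q).-1.
exists ('X^n + take_poly n P).
 by rewrite monicE lead_coefDl ?lead_coefXn // size_polyXn ltnS size_take_poly.
rewrite rmorphD /= map_polyXn; apply/polyP => i; rewrite coefD coefXn coef_map /= coef_take_poly.
have := congr1 (fun P : {poly E} => P`_i) eP; rewrite coef_map /= => e.
have [h|h|->] := ltngtP i n; first by rewrite add0r.
 by rewrite (raddf0 rE) addr0 nth_default // /n; move: h; rewrite /n; case: (size Q).
by rewrite (raddf0 rE) addr0 /n -lead_coefE (monicP mQ).
Qed.

Lemma red_poly P Q : P^r = Q^r -> exists D, P = Q + p%:R * D.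
Proof.
move=> h; have [|i|D hD] := @poly_choice A A (fun b a => a = p%:R * b) (P - Q).
- by rewrite mulr0.
- apply: rE_eq0; have := congr1 (fun P : {poly E} => P`_i) h; rewrite !coef_map /= coefB => e.
 by rewrite rmorphB /= e subrr.
by exists D; apply/polyP => i; rewrite coefD mulr_natl coefMn -mulr_natl -hD coefB addrC subrK.
Qed.

Lemma taylorA P y h : W y -> W h ->
 exists2 e, W e & P^v.[y + h] = P^v.[y] + h * (P^`())^v.[y] + h ^+ 2 * e.
Proof. by move=> ny nh; have [_ _ [e]] := taylor (vA_poly P) ny nh; exists e; rewrite // -deriv_map. Qed.

Lemma horner_cong P n y y' : W y -> W y' -> cong n y y' -> cong n P^v.[y] P^v.[y'].
Proof.
move=> ny ny' c; elim/poly_ind: P => [|P a IH]; first by rewrite rmorph0 !horner0; exact: congxx.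
rewrite rmorphD rmorphM /= map_polyX map_polyC !hornerMXaddC; apply: congD => //.
by apply: congM => //; exact: horner_le1.
Qed.

Lemma root_uniq P y y' : P^v.[y] = 0 -> P^v.[y'] = 0 -> W y -> W y' ->
 `|(P^`())^v.[y]| = 1 -> cong 1 y' y -> y = y'.
Proof.
move=> r0 r1 ny ny' d1 c; have nh : W (y' - y) by apply: (le_trans c); exact: ppow_le1.
have [e ne] := taylorA P ny nh.
rewrite addrC subrK r1 r0 add0r => e0; apply/eqP; rewrite eq_sym -subr_eq0; apply/eqP.
apply: contrapT => /eqP h0; have : (y' - y) * ((P^`())^v.[y] + (y' - y) * e) = 0 by rewrite e0; ring.
move/eqP; rewrite mulf_eq0 (negPf h0) -pnorm_eq0 addrC pnorm_dom ?d1 ?oner_eq0 //.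
apply: le_lt_trans (ppow_lt1 0); exact: pnormMr_le.
Qed.

(** The common properties under which Newton iteration stays inside D; D will be the unit ball or
    the closure of A_{Q_p}[y]. *)
Record closed_ring (D : B -> Prop) : Prop := ClosedRing {
 cr_D : forall x y, D x -> D y -> D (x + y);
 cr_M : forall x y, D x -> D y -> D (x * y);
 cr_A : forall a, D (vA a);
 cr_le1 : forall x, D x -> W x;
 cr_lim : forall x, (forall n, exists2 y, D y & cong n x y) -> D x }.

Lemma cr_horner D P y : closed_ring D -> D y -> D P^v.[y].
Proof.
move=> hD hy; elim/poly_ind: P => [|P a IH].
 by rewrite rmorph0 horner0 -(rmorph0 vA); exact: cr_A.
rewrite rmorphD rmorphM /= map_polyX map_polyC hornerMXaddC; apply: (cr_D hD); last exact: cr_A.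
exact: cr_M.
Qed.

Lemma hensel D P y0 c : closed_ring D -> D y0 -> D c -> `|P^v.[y0]| <= p%:R^-1 ->
 cong 1 (c * (P^`())^v.[y0]) 1 -> exists y, [/\ D y, P^v.[y] = 0 & cong 1 y y0].
Proof.
move=> hD hy0 hc r0 d0; pose v n := iter n (fun y => y + vA (-1) * (c * P^v.[y])) y0.
have hv n : D (v n).
 elim: n => [|n IH] //=; apply: (cr_D hD) => //; apply: (cr_M hD); first exact: cr_A.
 by apply: (cr_M hD) => //; exact: cr_horner.
have nv n := cr_le1 hD (hv n); have nc := cr_le1 hD hc.
have step n : v n.+1 = v n + (- (c * P^v.[v n])) by rewrite /= rmorphN rmorph1 mulN1r.
have hr n : cong 1 (v n) y0 /\ `|P^v.[v n]| <= p%:R ^- n.+1.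
 elim: n => [|n [IH1 IH2]]; first by rewrite ppow1; split=> //; exact: congxx.
 have nh : `|- (c * P^v.[v n])| <= p%:R ^- n.+1 by rewrite pnormN; exact: pnormMl_le.
 split.
  rewrite step; apply: congT IH1; rewrite /cong addrC addKr.
  by apply: (le_trans nh); exact: ppow_le.
 have [e ne ee] := taylorA P (nv n) (le_trans nh (ppow_le1 _)).
 have cd : cong 1 (c * (P^`())^v.[v n]) 1.
  by apply: congT d0; apply: congMl => //; apply: horner_cong => //; exact: (nv 0%N).
 rewrite step ee.
 have -> : P^v.[v n] + - (c * P^v.[v n]) * (P^`())^v.[v n] + (- (c * P^v.[v n])) ^+ 2 * e =
  P^v.[v n] * (1 - c * (P^`())^v.[v n]) + (- (c * P^v.[v n])) ^+ 2 * e by ring.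
 apply: pnormD_le.
  rewrite pnormM ppowS mulrC; apply: ler_pM; rewrite ?pnorm_ge0 // pnormBC -ppow1; exact: cd.
 apply: pnormMr_le => //; rewrite pnormM ppowS; apply: ler_pM; rewrite ?pnorm_ge0 //.
 by apply: (le_trans nh); rewrite -ppow1; exact: ppow_le.
have [n|l [_ hl]] := @padic_lim _ v.
 rewrite step /cong addrC addKr pnormN; apply: pnormMl_le => //.
 by apply: (le_trans (hr n).2); exact: ppow_le.
have nl : W l by apply: cong_norm (hl 0%N) (nv 0%N).
exists l; split.
- by apply: (cr_lim hD) => n; exists (v n).
- apply: cong_eq => n; apply: congT (horner_cong P nl (nv n) (hl n)) _.
 by apply/cong0P; apply: (le_trans (hr n).2); exact: ppow_le.
- by apply: congT (hl 1%N) (hr 1%N).1.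
Qed.

Lemma cr_W : closed_ring (fun x => W x).
Proof.
split=> [x y|x y|a|x|x h] //; [exact: pnormD_le|exact: W_M|exact: vA_le1|].
by have [y ny c] := h 0%N; exact: cong_norm c ny.
Qed.

(* y generates an unramified extension of AA, its minimal polynomial being minimal modulo p *)
Definition etm y := exists P, [/\ P \is monic, P^v.[y] = 0, W y, `|(P^`())^v.[y]| = 1 &
 forall Q, `|Q^v.[y]| < 1 -> exists D D', Q = D * P + p%:R * D'].

Lemma norm1_res x : W x -> res x != 0 -> `|x| = 1.
Proof.
move=> nx r0; apply/eqP; rewrite eq_le nx; apply: contraNT r0; rewrite -ltNge => h.
by apply/eqP/res_eq0.
Qed.

(** A monic lift of the minimal polynomial of w has a root over w by Hensel. Its minimality modulo p
    survives: a polynomial whose value at y has residue 0 is divisible by it modulo p. *)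
Lemma lift_etm w : sepel p eE w -> exists2 y, etm y & res y = w.
Proof.
move=> sw; have [m [mm rm hm]] := field_minp (sepel_alg tilt_pchar sw).
have [g [_ /rootP rg dg]] := sepel_poly tilt_pchar sw.
have dm : (m^`())^e.[w] != 0.
 have /dvdpP[D eD] := hm _ rg; apply/eqP => h0.
 have : (g^`())^e.[w] = 0.
  by rewrite eD derivM rmorphD !rmorphM /= hornerD !hornerM rm h0 !mulr0 addr0.
 by rewrite dg rmorph1 hornerC => /eqP; rewrite oner_eq0.
have [P mP eP] := lift_monic mm; have [y0 [ny0 ey0]] := lift_ex w.
have dP : (P^`())^r = m^`() by rewrite -deriv_map eP.
have n1 : `|(P^`())^v.[y0]| = 1.
 by apply: norm1_res; [exact: horner_le1|rewrite res_horner // dP ey0].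
have [||||y [ny ry cy]] := @hensel (fun x => W x) P y0 ((P^`())^v.[y0])^-1 cr_W => //.
- by rewrite pnormV n1 invr1.
- by apply/res_lt; [exact: horner_le1|rewrite res_horner // eP ey0].
- by rewrite mulVf ?norm1N0 //; exact: congxx.
have ey : res y = w by rewrite -ey0; apply/res_cong.
exists y => //; exists P; split=> //.
 by apply: norm1_res; [exact: horner_le1|rewrite res_horner // dP ey].
move=> Q nQ; have /hm/dvdpP[D eD] : Q^r^e.[w] = 0.
 by rewrite -ey -res_horner //; apply/res_eq0 => //; exact: horner_le1.
have [D1 eD1] := lift_poly D.
have [D' e'] : exists D', Q = D1 * P + p%:R * D' by apply: red_poly; rewrite rmorphM /= eD1 eP.
by exists D1, D'.
Qed.

Definition cl_gen y x := forall n, exists P, cong n x P^v.[y].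

Lemma cr_cl_gen y : W y -> closed_ring (cl_gen y).
Proof.
move=> ny; have le1 x : cl_gen y x -> W x.
 by move=> /(_ 0%N)[P c]; apply: cong_norm c _; exact: horner_le1.
split=> [x x' h h' n|x x' h h' n|a n|x|x h n] //.
- have [P c] := h n; have [P' c'] := h' n; exists (P + P').
 by rewrite rmorphD hornerD; exact: congD.
- have [P c] := h n; have [P' c'] := h' n; exists (P * P').
 by rewrite rmorphM hornerM; apply: congM => //; [exact: le1|exact: horner_le1].
- by exists a%:P; rewrite map_polyC hornerC; exact: congxx.
- exact: le1.
- by have [x' /(_ n)[P c] c'] := h n; exists P; exact: congT c.
Qed.

Lemma cl_gen_id y : cl_gen y y.
Proof. by move=> n; exists 'X; rewrite map_polyX hornerX; exact: congxx. Qed.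

Lemma etale_sepel P y : P^v.[y] = 0 -> W y -> `|(P^`())^v.[y]| = 1 -> sepel p eE (res y).
Proof.
move=> rP ny dP; apply: (etale_sep tilt_pchar (P := P^r)); first by rewrite -res_horner // rP res0.
by rewrite deriv_map -res_horner //; apply/eqP => /(res_eq0 (horner_le1 _ ny)); rewrite dP ltxx.
Qed.

Lemma etm_sepel y : etm y -> sepel p eE (res y) /\ W y.
Proof. by move=> [P [_ rP ny dP _]]; split=> //; exact: etale_sepel rP ny dP. Qed.

(** The residue of y' lifts to the closure of A_{Q_p}[y], as does an inverse of the residual
    derivative. Hensel inside this closure gives a root of P there, and it must be y' by uniqueness
    of the root with this residue. *)
Lemma etale_cl y y' P : etm y -> P^v.[y'] = 0 -> W y' -> `|(P^`())^v.[y']| = 1 ->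
 gen eE (res y) (res y') -> cl_gen y y'.
Proof.
move=> hy rP ny' dP hg; have [sy ny] := etm_sepel hy.
have hD := cr_cl_gen ny; have idy := cl_gen_id y.
have lft t : gen eE (res y) t -> exists2 x, cl_gen y x & res x = t.
 move=> [Q ->]; have [Q1 eQ1] := lift_poly Q; exists Q1^v.[y]; first exact: (cr_horner _ hD idy).
 by rewrite res_horner // eQ1.
have [y0 hy0 ey0] := lft _ hg; have ny0 := cr_le1 hD hy0.
have c0 : cong 1 y0 y' by apply/res_cong.
have n1 : `|(P^`())^v.[y0]| <= 1 by exact: horner_le1.
have n2 : `|(P^`())^v.[y']| <= 1 by exact: horner_le1.
have [c hc ec] : exists2 c, cl_gen y c & res c = (res (P^`())^v.[y'])^-1.
 apply: lft; apply: (gen_inv (sepel_alg tilt_pchar sy)); rewrite res_horner //; apply: (gen_trans hg).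
 by exists (P^`())^r.
have r1 : res (P^`())^v.[y'] != 0.
 by apply/eqP => /(res_eq0 n2); rewrite dP ltxx.
have [||y1 [hy1 ry1 cy1]] := @hensel (cl_gen y) P y0 c hD hy0 hc => //.
- rewrite -ppow1; apply/cong0P; rewrite -rP; exact: horner_cong.
- apply/res_cong; rewrite ?pnorm1 ?W_M ?(cr_le1 hD hc) // res1 resM ?(cr_le1 hD hc) //.
 rewrite ec; have /res_cong -> // : cong 1 (P^`())^v.[y0] (P^`())^v.[y'] by exact: horner_cong.
 by rewrite mulVf.
suff -> : y' = y1 by [].
by apply: (root_uniq rP ry1 ny' _ dP); [exact: cr_le1 hy1|exact: congT c0].
Qed.

Lemma inf_E n : exists s : seq E, uniq s /\ size s = n.
Proof.
have [b eb] : exists b : E, eE b = pb.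
 have [a ea] : exists a, vA a = pi_eps eps by apply: vA_ex; apply: AA_Rp; exact: Rp_pe.
 by exists (rE a); rewrite rEP ea res_pe.
exists [seq b ^+ i | i <- iota 0 n]; rewrite size_map size_iota; split=> //.
rewrite map_inj_uniq ?iota_uniq // => i k /(congr1 (fun b => tnorm (eE b))).
rewrite !rmorphXn /= eb !tnormX => e; apply/eqP; apply: contraTT isT => ik.
have lt0 : 0 < tnorm pb by [].
have lt1 : tnorm pb < 1 by [].
by move: ik; rewrite neq_ltn => /orP[] h; have := h; rewrite -(ltr_iXn2l lt0 lt1) e ltxx.
Qed.

(** The primitive element theorem for the residues over the infinite field E, lifted. It makes
    finite unramified extensions a directed system, so that sums and products can be formed. *)
Lemma etm_dir y1 y2 : etm y1 -> etm y2 -> exists2 y, etm y & cl_gen y y1 /\ cl_gen y y2.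
Proof.
move=> h1 h2; have [s1 n1] := etm_sepel h1; have [s2 n2] := etm_sepel h2.
have [|w [sw g1 g2]] := sep_trans tilt_pchar inf_E s1 (sepel_alg tilt_pchar s2).
 move=> P Pc _ Px PD PM; apply: (gen_subring Pc Px PD PM); exact: s2.
have [y hy ey] := lift_etm sw; exists y => //; split.
 by have [P [_ r n d _]] := h1; apply: (etale_cl hy r n d); rewrite ey.
by have [P [_ r n d _]] := h2; apply: (etale_cl hy r n d); rewrite ey.
Qed.

(** The ring of integers of the p-adic completion of the maximal unramified extension of B_{Q_p}. *)
Definition NN x := forall n, exists y, etm y /\ exists Q, cong n x Q^v.[y].

Lemma NN_le1 x : NN x -> W x.
Proof. by move=> /(_ 0%N)[y [/etm_sepel[_ ny] [Q c]]]; apply: cong_norm c _; exact: horner_le1. Qed.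

Lemma NN2 x1 x2 n : NN x1 -> NN x2 -> exists y Q1 Q2, [/\ etm y, cong n x1 Q1^v.[y] & cong n x2 Q2^v.[y]].
Proof.
move=> /(_ n)[y1 [h1 [Q1 c1]]] /(_ n)[y2 [h2 [Q2 c2]]].
have [y hy [g1 g2]] := etm_dir h1 h2; have [_ ny] := etm_sepel hy; have hD := cr_cl_gen ny.
have [P1 c1'] := cr_horner Q1 hD g1 n; have [P2 c2'] := cr_horner Q2 hD g2 n.
by exists y, P1, P2; split=> //; [exact: congT c1'|exact: congT c2'].
Qed.

Lemma NN_cl_gen y x : etm y -> cl_gen y x -> NN x.
Proof. by move=> hy hx n; exists y; split. Qed.

Lemma cr_NN : closed_ring NN.
Proof.
split=> [x x' h h' n|x x' h h' n|a|x|x h n].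
- by have [y [Q1 [Q2 [hy c1 c2]]]] := NN2 n h h'; exists y; split=> //; exists (Q1 + Q2);
  rewrite rmorphD hornerD; exact: congD.
- have [y [Q1 [Q2 [hy c1 c2]]]] := NN2 n h h'; exists y; split=> //; exists (Q1 * Q2).
 have [_ ny] := etm_sepel hy.
 by rewrite rmorphM hornerM; apply: congM => //; [exact: NN_le1|exact: horner_le1].
- have s0 : sepel p eE 0 by exists 0; rewrite rmorph0 horner0.
 have [y hy _] := lift_etm s0; have [_ ny] := etm_sepel hy.
 by apply: (NN_cl_gen hy); exact: (cr_A (cr_cl_gen ny)).
- exact: NN_le1.
- by have [x' /(_ n)[y [hy [Q c]]] c'] := h n; exists y; split=> //; exists Q; exact: congT c.
Qed.

Lemma NN_AA x : AA x -> NN x.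
Proof. by move=> /vA_ex[a <-]; exact: (cr_A cr_NN). Qed.

Lemma NN_B x y : NN x -> NN y -> NN (x - y).
Proof.
move=> hx hy; apply: (cr_D cr_NN) => //; rewrite -mulN1r -(rmorph1 vA) -rmorphN.
by apply: (cr_M cr_NN) => //; exact: (cr_A cr_NN).
Qed.

(** If p divides Q(y), the minimality in [etm] gives Q = D P + p D', and D'(y) approximates x. *)
Lemma NN_sat x : W x -> NN (p%:R * x) -> NN x.
Proof.
move=> nx h n; have [y [hy [Q c]]] := h n.+1; exists y; split=> //.
have [P [_ rP ny _ hm]] := hy.
have [|D [D' eQ]] := hm Q.
 apply: le_lt_trans (ppow_lt1 0); rewrite -[Q^v.[y]](subKr (p%:R * x)).
 apply: pnormB_le; first by rewrite pnormM pnorm_p ler_piMr.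
 by apply: (le_trans c); exact: ppow_le.
exists D'; apply: (@congp _ n 1); rewrite expr1 add1n; move: c.
by rewrite eQ rmorphD !rmorphM rmorph_nat /= hornerD !hornerM rP mulr0 add0r -polyC_natr hornerC.
Qed.

Lemma NN_etale P y : P^v.[y] = 0 -> W y -> `|(P^`())^v.[y]| = 1 -> NN y.
Proof.
move=> rP ny dP; have sy := etale_sepel rP ny dP; have [y' hy' ey'] := lift_etm sy.
by apply: (NN_cl_gen hy'); apply: (etale_cl hy' rP ny dP); rewrite ey'; exact: gen_id.
Qed.

Fact frA_key : {r : {rmorphism A -> A} | forall a, vA (r a) = fr (vA a)}.
Proof.
have h a : fr (vA a) \in sr AAr by apply/AArP; apply: AA_fr; exact: vA_AA.
pose r a : A := Sub (fr (vA a)) (h a).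
have er a : vA (r a) = fr (vA a) by rewrite srvE.
have vI := @srv_inj _ AAr.
have [|||f hf] := @rmorph_ex _ _ r.
- by apply: vI; rewrite er !rmorph1.
- by move=> a b; apply: vI; rewrite rmorphB !er !rmorphB.
- by move=> a b; apply: vI; rewrite rmorphM !er !rmorphM.
by exists f => a; rewrite hf er.
Qed.

Lemma NN_fr x : NN x -> NN (fr x).
Proof.
have [frA hA] := frA_key.
have hh P y : (map_poly frA P)^v.[fr y] = fr P^v.[y].
 elim/poly_ind: P => [|P a IH]; first by rewrite !rmorph0 !horner0 rmorph0.
 rewrite !rmorphD !rmorphM /= !map_polyX !map_polyC /= !hornerMXaddC IH rmorphD rmorphM hA //.
move=> hx; apply: (cr_lim cr_NN) => n; have [y [[P [_ r ny d _]] [Q c]]] := hx n.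
exists (fr Q^v.[y]); last by rewrite /cong -rmorphB frob_norm.
rewrite -hh; apply: (cr_horner _ cr_NN); apply: (@NN_etale (map_poly frA P)).
- by rewrite hh r rmorph0.
- by rewrite frob_norm.
- by rewrite deriv_map hh frob_norm.
Qed.

Lemma NN_res x : NN x -> sepel p eE (res x).
Proof.
move=> hx; have nx := NN_le1 hx; have [y [hy [Q c]]] := hx 1%N; have [sy ny] := etm_sepel hy.
apply: (sepel_gen tilt_pchar sy); exists Q^r; rewrite -res_horner //; apply/res_cong => //; exact: horner_le1.
Qed.

Lemma NN_lift t : sepel p eE t -> exists2 x, NN x & res x = t.
Proof.
by move=> /lift_etm[y hy ey]; exists y => //; apply: (NN_cl_gen hy); exact: cl_gen_id.
Qed.

(** The residue is a root of G(X^(p^2) - a X), where G has derivative 1 and kills the residue of s;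
    the derivative is -a, so the residue is separable over E and lifts to some f_0. The quotient (f
    - f_0) / p solves an equation of the same kind with another s, which is why an inhomogeneous
    term is allowed. *)
Lemma NN_frob2 f a s : W f -> `|vA a| = 1 -> NN s -> fr2 f = vA a * f + s -> NN f.
Proof.
move=> nf na hs ef; apply: (cr_lim cr_NN) => n.
elim: n f s nf hs ef => [|n IH] f s nf hs ef.
 by exists 0; [rewrite -(rmorph0 vA); exact: (cr_A cr_NN)|apply/cong0P; rewrite ppow0].
have ns := NN_le1 hs.
have st : sepel p eE (res f).
 have [G [_ /rootP rG dG]] := sepel_poly tilt_pchar (NN_res hs).
 have et : (res f ^+ p) ^+ p = eE (rE a) * res f + res s.
  have := congr1 (@res R p S) ef; rewrite !frob_res ?frob_norm // => ->.
  by rewrite resD ?W_M ?vA_le1 // resM ?vA_le1 // rEP.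
 have p0 : (p%:R : E) = 0.
  by apply: (fmorph_inj eE); rewrite rmorph_nat rmorph0; have [_ /eqP] := andP tilt_pchar.
 pose U : {poly E} := 'X^(p * p) - (rE a)%:P * 'X.
 have eU : U^e.[res f] = res s.
  rewrite rmorphB rmorphM /= map_polyXn map_polyX map_polyC hornerD hornerN hornerM hornerC hornerX.
  by rewrite hornerXn exprM et addrC addKr.
 apply: (etale_sep tilt_pchar (P := G \Po U)); first by rewrite map_comp_poly horner_comp eU.
 rewrite deriv_comp dG rmorphM /= hornerM comp_polyC rmorph1 hornerC mul1r.
 rewrite derivB derivXn derivM derivX derivC mul0r add0r mulr1 -mulr_natl natrM -polyC_natr p0 !mul0r sub0r.
 rewrite rmorphN /= map_polyC hornerN hornerC oppr_eq0 /=; apply/eqP; rewrite rEP => /(res_eq0 (vA_le1 a)).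
 by rewrite na ltxx.
have [f0 hf0 ef0] := NN_lift st; have nf0 := NN_le1 hf0.
have [|f' nf' ef'] := @B_div 1 (f - f0); first by apply/res_cong.
rewrite expr1 in ef'; have ff : f = f0 + p%:R * f' by rewrite -ef' addrC subrK.
have hs' : NN (fr (fr f') - vA a * f').
 apply: NN_sat.
  by apply: pnormB_le; rewrite ?frob_norm // pnormM na mul1r.
 have -> : p%:R * (fr (fr f') - vA a * f') = (vA a * f0 + s) - fr2 f0.
  have := ef; rewrite ff !rmorphD !rmorphM !rmorph_nat /= => e.
  have e2 : fr2 f0 = vA a * (f0 + p%:R * f') + s - p%:R * fr (fr f') by rewrite -e addrK.
  by rewrite e2; ring.
 apply: NN_B; last by apply: NN_fr; exact: NN_fr.
 by apply: (cr_D cr_NN) => //; apply: (cr_M cr_NN) => //; exact: (cr_A cr_NN).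
have [|g hg cg] := IH f' _ nf' hs'; first by ring.
exists (f0 + p%:R * g).
 by apply: (cr_D cr_NN) => //; apply: (cr_M cr_NN) => //; rewrite -(rmorph_nat vA); exact: (cr_A cr_NN).
have c1 : cong (1 + n) (p%:R ^+ 1 * f') (p%:R ^+ 1 * g) by exact: congMp.
by rewrite ff; apply: congD; [exact: congxx|rewrite !expr1 in c1].
Qed.

Lemma BQp_int_AA x : BQp eps x -> W x -> AA x.
Proof. by move=> /(BQp_AA)[k h] nx; exact: (saturate AA_sat nx h). Qed.

Lemma NN_Bnr x : NN x -> Bnr eps x.
Proof.
move=> hx e e0; have [n hn] := ppow_small e0.
have [y [[P [mP rP ny dP _]] [Q c]]] := hx n.
exists Q^v.[y]; split; last exact: le_lt_trans c hn.
exists y, P^v, Q^v; split.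
- exact: monic_map.
- exact/rootP.
- by rewrite deriv_map.
- by move=> k; rewrite coef_map; split; [apply: AA_BQp; exact: vA_AA|exact: vA_le1].
- by split=> // k; rewrite coef_map; apply: AA_BQp; exact: vA_AA.
Qed.

Lemma monic_root_le1 (F : padic) (P : {poly F}) (y : F) : P \is monic -> (forall k, W P`_k) ->
 root P y -> W y.
Proof.
move=> mP hP /rootP rP; rewrite leNgt; apply/negP => ny; move: rP.
rewrite horner_coef; have := monic_neq0 mP; rewrite -size_poly_gt0; move: (monicP mP); rewrite /lead_coef.
case: (size P) => // n /= lc _; rewrite big_ord_recr /= lc mul1r => /eqP; rewrite addr_eq0 => /eqP e.
have n0 : 0 < `|y| by lra.
have : `|y ^+ n| < `|y ^+ n|.
 rewrite -{1}pnormN -e; case: n {lc e} => [|n]; first by rewrite big_ord0 pnorm0 pnorm1.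
 apply: (@le_lt_trans _ _ (`|y| ^+ n)); last by rewrite pnormX exprS ltr_pMl // exprn_gt0.
 apply: pnorm_sum_le => [|i _ _]; first by rewrite exprn_ge0 // ltW.
 rewrite pnormM pnormX -[X in _ <= X]mul1r; apply: ler_pM; rewrite ?pnorm_ge0 ?exprn_ge0 ?(ltW n0) //.
 by rewrite ler_eXn2l // -ltnS.
by rewrite ltxx.
Qed.

(** The generator y is a root of a monic integral polynomial with unit derivative, hence lies in
    [NN]. Denominators of Q are cleared by a power of p and removed afterwards by saturation. *)
Lemma Bnr_NN x : Bnr eps x -> W x -> NN x.
Proof.
move=> hx nx; apply: (cr_lim cr_NN) => n.
have [_ [[y [P [Q [mP rP dP hP [hQ ->]]]]] c]] := hx _ (ppow_gt0 n).
exists Q.[y]; last exact: ltW.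
have nz : W Q.[y].
 by rewrite -[Q.[y]](subKr x); apply: pnormB_le => //; apply: (le_trans (ltW c)); exact: ppow_le1.
have ny : W y by apply: monic_root_le1 mP _ rP => k; exact: (hP k).2.
have [P1 eP1] : exists P1 : {poly A}, P1^v = P.
 by apply: lift_srT => k; apply/AArP; apply: BQp_int_AA; [exact: (hP k).1|exact: (hP k).2].
have hy : NN y.
 by apply: (@NN_etale P1) => //; [rewrite eP1; exact/rootP|rewrite -deriv_map eP1].
have [k hk] : exists k, forall i, AA (p%:R ^+ k * Q`_i).
 suff h m : exists k, forall i, (i < m)%N -> AA (p%:R ^+ k * Q`_i).
  have [k hk] := h (size Q); exists k => i; have [/hk//|hi] := ltnP i (size Q).
  by rewrite nth_default // mulr0 -(rmorph0 vA); exact: vA_AA.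
 elim: m => [|m [k hk]]; first by exists 0%N.
 have [k' hk'] := BQp_AA (hQ m); exists (k + k')%N => i; rewrite ltnS leq_eqVlt => /orP[/eqP ->|/hk h].
  rewrite exprD -mulrA; apply: AA_M => //; apply: AA_X; apply: AA_Rp; exact: Rp_nat.
 rewrite addnC exprD -mulrA; apply: AA_M => //; apply: AA_X; apply: AA_Rp; exact: Rp_nat.
have [Q1 eQ1] : exists Q1 : {poly A}, Q1^v = p%:R ^+ k *: Q.
 by apply: lift_srT => i; apply/AArP; rewrite coefZ.
apply: (saturate (k := k) NN_sat) => //; rewrite -hornerZ -eQ1; exact: (cr_horner _ cr_NN hy).
Qed.

(** Reduces invariants to the residue fields: the residue of x is in E by the hypothesis on
    separable elements, a lift of it in A_{Q_p} is itself invariant, and the difference divided by p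
    is treated in turn. *)
Lemma NN_fixed (H : galois S -> Prop) x : (forall g, H g -> fixes_cyclo g) ->
 (forall t, sepel p eE t -> (forall g, H g -> gt g t = t) -> t \in sf EE) ->
 NN x -> (forall g, H g -> galB g x = x) -> AA x.
Proof.
move=> hH core hx fx; apply: AA_cl => n; elim: n x hx fx => [|n IH] x hx fx.
 exists 0; split; first by rewrite -(rmorph0 vA); exact: vA_AA.
 by apply/cong0P; rewrite ppow0; exact: NN_le1.
have nx := NN_le1 hx.
have /EEP[a ha ea] : res x \in sf EE.
 by apply: core => [|g hg]; [exact: NN_res|rewrite -res_gal // fx].
have na := AA_le1 ha.
have [|x' nx' ex'] := @B_div 1 (x - a); first by apply/res_cong.
rewrite expr1 in ex'.
have [||b [hb cb]] := IH x'.
- by apply: NN_sat => //; rewrite -ex'; apply: NN_B => //; exact: NN_AA.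
- move=> g hg; apply: (mulfI (pF_neq0 (F := B))).
 have := congr1 (galB g) ex'; rewrite rmorphM rmorph_nat rmorphB /= fx // => <-.
 by rewrite (AA_gal_fix (hH g hg) ha).
exists (a + p%:R * b); split.
 by apply: AA_D => //; apply: AA_M => //; apply: AA_Rp; exact: Rp_nat.
rewrite -[x](subrK a) ex' addrC; apply: congD => //.
have c1 : cong (1 + n) (p%:R ^+ 1 * x') (p%:R ^+ 1 * b) by exact: congMp.
by rewrite !expr1 in c1.
Qed.

End Unramified.

(** * Conjugate algebraic elements have the same norm *)

Section ConjugateNorms.
Context (iC : {rmorphism K -> C}) (iC_norm : forall a, `|iC a| = `|a|).
Implicit Types (P Q : {poly K}) (x y z : C).
Local Notation "P ^i" := (map_poly iC P) (at level 2, format "P ^i").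

Lemma coef_bound n x (e : R) P : 0 <= e -> (forall k, (k < n)%N -> `|P`_k| <= e) -> (size P <= n)%N ->
 `|P^i.[x]| <= e * (1 + `|x|) ^+ n.
Proof.
move=> e0 hP sP; have h1 : 1 <= 1 + `|x| by rewrite lerDl pnorm_ge0.
rewrite (@horner_coef_wide _ n) ?size_map_poly //; apply: pnorm_sum_le => [|i _ _].
 by rewrite mulr_ge0 // exprn_ge0 // (le_trans ler01).
rewrite pnormM pnormX coef_map iC_norm; apply: ler_pM; rewrite ?pnorm_ge0 ?exprn_ge0 ?pnorm_ge0 ?hP //.
apply: (@le_trans _ _ ((1 + `|x|) ^+ i)); first by rewrite lerXn2r ?nnegrE ?pnorm_ge0 ?(le_trans ler01) // lerDr.
by apply: ler_weXn2l => //; exact: ltnW.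
Qed.

(** Equivalence of norms on a finite-dimensional space over a complete field. In the induction, if
    x^n were approximated arbitrarily well by values of polynomials of smaller degree, their
    coefficients would converge, and the limit would be a linear relation. *)
Lemma lin_bound x n : (forall Q, (size Q <= n)%N -> Q^i.[x] = 0 -> Q = 0) ->
 exists2 c : R, 0 < c & forall Q, (size Q <= n)%N -> forall k, `|Q`_k| <= c * `|Q^i.[x]|.
Proof.
elim: n => [|n IH] h.
 exists 1 => // Q; rewrite leqn0 size_poly_eq0 => /eqP -> k.
 by rewrite coef0 pnorm0 mulr_ge0 ?pnorm_ge0.
have [Q sQ|c0 c00 hc] := IH; first by apply: h; exact: leqW.
have [d d0 hd] : exists2 d : R, 0 < d & forall Q, (size Q <= n)%N -> d <= `|x ^+ n + Q^i.[x]|.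
 apply: contrapT => nd.
 have [e he] : exists e : nat, c0 <= p%:R ^+ e.
  have ci : 0 < c0^-1 by rewrite invr_gt0.
  have [e he] := ppow_small ci.
  exists e; have := ltW he; rewrite -[X in _ <= X -> _]mul1r ler_pdivlMr // mulrC.
  by rewrite ler_pdivrMr ?mul1r // exprn_gt0 // pr_gt0.
 have hm (m : nat) : exists Q, (size Q <= n)%N /\ `|x ^+ n + Q^i.[x]| <= p%:R ^- (m + e).
  apply: contrapT => hm; apply: nd; exists (p%:R ^- (m + e)) => //.
  move=> Q sQ; rewrite leNgt; apply/negP => /ltW hh; apply: hm; by exists Q.
 have [q hq] := choice hm.
 have hv i (m : nat) : cong m (q m.+1)`_i (q m)`_i.
  rewrite /cong -coefB; apply: (@le_trans _ _ (c0 * `|(q m.+1 - q m)^i.[x]|)).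
   apply: hc; rewrite (leq_trans (size_polyD _ _)) // size_polyN geq_max (hq _).1 (hq _).1 //.
  apply: (@le_trans _ _ (p%:R ^+ e * p%:R ^- (m + e))).
   apply: ler_pM; rewrite ?pnorm_ge0 ?(ltW c00) // rmorphB hornerD hornerN.
   have -> : (q m.+1)^i.[x] - (q m)^i.[x] = (x ^+ n + (q m.+1)^i.[x]) - (x ^+ n + (q m)^i.[x]) by ring.
   apply: pnormB_le; last exact: (hq _).2.
   by apply: (le_trans (hq _).2); apply: ppow_le; rewrite addSn.
  by rewrite addnC ppowD mulrA divff ?mul1r // expf_neq0 // lt0r_neq0 // pr_gt0.
 have hl i : exists l, forall m, cong m l (q m)`_i.
  by have [l [_ hl]] := padic_lim (hv i); exists l.
 have [l {}hl] := choice hl; pose Q := \poly_(i < n) l i.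
 have eQ m k : cong m Q`_k (q m)`_k.
  rewrite coef_poly; case: ltnP => hk => //.
  by rewrite nth_default ?(leq_trans (hq m).1) //; exact: congxx.
 have : x ^+ n + Q^i.[x] = 0.
  apply: cong_eq => m; apply/cong0P.
  have [m' hm'] : exists m', p%:R ^- m' * (1 + `|x|) ^+ n <= p%:R ^- m.
   have h1 : 0 < (1 + `|x|) ^+ n by rewrite exprn_gt0 // ltr_wpDr ?pnorm_ge0.
   have [m' hm'] := ppow_small (divr_gt0 (ppow_gt0 m) h1).
   by exists m'; rewrite -ler_pdivlMr // ltW.
  pose M := maxn m m'.
  have -> : x ^+ n + Q^i.[x] = (x ^+ n + (q M)^i.[x]) + (Q - q M)^i.[x].
   by rewrite rmorphB hornerD hornerN; ring.
  apply: pnormD_le.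
   by apply: (le_trans (hq M).2); apply: ppow_le; rewrite (leq_trans (leq_maxl m m')) // leq_addr.
  apply: le_trans hm'; apply: le_trans (@coef_bound n x _ _ (ppow_ge0 M) _ _) _ => [k _||].
  - by rewrite coefB; exact: eQ.
  - by rewrite (leq_trans (size_polyD _ _)) // size_polyN geq_max size_poly (hq _).1.
  rewrite ler_wpM2r ?exprn_ge0 ?addr_ge0 ?pnorm_ge0 //; apply: ppow_le; exact: leq_maxr.
 have sQ : (size Q <= n)%N by exact: size_poly.
 move=> e0; have h0 : 'X^n + Q = 0.
  apply: h; last by rewrite rmorphD /= map_polyXn hornerD hornerXn.
  by rewrite (leq_trans (size_polyD _ _)) // geq_max size_polyXn leqnn (leq_trans sQ).
 have := lead_coef0 K; rewrite -h0 lead_coefDl ?size_polyXn // lead_coefXn => /eqP.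
 by rewrite oner_eq0.
have n0 : 0 <= `|x| ^+ n by rewrite exprn_ge0 ?pnorm_ge0.
pose c1 := c0 * (1 + `|x| ^+ n / d); have c11 : c0 <= c1.
 by rewrite ler_peMr ?(ltW c00) // lerDl divr_ge0 ?(ltW d0).
have c10 : 0 < c1 by lra.
exists (d^-1 + c1) => [|Q sQ k]; first by rewrite addr_gt0 ?invr_gt0.
pose Q0 := take_poly n Q; pose c := Q`_n.
have eQ : Q = Q0 + c *: 'X^n.
 apply/polyP => i; rewrite coefD coefZ coefXn coef_take_poly.
 have [hi|hi|->] := ltngtP i n; rewrite ?mulr0 ?addr0 ?mulr1 ?add0r //.
 by rewrite nth_default // (leq_trans sQ).
have sQ0 : (size Q0 <= n)%N by exact: size_take_poly.
have eQx : Q^i.[x] = Q0^i.[x] + iC c * x ^+ n.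
 by rewrite {1}eQ rmorphD /= map_polyZ map_polyXn hornerD hornerZ hornerXn.
have hcn : `|c| <= d^-1 * `|Q^i.[x]|.
 have [->|c00'] := eqVneq c 0; first by rewrite pnorm0 mulr_ge0 ?pnorm_ge0 ?invr_ge0 ?(ltW d0).
 have ic0 : iC c != 0 by rewrite fmorph_eq0.
 have h2 := hd (c^-1 *: Q0) (leq_trans (size_scale_leq _ _) sQ0).
 rewrite mulrC ler_pdivlMr // eQx.
 have -> : Q0^i.[x] + iC c * x ^+ n = iC c * (x ^+ n + (c^-1 *: Q0)^i.[x]).
  by rewrite map_polyZ hornerZ fmorphV mulrDr mulVKf // addrC.
 by rewrite pnormM iC_norm ler_wpM2l ?pnorm_ge0.
have hQ0 j : `|Q0`_j| <= c1 * `|Q^i.[x]|.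
 apply: (le_trans (hc _ sQ0 j)); rewrite -mulrA ler_wpM2l ?(ltW c00) //.
 have -> : Q0^i.[x] = Q^i.[x] - iC c * x ^+ n by rewrite eQx addrK.
 apply: pnormB_le.
  by rewrite mulrDl mul1r lerDl mulr_ge0 ?pnorm_ge0 ?divr_ge0 ?(ltW d0).
 rewrite pnormM iC_norm pnormX mulrDl mul1r.
 apply: le_trans (_ : `|x| ^+ n / d * `|Q^i.[x]| <= _); last by rewrite lerDr pnorm_ge0.
 by rewrite mulrC -mulrA ler_wpM2l.
rewrite mulrDl eQ coefD coefZ coefXn; have d1 : 0 <= d^-1 * `|Q^i.[x]| by rewrite mulr_ge0 ?pnorm_ge0 ?invr_ge0 ?(ltW d0).
have d2 : 0 <= c1 * `|Q^i.[x]| by rewrite mulr_ge0 ?pnorm_ge0 ?(ltW c10).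
rewrite -eQ; apply: pnormD_le.
 by apply: (le_trans (hQ0 k)); rewrite lerDr.
case: (k == n); rewrite ?mulr1 ?mulr0 ?pnorm0 ?addr_ge0 //.
by apply: (le_trans hcn); rewrite lerDl.
Qed.

Definition conjugate x y := forall Q, Q^i.[x] = 0 -> Q^i.[y] = 0.

Lemma pow_le1 (t D : R) : 0 <= t -> (forall m, t ^+ m <= D) -> t <= 1.
Proof.
move=> t0 h; rewrite leNgt; apply/negP => t1.
have D0 : 0 < D by apply: lt_le_trans (h 0%N); rewrite expr0.
have tp : 0 < t by lra.
have [|||N hN] := @pow_small t^-1 (D^-1).
- by rewrite invr_ge0.
- by rewrite invf_lt1.
- by rewrite invr_gt0.
by have := hN N (leqnn N); rewrite exprVn ltf_pV2 ?posrE ?exprn_gt0 // ltNge h.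
Qed.

(** x^m and y^m are values of one polynomial r of bounded degree, whose coefficients are at most a
    constant times the norm of x^m. So the powers of the ratio of the two norms stay bounded. *)
Lemma conj_le x y : algebraicOver iC x -> conjugate x y -> `|y| <= `|x|.
Proof.
move=> ax xy; have [x0|x0] := eqVneq x 0.
 by have := xy 'X; rewrite map_polyX !hornerX x0 => ->.
have [P [mP rP hP]] := field_minp ax; pose n := (size P).-1.
have sP : size P = n.+1 by rewrite prednK // size_poly_gt0 monic_neq0.
have [Q sQ rQ|c c0 hc] := @lin_bound x n.
 apply/eqP; apply: contraTT sQ => Q0; rewrite -ltnNge -sP; apply: dvdp_leq => //; exact: hP.
have nx : 0 < `|x| by rewrite lt_neqAle pnorm_ge0 eq_sym pnorm_eq0 x0.
rewrite -[`|x|]mul1r -ler_pdivrMr //.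
apply: (@pow_le1 _ (c * (1 + `|y|) ^+ n)); first by rewrite divr_ge0 ?pnorm_ge0.
move=> m; pose r := 'X^m %% P.
have sr : (size r <= n)%N by rewrite -ltnS -sP ltn_modp monic_neq0.
have er z : P^i.[z] = 0 -> z ^+ m = r^i.[z].
 move=> rz; have := congr1 (fun P => P^i.[z]) (divp_eq 'X^m P).
 by rewrite rmorphD rmorphM /= map_polyXn hornerXn hornerD hornerM rz mulr0 add0r.
rewrite exprMn exprVn ler_pdivrMr ?exprn_gt0 // -!pnormX (er y (xy _ rP)).
rewrite mulrAC; apply: coef_bound => // [|k _]; first by rewrite mulr_ge0 ?pnorm_ge0 ?(ltW c0).
by rewrite (er x) //; exact: hc.
Qed.

Lemma conj_norm x y : algebraicOver iC x -> conjugate x y -> `|y| = `|x|.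
Proof.
move=> ax xy; have [x0|x0] := eqVneq x 0.
 by have := xy 'X; rewrite map_polyX !hornerX x0 => ->.
have [B eB] := gen_inv ax (gen_id iC x).
have e1 : y * B^i.[y] = 1.
 have := xy ('X * B - 1); rewrite !rmorphB !rmorphM !rmorph1 /= map_polyX !hornerD !hornerM !hornerN !hornerX !hornerC.
 by rewrite -eB divff // subrr => /(_ erefl)/eqP; rewrite subr_eq0 => /eqP.
have y0 : y != 0 by apply: contraNneq (oner_neq0 C) => y0; rewrite -e1 y0 mul0r.
have eBy : y^-1 = B^i.[y] by apply: (mulfI y0); rewrite divff.
apply: le_anti; rewrite conj_le //=.
have := @conj_le x^-1 y^-1; rewrite !pnormV lef_pV2 ?posrE ?lt_neqAle ?pnorm_ge0 1?eq_sym ?pnorm_eq0 ?x0 ?y0 //.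
apply; first by apply: (gen_alg ax); exact: gen_inv (gen_id _ _).
by move=> Q; rewrite eB eBy -!horner_comp -!map_comp_poly; exact: xy.
Qed.

End ConjugateNorms.

(** * Extension of isometric relations by continuity *)

Section DenseExtension.
Implicit Types (x y z : C) (G : C -> C -> Prop).

(** Automorphisms are handled as graphs, so that inverses are free: the same lemmas give totality
    and surjectivity of the extension to C_p. *)
Definition rel_closure G x y := forall e : R, 0 < e -> exists x' y', [/\ G x' y', `|x - x'| < e & `|y - y'| < e].

Definition isom_rel G := forall x y x' y', G x y -> G x' y' -> `|x - x'| = `|y - y'|.

Lemma rel_closure_isom G : isom_rel G -> isom_rel (rel_closure G).
Proof.
move=> h x y x' y' h1 h2; apply/eqP; rewrite eq_le; apply/andP.
have st (u v u' v' : C) (e : R) : `|u - u'| < e -> `|v - v'| < e -> `|u' - v'| <= `|u - v| + e.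
 move=> c c'; have -> : u' - v' = (u - v) + ((v - v') - (u - u')) by ring.
 have e0 : 0 < e by apply: le_lt_trans c; exact: pnorm_ge0.
 apply: pnormD_le; first by lra.
 apply: (@le_trans _ _ e); last by rewrite lerDr pnorm_ge0.
 by apply: pnormB_le; exact: ltW.
have key (u v u' v' : C) : (forall e : R, 0 < e -> `|u' - v'| <= `|u - v| + e) -> `|u' - v'| <= `|u - v|.
 by move=> hh; apply/ler_addgt0Pr => e e0; exact: hh.
have dbl (e : R) : 0 < e -> 0 < e / 2 by lra.
split; apply: key => e e0; have [x1 [y1 [g1 a1 b1]]] := h1 _ (dbl _ e0); have [x2 [y2 [g2 a2 b2]]] := h2 _ (dbl _ e0);
 have ee := h _ _ _ _ g1 g2; rewrite (splitr e) addrA.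
- rewrite pnormBC in a1; rewrite pnormBC in a2; apply: (le_trans (st _ _ _ _ _ a1 a2)).
 by rewrite lerD2r ee; exact: st b1 b2.
- rewrite pnormBC in b1; rewrite pnormBC in b2; apply: (le_trans (st _ _ _ _ _ b1 b2)).
 by rewrite lerD2r -ee; exact: st a1 a2.
Qed.

Lemma rel_closure_total G (D : C -> Prop) : isom_rel G -> (forall x, D x -> exists y, G x y) ->
 (forall x (e : R), 0 < e -> exists y, D y /\ `|x - y| < e) ->
 forall x, exists y, rel_closure G x y.
Proof.
move=> hG tot dense x.
have h (n : nat) : exists xy, G xy.1 xy.2 /\ `|x - xy.1| < p%:R ^- n.
 have [x' [/tot[y hy] c]] := dense x _ (ppow_gt0 n); by exists (x', y).
have [v hv] := choice h.
have [n|l [_ hl]] := @padic_lim _ (fun n => (v n).2).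
 rewrite /cong -(hG _ _ _ _ (hv n.+1).1 (hv n).1).
 have -> : (v n.+1).1 - (v n).1 = (x - (v n).1) - (x - (v n.+1).1) by ring.
 apply: pnormB_le; apply: ltW; first exact: (hv n).2.
 by apply: (lt_le_trans (hv n.+1).2); exact: ppow_le.
exists l => e e0; have [n hn] := ppow_small e0.
exists (v n).1, (v n).2; split; first exact: (hv n).1.
- exact: lt_trans (hv n).2 hn.
- exact: le_lt_trans (hl n) hn.
Qed.

Lemma isom_rel_fun G x y y' : isom_rel G -> G x y -> G x y' -> y = y'.
Proof.
by move=> h h1 h2; have /eqP := h _ _ _ _ h1 h2; rewrite subrr pnorm0 eq_sym pnorm_eq0 subr_eq0 => /eqP.
Qed.

Lemma rel_closureB G x y x' y' : (forall x y x' y', G x y -> G x' y' -> G (x - x') (y - y')) ->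
 rel_closure G x y -> rel_closure G x' y' -> rel_closure G (x - x') (y - y').
Proof.
move=> h h1 h2 e e0; have [x1 [y1 [g1 a1 b1]]] := h1 e e0; have [x2 [y2 [g2 a2 b2]]] := h2 e e0.
exists (x1 - x2), (y1 - y2); split; first by clo.
- have -> : x - x' - (x1 - x2) = (x - x1) - (x' - x2) by ring.
 by apply: pnormD_lt; rewrite ?pnormN.
- have -> : y - y' - (y1 - y2) = (y - y1) - (y' - y2) by ring.
 by apply: pnormD_lt; rewrite ?pnormN.
Qed.

Lemma mul_cont (e : R) x y : 0 < e -> exists2 d : R, 0 < d &
 forall x' y', `|x - x'| < d -> `|y - y'| < d -> `|x * y - x' * y'| < e.
Proof.
move=> e0; pose c := 1 + `|x| + `|y|.
have c0 : 0 < c by rewrite /c -addrA ltr_pwDl ?addr_ge0 ?pnorm_ge0.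
exists (Num.min 1 (e / c)); first by rewrite lt_min ltr01 divr_gt0.
move=> x' y'; rewrite !lt_min => /andP[a1 a2] /andP[b1 b2].
have -> : x * y - x' * y' = (x - x') * y + x' * (y - y') by ring.
rewrite ltr_pdivlMr // in a2; rewrite ltr_pdivlMr // in b2.
apply: pnormD_lt; rewrite pnormM.
 apply: le_lt_trans a2; rewrite ler_wpM2l ?pnorm_ge0 // lerDr addr_ge0 ?pnorm_ge0 //.
apply: le_lt_trans b2; rewrite mulrC ler_wpM2l ?pnorm_ge0 //.
have -> : x' = x - (x - x') by ring.
apply: pnormB_le; first by rewrite /c -addrA addrCA lerDl addr_ge0 ?pnorm_ge0.
by apply: (le_trans (ltW a1)); rewrite /c -addrA lerDl addr_ge0 ?pnorm_ge0.
Qed.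

Lemma rel_closureM G x y x' y' : (forall x y x' y', G x y -> G x' y' -> G (x * x') (y * y')) ->
 rel_closure G x y -> rel_closure G x' y' -> rel_closure G (x * x') (y * y').
Proof.
move=> h h1 h2 e e0; have [d1 d10 hd1] := mul_cont x x' e0; have [d2 d20 hd2] := mul_cont y y' e0.
have d0 : 0 < Num.min d1 d2 by rewrite lt_min d10.
have [x1 [y1 [g1 a1 b1]]] := h1 _ d0; have [x2 [y2 [g2 a2 b2]]] := h2 _ d0.
move: a1 b1 a2 b2; rewrite !lt_min => /andP[a1 _] /andP[_ b1] /andP[a2 _] /andP[_ b2].
by exists (x1 * x2), (y1 * y2); split; [exact: h|exact: hd1|exact: hd2].
Qed.

Lemma rel_closure_sub G x y : G x y -> rel_closure G x y.
Proof. by move=> h e e0; exists x, y; rewrite !subrr pnorm0. Qed.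

End DenseExtension.

(** * Extension of automorphisms of algebraic elements to C_p, and Galois correspondence *)

Section Automorphisms.
Local Notation alg := (algebraicOver iC).
Local Notation CC := (C * C)%type.
Implicit Types (x y z : C) (t s : T) (Q : {poly K}) (G : C -> C -> Prop).

(** The action on coordinates is a ring endomorphism of the tilt, which lifts to Witt vectors;
    inverting p extends it to the whole field. A scaled unit and its inverse both have integral
    images, whence the isometry. *)
Lemma galB_ex (gC : {rmorphism C -> C}) : isometric gC ->
 exists gB : {rmorphism B -> B}, (forall x : B, `|gB x| = `|x|) /\
  forall x : B, W x -> forall n, tcoord (res (gB x)) n = gC (tcoord (res x) n).
Proof.
move=> ng; have /choice[f hf] : forall t : T, exists s, forall n, tcoord s n = gC (tcoord t n).
 move=> t; have [n|s hs] := @tcoord_surj _ _ S (fun n => gC (tcoord t n)).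
  by rewrite -rmorphXn tcoord_compat.
 by exists s => n; rewrite hs.
have f_eq t s : (forall n, tcoord s n = gC (tcoord t n)) -> f t = s.
 by move=> h; apply: tcoordP => n; rewrite hf h.
have f0 : f 0 = 0 by apply: f_eq => n; rewrite !tcoord_zero rmorph0.
have f1 : f 1 = 1 by apply: f_eq => n; rewrite !tcoord_one rmorph1.
have fM s t : f (s * t) = f s * f t by apply: f_eq => n; rewrite !tcoordM !hf rmorphM.
have fD s t : f (s + t) = f s + f t.
 apply: f_eq => n; apply: (tends_uniq (tcoordD (f s) (f t) n)).
 have /tendsP h := tcoordD s t n; apply/tendsP => e /h[M hM]; exists M => m /hM.
 by rewrite !hf -rmorphD -rmorphXn -rmorphB ng.
have wd : witt_datum (fun=> True) (teich \o f : T -> B) by exact: wd_teich_comp.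
pose tf := th (fun=> True) (teich \o f : T -> B).
pose r (x y : B) := exists n, tf (p%:R ^+ n * x) (p%:R ^+ n * y).
have thp n (x y : B) : tf x y ->
  tf (p%:R ^+ n * x) (p%:R ^+ n * y).
 by move=> h; apply: (thM wd) => //; apply: (thX wd); exact: th_nat.
have up n m (x y : B) : tf (p%:R ^+ n * x) (p%:R ^+ n * y) ->
  tf (p%:R ^+ (m + n) * x) (p%:R ^+ (m + n) * y).
 by rewrite exprD -!mulrA; exact: thp.
have r_fun (x y y' : B) : r x y -> r x y' -> y = y'.
 move=> [n hn] [m hm]; have := th_uniq wd (up _ m _ _ hn) (_ : tf _ (p%:R ^+ (m + n) * y')).
 by move=> h; apply: (mulfI (pX_neq0 (m + n))); apply: h; rewrite addnC; exact: up.
have r_tot (x : B) : exists y : B, r x y.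
 have [n hn] := F_scale x; have [w hw] := th_total wd hn.
 by exists (w / p%:R ^+ n), n; rewrite mulrCA divff ?mulr1 ?pX_neq0.
have [g hg] := choice r_tot.
have [|x y|x y|gB hB] := @rmorph_ex B B g.
- by apply: (r_fun 1) => //; exists 0%N; rewrite expr0 !mulr1; exact: th1.
- apply: (r_fun (x - y)) => //; have [n hn] := hg x; have [m hm] := hg y; exists (m + n)%N.
 by rewrite !mulrBr; apply: thB; [exact: up|rewrite addnC; exact: up].
- apply: (r_fun (x * y)) => //; have [n hn] := hg x; have [m hm] := hg y; exists (n + m)%N.
 by rewrite exprD [X in tf X]mulrACA [X in tf _ X]mulrACA; exact: (thM wd).
have gW (x : B) : W x -> tf x (gB x).
 move=> nx; have [w hw] := th_total wd nx; suff -> : gB x = w by [].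
 by rewrite hB; apply: (r_fun x) => //; exists 0%N; rewrite expr0 !mul1r.
have g1 (x : B) : `|x| = 1 -> `|gB x| = 1.
 move=> nx; have h1 : W (gB x).
  by have [] := th_norm_le1 wd (gW x _); rewrite ?nx.
 have nx' : `|x^-1| = 1 by rewrite pnormV nx invr1.
 have h2 : W (gB x^-1).
  by have [] := th_norm_le1 wd (gW x^-1 _); rewrite ?nx'.
 have e : `|gB x| * `|gB x^-1| = 1 by rewrite -pnormM -rmorphM divff ?rmorph1 ?pnorm1 ?norm1N0.
 by apply/eqP; rewrite eq_le h1 /= -e ler_piMr // pnorm_ge0.
exists gB; split=> [x|x nx n].
 have [->|x0] := eqVneq x 0; first by rewrite rmorph0.
 have [n [k nu]] := unit_scale x0.
 have := g1 _ nu; rewrite !rmorphM fmorphV !rmorphXn rmorph_nat -nu !pnormM.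
 have c0 : `|(p%:R ^+ k : B)^-1| != 0 by rewrite pnorm_eq0 invr_eq0 pX_neq0.
 have d0 : `|(p%:R ^+ n : B)| != 0 by rewrite pnorm_eq0.
 by move=> /(mulIf c0)/(mulfI d0).
have h := gW _ nx; have [_ c] := th_res wd h; have [_ nw] := th_norm_le1 wd h.
have -> : res (gB x) = f (res x).
 by rewrite -[f _]res_teich; apply/res_cong => //; exact: W_teich.
exact: hf.
Qed.

Lemma closed_root (P : {poly C}) : P \is monic -> (1 < size P)%N -> exists x, root P x.
Proof.
move=> mP sP; have n0 : (0 < (size P).-1)%N by case: (size P) sP => [|[]].
have [x hx] := @Cp_closed _ _ S _ (fun i => - P`_i) n0.
exists x; rewrite rootE horner_coef; move: hx (monicP mP); rewrite /lead_coef.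
case: (size P) sP => // n _ /= hx lc; rewrite big_ord_recr /= lc mul1r hx -big_split /= big1 //.
by move=> i _; rewrite mulNr subrr.
Qed.

Record partial_aut G : Prop := PartialAut {
 pa_alg : forall x y, G x y -> alg x /\ alg y;
 pa_K : forall a, G (iC a) (iC a);
 pa_B : forall x y x' y', G x y -> G x' y' -> G (x - x') (y - y');
 pa_M : forall x y x' y', G x y -> G x' y' -> G (x * x') (y * y');
 pa_0 : forall y, G 0 y -> y = 0 }.

Section Partial.
Context (G : C -> C -> Prop) (hG : partial_aut G).

Lemma pa_D x y x' y' : G x y -> G x' y' -> G (x + x') (y + y').
Proof.
move=> h h'; rewrite -[x']opprK -[y']opprK -[- x']sub0r -[- y']sub0r; apply: (pa_B hG) => //.
by apply: (pa_B hG) => //; rewrite -(rmorph0 iC); exact: pa_K.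
Qed.

Lemma pa_horner Q x y : G x y -> G (map_poly iC Q).[x] (map_poly iC Q).[y].
Proof.
move=> h; elim/poly_ind: Q => [|Q a IH]; first by rewrite rmorph0 !horner0 -(rmorph0 iC); exact: pa_K.
rewrite rmorphD rmorphM /= map_polyX map_polyC !hornerMXaddC; apply: pa_D; last exact: pa_K.
exact: pa_M.
Qed.

Lemma pa_conj x y : G x y -> conjugate iC x y.
Proof. by move=> h Q rQ; have := pa_horner Q h; rewrite rQ; exact: pa_0. Qed.

Lemma pa_norm x y : G x y -> `|y| = `|x|.
Proof.
by move=> h; apply: (conj_norm (@QpCp_norm _ _ S)); [exact: (pa_alg hG h).1|exact: pa_conj].
Qed.

Lemma pa_isom : isom_rel G.
Proof. by move=> x y x' y' h h'; rewrite (pa_norm (pa_B hG h h')). Qed.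

Lemma pa_closed : subring_closed ([pred z | `[< G z.1 z.2 >]] : {pred CC}).
Proof.
split=> [|x y /asboolP hx /asboolP hy|x y /asboolP hx /asboolP hy]; apply/asboolP => /=.
- by rewrite -(rmorph1 iC); exact: pa_K.
- exact: pa_B.
- exact: pa_M.
Qed.
Let A := srT (Subring pa_closed).
Let v := srv (Subring pa_closed).

Lemma pa_val (a : A) : G (v a).1 (v a).2.
Proof. by have /asboolP := srvP a. Qed.
Lemma pa_ex x y : G x y -> exists a : A, v a = (x, y).
Proof. by move=> h; apply: srv_ex; apply/asboolP. Qed.

Lemma pa_inv (a : A) : a != 0 -> exists b, b * a = 1.
Proof.
move=> a0; have h := pa_val a; have x0 : (v a).1 != 0.
 apply: contraNneq a0 => x0; apply/eqP; apply: (@srv_inj _ (Subring pa_closed)); rewrite rmorph0 -/v.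
 by move: h; rewrite x0 => /(pa_0 hG) y0; apply/eqP; rewrite -pair_eqE /= x0 y0 eqxx.
have [Q eQ] := gen_inv (pa_alg hG h).1 (gen_id iC (v a).1).
have [b eb] := pa_ex (pa_horner Q h).
have e : (map_poly iC ('X * Q - 1)).[(v a).2] = 0.
 apply: (pa_conj h); rewrite rmorphB rmorphM rmorph1 /= map_polyX hornerD hornerM hornerN hornerX hornerC -eQ.
 by rewrite divff // subrr.
move: e; rewrite rmorphB rmorphM rmorph1 /= map_polyX hornerD hornerM hornerN hornerX hornerC.
move=> /eqP; rewrite subr_eq0 => /eqP e.
exists b; apply: (@srv_inj _ (Subring pa_closed)); rewrite rmorphM rmorph1 -/v eb.
by apply/eqP; rewrite -pair_eqE /= -eQ mulVf // mulrC e !eqxx.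
Qed.

(** One step of the extension, with the graph as base ring: y is a root of the conjugate of the
    minimal polynomial of x, and the pairs (Q_1(x), Q_2(y)) form a larger partial automorphism,
    which maximality identifies with G. *)
Lemma pa_extend x : alg x -> (forall G', partial_aut G' -> (forall a b, G a b -> G' a b) -> forall a b, G' a b -> G a b) ->
 exists y, G x y.
Proof.
move=> ax hmax.
pose f1 : {rmorphism A -> C} := (fst : {rmorphism CC -> C}) \o v.
pose f2 : {rmorphism A -> C} := (snd : {rmorphism CC -> C}) \o v.
have f1a (Q : {poly A}) i : integralOver iC (map_poly f1 Q)`_i.
 by rewrite coef_map; apply/integral_algebraic; exact: (pa_alg hG (pa_val _)).1.
have f2a (Q : {poly A}) i : integralOver iC (map_poly f2 Q)`_i.
 by rewrite coef_map; apply/integral_algebraic; exact: (pa_alg hG (pa_val _)).2.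
have [Q0 Q00 /rootP rQ0] := ax.
have [|P0 hP0] := @poly_choice A C (fun a c => v a = (c, c)) (map_poly iC Q0) (rmorph0 v).
 by move=> i; rewrite coef_map; apply: pa_ex; exact: pa_K.
have e0 : map_poly f1 P0 = map_poly iC Q0 by apply/polyP => i; rewrite coef_map /= hP0.
have P00 : P0 != 0.
 by apply: contraNneq Q00 => P00; rewrite -(map_poly_eq0 iC) -e0 P00 rmorph0.
have [|P [mP rP hP]] := @minp_ex A C f1 x pa_inv; first by exists P0; rewrite ?e0.
have s1 : (1 < size (map_poly f2 P))%N.
 rewrite size_map_poly_id0; last by rewrite (monicP mP) rmorph1 oner_eq0.
 rewrite ltnNge; apply/negP => /size1_polyC eP; move: rP mP; rewrite eP map_polyC hornerC monicE lead_coefC.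
 move=> e /eqP e'; have h1 : f1 P`_0 = 1 by rewrite e'; exact: rmorph1.
 by have /eqP := etrans (esym h1) e; rewrite oner_eq0.
have [y /rootP ry] := closed_root (monic_map f2 mP) s1.
have ay : alg y.
 apply/integral_algebraic; apply: (integral_root_monic (monic_map f2 mP)); first exact/rootP.
 by apply/integral_poly.
pose G' a b := exists Q : {poly A}, a = (map_poly f1 Q).[x] /\ b = (map_poly f2 Q).[y].
have sub a b : G a b -> G' a b.
 by move=> /pa_ex[c ec]; exists c%:P; rewrite !map_polyC !hornerC /= ec.
have hG' : partial_aut G'.
 split=> [a b [Q [-> ->]]|a|a b a' b' [Q [-> ->]] [Q' [-> ->]]|a b a' b' [Q [-> ->]] [Q' [-> ->]]|b [Q [/esym rQ ->]]].
 - split; apply/integral_algebraic; apply: integral_horner; try exact/integral_algebraic; exact/integral_poly.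
 - by apply: sub; exact: pa_K.
 - by exists (Q - Q'); rewrite !rmorphB !hornerD !hornerN.
 - by exists (Q * Q'); rewrite !rmorphM !hornerM.
 - by have [D ->] := hP _ rQ; rewrite rmorphM hornerM ry mulr0.
exists y; apply: (hmax _ hG' sub); exists 'X; by rewrite !map_polyX !hornerX.
Qed.

End Partial.

Lemma partial_aut_max G : partial_aut G -> exists G', [/\ partial_aut G', forall a b, G a b -> G' a b &
 forall G2, partial_aut G2 -> (forall a b, G' a b -> G2 a b) -> forall a b, G2 a b -> G' a b].
Proof.
move=> hG; pose P (X : set CC) := X = set0 \/ (partial_aut (fun a b => X (a, b)) /\ forall a b, G a b -> X (a, b)).
have [F FP tF|X [PX mX]] := @Zorn_bigcup CC P.
 have [h0|/existsNP[X0 hX0]] := pselect (forall X, F X -> X = set0).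
  by left; rewrite -subset0 => z [X /h0 ->].
 have {hX0} [FX0 X00] : F X0 /\ X0 <> set0 by apply/not_implyP.
 right; have hX X : F X -> forall z : CC, X z -> partial_aut (fun a b => X (a, b)) /\ forall a b, G a b -> X (a, b).
  by move=> /FP[->|] // z.
 have [h1 h2] : partial_aut (fun a b => X0 (a, b)) /\ forall a b, G a b -> X0 (a, b) by case: (FP _ FX0).
 have both (z z' : CC) : (\bigcup_(X in F) X)%classic z -> (\bigcup_(X in F) X)%classic z' ->
   exists X, [/\ F X, partial_aut (fun a b => X (a, b)), X z & X z'].
  move=> [X FX Xz] [X' FX' Xz']; have [hh|hh] := tF _ _ FX FX'.
   by exists X'; split=> //; [exact: (hX _ FX' _ Xz').1|exact: hh].
  by exists X; split=> //; [exact: (hX _ FX _ Xz).1|exact: hh].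
 split; last by move=> a b /h2 hab; exists X0.
 split=> [a b [X FX Xz]|a|a b a' b' h h'|a b a' b' h h'|b h].
 - exact: (pa_alg (hX _ FX _ Xz).1 Xz).
 - by exists X0 => //; exact: (pa_K h1).
 - by have [X [FX pX z1 z2]] := both _ _ h h'; exists X => //; exact: (pa_B pX).
 - by have [X [FX pX z1 z2]] := both _ _ h h'; exists X => //; exact: (pa_M pX).
 - by have [X [FX pX z1 _]] := both _ _ h h; exact: (pa_0 pX).
have maxX G2 : partial_aut G2 -> (forall a b, G a b -> G2 a b) -> (forall a b, X (a, b) -> G2 a b) ->
  forall a b, G2 a b -> X (a, b).
 move=> h2 g2 x2 a b hab; apply: contrapT => nX.
 have hP2 : P [set z : CC | G2 z.1 z.2]%classic by right; split.
 by apply: (mX _ _ hP2); split=> [[a' b'] /x2 //|/(_ (a, b) hab)].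
case: PX => [X0|[hX gX]].
 exfalso; have := maxX G hG (fun _ _ h => h) _ _ _ (pa_K hG 0); rewrite X0; apply=> // a b [].
exists (fun a b => X (a, b)); split=> // G2 h2 x2; apply: maxX => // a b /gX; exact: x2.
Qed.

(** The assignment of Q(y) to Q(x) for Q over M is a partial automorphism; a maximal one containing
    it is defined on all algebraic elements, and continuity extends it to C_p. *)
Theorem galois_ex (M : subfield C) x y : (forall a, iC a \in sf M) -> (forall z, z \in sf M -> alg z) ->
 alg x -> alg y -> (forall Q : {poly sfT M}, (map_poly (sfv M) Q).[x] = 0 -> (map_poly (sfv M) Q).[y] = 0) ->
 exists g : galois S, (forall z, z \in sf M -> galC g z = z) /\ galC g x = y.
Proof.
move=> KM aM ax ay hxy.
pose G0 a b := exists Q : {poly sfT M}, a = (map_poly (sfv M) Q).[x] /\ b = (map_poly (sfv M) Q).[y].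
have MG z : z \in sf M -> G0 z z.
 by move=> h; exists (Sub z h : sfT M)%:P; rewrite map_polyC !hornerC /= sfv_sub.
have cM (Q : {poly sfT M}) i : integralOver iC (map_poly (sfv M) Q)`_i.
 by rewrite coef_map; apply/integral_algebraic; apply: aM; exact: sfvP.
have hG0 : partial_aut G0.
 split=> [a b [Q [-> ->]]|a|a b a' b' [Q [-> ->]] [Q' [-> ->]]|a b a' b' [Q [-> ->]] [Q' [-> ->]]|b [Q [/esym rQ ->]]].
 - split; apply/integral_algebraic; apply: integral_horner; try exact/integral_algebraic; exact/integral_poly.
 - exact: MG.
 - by exists (Q - Q'); rewrite !rmorphB !hornerD !hornerN.
 - by exists (Q * Q'); rewrite !rmorphM !hornerM.
 - exact: hxy.
have [G [hG sG mG]] := partial_aut_max hG0.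
have iG := pa_isom hG; have tG z : alg z -> exists z', G z z' by move=> h; exact: pa_extend.
have iG' : isom_rel (fun a b => G b a) by move=> a b a' b' h h'; rewrite (iG _ _ _ _ h h').
(* Surjectivity on algebraic elements: G maps a largest set of distinct roots of P injectively to
   roots of P; if z were missed, adding it to the images would give a larger set. *)
have sG' z : alg z -> exists z', G z' z.
 move=> [P P0 rP]; pose rts (s : seq C) := uniq s && all (root (map_poly iC P)) s.
 have P0' : map_poly iC P != 0 by rewrite map_poly_eq0.
 have hex : exists n, `[< exists2 s, rts s & size s = n >] by exists 0%N; apply/asboolP; exists [::].
 have hub n : `[< exists2 s, rts s & size s = n >] -> (n <= size (map_poly iC P))%N.
  by move=> /asboolP[s /andP[us rs] <-]; apply: ltnW; exact: max_poly_roots.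
 case: (ex_maxnP hex hub) => n /asboolP[s /andP[us rs] ss] hmax.
 have /choice[g hg] : forall a, exists b, a \in s -> G a b.
  move=> a; case: (boolP (a \in s)) => [has|_]; last by exists 0.
  by have [|b hb] := tG a; [exists P => //; exact: (allP rs)|exists b].
 apply: contrapT => nz; have := hmax (size (z :: map g s)); rewrite /= size_map -ss ltnn.
 move=> h; suff : false by []. apply: h; apply/asboolP; exists (z :: map g s); rewrite /= ?size_map //.
 rewrite /rts /= rP /=; apply/andP; split; last first.
  apply/allP => _ /mapP[a has ->]; apply/rootP; apply: (pa_conj hG (hg _ has)); apply/rootP.
  exact: (allP rs).
 apply/andP; split; first by apply/negP => /mapP[a has e]; apply: nz; exists a; rewrite e; exact: hg.
 rewrite map_inj_in_uniq // => a b has hbs e; have := hg _ hbs; rewrite -e => h2.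
 exact: (isom_rel_fun iG' (hg _ has) h2).
have dense z (e : R) : 0 < e -> exists z', alg z' /\ `|z - z'| < e by exact: Cp_dense.
have tot : forall z, exists z', rel_closure G z z' by exact: rel_closure_total iG tG dense.
have tot' : forall z, exists z', rel_closure (fun a b => G b a) z z' by exact: rel_closure_total iG' sG' dense.
have icG := rel_closure_isom iG; have [g hg] := choice tot.
have gE z z' : rel_closure G z z' -> g z = z' by exact: (isom_rel_fun icG (hg z)).
have gG z z' : G z z' -> g z = z' by move=> h; apply: gE; exact: rel_closure_sub.
have [|z z'|z z'|gC hC] := @rmorph_ex C C g.
- by apply: gG; rewrite -(rmorph1 iC); exact: (pa_K hG).
- by apply: gE; apply: rel_closureB => //; exact: (pa_B hG).
- by apply: gE; apply: rel_closureM => //; exact: (pa_M hG).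
have g0 : rel_closure G 0 0 by apply: rel_closure_sub; rewrite -(rmorph0 iC); exact: (pa_K hG).
have gn z : `|gC z| = `|z|.
 by have := icG _ _ _ _ (hg z) g0; rewrite !subr0 hC.
have [gB [nB rB]] := galB_ex gn.
have gK a : gC (iC a) = iC a by rewrite hC; apply: gG; exact: (pa_K hG).
have gs z : exists z', gC z' = z.
 have [z' hz] := tot' z; exists z'; rewrite hC; apply: gE => e e0.
 by have [a [b [h1 h2 h3]]] := hz e e0; exists b, a.
exists (Galois gn gK gs nB rB); split=> [z hz|] /=; rewrite hC; apply: gG; apply: sG; first by clo.
by exists 'X; rewrite map_polyX !hornerX.
Qed.

(** If the minimal polynomial of x over M has degree at least 2, it has another root, since the
    characteristic is 0 and x is a simple root; [galois_ex] then moves x to it. *)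
Lemma gal_move (M : subfield C) x : (forall a, iC a \in sf M) -> (forall z, z \in sf M -> alg z) -> alg x ->
 (forall g : galois S, (forall z, z \in sf M -> galC g z = z) -> galC g x = x) -> x \in sf M.
Proof.
move=> KM aM ax h.
have axM : algebraicOver (sfv M) x.
 have [Q Q0 rQ] := ax.
 have [P eP] : exists P : {poly sfT M}, map_poly (sfv M) P = map_poly iC Q.
  by apply: lift_sfT => i; rewrite coef_map; exact: KM.
 exists P; last by rewrite eP.
 by rewrite -(map_poly_eq0 (sfv M)) eP map_poly_eq0.
have [P [mP rP hP]] := field_minp axM.
have s0 : (0 < size P)%N by rewrite size_poly_gt0 monic_neq0.
have [s1|s1] := ltnP 2 (size P); last first.
 have : (size P == 2) || (size P == 1)%N by move: s0 s1; case: (size P) => [|[|[|]]].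
 case/orP => /eqP sP.
  have : (map_poly (sfv M) P).[x] = sfv M P`_0 + x.
   rewrite horner_coef size_map_poly sP !big_ord_recl big_ord0 addr0 !coef_map /= mulr1 expr1.
   by have := monicP mP; rewrite lead_coefE sP /= => ->; rewrite rmorph1 mul1r.
  rewrite rP => /esym/eqP; rewrite addrC addr_eq0 => /eqP ->; rewrite -rmorphN; exact: sfvP.
 have /size1_polyC eP : (size P <= 1)%N by rewrite sP.
 move: rP mP; rewrite eP map_polyC hornerC monicE lead_coefC => /eqP; rewrite fmorph_eq0 => /eqP ->.
 by rewrite eq_sym oner_eq0.
have /factor_theorem[q eq_] : root (map_poly (sfv M) P) x by exact/rootP.
have mq : q \is monic by rewrite -(monicMr _ (monicXsubC x)) -eq_ monic_map.
have sq : (1 < size q)%N.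
 have := size_map_poly (sfv M) P; rewrite eq_ size_Mmonic ?monicXsubC ?monic_neq0 // size_XsubC => e.
 by move: s1; rewrite -e addn2 /= ltnS.
have [y ry] := closed_root mq sq.
have xy : y != x.
 apply/eqP => e; move: ry; rewrite e => /factor_theorem[q2 eq2].
 have dP : (map_poly (sfv M) P^`()).[x] = 0.
  rewrite -deriv_map eq_ derivM hornerD !hornerM hornerXsubC subrr mulr0 add0r eq2 hornerM.
  by rewrite hornerXsubC subrr mulr0 mul0r.
 have /dvdp_leq : P %| P^`() by clo.
 have dP0 : P^`() != 0.
  have [n en] : exists n, size P = n.+2 by move: s1; case: (size P) => [|[|n]] // _; exists n.
  apply/eqP => /(congr1 (fun P : {poly sfT M} => sfv M P`_n)).
  rewrite coef_deriv coef0 rmorph0 rmorphMn; have := monicP mP; rewrite lead_coefE en /= => ->.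
  by rewrite rmorph1; apply/eqP; exact: (natF_neq0 (F := C)).
 by move=> /(_ dP0); rewrite leqNgt lt_size_deriv // monic_neq0.
have rPy : (map_poly (sfv M) P).[y] = 0 by rewrite eq_ hornerM (rootP ry) mul0r.
have ay : alg y.
 apply/integral_algebraic; apply: (integral_root_monic (monic_map (sfv M) mP)); first exact/rootP.
 by apply/integral_poly => i; rewrite coef_map; apply/integral_algebraic; apply: aM; exact: sfvP.
have [Q /hP/dvdpP[D ->]|g [gM gx]] := galois_ex KM aM ax ay.
 by rewrite rmorphM hornerM rPy mulr0.
by move: xy; rewrite -gx h ?eqxx.
Qed.

End Automorphisms.

(** * Galois-invariant separable elements are near the perfect closure of E *)

Section SeparableFixed.
Implicit Types (s t a : T) (x y z : C).

Lemma zeta_up m n : (m <= n)%N -> zeta m = zeta n ^+ (p ^ (n - m)).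
Proof. by move=> h; rewrite -(tcoord_iter eps (n - m) m) subnKC. Qed.

Lemma zeta_alg n : algebraicOver iC (zeta n).
Proof.
exists ('X^(p ^ n) - 1%:P); first by rewrite -size_poly_eq0 size_XnsubC.
by apply/rootP; rewrite rmorphB /= map_polyXn map_polyC hornerD hornerN hornerXn hornerC tcoord_epsX //= rmorph1 subrr.
Qed.

Lemma Linf_closed : divring_closed [pred x | `[< exists n, gen iC (zeta n) x >]].
Proof.
have up m n x : (m <= n)%N -> gen iC (zeta m) x -> gen iC (zeta n) x.
 by move=> h; apply: gen_trans; rewrite (zeta_up h); apply: genX; exact: gen_id.
split=> [|x y /asboolP[m hx] /asboolP[n hy]|x y /asboolP[m hx] /asboolP[n hy]]; apply/asboolP.
- by exists 0%N; rewrite -(rmorph1 iC); exact: gen_const.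
- exists (maxn m n); apply: genD; first by apply: up hx; exact: leq_maxl.
 by apply: genN; apply: up hy; exact: leq_maxr.
- exists (maxn m n); apply: genM; first by apply: up hx; exact: leq_maxl.
 by apply: gen_inv; [exact: zeta_alg|apply: up hy; exact: leq_maxr].
Qed.
Definition Linf : subfield C := Subfield Linf_closed.

Lemma LinfP x : (x \in sf Linf) <-> exists n, gen iC (zeta n) x.
Proof. by split=> [/asboolP|h] //; exact/asboolP. Qed.
Lemma Linf_K c : iC c \in sf Linf.
Proof. by apply/LinfP; exists 0%N; exact: gen_const. Qed.
Lemma Linf_zeta n : zeta n \in sf Linf.
Proof. by apply/LinfP; exists n; exact: gen_id. Qed.
Lemma Linf_alg x : x \in sf Linf -> algebraicOver iC x.
Proof. by move=> /LinfP[n h]; apply: gen_alg h; exact: zeta_alg. Qed.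
Lemma zeta_norm n : `|zeta n.+1 - 1| ^+ (p ^ n * p.-1) = p%:R^-1.
Proof. by rewrite exprM (eps_norm_ge n).2; exact: eps1_norm. Qed.

Lemma cyclo_poly n : exists P : {poly K}, [/\ P \is monic, size P = (p ^ n * p.-1).+1 & (map_poly iC P).[zeta n.+1 - 1] = 0].
Proof.
pose X1 : {poly K} := 'X - (-1)%:P; pose Y k := X1 ^+ k.
have mY k : Y k \is monic by rewrite monic_exp // monicXsubC.
have sY k : size (Y k) = k.+1 by rewrite size_exp_XsubC.
have dY k : (0 < k)%N -> Y k - 1 \is monic /\ size (Y k - 1) = k.+1.
 move=> k0; have s1 : (size (- (1 : {poly K})) < size (Y k))%N by rewrite size_polyN size_poly1 sY.
 by rewrite monicE lead_coefDl // size_polyDl // -monicE mY.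
pose P := \sum_(k < p) Y (p ^ n)%N ^+ k.
have e : Y (p ^ n * p)%N - 1 = (Y (p ^ n)%N - 1) * P by rewrite /Y exprM subrX1.
have pn0 : (0 < p ^ n)%N by [].
have pnp0 : (0 < p ^ n * p)%N by rewrite muln_gt0 pn0.
have [m1 s1] := dY _ pnp0.
have [m2 s2] := dY _ pn0.
have mP : P \is monic by rewrite -(monicMl _ m2) -e.
exists P; split=> //.
 have := s1; rewrite e size_Mmonic ?monic_neq0 // s2 addSn /= => h.
 have p1 := p_gt1.
 have : (p ^ n * p = p ^ n * p.-1 + p ^ n)%N by have := mulnS (p ^ n) p.-1; rewrite prednK ?(ltnW p1) // addnC.
 by move=> h2; move: h; rewrite h2; lia.
have eX : (map_poly iC X1).[zeta n.+1 - 1] = zeta n.+1.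
 by rewrite rmorphB /= map_polyX map_polyC hornerD hornerN hornerX hornerC /= rmorphN1; ring.
have ez : zeta n.+1 ^+ (p ^ n) = zeta 1 by rewrite -(tcoord_iter eps n 1).
have := congr1 (fun P => (map_poly iC P).[zeta n.+1 - 1]) e.
rewrite rmorphM !rmorphB !rmorphXn !rmorph1 /= hornerM !hornerD !hornerN !hornerC !horner_exp eX exprM ez.
have -> : zeta 1 ^+ p = 1 by rewrite tcoord_compat; have [] := eps_ok.
rewrite subrr => /esym/eqP; rewrite mulf_eq0 subr_eq0 => /orP[/eqP z1|/eqP] //.
by case: eps_ok => _ /(_ z1).
Qed.

Lemma ex_max (F : nat -> R) n : exists2 i, (i <= n)%N & forall j, (j <= n)%N -> F j <= F i.
Proof.
elim: n => [|n [i hi h]]; first by exists 0%N => // j; rewrite leqn0 => /eqP ->.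
have [hh|hh] := leP (F n.+1) (F i).
 by exists i => [|j]; [exact: leqW|rewrite leq_eqVlt => /orP[/eqP ->|/h]].
exists n.+1 => // j; rewrite leq_eqVlt => /orP[/eqP ->|/h h'] //; exact: le_trans (ltW hh).
Qed.

(** The Eisenstein argument: coefficients have norms in the powers of p, while those of w^i for i <
    e are incongruent modulo them. The large terms of the sum therefore have distinct norms, and no
    cancellation can occur. *)
Lemma eisen_int (w : C) e (c : {poly K}) : (0 < e)%N -> `|w| ^+ e = p%:R^-1 -> (size c <= e)%N ->
 W ((map_poly iC c).[w]) -> forall i, W c`_i.
Proof.
move=> e0 ew sc nc; have w0 : 0 < `|w|.
 rewrite lt_neqAle pnorm_ge0 andbT eq_sym; apply/eqP => h.
 by move: pinv_gt0; rewrite -ew h expr0n eqn0Ngt e0 /= ltxx.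
have w1 : `|w| < 1.
 by rewrite ltNge; apply/negP => h; have := exprn_ege1 e h; rewrite ew leNgt pinv_lt1.
pose F i := `|c`_i| * `|w| ^+ i.
have F0 i : 0 <= F i by rewrite mulr_ge0 ?exprn_ge0 ?pnorm_ge0.
have [i0 hi0 hm] := ex_max F e.-1; rewrite -ltnS prednK // in hi0.
have {}hm j : (j < e)%N -> F j <= F i0 by move=> h; apply: hm; rewrite -ltnS prednK.
have F1 : F i0 <= 1.
 rewrite leNgt; apply/negP => F1; suff : `|(map_poly iC c).[w]| = F i0 by move=> h; rewrite h leNgt F1 in nc.
 have cw (a b : nat) : (a < b)%N -> (b < e)%N -> F b = F a -> 0 < F b -> False.
  move=> ab be eF Fb; have cb : 0 < `|c`_b| by rewrite -(pmulr_lgt0 _ (exprn_gt0 b w0)).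
  have cb0 : c`_b != 0 by rewrite -pnorm_eq0 lt0r_neq0.
  have eq_ : `|c`_a / c`_b| = `|w| ^+ (b - a).
   rewrite pnormM pnormV; apply: (mulIf (lt0r_neq0 cb)); rewrite divfK ?lt0r_neq0 //.
   apply: (mulIf (lt0r_neq0 (exprn_gt0 a w0))); rewrite -/(F a) -eF /F mulrAC -exprD subnK ?(ltnW ab) //.
   by rewrite mulrC.
  have d1 : `|c`_a / c`_b| < 1 by rewrite eq_ exprn_ilt1 ?pnorm_ge0 // -ltnNge.
  have := Qp_disc d1; rewrite eq_ -ew ler_iXn2l // leqNgt => /negP; apply.
  by apply: leq_ltn_trans be; exact: leq_subr.
 rewrite (@horner_coef_wide _ e) ?size_map_poly // (bigD1 (Ordinal hi0)) //=.
 have nF i : `|(map_poly iC c)`_i * w ^+ i| = F i by rewrite pnormM pnormX coef_map QpCp_norm.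
 rewrite addrC pnorm_dom nF //; apply: (big_ind (fun x => `|x| < F i0)) => [|x y|i].
 - by rewrite pnorm0 (lt_trans ltr01).
 - exact: pnormD_lt.
 move=> ii; rewrite nF lt_neqAle hm ?andbT //; apply/eqP => eF.
 have Fi0 : 0 < F i0 by exact: lt_trans F1.
 have : (i != i0 :> nat) by apply: contraNneq ii => h; apply/eqP/val_inj.
 rewrite neq_ltn => /orP[] h; first by apply: (cw _ _ h hi0).
 by apply: (cw _ _ h (ltn_ord i)); rewrite ?eF.
move=> i; have [ie|ie] := ltnP i e; last by rewrite nth_default ?pnorm0 // (leq_trans sc).
rewrite leNgt; apply/negP => ci; have ci0 : 0 < `|c`_i| by exact: lt_trans ci.
have : `|(c`_i)^-1| < 1 by rewrite pnormV invf_lt1.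
move/Qp_disc; rewrite pnormV -ew => h.
have : `|w| ^+ i <= (`|c`_i|)^-1.
 by rewrite -[X in _ <= X]mul1r ler_pdivlMr // mulrC (le_trans (hm _ ie)).
by move=> /le_trans/(_ h); rewrite ler_iXn2l // leqNgt ie.
Qed.

Lemma Linf_int x : x \in sf Linf -> W x -> exists n, forall m, (n <= m)%N ->
 exists (k : nat -> nat) N, cong 1 x (\sum_(i < N) (k i)%:R * (zeta m.+1 - 1) ^+ i).
Proof.
move=> /LinfP[n hx] nx; exists n => m nm; set w := zeta m.+1 - 1; pose e := (p ^ m * p.-1)%N.
have p1 := p_gt1.
have e0 : (0 < e)%N by rewrite muln_gt0 expn_gt0 prime_gt0 //= -subn1 subn_gt0.
have [Q eQ] : gen iC w x.
 apply: (gen_trans _ hx); rewrite (zeta_up (leqW nm)); apply: genX.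
 have -> : zeta m.+1 = w + 1 by rewrite subrK.
 by apply: genD; [exact: gen_id|rewrite -(rmorph1 iC); exact: gen_const].
have [P [mP sP rP]] := cyclo_poly m; pose r := Q %% P.
have er : x = (map_poly iC r).[w].
 by rewrite eQ {1}(divp_eq Q P) rmorphD rmorphM /= hornerD hornerM rP mulr0 add0r.
have sr : (size r <= e)%N by rewrite -ltnS -sP ltn_modp monic_neq0.
have ri : forall i, W r`_i by apply: (@eisen_int w e) => //; [exact: zeta_norm|rewrite -er].
have /choice[k hk] : forall i, exists k : nat, cong 1 r`_i k%:R.
 by move=> i; exact: (Qp_zint (ri i) 1%N).
exists k, e; rewrite er (@horner_coef_wide _ e) ?size_map_poly //; apply: cong_sum => i _ _.
rewrite mulrC [X in cong _ _ X]mulrC coef_map; apply: congMl.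
 by rewrite pnormX exprn_ile1 ?pnorm_ge0 //; apply: ltW; exact: eps_lt1.
by rewrite /= -(rmorph_nat iC) /cong -rmorphB QpCp_norm; exact: hk.
Qed.

(** The perfect closure of E in the tilt; p-th roots are needed because deep coordinates of elements
    of E only see small powers of zeta_n - 1. *)
Definition perf t := exists k, t ^+ (p ^ k) \in sf EE.

Lemma EE_X t n : t \in sf EE -> t ^+ n \in sf EE.
Proof. by move=> h; rewrite -(sfv_sub h) -rmorphXn; exact: sfvP. Qed.
Lemma EE_D s t : s \in sf EE -> t \in sf EE -> s + t \in sf EE.
Proof. by move=> h h'; rewrite -(sfv_sub h) -(sfv_sub h') -rmorphD; exact: sfvP. Qed.
Lemma EE_M s t : s \in sf EE -> t \in sf EE -> s * t \in sf EE.
Proof. by move=> h h'; rewrite -(sfv_sub h) -(sfv_sub h') -rmorphM; exact: sfvP. Qed.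
Lemma EE_pb : pb \in sf EE.
Proof. by apply/EEP; exists pe; [apply: AA_Rp; exact: Rp_pe|exact: res_pe]. Qed.
Lemma EE_nat n : n%:R \in sf EE.
Proof. by rewrite -(rmorph_nat eE); exact: sfvP. Qed.

Lemma perf2 s t : perf s -> perf t -> exists k, s ^+ (p ^ k) \in sf EE /\ t ^+ (p ^ k) \in sf EE.
Proof.
move=> [i hi] [j hj]; exists (i + j)%N; split; first by rewrite expnD exprM; exact: EE_X.
by rewrite addnC expnD exprM; exact: EE_X.
Qed.

Lemma perf_M s t : perf s -> perf t -> perf (s * t).
Proof. by move=> h /(perf2 h)[k [h1 h2]]; exists k; rewrite exprMn; exact: EE_M. Qed.
Lemma perf_D s t : perf s -> perf t -> perf (s + t).
Proof. by move=> h /(perf2 h)[k [h1 h2]]; exists k; rewrite texppD; exact: EE_D. Qed.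
Lemma perf_E t : t \in sf EE -> perf t.
Proof. by move=> h; exists 0%N; rewrite expn0 expr1. Qed.

(** Modulo p, x is an integral polynomial in zeta_(M+1) - 1 for a large M, and zeta_(M+1) - 1 is
    congruent to the m-th coordinate of a p-power root of eps - 1. *)
Lemma near_perf m x : x \in sf Linf -> W x -> exists s, [/\ Oi s, perf s & cong 1 (tcoord s m) x].
Proof.
move=> hx nx; have [n hn] := Linf_int hx nx.
have [k [N c]] := hn (maxn n m) (leq_maxl _ _); set M := maxn n m in c.
pose Pz y := exists s, [/\ Oi s, perf s & cong 1 (tcoord s m) y].
have PD y z : Pz y -> Pz z -> Pz (y + z).
 move=> [s [h1 h2 h3]] [t [k1 k2 k3]]; exists (s + t); split; [exact: OiD|exact: perf_D|].
 by apply: congT (tcoordD_cong m h1 k1) _; exact: congD.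
have PM y z : W z -> Pz y -> Pz z -> Pz (y * z).
 move=> nz [s [h1 h2 h3]] [t [k1 k2 k3]]; exists (s * t); split; [exact: OiM|exact: perf_M|].
 by rewrite tcoordM; apply: congM => //; exact: Oi_coord.
have P0 : Pz 0 by exists 0; split; [exact: Oi0|exact: (perf_E (EE_nat 0))|rewrite tcoord_zero; exact: congxx].
have P1 : Pz 1 by exists 1; split; [exact: Oi1|exact: (perf_E (EE_nat 1))|rewrite tcoord_one; exact: congxx].
have Pn (i : nat) : Pz i%:R by elim: i => [|i IH] //; rewrite -natr1; exact: PD.
have nz : W (zeta M.+1 - 1) by apply: ltW; exact: eps_lt1.
have Pz1 : Pz (zeta M.+1 - 1).
 exists (rtn (M.+1 - m) pb); split.
 - by apply: Oi_rtn; exact: Oi_pb.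
 - by exists (M.+1 - m)%N; rewrite rtnK; exact: EE_pb.
 rewrite tcoord_rtn subnKC; last by lia.
 by apply: congS; exact: eps_cong.
suff [s [h1 h2 h3]] : Pz (\sum_(i < N) (k i)%:R * (zeta M.+1 - 1) ^+ i).
 by exists s; split=> //; apply: congT h3 (congS c).
have PX j : Pz ((zeta M.+1 - 1) ^+ j).
 by elim: j => [|j IH]; rewrite ?expr0 ?exprS //; apply: (PM _ _ _ Pz1 IH); exact: W_X.
by apply: (big_ind Pz) => // i _; apply: (PM _ _ _ (Pn _) (PX _)); exact: W_X.
Qed.

Lemma EE_Rp t : t \in sf EE -> exists N (y : B), Rp y /\ res y = t * pb ^+ N.
Proof.
move=> /EEP[x hx <-]; have [N [y [hy c]]] := hx 1%N; exists N, y; split=> //.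
have nx := AA_le1 hx.
have npe : W (pe ^+ N) by clo.
rewrite -(res_pe) -resX // -resM //.
apply/res_cong; [exact: (Wp_le1 (Rp_Wp hy))|exact: W_M|].
have -> : y = y / pe ^+ N * pe ^+ N by field.
by rewrite mulrC [X in cong _ _ X]mulrC; apply: congMl => //; exact: congS.
Qed.

Lemma Rp_res_tail (y : B) : Rp y -> exists (k : nat) (z : B), Rp z /\ res y = k%:R + pb * res z.
Proof.
move=> /Rp_tail[c [z [nc hz ->]]]; have [k hk] := Qp_zint nc 1%N; exists k, z; split=> //.
have nz := Wp_le1 (Rp_Wp hz).
rewrite resD ?QpBt_norm ?W_M // resM // res_pe -(res_nat k); congr (_ + _).
apply/res_cong; rewrite ?QpBt_norm //.
by rewrite -(rmorph_nat iB) /cong -rmorphB QpBt_norm; exact: hk.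
Qed.

Lemma Rp_res_sum (y : B) M : Rp y -> exists (k : nat -> nat) (z : B), Rp z /\
 res y = \sum_(i < M) (k i)%:R * pb ^+ i + pb ^+ M * res z.
Proof.
move=> hy; elim: M => [|M [k [z [/Rp_res_tail[c [z' [hz' ->]]] ->]]]].
 by exists (fun=> 0%N), y; rewrite big_ord0 add0r mul1r.
exists (fun i => if i == M then c else k i), z'; split=> //.
rewrite big_ord_recr /= eqxx mulrDr mulrA -exprSr addrA [c%:R * _]mulrC; congr (_ + _ + _).
by apply: eq_bigr => i _; rewrite ltn_eqF.
Qed.

(** The converse direction: a truncation of the series is a polynomial in eps - 1 with natural
    coefficients, whose m-th coordinate modulo p is the same polynomial in zeta_m - 1. *)
Lemma res_Rp_Linf (y : B) m : Rp y -> exists x, [/\ x \in sf Linf, W x & cong 1 (tcoord (res y) m) x].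
Proof.
move=> hy; have [M hM] := tnorm_pbX_small (ppow_gt0 (p ^ m)).
have [k [z [hz ey]]] := Rp_res_sum M hy; set s := \sum_(i < M) _ in ey.
have Opb : Oi pb by [].

pose Pz t := Oi t /\ exists x, [/\ x \in sf Linf, W x & cong 1 (tcoord t m) x].
have LD x x' : x \in sf Linf -> x' \in sf Linf -> x + x' \in sf Linf.
 by move=> h h'; rewrite -(sfv_sub h) -(sfv_sub h') -rmorphD; exact: sfvP.
have LM x x' : x \in sf Linf -> x' \in sf Linf -> x * x' \in sf Linf.
 by move=> h h'; rewrite -(sfv_sub h) -(sfv_sub h') -rmorphM; exact: sfvP.
have L1 : 1 \in sf Linf by rewrite -(rmorph1 iC); exact: Linf_K.
have L0 : 0 \in sf Linf by rewrite -(rmorph0 iC); exact: Linf_K.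
have PD s1 s2 : Pz s1 -> Pz s2 -> Pz (s1 + s2).
 move=> [u1 [x1 [a1 b1 c1]]] [u2 [x2 [a2 b2 c2]]]; split; first by clo.
 exists (x1 + x2); split; [exact: LD|exact: pnormD_le|].
 by apply: congT (tcoordD_cong m u1 u2) _; exact: congD.
have PM s1 s2 : Pz s1 -> Pz s2 -> Pz (s1 * s2).
 move=> [u1 [x1 [a1 b1 c1]]] [u2 [x2 [a2 b2 c2]]]; split; first by clo.
 by exists (x1 * x2); split; [exact: LM|exact: W_M|rewrite tcoordM; apply: congM => //; exact: Oi_coord].
have P0 : Pz 0.
 by split; [exact: Oi0|exists 0; rewrite tcoord_zero pnorm0; split=> //; exact: congxx].
have P1 : Pz 1.
 by split; [exact: Oi1|exists 1; rewrite tcoord_one pnorm1; split=> //; exact: congxx].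
have Pn (n : nat) : Pz n%:R by elim: n => [|n IH] //; rewrite -natr1; exact: PD.
have Ppb : Pz pb.
 split=> //; exists (zeta m - 1); split; last by apply: congS; exact: eps_cong.
  have e1 : - 1 \in sf Linf by rewrite -(rmorphN1 iC); exact: Linf_K.
  by apply: LD => //; exact: Linf_zeta.
 by apply: ltW; exact: eps_lt1.
have PX j : Pz (pb ^+ j) by elim: j => [|j IH]; rewrite ?exprS //; exact: PM.
have [us [x [h1 h2 h3]]] : Pz s.
 by apply: (big_ind Pz) => // i _; exact: PM.
exists x; split=> //; apply: congT _ h3; apply/tcoord_close => //.
 by apply: Wp_res; exact: (Rp_Wp hy).
rewrite ey addrC addKr tnormM tnormX; apply: le_trans (hM M (leqnn _)).
by rewrite ler_piMr ?exprn_ge0 ?tnorm_ge0 //; exact: Wp_res (Rp_Wp hz).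
Qed.

(** P'/P is the sum of 1/(x - r) over the roots, so its norm is at most the largest of the terms.
    The proof goes by contradiction and by induction on the degree, taking out one root at a
    time. *)
Lemma near_root (P : {poly C}) x : (P^`()).[x] != 0 ->
 exists2 r, root P r & `|x - r| * `|(P^`()).[x]| <= `|P.[x]|.
Proof.
move=> d0; apply: contrapT => nr.
have {nr} nr r : root P r -> `|P.[x]| / `|(P^`()).[x]| < `|x - r|.
 move=> hr; rewrite ltNge; apply/negP => h; apply: nr; exists r => //.
 by rewrite -ler_pdivlMr // lt_neqAle pnorm_ge0 eq_sym pnorm_eq0 d0.
set rho := _ / _ in nr; have rho0 : 0 <= rho by rewrite divr_ge0 ?pnorm_ge0.
have P0 : P != 0 by apply: contraNneq d0 => ->; rewrite deriv0 horner0.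
suff : rho * `|(P^`()).[x]| < `|P.[x]| by rewrite /rho divfK ?pnorm_eq0 // ltxx.
have [n sP] : exists n, (size P <= n.+1)%N by exists (size P); exact: leqnSn.
move: rho rho0 nr => r0 r00; clear d0; elim: n P P0 sP => [|n IH] P P0 sP nr.
 have [c eP] : exists c, P = c%:P by exists P`_0; apply: size1_polyC.
 by rewrite eP derivC horner0 pnorm0 mulr0 hornerC lt_neqAle pnorm_ge0 eq_sym pnorm_eq0 andbT -polyC_eq0 -eP.
have [s1|s1] := leqP (size P) 1.
 by apply: IH => //; exact: (leq_trans s1).
have l0 : lead_coef P != 0 by rewrite lead_coef_eq0.
have [||r] := @closed_root ((lead_coef P)^-1 *: P).
- by rewrite monicE lead_coefZ mulVf.
- by rewrite size_scale // invr_eq0.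
rewrite rootZ ?invr_eq0 // => hr; have /factor_theorem[Q eP] := hr.
have Q0 : Q != 0 by apply: contraNneq P0 => Q0; rewrite eP Q0 mul0r.
have sQ : (size Q <= n.+1)%N.
 by move: sP; rewrite eP size_Mmonic ?monicXsubC // size_XsubC addn2.
have lQ : r0 * `|(Q^`()).[x]| < `|Q.[x]|.
 by apply: (IH _ Q0 sQ) => s' hs; apply: nr; rewrite eP rootM hs.
have xr := nr _ hr; have qx : 0 < `|Q.[x]| by apply: le_lt_trans lQ; rewrite mulr_ge0 ?pnorm_ge0.
rewrite eP derivM derivXsubC mulr1 hornerD !hornerM hornerXsubC [X in _ < X]pnormM.
have xr0 : 0 < `|x - r| by exact: le_lt_trans xr.
apply: (@le_lt_trans _ _ (r0 * Num.max (`|(Q^`()).[x] * (x - r)|) (`|Q.[x]|))).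
 by rewrite ler_wpM2l // pnormD.
rewrite maxr_pMr // gt_max pnormM mulrA ltr_pM2r // lQ /=.
by rewrite mulrC ltr_pM2l.
Qed.

Definition fixed t := forall g : galois S, fixes_cyclo g -> gt g t = t.

(* Krasner: a coordinate of t is close to a root of a polynomial over Linf, and this root is
  unique near it, hence fixed. *)
Lemma coord_near t : Oi t -> sepel p eE t -> fixed t -> exists m0, forall m, (m0 <= m)%N ->
 exists x, [/\ x \in sf Linf, W x & `|tcoord t m - x| ^+ 4 <= p%:R^-1].
Proof.
move=> ht st ft; have [g [_ /rootP rg dg]] := sepel_poly tilt_pchar st.
have [M hM] : exists M, forall i, exists2 y : B, Rp y & res y = eE g`_i * pb ^+ M.
 suff h n : exists M, forall i, (i < n)%N -> exists2 y : B, Rp y & res y = eE g`_i * pb ^+ M.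
  have [M hM] := h (size g); exists M => i; have [/hM//|hi] := ltnP i (size g).
  by exists 0; [exact: Rp0|rewrite nth_default // rmorph0 mul0r res0].
 have up N k (y : B) s : Rp y -> res y = s * pb ^+ N -> exists2 y' : B, Rp y' & res y' = s * pb ^+ (N + k).
  move=> hy ey; exists (y * pe ^+ k); first by apply: RpM => //; apply: RpX => //; exact: Rp_pe.
  rewrite resM ?resX ?res_pe ?ey ?exprD ?mulrA //; first by clo.
  by rewrite pnormX pe_norm // expr1n.
 elim: n => [|n [M hM]]; first by exists 0%N.
 have [N [y [hy ey]]] := EE_Rp (sfvP g`_n); exists (N + M)%N => i; rewrite ltnS leq_eqVlt => /orP[/eqP ->|/hM[z hz ez]].
  exact: up hy ey.
 by rewrite addnC; exact: up hz ez.
pose G := pb ^+ M *: map_poly eE g.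
have rG : G.[t] = 0 by rewrite hornerZ rg mulr0.
have dG : (G^`()).[t] = pb ^+ M by rewrite derivZ deriv_map dg rmorph1 hornerZ hornerC mulr1.
have pb0 : 0 < tnorm pb by [].
have pb1 : tnorm pb < 1 by [].
pose del := tnorm pb ^+ M; have del0 : 0 < del by rewrite exprn_gt0.
(* From this m0 on, the norm D of the derivative at the m-th coordinate satisfies D^4 >= 1/p. Then
   D^2 > 1/p isolates the root, and the distance to it, at most p^(-1) / D, has a fourth power at
   most 1/p. *)
have [m0 hm0] := ppow_small (exprn_gt0 4 del0); exists m0 => m mm.
have /choice[b hb] : forall i, exists x, [/\ x \in sf Linf, W x & cong 1 (tcoord G`_i m) x].
 move=> i; have [y hy ey] := hM i; have := res_Rp_Linf m hy.
 by rewrite coefZ coef_map /= mulrC -ey.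
have OG i : Oi G`_i.
 by have [y hy ey] := hM i; rewrite coefZ coef_map /= mulrC -ey; apply: Wp_res; exact: (Rp_Wp hy).
set tm := tcoord t m; have ntm : W tm by exact: Oi_coord.
have ev (P : {poly T}) (Q : {poly C}) : (forall i, Oi P`_i) -> (forall i, W Q`_i) ->
  (forall i, cong 1 (tcoord P`_i m) Q`_i) -> cong 1 (tcoord P.[t] m) Q.[tm] /\ Oi P.[t].
 move=> hP hQ hPQ; pose N := maxn (size P) (size Q).
 rewrite (@horner_coef_wide _ N P) ?leq_maxl // (@horner_coef_wide _ N Q) ?leq_maxr //.
 elim: N => [|N [IH1 IH2]].
  by rewrite !big_ord0 tcoord_zero; split; [exact: congxx|exact: Oi0].
 have hX : Oi (P`_N * t ^+ N) by clo.
 rewrite !big_ord_recr /=; split; last by clo.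
 apply: congT (tcoordD_cong m IH2 hX) _; apply: congD => //.
 by rewrite tcoordM tcoordX mulrC [X in cong _ _ X]mulrC; apply: congMl => //; exact: W_X.
have On k : Oi (k%:R : T).
 by elim: k => [|k IH]; [exact: Oi0|rewrite -natr1; apply: OiD => //; exact: Oi1].
pose H := \poly_(i < size G) b i.
have hH i : W H`_i by rewrite coef_poly; case: ifP => _; [have [] := hb i|rewrite pnorm0].
have LH i : H`_i \in sf Linf.
 by rewrite coef_poly; case: ifP => _; [have [] := hb i|rewrite -(rmorph0 iC); exact: Linf_K].
have GH i : cong 1 (tcoord G`_i m) H`_i.
 rewrite coef_poly; case: ltnP => hi; first by have [] := hb i.
 by rewrite nth_default // tcoord_zero; exact: congxx.
have [c0 _] := ev G H OG hH GH.
have tcn k : cong 1 (tcoord (k%:R : T) m) k%:R.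
 elim: k => [|k IH]; first by rewrite tcoord_zero; exact: congxx.
 rewrite -natr1 -[in X in cong _ _ X]natr1; apply: congT (tcoordD_cong m (On k) Oi1) _.
 by rewrite tcoord_one; apply: congD => //; exact: congxx.
have [|||c1 _] := ev G^`() H^`().
- by move=> i; rewrite coef_deriv -mulr_natl; exact: OiM.
- by move=> i; rewrite coef_deriv -mulr_natl; apply: W_M => //; exact: W_nat.
- move=> i; rewrite !coef_deriv -[X in tcoord X]mulr_natl -[X in cong _ _ X]mulr_natl tcoordM; apply: congM => //; exact: Oi_coord.
rewrite dG in c1; rewrite rG tcoord_zero in c0.
set D := `|tcoord (pb ^+ M) m|.
have eD : D ^+ (p ^ m) = del by rewrite -tnorm_coord tnormX.
have D1 : D <= 1 by apply: Oi_coord; apply: OiX; exact: Oi_pb.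
have Dp0 : 0 <= D := pnorm_ge0 _.
have D4 : p%:R^-1 <= D ^+ 4.
 rewrite leNgt; apply/negP => h.
 have p0 : (0 < p ^ m)%N by [].
 have : (D ^+ 4) ^+ (p ^ m) < p%:R^-1 ^+ (p ^ m).
  by rewrite ltrXn2r -?lt0n ?nnegrE ?exprn_ge0 ?pinv_ge0.
 rewrite -exprM mulnC exprM eD exprVn ltNge => /negP; apply; apply: ltW; apply: le_lt_trans hm0.
 by apply: ppow_le; apply: (leq_trans mm); apply: ltnW; apply: ltn_expl; exact: prime_gt1.
have D0 : 0 < D.
 by rewrite lt_neqAle Dp0 andbT eq_sym; apply/eqP => h; move: D4; rewrite h expr0n /= leNgt pinv_gt0.
have D2 : p%:R^-1 < D ^+ 2.
 rewrite ltNge; apply/negP => h; have : D ^+ 4 <= p%:R^-1 * p%:R^-1.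
  by rewrite (exprM D 2 2) expr2; apply: ler_pM; rewrite ?exprn_ge0.
 move/(le_trans D4); rewrite leNgt; apply/negP; rewrite negbK -[X in _ < X]mul1r ltr_pM2r ?pinv_gt0 //.
 exact: pinv_lt1.
have pD : p%:R^-1 < D by apply: lt_le_trans D2 _; rewrite ler_piMr.
have nd : `|(H^`()).[tm]| = D.
 by apply: pnorm_close; rewrite pnormBC; apply: le_lt_trans c1 _; rewrite ppow1.
have n0 : `|H.[tm]| <= p%:R^-1 by rewrite -ppow1; apply/cong0P; exact: congS.
have [|r rr nr] := @near_root H tm; first by rewrite -pnorm_eq0 nd lt0r_neq0.
rewrite nd in nr; have {}nr : `|tm - r| * D <= p%:R^-1 by exact: le_trans nr n0.
have nrD : `|tm - r| < D.
 by rewrite -(ltr_pM2r D0) (le_lt_trans nr) // -expr2.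
have nr4 : `|tm - r| ^+ 4 <= p%:R^-1.
 rewrite -(ler_pM2r (exprn_gt0 4 D0)) -exprMn; apply: (@le_trans _ _ (p%:R^-1 ^+ 4)).
  by rewrite lerXn2r ?nnegrE ?mulr_ge0 ?pnorm_ge0 ?pinv_ge0.
 apply: le_trans (ler_wpM2l pinv_ge0 D4); rewrite !exprS mulr1 ler_wpM2l ?pinv_ge0 //.
 by rewrite ler_piMr ?pinv_ge0 // mulr_ile1 ?pinv_ge0 ?pinv_le1.
have r1 : W r.
 have -> : r = tm - (tm - r) by ring.
 by apply: pnormB_le => //; exact: (le_trans (ltW nrD)).
exists r; split=> //.
have uniq_r r' : root H r' -> `|tm - r'| < D -> r' = r.
 move=> /rootP rr' nr'; apply/eqP; rewrite -subr_eq0; apply/negPn/negP => ne.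
 have close : `|r' - r| < D.
  have -> : r' - r = (tm - r) - (tm - r') by ring.
  by apply: pnormD_lt; rewrite ?pnormN.
 have [_ _ [e ne1 E]] := taylor hH r1 (le_trans (ltW close) D1).
 have dH : forall i, `|(H^`())`_i| <= 1.
  by move=> i; rewrite coef_deriv -mulr_natl; apply: W_M => //; exact: W_nat.
 have ntr : W (tm - r) by exact: (le_trans (ltW nrD)).
 have [_ n2 [e' ne' E']] := taylor dH r1 ntr.
 rewrite addrC subrK in E'; rewrite addrC subrK rr' (rootP rr) add0r in E.
 have nd' : `|(H^`()).[r]| = D.
  rewrite -nd; apply: pnorm_close; rewrite nd pnormBC E'.
  have -> : (H^`()).[r] + (tm - r) * (H^`()^`()).[r] + (tm - r) ^+ 2 * e' - (H^`()).[r] =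
   (tm - r) * ((H^`()^`()).[r] + (tm - r) * e') by ring.
  rewrite pnormM; apply: le_lt_trans nrD; rewrite ler_piMr ?pnorm_ge0 //.
  by apply: pnormD_le => //; exact: W_M.
 have : (r' - r) * ((H^`()).[r] + (r' - r) * e) = 0 by rewrite E; ring.
 have hs : `|(r' - r) * e| < `|(H^`()).[r]|.
  by rewrite nd' pnormM; apply: le_lt_trans close; rewrite ler_piMr ?pnorm_ge0.
 by move/eqP; rewrite mulf_eq0 (negPf ne) /= -pnorm_eq0 addrC pnorm_dom // nd' (negPf (lt0r_neq0 D0)).
apply: (gal_move Linf_K Linf_alg).
- have H0 : H != 0 by apply: contraNneq (lt0r_neq0 D0) => H0; rewrite -nd H0 deriv0 horner0 pnorm0.
 have l0 : lead_coef H != 0 by rewrite lead_coef_eq0.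
 apply/integral_algebraic; apply: (@integral_root_monic _ _ _ _ ((lead_coef H)^-1 *: H)).
 + by rewrite monicE lead_coefZ mulVf.
 + by rewrite rootZ ?invr_eq0.
 apply/integral_poly => i; rewrite coefZ; apply/integral_algebraic; apply: Linf_alg.
 rewrite -(sfv_sub (LH i)) -(sfv_sub (LH (size H).-1 : lead_coef H \in sf Linf)) -fmorphV -rmorphM.
 exact: sfvP.
move=> g' hg'; have hz n : galC g' (zeta n) = zeta n by apply: hg'; exact: Linf_zeta.
apply: uniq_r.
 have -> : H = map_poly (galC g') H by apply/polyP => i; rewrite coef_map /= hg'.
 by rewrite fmorph_root.
have -> : tm = galC g' tm by rewrite -tcoord_gt ft.
by rewrite -rmorphB galC_norm.
Qed.

Lemma near_E_perf t : Oi t -> sepel p eE t -> fixed t -> forall e : R, 0 < e ->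
 exists s, [/\ Oi s, perf s & tnorm (t - s) <= e].
Proof.
move=> ht st ft e e0; have [m0 hm0] := coord_near ht st ft.
have [m1 hm1] := ppow_small (exprn_gt0 4 e0); pose m := maxn m0 m1.
have [x [hx nx cx]] := hm0 m (leq_maxl _ _); have [s [hs ps cs]] := near_perf m hx nx.
exists s; split=> //.
have h4 : `|tcoord (t - s) m| ^+ 4 <= p%:R^-1.
 have e1 : tcoord (t - s) m = (tcoord t m - x) + ((x - tcoord s m) - (tcoord t m - (tcoord (t - s) m + tcoord s m))) by ring.
 have c1 : cong 1 (tcoord t m) (tcoord (t - s) m + tcoord s m).
  by rewrite -{1}(subrK s t); apply: tcoordD_cong => //; apply: OiD => //; exact: OiN.
 have h1 : `|(x - tcoord s m) - (tcoord t m - (tcoord (t - s) m + tcoord s m))| <= p%:R^-1.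
  by rewrite -ppow1; apply: pnormB_le => //; exact: congS.

 have pw : forall v : R, 0 <= v -> v <= p%:R^-1 -> v ^+ 4 <= p%:R^-1.
  move=> v v0 hv; apply: (@le_trans _ _ (v ^+ 1)) => //.
  by apply: ler_wiXn2l => //; apply: (le_trans hv); exact: pinv_le1.
 have := pnormD (tcoord t m - x) ((x - tcoord s m) - (tcoord t m - (tcoord (t - s) m + tcoord s m))).
 rewrite -e1 le_max => /orP[] h.
  by apply: le_trans cx; rewrite lerXn2r ?nnegrE ?pnorm_ge0.
 by apply: pw; [exact: pnorm_ge0|exact: le_trans h h1].
rewrite -(@ler_pXn2r _ 4) ?nnegrE ?(ltW e0) //.
rewrite (tnorm_coord _ m) -exprM mulnC exprM; apply: (@le_trans _ _ (p%:R^-1 ^+ (p ^ m))).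
 by rewrite lerXn2r ?nnegrE ?exprn_ge0 ?pnorm_ge0 ?pinv_ge0.
rewrite exprVn; apply: ltW; apply: le_lt_trans hm1; apply: ppow_le.
apply: (leq_trans (leq_maxr m0 m1)); apply: ltnW; apply: ltn_expl; exact: prime_gt1.
Qed.

End SeparableFixed.
#[local] Hint Resolve EE_X EE_D EE_M EE_pb perf_M perf_D perf_E : closed.

(** * Completeness of E and the descent from its perfect closure *)

Section ResidueFieldClosed.
Implicit Types (s t a : T) (y z : B).

Lemma nat_small (k : nat) : tnorm (k%:R : T) < 1 -> k%:R = 0 :> T.
Proof.
move=> h; apply/eqP; rewrite -tnorm_eq0; apply/negPn/negP => k0.
have e : (k%:R : T) ^+ p = k%:R by rewrite -(pFrobenius_autE tilt_pchar) pFrobenius_aut_nat.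
have k1 : 0 < tnorm (k%:R : T) by rewrite lt_neqAle tnorm_ge0 eq_sym k0.
have : tnorm (k%:R : T) ^+ p < tnorm (k%:R : T).
 by rewrite -[X in _ < X]expr1 ltr_iXn2l // prime_gt1.
by rewrite -tnormX e ltxx.
Qed.

Lemma Oi_resR y : Rp y -> Oi (res y).
Proof. by move=> hy; apply: Wp_res; exact: (Rp_Wp hy). Qed.

Lemma pb_lt1M t : Oi t -> tnorm (pb * t) < 1.
Proof.
move=> ht; rewrite tnormM; apply: le_lt_trans tnorm_pb_lt1.
by rewrite ler_piMr ?tnorm_ge0.
Qed.

Lemma EE_Oi_Rp a : a \in sf EE -> Oi a -> exists2 y, Rp y & res y = a.
Proof.
move=> ha oa; have [N [y [hy ey]]] := EE_Rp ha; elim: N y hy ey => [|N IH] y hy ey.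
 by exists y => //; rewrite ey expr0 mulr1.
have [k [y' [hy' e']]] := Rp_res_tail hy; apply: (IH y' hy').
have pb0 := pb_neq0.
have k0 : k%:R = 0 :> T.
 apply: nat_small; have -> : k%:R = pb * (a * pb ^+ N) + - (pb * res y') by rewrite mulrCA -exprS -ey e' addrK.
 apply: tnormD_lt; rewrite ?tnormN; apply: pb_lt1M; last by clo.
 by apply: OiM => //; apply: OiX; exact: Oi_pb.
by apply: (mulfI pb0); rewrite mulrCA -exprS -ey e' k0 add0r.
Qed.

Definition Rlim t := Oi t /\ forall e : R, 0 < e -> exists y, Rp y /\ tnorm (t - res y) <= e.

Lemma Rlim_digit t : Rlim t -> exists (k : nat) t', Rlim t' /\ t = k%:R + pb * t'.
Proof.
move=> [ot ht]; have lt0 : 0 < tnorm pb by exact: tnorm_pb_gt0.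
have pb0 := pb_neq0.
have [y [hy cy]] := ht _ lt0; have [k [y' [hy' ey]]] := Rp_res_tail hy.
pose t' := (t - k%:R) / pb; have et : t = k%:R + pb * t' by rewrite mulrC divfK // addrC subrK.
have kb : tnorm (t - k%:R) <= tnorm pb.
 have -> : t - k%:R = (t - res y) + pb * res y' by rewrite ey; ring.
 by apply: tnormD_le => //; rewrite tnormM ler_piMr ?tnorm_ge0 //; exact: Oi_resR.
have ot' : Oi t' by exact: tnorm_divr.
exists k, t'; split=> //; split=> // e e0.
have d0 : 0 < Num.min 1 e * tnorm pb by rewrite mulr_gt0 // lt_min ltr01.
have [y1 [hy1 c1]] := ht _ d0; have [k1 [y1' [hy1' ey1]]] := Rp_res_tail hy1.
have c1' : tnorm (t - res y1) <= tnorm pb.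
 by apply: (le_trans c1); rewrite ler_piMl ?tnorm_ge0 // ge_min lexx.
have c1e : tnorm (t - res y1) <= e * tnorm pb.
 by apply: (le_trans c1); rewrite ler_wpM2r ?tnorm_ge0 // ge_min lexx orbT.
have ek : k1%:R = k%:R :> T.
 have lt1 := tnorm_pb_lt1; have h2 : tnorm (k1%:R - k%:R : T) < 1.
  have -> : k1%:R - k%:R = (t - k%:R) - ((t - res y1) + pb * res y1') by rewrite ey1; ring.
  apply: (@le_lt_trans _ _ (tnorm pb)) => //.
  apply: tnormB_le => //; apply: tnormD_le => //.
  by rewrite tnormM ler_piMr ?tnorm_ge0 //; exact: Oi_resR.
 have p0 : (0 < p)%N by clo.
 have ep : (k1%:R - k%:R : T) = (k1 + k * p.-1)%:R.
  rewrite natrD natrM; congr (_ + _); apply/eqP; rewrite eq_sym -subr_eq0 opprK -{2}[k%:R]mulr1 -mulrDr natr1 prednK //.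
  by rewrite tilt_p mulr0.
 by apply/eqP; rewrite -subr_eq0 ep; apply/eqP/nat_small; rewrite -ep.
exists y1'; split=> //; rewrite -(ler_pM2r lt0); apply: le_trans c1e; rewrite -tnormM.
by rewrite ey1 ek [in X in _ <= X]et le_eqVlt; apply/orP; left; apply/eqP; congr tnorm; ring.
Qed.

(** Digits in F_p are extracted one after the other, and the power series in pi with these digits as
    coefficients reduces to t. *)
Lemma Rlim_E t : Rlim t -> t \in sf EE.
Proof.
have /choice[f hf] : forall t, exists kt : nat * T, Rlim t -> Rlim kt.2 /\ t = kt.1%:R + pb * kt.2.
 move=> s; have [hs|hs] := pselect (Rlim s); last by exists (0%N, 0).
 by have [k [s' h]] := Rlim_digit hs; exists (k, s').
move=> ht; pose c s n : K := ((f (iter n (fun s => (f s).2) s)).1)%:R.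
have nc s n : W (c s n) by exact: W_nat.
have [y hy] := PS_ex (nc t); have hRy : Rp y by exists (c t).
apply/EEP; exists y; first by clo.
apply/eqP; rewrite eq_sym -subr_eq0; apply/eqP; apply: tilt_eq0 => m.
elim: m t ht y hy {hRy} => [|m IH] s hs y hy.
 by rewrite expr0; apply: tnormB_le; [exact: hs.1|apply: Oi_resR; exists (c s)].
have [hs' es] := hf s hs; have [y' hy' ey] := PS_tail hy.
have e0 : res y = (f s).1%:R + pb * res y'.
 have ny := Wp_le1 (PS_Wp hy').
 rewrite ey /c /= rmorph_nat resD ?W_nat ?W_M ?pe_le1 // resM ?pe_le1 // res_pe res_nat //.
have e1 : PS (c (f s).2) y' by move: hy'; congr (PS _ _); apply/funext => n; rewrite /c iterSr.
rewrite {1}es e0 exprS.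
have -> : (f s).1%:R + pb * (f s).2 - ((f s).1%:R + pb * res y') = pb * ((f s).2 - res y') by ring.
by rewrite tnormM ler_wpM2l ?tnorm_ge0 //; exact: IH.
Qed.

Lemma EE_closed t : Oi t -> (forall e : R, 0 < e -> exists a, a \in sf EE /\ tnorm (t - a) <= e) -> t \in sf EE.
Proof.
move=> ot h; apply: Rlim_E; split=> // e e0.
have [|a [ha ca]] := h (Num.min 1 e); first by rewrite lt_min ltr01.
have [a1 a2] : tnorm (t - a) <= 1 /\ tnorm (t - a) <= e by move: ca; rewrite le_min => /andP[].
have oa : Oi a by rewrite -[a](subKr t); exact: tnormB_le.
by have [y hy ey] := EE_Oi_Rp ha oa; exists y; rewrite ey.
Qed.

Lemma horner_lip (P : {poly T}) : exists2 c : R, 0 <= c & forall s t, Oi s -> Oi t ->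
 tnorm P.[s] <= c /\ tnorm (P.[s] - P.[t]) <= c * tnorm (s - t).
Proof.
elim/poly_ind: P => [|P a [c c0 IH]].
 by exists 0 => // s t _ _; rewrite !horner0 subrr tnorm0 mul0r.
exists (Num.max c (tnorm a)) => [|s t os ot]; first by rewrite le_max c0.
have [h1 h2] := IH s t os ot; have [h3 _] := IH t s ot os; rewrite !hornerMXaddC; split.
 apply: tnormD_le; last by rewrite le_max lexx orbT.
 by rewrite tnormM le_max; apply/orP; left; apply: le_trans h1; rewrite ler_piMr ?tnorm_ge0.
have -> : P.[s] * s + a - (P.[t] * t + a) = (P.[s] - P.[t]) * s + P.[t] * (s - t) by ring.
apply: (@le_trans _ _ (c * tnorm (s - t))); last by rewrite ler_wpM2r // le_max lexx.
apply: tnormD_le; rewrite tnormM; first by apply: le_trans h2; rewrite ler_piMr ?tnorm_ge0.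
by rewrite ler_wpM2r ?tnorm_ge0.
Qed.

(** Separability undoes the p-th roots. As t = Q(t^p), the map sending s to Q(s^p) keeps s close to
    t, Q being Lipschitz and the p-th power contracting, while it lowers by one the power of
    Frobenius needed to bring s into E. So t is a limit of elements of E, which is complete. *)
Lemma sepel_perf_closed t : Oi t -> sepel p eE t ->
 (forall e : R, 0 < e -> exists s, [/\ Oi s, perf s & tnorm (t - s) <= e]) -> t \in sf EE.
Proof.
move=> ot [Q eQ] h; apply: EE_closed => // e e0; have [c c0 hc] := horner_lip (map_poly eE Q).
have c1 : 0 < (c + 1)^-1 by rewrite invr_gt0 ltr_wpDl.
pose eta := Num.min e (Num.min 1 (c + 1)^-1).
have eta0 : 0 < eta by rewrite !lt_min e0 ltr01.
have [s [os [k ks] cs]] := h _ eta0.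
have eta1 : eta <= 1 by rewrite !ge_min lexx !orbT.
have etac : c * eta <= 1.
 apply: (@le_trans _ _ (c * (c + 1)^-1)); first by rewrite ler_wpM2l // !ge_min lexx !orbT.
 by rewrite ler_pdivrMr ?mul1r ?ltr_wpDl // lerDl.
suff [a [ha ca]] : exists a, a \in sf EE /\ tnorm (t - a) <= eta.
 by exists a; split=> //; apply: (le_trans ca); rewrite ge_min lexx.
elim: k s os ks cs => [|k IH] s os ks cs; first by exists s; rewrite expn0 expr1 in ks.
pose s' := (map_poly eE Q).[s ^+ p].
have cs' : tnorm (t - s') <= eta.
 rewrite {1}eQ; have [_ h2] := hc _ _ (OiX p ot) (OiX p os); apply: (le_trans h2).
 have -> : t ^+ p - s ^+ p = (t - s) ^+ p by rewrite -!(pFrobenius_autE tilt_pchar) -rmorphB.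
 have ts1 := le_trans cs eta1.
 apply: (@le_trans _ _ (c * (eta * eta))); last by rewrite mulrA ler_piMl // ltW.
 rewrite ler_wpM2l // tnormX; apply: (@le_trans _ _ (tnorm (t - s) ^+ 2)).
  by apply: ler_wiXn2l; rewrite ?tnorm_ge0 //; exact: prime_gt1.
 by rewrite expr2; apply: ler_pM; rewrite ?tnorm_ge0.
apply: (IH s') => //.
 by rewrite /Oi -[s'](subKr t); apply: tnormB_le => //; exact: le_trans cs' eta1.
have g0 : gen eE (s ^+ p) s' by exists Q.
have [Q' ->] : gen eE (s ^+ (p ^ k.+1)) (s' ^+ (p ^ k)).
 rewrite expnS exprM; elim: (k) => [|j IHj] //.
 by rewrite expnSr !exprM; exact: (gen_expp tilt_pchar).
rewrite -(sfv_sub ks) horner_map; exact: sfvP.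
Qed.

Lemma gtM (g : galois S) s t : gt g (s * t) = gt g s * gt g t.
Proof. by apply: tcoordP => n; rewrite tcoordM !tcoord_gt tcoordM rmorphM. Qed.

(** Multiplication by a power of eps - 1, which is invariant and in E, makes t integral and
    preserves separability; approximation in the perfect closure and [sepel_perf_closed]
    conclude. *)
Theorem sepel_fixed t : sepel p eE t ->
 (forall g : galois S, fixes_cyclo g -> gt g t = t) -> t \in sf EE.
Proof.
move=> st ft; have pb0 : pb != 0 by exact: pb_neq0.
have hpb g : fixes_cyclo g -> gt g pb = pb.
 move=> hg; rewrite -(res_pe) -res_gal //; congr res.
 by apply: AA_gal_fix => //; apply: AA_Rp; exact: Rp_pe.
have [N oN] : exists N, Oi (t * pb ^+ N).
 have [->|t0] := eqVneq t 0; first by exists 0%N; rewrite mul0r; exact: Oi0.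
 have ti : 0 < (tnorm t)^-1 by rewrite invr_gt0 tnorm_gt0.
 have [N hN] := tnorm_pbX_small ti; exists N.
 by rewrite /Oi tnormM tnormX mulrC -ler_pdivlMr ?tnorm_gt0 // mul1r; exact: hN.
have sN : sepel p eE (t * pb ^+ N).
 apply: (sepel_gen tilt_pchar st); apply: genM; first exact: gen_id.
 by rewrite -(sfv_sub EE_pb) -rmorphXn; exact: gen_const.
have fN : fixed (t * pb ^+ N).
 move=> g hg; rewrite gtM ft //; congr (_ * _).
 elim: N {oN sN} => [|N IH]; last by rewrite exprS gtM IH hpb.
 by rewrite expr0 /gt teich1 rmorph1 res1.
have hN := sepel_perf_closed oN sN (near_E_perf oN sN fN).
have -> : t = t * pb ^+ N / pb ^+ N by rewrite mulfK // expf_neq0.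
have [_ _ hd] := sf_closed EE; apply: hd => //; apply: EE_X; exact: EE_pb.
Qed.

End ResidueFieldClosed.

(** * Overconvergence as linear growth of denominators *)

Section LinearGrowth.
Local Notation tp := (teich pb : B).
Implicit Types (x y z e : B) (t s : T).

Definition lv e k n x := exists2 z, Wp z & cong n (e ^+ k * x) z.

Lemma lv_le e k k' n x : Wp e -> (k <= k')%N -> lv e k n x -> lv e k' n x.
Proof.
move=> he kk [z hz c]; exists (e ^+ (k' - k) * z); first by apply: WpM => //; exact: WpX.
have -> : e ^+ k' = e ^+ (k' - k) * e ^+ k by rewrite -exprD subnK.
by rewrite -mulrA; apply: congMl => //; apply: Wp_le1; exact: WpX.
Qed.

Lemma lvM e k k' n x x' : Wp e -> W x -> W x' -> lv e k n x -> lv e k' n x' -> lv e (k + k') n (x * x').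
Proof.
move=> he nx nx' [z hz c] [z' hz' c']; exists (z * z'); first by clo.
have ne i : W (e ^+ i) by clo.
rewrite exprD mulrACA; apply: congM => //; [exact: W_M|exact: Wp_le1].
Qed.

Lemma lvD e k n x x' : lv e k n x -> lv e k n x' -> lv e k n (x + x').
Proof.
by move=> [z hz c] [z' hz' c']; exists (z + z'); [exact: WpD|rewrite mulrDr; exact: congD].
Qed.

(** Two denominators that agree modulo p, such as pi and the Teichmuller lift of its residue, are
    interchangeable at the cost of n more factors, which keeps the growth linear. *)
Lemma lv_change e e' w k n x : Wp e' -> Wp w -> e = e' + p%:R * w -> W x -> lv e' k n x -> lv e (k + n) n x.
Proof.
move=> he' hw -> nx [z hz c]; have [u [v [hu hv E]]] := pow_split k n he' hw.
exists (u * z); first by clo.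
rewrite E mulrDl -[u * z]addr0; apply: congD.
 by rewrite mulrAC mulrC; apply: congMl => //; exact: Wp_le1.
apply/cong0P; rewrite -mulrA pnormM pnorm_pow ler_piMr ?ppow_ge0 //.
by apply: W_M => //; exact: Wp_le1.
Qed.

Lemma Wp_tp : Wp tp.
Proof. by apply: Wp_teich; exact: Oi_pb. Qed.

Lemma lv_pe k n x : W x -> lv tp k n x -> lv pe (k + n) n x.
Proof.
move=> nx; have [w hw e] := teich_pb; apply: (@lv_change _ _ (- w)) => //.
- exact: Wp_tp.
- exact: WpN.
- by rewrite e; ring.
Qed.

Lemma lv_tp k n x : W x -> lv pe k n x -> lv tp (k + n) n x.
Proof.
move=> nx; have [w hw e] := teich_pb; apply: (@lv_change _ _ w) => //.
Qed.

(** Multiplication by an exponent affine in n makes x integral modulo p^n. The Teichmuller lift is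
    used as denominator because it acts diagonally on coordinates and is well behaved under
    phi^-1. *)
Definition LG x := `|x| <= 1 /\ exists N k, forall n, lv tp (N + k * n) n x.

Lemma LG_M x y : LG x -> LG y -> LG (x * y).
Proof.
move=> [nx [N [k h]]] [ny [N' [k' h']]]; split; first by clo.
exists (N + N')%N, (k + k')%N => n; have := lvM Wp_tp nx ny (h n) (h' n).
by rewrite mulnDl addnACA.
Qed.

Lemma LG_D x y : LG x -> LG y -> LG (x + y).
Proof.
move=> [nx [N [k h]]] [ny [N' [k' h']]]; split; first by clo.
exists (N + N')%N, (k + k')%N => n; rewrite mulnDl addnACA; apply: lvD.
 by apply: lv_le (h n); [exact: Wp_tp|exact: leq_addr].
by apply: lv_le (h' n); [exact: Wp_tp|exact: leq_addl].
Qed.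

Lemma LG_Wp x : Wp x -> LG x.
Proof.
move=> hx; split; first by clo.
exists 0%N, 0%N => n; exists x => //; rewrite expr0 mul1r; exact: congxx.
Qed.

Lemma LG_Adag x : Adag x -> LG x.
Proof.
move=> hx; have nx : W x by exact: (Adag_le1 hx).
have [N [k hG]] := hx.
have gs n y : GS k y -> lv pe (k * n) n y.
 elim: n y => [|n IH] y hy.
  exists 0 => //.
  by rewrite muln0 expr0 mul1r; apply/cong0P; rewrite ppow0; exact: (GS_le1 hy).
 have [z [y' [hz hy' ->]]] := GS_coef hy; have [z' hz' c] := IH _ hy'.
 exists (pe ^+ (k * n.+1) * z + p%:R * z').
  by clo.
 rewrite mulrDr; apply: congD => //.
 have -> : pe ^+ (k * n.+1) * (pe_s k * y') = p%:R * (pe ^+ (k * n) * y').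
  have e : p%:R = pe_s k * pe ^+ k by exact: pe_sE.
  by rewrite [in RHS]e mulnS exprD; ring.
 have c1 : cong (1 + n) (p%:R ^+ 1 * (pe ^+ (k * n) * y')) (p%:R ^+ 1 * z') by exact: congMp.
 by rewrite !expr1 in c1.
split=> //; exists N, k.+1 => n; rewrite mulSn addnCA addnC; apply: lv_tp => //.
have [y hy c] := hG n; have [z hz c'] := gs n y hy; exists z => //.
apply: congT c'; rewrite addnC exprD -mulrA; apply: congMl => //.
by rewrite pnormX pe_norm // expr1n.
Qed.

Lemma W_coords x : W x -> exists c, witt_coords x c.
Proof.
move=> nx; have [y|c [hc _]] := @coords_ex (fun x => W x) _ x nx; last by exists c.
by move=> ny; split=> //; exact: witt_digit.
Qed.

Lemma lv_coords x c k n : witt_coords x c -> (forall i, (i < n)%N -> Oi (pb ^+ k * c i)) -> lv tp k n x.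
Proof.
move=> hc h; exists (\sum_(i < n) p%:R ^+ i * teich (pb ^+ k * c i)).
 by apply: Wp_sum => i _ _; apply: WpM; [apply: WpX; exact: Wp_nat|apply: Wp_teich; exact: h].
have -> : \sum_(i < n) p%:R ^+ i * teich (pb ^+ k * c i) = tp ^+ k * \sum_(i < n) p%:R ^+ i * teich (c i).
 by rewrite mulr_sumr; apply: eq_bigr => i _; rewrite teichM teichX mulrCA.
apply: congMl; last exact: hc.
by rewrite -teichX; exact: W_teich.
Qed.

Lemma pb_scale t : exists k, forall k', (k <= k')%N -> Oi (pb ^+ k' * t).
Proof.
have [->|t0] := eqVneq t 0; first by exists 0%N => k' _; rewrite mulr0; exact: Oi0.
have ti : 0 < (tnorm t)^-1 by rewrite invr_gt0 tnorm_gt0.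
have [k hk] := tnorm_pbX_small ti; exists k => k' /hk h.
by rewrite /Oi tnormM tnormX -ler_pdivlMr ?tnorm_gt0 // mul1r.
Qed.

Lemma lv_ex n x : W x -> exists k, lv tp k n x.
Proof.
move=> nx; have [c hc] := W_coords nx.
suff [k hk] : exists k, forall i, (i < n)%N -> Oi (pb ^+ k * c i) by exists k; exact: lv_coords hc hk.
elim: n => [|n [k hk]]; first by exists 0%N.
have [k' hk'] := pb_scale (c n); exists (k + k')%N => i; rewrite ltnS leq_eqVlt => /orP[/eqP ->|/hk h].
 by apply: hk'; exact: leq_addl.
by rewrite addnC exprD -mulrA; apply: OiM => //; apply: OiX; exact: Oi_pb.
Qed.

Lemma lv_frobV2 k n x : lv tp (p ^ 2 * k) n (fr2 x) -> lv tp k n x.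
Proof.
move=> [z hz c]; exists (frobV (frobV z)); first by clo.
have -> : tp ^+ k * x = frobV (frobV (tp ^+ (p ^ 2 * k) * fr2 x)).
 rewrite !frobVM !frobKV !frobVX !frobV_teich exprM; congr (_ ^+ _ * _).
 by rewrite expnS expn1 exprM -!teichX !rtK.
by rewrite /cong -!frobVN -!frobVD !frobV_norm.
Qed.

(** Let l be the least exponent that works modulo p^n, and K that of q. Then l + K works for
    phi^2(x) = q x, and applying phi^-2 divides exponents by p^2 >= 4; minimality of l gives l <= K
    + 1. *)
Lemma LG_frob2 q x : LG q -> W x -> fr2 x = q * x -> LG x.
Proof.
move=> [nq [N [k hq]]] nx ex; split=> //; exists N.+1, k => n; set Kq := (N + k * n)%N.
have hex : exists l, `[< lv tp l n x >] by have [l hl] := lv_ex n nx; exists l; apply/asboolP.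
case: (ex_minnP hex) => l /asboolP hl hmin.
apply: (lv_le Wp_tp _ hl); rewrite addSn -/Kq leqNgt; apply/negP => h.
pose l' := l.-1; have hl' : lv tp l' n x.
 apply: lv_frobV2; rewrite ex; apply: lv_le (lvM Wp_tp nq nx (hq n) hl); first by clo.
 rewrite -/Kq; have p2 : (4 <= p ^ 2)%N by rewrite -[4%N]/(2 ^ 2)%N leq_sqr; exact: prime_gt1.
 apply: (@leq_trans (4 * l')); last by rewrite leq_mul2r p2 orbT.
 by rewrite /l'; move: h; lia.
have : (l <= l')%N by apply: hmin; apply/asboolP.
by rewrite /l'; move: h; lia.
Qed.

Lemma coords_Oi n : forall x c z, witt_coords x c -> Wp z -> cong n x z -> forall i, (i < n)%N -> Oi (c i).
Proof.
elim: n => // n IH x c z hc hz xz i hi; have nz : W z by exact: Wp_le1.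
have nx := cong_norm xz nz.
have c0 : cong 1 x (teich (c 0%N)) by have := hc 1%N; rewrite big_ord1 mul1r.
have r0 : c 0%N = res x.
 by rewrite -[c 0%N]res_teich; apply/res_cong => //; exact: congS.
have rz : res x = res z by apply/res_cong => //; apply: cong_le xz.
case: i hi => [|i] hi; first by rewrite r0 rz; exact: Wp_res.
have [z' hz' ez] := Wp_digit hz; have [x' nx' ex] := witt_digit nx.
apply: (IH x' (fun i => c i.+1) z') => // [m|].
 apply: (@congp _ m 1); rewrite expr1 add1n; have := hc m.+1.
 have -> : p%:R * x' = x - teich (c 0%N) by rewrite r0 {1}ex [teich _ + _]addrC addrK.
 rewrite big_ord_recl mul1r /cong opprD addrA mulr_sumr.
 by congr (`|_ - _| <= _); apply: eq_bigr => j _; rewrite exprS mulrA.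
apply: (@congp _ n 1); rewrite expr1 add1n; move: xz.
by rewrite /cong {1}ex {1}ez rz opprD addrACA subrr add0r.
Qed.

(** The bound on denominators bounds the norm of c_i by r^(-(M + k(i+1))), r being the norm of eps -
    1; any m with p^(-m) < r^k / p makes the weighted norms tend to 0. *)
Lemma LG_overconvergent N x : LG (p%:R ^+ N * x) -> overconvergent x.
Proof.
set w := p%:R ^+ N * x; move=> [nw [M [k hk]]]; have [c hc] := W_coords nw.
have hO i : Oi (pb ^+ (M + k * i.+1) * c i).
 have [z hz cz] := hk i.+1; set e := (M + k * i.+1)%N in cz *.
 apply: (coords_Oi (x := tp ^+ e * w) (z := z) (c := fun i => pb ^+ e * c i) (n := i.+1)) => // n.
 have -> : \sum_(i < n) p%:R ^+ i * teich (pb ^+ e * c i) = tp ^+ e * \sum_(i < n) p%:R ^+ i * teich (c i).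
  by rewrite mulr_sumr; apply: eq_bigr => j _; rewrite teichM teichX mulrCA.
 by apply: congMl; [rewrite -teichX; exact: W_teich|exact: hc].
have t0 : 0 < tnorm pb by [].
pose r := tnorm pb; have rk (i : nat) : 0 < r ^+ i by rewrite exprn_gt0.
have [m hm] := ppow_small (mulr_gt0 (rk k) pinv_gt0).
exists N, m, c; split=> //; apply/cvgrPdist_lt => d d0.
have d1 : 0 < d * r ^+ (M + k) by rewrite mulr_gt0.
have [n0 hn0] := ppow_small d1; exists n0 => // i /= hi.
have nn : 0 <= tnorm (c i) * (p%:R ^- i) ^+ m by rewrite mulr_ge0.
rewrite sub0r normrN ger0_norm // -(ltr_pM2r (rk (M + k)%N)); apply: le_lt_trans hn0.
have h1 : tnorm (c i) * r ^+ (M + k * i.+1) <= 1 by have := hO i; rewrite /Oi tnormM tnormX mulrC.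
have h2 : (p%:R ^- i) ^+ m <= (r ^+ k) ^+ i * p%:R ^- i.
 have -> : (p%:R ^- i) ^+ m = (p%:R ^- m) ^+ i :> R by rewrite -!exprVn -!exprM mulnC.
 rewrite -[X in _ * X]exprVn -exprMn lerXn2r ?nnegrE //.
  by rewrite mulr_ge0 ?(ltW (rk k)) // pinv_ge0.
 exact: ltW.
apply: (@le_trans _ _ (tnorm (c i) * ((r ^+ k) ^+ i * p%:R ^- i) * r ^+ (M + k))).
 by rewrite ler_wpM2r ?(ltW (rk _)) // ler_wpM2l ?tnorm_ge0.
have -> : tnorm (c i) * ((r ^+ k) ^+ i * p%:R ^- i) * r ^+ (M + k) = (tnorm (c i) * r ^+ (M + k * i.+1)) * p%:R ^- i.
 by rewrite mulnS -exprM !exprD; ring.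
apply: (@le_trans _ _ (p%:R ^- i)); last exact: ppow_le.
by rewrite ler_piMl ?ppow_ge0.
Qed.

Lemma overconvergent_LG x : overconvergent x -> exists N, LG (p%:R ^+ N * x).
Proof.
move=> [N [m [c [hc /cvgrPdist_lt ht]]]]; exists N; set w := p%:R ^+ N * x in hc *.
have nw : W w by have := hc 0%N; rewrite big_ord0 subr0 ppow0.
split=> //; have t0 : 0 < tnorm pb by exact: tnorm_pb_gt0.
have t1 : tnorm pb <= 1 by [].
have Op k : Oi (pb ^+ k) by clo.
have [k hk] := tnorm_pbX_small (ppow_gt0 m).
have [i0 _ hi0] := ht 1 ltr01.
have big i : (i0 <= i)%N -> Oi (pb ^+ (k * i) * c i).
 move=> /hi0 /=; rewrite sub0r normrN ger0_norm ?mulr_ge0 // => h.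
 rewrite /Oi tnormM mulrC tnormX; apply: le_trans (ltW h); rewrite ler_wpM2l // exprM.
 have -> : (p%:R ^- i) ^+ m = (p%:R ^- m) ^+ i :> R by rewrite -!exprVn -!exprM mulnC.
 by rewrite lerXn2r ?nnegrE ?exprn_ge0 ?tnorm_ge0 ?ppow_ge0 // hk.
have [M hM] : exists M, forall i, (i < i0)%N -> Oi (pb ^+ M * c i).
 elim: (i0) => [|n [M hM]]; first by exists 0%N.
 have [k' hk'] := pb_scale (c n); exists (M + k')%N => i; rewrite ltnS leq_eqVlt => /orP[/eqP ->|/hM h].
  by apply: hk'; exact: leq_addl.
 by rewrite addnC exprD -mulrA; exact: OiM.
exists M, k => n; apply: (lv_coords hc) => i hi.
have [h|h] := ltnP i i0; first by rewrite addnC exprD -mulrA; apply: OiM => //; exact: hM.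
have e : (M + k * n = (M + k * (n - i)) + k * i)%N by lia.
by rewrite e exprD -mulrA; apply: OiM => //; exact: big.
Qed.

(** Linear growth says that pi^k y has integral residue, hence the residue of a power series;
    subtracting it and dividing by p / pi^k gives an element with the same growth, and the expansion
    belongs to the closure of Z_p[[pi]][p / pi^k]. *)
Lemma AA_LG_Adag x : AA x -> LG x -> Adag x.
Proof.
move=> hx [nx [N [k0 h0]]]; pose k := k0.+1.
have hpe (i : nat) : W (pe ^+ i) by clo.
have h m : lv pe (N + k * m) m x.
 by have := lv_pe nx (h0 m); rewrite /k mulSn [(m + _)%N]addnC addnA.
have step n : forall y, AA y -> (forall m, lv pe (k * m) m y) -> exists2 g, GS k g & cong n (pe ^+ k * y) g.
 elim: n => [|n IH] y hy ly.
  exists 0; first by apply: GS_L; exact: Rp0.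
  by apply/cong0P; rewrite ppow0 W_M //; exact: (AA_le1 hy).
 set a := pe ^+ k * y; have ha : AA a.
  by apply: AA_M => //; apply: AA_Rp; apply: RpX => //; exact: Rp_pe.
 have na := AA_le1 ha.
 have Ores : Oi (res a).
  have [z hz c] := ly 1%N; rewrite muln1 -/a in c.
  have nz : W z by clo.
  by have -> : res a = res z; [apply/res_cong|exact: Wp_res].
 have [r hr er] : exists2 r, Rp r & res r = res a.
  by apply: EE_Oi_Rp => //; apply/EEP; exists a.
 have nr := Wp_le1 (Rp_Wp hr).
 have [|a1 na1 ea1] := @B_div 1 (a - r); first by apply/res_cong.
 rewrite expr1 in ea1.
 have ha1 : AA a1.
  apply: AA_sat => //; rewrite -ea1; apply: AA_D => //; apply: AA_N; exact: AA_Rp.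
 have [|g hg cg] := IH a1 ha1.
  move=> m; have [z hz c] := ly m.+1; pose z1 := z - pe ^+ (k * m) * r.
  have hz1 : Wp z1 by apply: WpB => //; apply: WpM; [apply: WpX; exact: Wp_pe|exact: (Rp_Wp hr)].
  have c1 : cong m.+1 (p%:R * (pe ^+ (k * m) * a1)) z1.
   have -> : p%:R * (pe ^+ (k * m) * a1) = pe ^+ (k * m.+1) * y - pe ^+ (k * m) * r.
    by rewrite mulrCA -ea1 /a mulrBr mulrA -exprD mulnS addnC.
   by apply: congB => //; exact: congxx.
  have nz1 : `|z1| <= p%:R ^- 1.
   rewrite -[z1](subKr (p%:R * (pe ^+ (k * m) * a1))); apply: pnormB_le.
    by rewrite pnormM pnorm_p ppow1 ler_piMr ?pinv_ge0 // W_M // hpe.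
   by apply: (le_trans c1); exact: ppow_le.
  have [z2 hz2 ez2] := Wp_div hz1 nz1; exists z2 => //.
  by apply: (@congp _ m 1); rewrite add1n expr1; move: c1; rewrite ez2 expr1.
 exists (r + pe_s k * g).
  by apply: GS_D; [exact: GS_L|apply: GS_M => //; exact: GS_s].
 have -> : a = r + pe_s k * (pe ^+ k * a1).
  have e : p%:R = pe_s k * pe ^+ k by exact: pe_sE.
  by rewrite mulrA -e -ea1 addrC subrK.
 by apply: congD; [exact: congxx|exact: pe_s_cong].
exists (k + N)%N, k => n; rewrite exprD -mulrA; apply: step.
 by apply: AA_M => //; apply: AA_Rp; apply: RpX => //; exact: Rp_pe.
by move=> m; have [z hz c] := h m; exists z => //; rewrite mulrA -exprD addnC.
Qed.

End LinearGrowth.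
#[local] Hint Resolve Wp_tp : core.
#[local] Hint Resolve LG_M LG_D LG_Wp LG_Adag : closed.

(** * Regular elements, and invariants in E^dagger *)

Section Descent.
Implicit Types (x y z : B) (c : K).

Lemma eval_pi_scale c (b : int -> K) x : eval_pi eps b x -> eval_pi eps (fun i => c * b i) (iB c * x).
Proof.
move=> [N h]; have [m nm] := F_scale c; exists (N + m)%N => n k; have [M0 hM0] := h n k.
exists M0 => M /hM0[y [z [ny /WplusP hz e]]]; have nm' : W (iB (p%:R ^+ m * c)) by rewrite QpBt_norm.
exists (iB (p%:R ^+ m * c) * y), (iB (p%:R ^+ m * c) * z); split.
- exact: W_M.
- by apply/WplusP; apply: WpM => //; exact: Wp_QpBt.
have -> : \sum_(k <- zrange M) iB (c * b k) * pe ^ k = iB c * \sum_(k <- zrange M) iB (b k) * pe ^ k.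
 by rewrite mulr_sumr; apply: eq_bigr => i _; rewrite rmorphM mulrA.
set s := \sum_(k <- zrange M) _ in e *.
have -> : p%:R ^+ (N + m) * (iB c * x - iB c * s) = iB (p%:R ^+ m * c) * (p%:R ^+ N * (x - s)).
 by rewrite rmorphM rmorphXn rmorph_nat exprD; ring.
by rewrite e; ring.
Qed.

Lemma BQp_scale c x : BQp eps x -> BQp eps (iB c * x).
Proof.
move=> [b [[C hC] /cvgrPdist_lt ht hb]]; exists (fun i => c * b i); split; last exact: eval_pi_scale.
 by exists (`|c| * C) => k; rewrite pnormM ler_wpM2l ?pnorm_ge0.
apply/cvgrPdist_lt => e e0; have c1 : 0 < `|c| + 1 by rewrite ltr_wpDl ?pnorm_ge0.
have [N _ hN] := ht _ (divr_gt0 e0 c1); exists N => // k /hN /=.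
rewrite !sub0r !normrN !ger0_norm ?pnorm_ge0 // ltr_pdivlMr // pnormM; apply: le_lt_trans.
by rewrite mulrC ler_wpM2l ?pnorm_ge0 // lerDl.
Qed.

Lemma Bnr_scale c x : Bnr eps x -> Bnr eps (iB c * x).
Proof.
move=> h e e0; have c1 : 0 < `|c| + 1 by rewrite ltr_wpDl ?pnorm_ge0.
have [_ [[y [P [Q [h1 h2 h3 h4 [hQ ->]]]]] hc]] := h _ (divr_gt0 e0 c1).
exists (iB c * Q.[y]); split.
 exists y, P, (iB c *: Q); split=> //; split; last by rewrite hornerZ.
 by move=> k; rewrite coefZ; exact: BQp_scale.
rewrite -mulrBr pnormM QpBt_norm; rewrite ltr_pdivlMr // in hc; apply: le_lt_trans hc.
by rewrite mulrC ler_wpM2l ?pnorm_ge0 // lerDl.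
Qed.

Lemma Edag_scale c (f : robba K) x : Edag_image eps f x -> exists f', Edag_image eps f' (iB c * x).
Proof.
move=> [[C hC] h]; exists (robba_monomial c 0 * f); split.
 by exists (`|c| * C) => n; rewrite robba_monE pnormM ler_wpM2l ?pnorm_ge0.
have -> : (robba_monomial c 0 * f : int -> K) = (fun i => c * f i) by apply/funext => i; exact: robba_monE.
exact: eval_pi_scale.
Qed.

(** The integral form of [Bdag]: completed unramified and of linear growth. These properties are
    stable under products, which are not directly visible on [Bdag]. *)
Definition regular x := NN x /\ LG x.

Lemma regular_M x y : regular x -> regular y -> regular (x * y).
Proof. by move=> [h1 h2] [h3 h4]; split; [exact: (cr_M cr_NN)|exact: LG_M]. Qed.
Lemma regular_D x y : regular x -> regular y -> regular (x + y).
Proof. by move=> [h1 h2] [h3 h4]; split; [exact: (cr_D cr_NN)|exact: LG_D]. Qed.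
Lemma regular_QpBt c : W c -> regular (iB c).
Proof. by move=> h; split; [apply: NN_AA; exact: AA_QpBt|apply: LG_Wp => //; exact: Wp_QpBt]. Qed.

(** Both halves come from the equation: separability of residues for the unramified part, division
    of denominators by p^2 for the growth. *)
Lemma regular_period q x : AA q -> LG q -> `|q| = 1 -> W x -> fr2 x = q * x -> regular x.
Proof.
move=> hq lq nq nx ex; split; last exact: LG_frob2 lq nx ex.
have [b eb] := vA_ex hq.
have h0 : NN 0 by rewrite -(rmorph0 iB); apply: NN_AA; apply: AA_QpBt; rewrite pnorm0.
by apply: (NN_frob2 (a := b) nx _ h0); rewrite eb ?addr0.
Qed.

Lemma pX_iB k x : iB (p%:R ^- k) * (p%:R ^+ k * x) = x.
Proof. by rewrite fmorphV rmorphXn rmorph_nat mulKf // pX_neq0. Qed.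

Lemma regular_Bdag k x : regular (p%:R ^+ k * x) -> Bdag eps x.
Proof.
move=> [h1 h2]; split; last exact: LG_overconvergent h2.
by rewrite -(pX_iB k x); apply: Bnr_scale; exact: (NN_Bnr h1).
Qed.

Lemma period_Bdag q x : AA q -> LG q -> `|q| = 1 -> fr2 x = q * x -> Bdag eps x.
Proof.
move=> hq lq nq ex; have [k hk] := F_scale x; apply: (@regular_Bdag k).
by apply: (regular_period hq lq nq hk); rewrite !rmorphM !rmorphXn !rmorph_nat ex mulrCA.
Qed.

Lemma Bdag_regular x : Bdag eps x -> exists k, forall k', (k <= k')%N -> regular (p%:R ^+ k' * x).
Proof.
move=> [h1 h2]; have [N [nN hN]] := overconvergent_LG h2; exists N => k' kk.
have e : p%:R ^+ k' * x = iB (p%:R ^+ (k' - N)) * (p%:R ^+ N * x).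
 by rewrite rmorphXn rmorph_nat mulrA -exprD subnK.
rewrite e; apply: regular_M; first by apply: regular_QpBt; rewrite pnorm_pow ppow_le1.
split => //.
apply: Bnr_NN => //; have -> : p%:R ^+ N = iB (p%:R ^+ N) by rewrite rmorphXn rmorph_nat.
exact: Bnr_scale.
Qed.

Lemma regular_fixed x : regular x ->
 (forall g : galois S, fixes_cyclo g -> galB g x = x) ->
 exists f, Edag_image eps f x.
Proof.
move=> [h1 h2] hx.
have hA : AA x.
 apply: (@NN_fixed (fun g => fixes_cyclo g)) => //.
 exact: sepel_fixed.
have [f hf] := Adag_ev (AA_LG_Adag hA h2).
by exists f; exact: eva_Edag.
Qed.

End Descent.
#[local] Hint Resolve regular_M regular_D regular_QpBt : closed.

Context (d : K) (sd : C) (d_ok : Zp2_sqrt d sd).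

(** * Z_{p^2} inside W(tilt) and the Galois action on it *)

Section Quadratic.

Lemma sd_Zp2 : Zp2 sd.
Proof.
case: d_ok => _ ->; exists 0, 1; rewrite pnorm0 pnorm1 ler01.
by split=> //; rewrite rmorph0 rmorph1 add0r mul1r.
Qed.

Lemma iB_fr (a : K) : fr (iB a) = iB a.
Proof. exact/isom_QpBt/frob_norm. Qed.

(* The square root of d in W(tilt): a combination of Teichmuller lifts of roots of unity *)
Lemma sdB_ex : exists x, [/\ x ^+ 2 = iB d, fr x = - x, W x, theta x = sd & x != 0].
Proof.
have [z [b [c [zp nb nc e]]]] := sd_Zp2.
have q0 := prim_order_gt0 zp.
have zq : z ^+ (p ^ 2) = z.
 by rewrite -[(p ^ 2)%N](@subnK 1) ?expn_gt0 ?prime_gt0 // exprD (prim_expr_order zp) mul1r expr1.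
(* The sequence z^(p^n) is compatible because z^(p^2) = z; the Teichmuller lift of this element is a
   root of unity fixed by phi^2 and sent to z by theta. *)
have [|t et] := @tcoord_surj _ _ S (fun n => z ^+ (p ^ n)).
 by move=> n; rewrite -exprM -expnSr expnSr -expnSr !expnS mulnA exprM -[(p * p)%N]/(p ^ 2)%N zq.
have tq : t ^+ (p ^ 2) = t by apply: tcoordP => n; rewrite tcoordX et -exprM mulnC exprM zq.
have nt : tnorm t = 1.
 have := congr1 (fun x : C => `|x|) (prim_expr_order zp); rewrite pnormX pnorm1 => /eqP.
 by rewrite pexpr_eq1 ?pnorm_ge0 // => /eqP; rewrite /tnorm et expn0 expr1.
have Ot : Oi t by rewrite /Oi nt.
pose zB := teich t.
have fz : fr2 zB = zB by rewrite !frob_teich -exprM tq.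
have nzB : W zB by exact: W_teich.
have thz : theta zB = z by rewrite theta_teich // et.
pose x := iB b + iB c * zB.
have fx : fr2 x = x by rewrite !rmorphD !rmorphM !iB_fr fz.
have nx : W x by apply: pnormD_le; [|apply: W_M]; rewrite ?QpBt_norm.
have tx : theta x = sd.
 rewrite thetaD ?thetaM ?theta_QpBt ?thz //; try exact: Wp_QpBt.
 - exact: Wp_teich.
 - by apply: WpM; [exact: Wp_QpBt|exact: Wp_teich].
have Wx : Wp x by exact: fix2_Wp.
have nd : W (iB d).
 rewrite QpBt_norm -(@QpCp_norm R p S d); case: d_ok => <- _; rewrite -tx -thetaX //.
 by apply: theta_le1; exact: WpX.
have x2 : x ^+ 2 = iB d.
 apply: theta_fix2_inj; rewrite ?rmorphXn ?fx ?iB_fr ?W_X //.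
 by rewrite thetaX // tx theta_QpBt; [case: d_ok|rewrite -(QpBt_norm)].
(* Otherwise x would be in Q_p, so the lifted root of unity would be fixed by phi and z^p = z; this
   contradicts the order p^2 - 1 of z. *)
have x0 : fr x != x.
 apply/eqP => fx1; have [a ea] := frob_fix fx1.
 have na : W a by rewrite -(QpBt_norm) -ea.
 have Zz : Zp2 z by exists z, 0, 1; rewrite pnorm0 pnorm1 rmorph0 rmorph1 add0r mul1r.
 have [y1 [y2 [n1 n2 ez]]] : exists y z0 : K, [/\ W y, W z0 & z = iC y + iC z0 * sd].
  by case: d_ok => _ <-.
 have ezB : zB = iB (y1 + y2 * a).
  have n3 : W (y1 + y2 * a) by clo.
  apply: theta_fix2_inj; rewrite ?iB_fr ?QpBt_norm //.
  by rewrite thz theta_QpBt // ez rmorphD rmorphM -tx ea theta_QpBt.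
 have : fr zB = zB by rewrite ezB iB_fr.
 rewrite frob_teich => /(congr1 theta); rewrite !theta_teich //; last by clo.
 rewrite tcoordX et expn0 expr1 => zz.
 have : (p == 1 %[mod p ^ 2 - 1])%N by rewrite -(eq_prim_root_expr zp) expr1 zz.
 by rewrite p_mod_p2m1.
have : (fr x - x) * (fr x + x) = 0.
 by rewrite -subr_sqr -rmorphXn x2 iB_fr subrr.
move/eqP; rewrite mulf_eq0 subr_eq0 (negPf x0) /= addr_eq0 => /eqP fx1.
exists x; split=> //; apply: contraNneq x0 => ->.
by rewrite rmorph0.
Qed.

Definition sdB : B := xget 0 [set x | [/\ x ^+ 2 = iB d, fr x = - x, W x, theta x = sd & x != 0]].

Lemma sdBP : [/\ sdB ^+ 2 = iB d, fr sdB = - sdB, W sdB, theta sdB = sd & sdB != 0].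
Proof. exact: (xgetPex 0 sdB_ex). Qed.
Lemma two_neq0 (F : padic) : 2%:R != 0 :> F.
Proof. exact: natF_neq0. Qed.

Lemma fix2_coords x : fr2 x = x -> exists y z : K, x = iB y + iB z * sdB.
Proof.
move=> fx; have [s2 fs ns ts s0] := sdBP.
have [y ey] : exists y : K, (x + fr x) / 2%:R = iB y.
 by apply: frob_fix; rewrite fmorph_div rmorph_nat rmorphD fx addrC.
have [z ez] : exists z : K, (x - fr x) / (2%:R * sdB) = iB z.
 apply: frob_fix; rewrite fmorph_div rmorphM rmorph_nat rmorphB fx fs.
 by rewrite mulrN invrN mulrN -mulNr opprB.
by exists y, z; rewrite -ey -ez; field; rewrite two_neq0 s0.
Qed.

Lemma fixesQp2P (g : galois S) : fixesQp2 g <-> galC g sd = sd.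
Proof.
split; first by move/asboolP; apply; exact: sd_Zp2.
move=> gs; apply/asboolP => x; case: d_ok => _ -> [y [z [_ _ ->]]].
by rewrite rmorphD rmorphM !galC_fix gs.
Qed.

Lemma gal_sd (g : galois S) : galC g sd = if fixesQp2 g then sd else - sd.
Proof.
case: ifPn => [/fixesQp2P //|/negP h]; have : (galC g sd - sd) * (galC g sd + sd) = 0.
 by rewrite -subr_sqr -rmorphXn; case: d_ok => -> _; rewrite galC_fix subrr.
move/eqP; rewrite mulf_eq0 subr_eq0 addr_eq0 => /orP[/eqP gs|/eqP //].
by case: h; apply/fixesQp2P.
Qed.

Lemma gal_sdB (g : galois S) : galB g sdB = if fixesQp2 g then sdB else fr sdB.
Proof.
have [s2 fs ns ts s0] := sdBP.
have fs2 : fr2 sdB = sdB by rewrite fs rmorphN fs opprK.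
have Ws : Wp sdB by exact: fix2_Wp.
apply: theta_fix2_inj; rewrite ?galB_norm //.
- by rewrite !frob_gal fs2.
- by case: ifP; rewrite ?fs2.
- by case: ifP; rewrite ?frob_norm.
by rewrite theta_gal // ts gal_sd; case: ifP => _; rewrite // fs thetaN // ts.
Qed.

Lemma gal_fix2 (g : galois S) x : fr2 x = x -> galB g x = if fixesQp2 g then x else fr x.
Proof.
move/fix2_coords => [y [z ->]].
rewrite !rmorphD !rmorphM !(isom_QpBt _ (galB_norm g)) !iB_fr gal_sdB.
by case: ifP.
Qed.

Lemma Zp2_lift (x : C) : Zp2 x -> exists X : B, [/\ fr2 X = X, W X & theta X = x].
Proof.
case: d_ok => _ -> [y [z [ny nz ->]]].
have [s2 fs ns ts s0] := sdBP.
have fs2 : fr2 sdB = sdB by rewrite fs rmorphN fs opprK.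
have Ws : Wp sdB by exact: fix2_Wp.
have [Wy Wz] : Wp (iB y) /\ Wp (iB z) by clo.
exists (iB y + iB z * sdB); split.
- by rewrite !rmorphD !rmorphM !iB_fr fs2.
- by apply: pnormD_le; [|apply: W_M]; rewrite ?QpBt_norm.
- by rewrite thetaD ?thetaM ?theta_QpBt ?ts //; exact: WpM.
Qed.

(** The inverse of the isomorphism induced by theta from the integral elements fixed by phi^2 to
    Z_{p^2}. *)
Definition lift2 (x : C) : B := xget 0 [set X : B | [/\ fr2 X = X, W X & theta X = x]].

Lemma lift2P (x : C) : Zp2 x -> [/\ fr2 (lift2 x) = lift2 x, W (lift2 x) & theta (lift2 x) = x].
Proof. by move=> h; exact: (xgetPex 0 (Zp2_lift h)). Qed.
Lemma lift2E (x : C) X : Zp2 x -> fr2 X = X -> W X -> theta X = x -> lift2 x = X.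
Proof. by move=> /lift2P[h1 h2 h3] k1 k2 k3; apply: theta_fix2_inj; rewrite ?h3. Qed.

End Quadratic.

(** * The period X up to a cocycle, from the Lubin-Tate period *)

Section Period.
Local Notation q := (p ^ 2)%N.
Implicit Types (x y z : B) (g h : galois S).

(** If x is a multiple of [w] modulo p^(n+1), the equation x = phi^-2(p x + x^q) makes it a multiple
    of [w^(1/q)] modulo p^(n+2), and the root still has norm less than 1. *)
Lemma nu_Wm x : Wp x -> tnorm (res x) < 1 -> fr2 x = p%:R * x + x ^+ q -> Wm x.
Proof.
move=> Wx rx fx.
have q0 : (0 < q)%N by [].
have q1 : (q = (q - 1).+1)%N by lia.
have main n : exists w z, [/\ tnorm w < 1, Wp z & cong n.+1 x (teich w * z)].
 elim: n => [|n [w [z [w1 Wz h]]]].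
  exists (res x), 1; split=> //.
  have nx : W x by clo.
  have nt : W (teich (res x)) by [].
  by rewrite mulr1; apply/res_cong; rewrite // res_teich.
 have Ow : Oi w by exact: ltW.
 exists (rt (rt w)), (frobV (frobV (p%:R * z + teich w ^+ (q - 1) * z ^+ q))); split.
 - have e : tnorm (rt (rt w)) ^+ q = tnorm w by rewrite exprM !tnorm_rt.
  move: w1; rewrite -e => w1; rewrite ltNge; apply/negP => h1.
  by move: w1; rewrite ltNge exprn_ege1.
 - do 2!apply: Wp_frobV; apply: WpD; apply: WpM => //; try exact: WpX.
  by apply: WpX; exact: Wp_teich.
 rewrite -!frobV_teich -!frobVM -[x]frobKV -[fr x]frobKV /cong -!frobVN -!frobVD !frobV_norm fx.
 have -> : teich w * (p%:R * z + teich w ^+ (q - 1) * z ^+ q) = p%:R * (teich w * z) + (teich w * z) ^+ q.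
  by rewrite exprMn {3}q1 exprS; ring.
 apply: congD; first by rewrite -[p%:R]expr1; exact: (congMp 1 h).
 apply: cong_expq => //; first by clo.
 by apply: W_M; [exact: W_teich|exact: Wp_le1].
move=> n; have [w [z [w1 Wz h]]] := main n.
have /B_div[y ny e] : `|x - teich w * z| <= p%:R ^- n by exact: cong_le (leqnSn n) h.
by exists w, y, z; split=> //; rewrite -e subrK.
Qed.

Lemma theta0 : theta (0 : B) = 0.
Proof. by rewrite -[X in theta X]/(0%:R) theta_nat. Qed.

(** g(nu) is the value at nu of the Lubin-Tate series [b]: under each theta phi^(-2n), both sides
    give g(t_n), by the definition of chi_2, and [theta_ker] applies. As [b](T) = b T + ..., the
    quotient by nu is b modulo nu. *)
Lemma lt_gal nu (t : nat -> C) g b : Wp nu -> Wm nu -> (forall n, `|t n| < 1) -> t 0%N = 0 ->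
 (forall n, p%:R * t n.+1 + t n.+1 ^+ q = t n) -> (forall n, theta (frobV2 n nu) = t n) ->
 is_chi2 g b -> exists r, [/\ Wp r, Wm (r - lift2 b) & galB g nu = nu * r].
Proof.
move=> Wnu hnu nt t0 et tnu [Zb nb [c [[c0 c1 Zc _] hc]]].
pose b' k := lift2 (c k).
have b'P k : [/\ fr2 (b' k) = b' k, W (b' k) & theta (b' k) = c k] by exact: lift2P _ (Zc k).
have Wb k : Wp (b' k) by have [h1 h2 _] := b'P k; exact: fix2_Wp.
have [N hN] := weak_series hnu Wb.
have eN M : N 0%N = \sum_(k < M) b' k * nu ^+ k + nu ^+ M * N M.
 elim: M => [|M IH]; first by rewrite big_ord0 add0r mul1r.
 by rewrite {1}IH (hN M).2 big_ord_recr /= exprSr; ring.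
have tor n : lt_torsion (t n).
 split=> //; exists n; elim: n => [|n IH] //; rewrite iterSr /= /lt_p !hornerE -[in X in iter n _ X]et in IH *.
 by rewrite -IH -et.
have e : galB g nu = N 0%N.
 apply/eqP; rewrite -subr_eq0; apply/eqP; have WN := (hN 0%N).1; have Wg : Wp (galB g nu) by exact: Wp_gal.
 apply: theta_ker => [|n]; first by clo.
 rewrite frobV2D frobV2N frobV2_gal thetaB; last 2 first.
 - by apply: Wp_gal; exact: Wp_frobV2.
 - exact: Wp_frobV2.
 rewrite theta_gal ?tnu; last exact: Wp_frobV2.
 apply/eqP; rewrite subr_eq0; apply/eqP.
 apply: (tends_uniq (hc _ (tor n))); apply/tendsP => ee ee0.
 have [M hM] := pow_small (pnorm_ge0 (t n)) (nt n) ee0; exists M => k hk.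
 rewrite pnormBC.
 suff -> : theta (frobV2 n (N 0%N)) - \sum_(k0 < k) c k0 * t n ^+ k0 = t n ^+ k * theta (frobV2 n (N k)).
  rewrite pnormM pnormX; apply: le_lt_trans (hM k hk).
  by rewrite ler_piMr ?exprn_ge0 ?pnorm_ge0 //; apply: theta_le1; apply: Wp_frobV2; exact: (hN k).1.
 have WNk : Wp (frobV2 n (N k)) by apply: Wp_frobV2; exact: (hN k).1.
 have Wnun : Wp (frobV2 n nu) by exact: Wp_frobV2.
 have -> : theta (frobV2 n (N 0%N)) = theta (\sum_(k0 < k) b' k0 * frobV2 n nu ^+ k0 + frobV2 n nu ^+ k * frobV2 n (N k)).
  rewrite {1}(eN k) frobV2D frobV2M frobV2X; congr (theta (_ + _)).
  elim: k {hk WNk} => [|k IH]; first by rewrite !big_ord0 frobV2_fix ?rmorph0.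
  by rewrite !big_ord_recr /= frobV2D IH frobV2M frobV2X; congr (_ + _ * _); rewrite frobV2_fix //; case: (b'P k).
 have Ws m : Wp (\sum_(k0 < m) b' k0 * frobV2 n nu ^+ k0).
  by apply: Wp_sum => i _ _; apply: WpM => //; exact: WpX.
 have -> : theta (\sum_(k0 < k) b' k0 * frobV2 n nu ^+ k0 + frobV2 n nu ^+ k * frobV2 n (N k)) =
   \sum_(k0 < k) c k0 * t n ^+ k0 + t n ^+ k * theta (frobV2 n (N k)).
  rewrite thetaD //; last by apply: WpM => //; exact: WpX.
  rewrite thetaM ?thetaX ?tnu //; last by clo.
  congr (_ + _); elim: (k) => [|m IH]; first by rewrite !big_ord0 theta0.
  rewrite !big_ord_recr /= thetaD; [|exact: Ws|by apply: WpM => //; exact: WpX].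
  by rewrite IH thetaM ?thetaX ?tnu //; [case: (b'P m) => _ _ ->|exact: WpX].
 by rewrite addrAC subrr add0r.
have b0 : b' 0%N = 0.
 rewrite /b' c0; have Z0 : Zp2 (0 : C) by rewrite -c0.
 apply: (lift2E Z0); rewrite ?rmorph0 ?pnorm0 //.
 exact: theta0.
exists (N 1%N); split; [exact: (hN 1%N).1| |by rewrite e (hN 0%N).2 b0 add0r].
rewrite (hN 1%N).2 /b' c1 addrAC subrr add0r.
by apply: WmMr => //; exact: (hN 2%N).1.
Qed.

(** phi^2(nu) = xi nu with xi = p + nu^(q-1). Transported by phi^-2, xi and Q2 both lie in the
    kernel of theta, which xi generates; so Q2 = xi v, and X_0 = nu w with phi^2(w) = v w. *)
Lemma lt_period_ex : exists X0, [/\ `|X0| = 1, Wp X0, fr2 X0 = eQ2 * X0 &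
 forall g b, is_chi2 g b -> exists r, [/\ Wp r, Wm (r - lift2 b) & galB g X0 = r * X0]].
Proof.
have [t [t0 t1 nt et]] := lt_seq.
have [nu [Wnu fnu tnu cnu]] := lt_nu t0 nt et.
have [n1 n2 n3] := t1_norm t1.
have nu2 : `|tcoord (res nu) 2| = `|t 1%N|.
 by apply: pnorm_close; apply: le_lt_trans n1; rewrite -ppow1.
have q0 : (0 < q)%N by [].
have rnu : tnorm (res nu) < 1.
 by rewrite (tnorm_coord _ 2) nu2 exprn_ilt1 ?pnorm_ge0 // -lt0n.
have hnu : Wm nu by exact: nu_Wm.
have nnu0 : res nu != 0.
 apply: contraTneq n1 => h; rewrite -nu2 h tcoord_zero pnorm0 -leNgt; exact: pinv_ge0.
have q1 : (q = (q - 1).+1)%N by lia.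
pose xi := p%:R + nu ^+ (q - 1); pose xi' := frobV2 1 xi.
have Wxi : Wp xi by apply: WpD; [exact: Wp_nat|exact: WpX].
have Wxi' : Wp xi' by exact: Wp_frobV2.
have exi' : xi' = p%:R + frobV2 1 nu ^+ (q - 1) by rewrite /xi' frobV2D frobV2_p frobV2X.
have Wnu1 : Wp (frobV2 1 nu) by exact: Wp_frobV2.
have txi : theta xi' = 0.
 rewrite exi' thetaD; [|exact: Wp_nat|exact: WpX].
 by rewrite theta_nat thetaX // tnu t1 subrr.
have nnu : W nu by clo.
have nxi : tnorm (res xi') = p%:R^-1.
 have nn1 := Wp_le1 Wnu1.
 rewrite exi' resD ?W_X // (res_nat p) tilt_p add0r resX // tnormX.
 have -> : tnorm (res (frobV2 1 nu)) = `|t 1%N| => //.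
 by rewrite /frobV2 /= !res_frobV ?frobV_norm // /tnorm !tcoord_rt nu2.
have WQ : Wp (frobV eQ) by clo.
have [v' Wv' ev'] := theta_div Wxi' txi nxi WQ theta_Qinv.
pose v := fr (fr v').
have Wv : Wp v by do 2!apply: Wp_frob.
have eQv : eQ2 = xi * v by rewrite /eQ2 -[eQ]frobVK ev' !rmorphM !frobVK.
(* Both xi and Q2 are p modulo the ideal, through nu and phi(pi) respectively; hence p (v - 1)
   belongs to it, and the ideal is saturated for division by p. *)
have hv : Wm (v - 1).
 have n1v : W (v - 1) by clo.
 apply: Wm_divp => //; have [r hr er] := eQ_const.
 have -> : p%:R * (v - 1) = fr pe * fr r - nu * (nu ^+ (q - 2) * v).
  have -> : nu * (nu ^+ (q - 2) * v) = nu ^+ (q - 1) * v.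
   rewrite mulrA -exprS; congr (_ ^+ _ * _).
   by have := q_gt; have := p_gt1; lia.
  have : xi * v = p%:R + fr pe * fr r by rewrite -eQv /eQ2 er rmorphD rmorphM rmorph_nat.
  by rewrite /xi => h; rewrite -[fr pe * fr r](addKr p%:R) -h; ring.
 apply: WmB; apply: WmMr => //.
 - by apply: Wp_frob; exact: Rp_Wp hr.
 - by apply: Wm_frob; exact: Wm_pe.
 - by apply: WpM => //; exact: WpX.
have [w [Ww hw fw]] := frob2_unit_solve Wv hv.
have [WwV rw] := Wm_unit Ww hw.
have nw : `|w| = 1.
 by apply: norm1_res; [exact: Wp_le1|rewrite -tnorm_eq0 rw oner_eq0].
exists (nu * w); split.
- by rewrite pnormM nw mulr1; apply: norm1_res.
- exact: WpM.
- rewrite !rmorphM fnu fw eQv /xi {1}q1 exprS; ring.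
move=> g b hb; have [r [Wr hr er]] := lt_gal Wnu hnu nt t0 et tnu hb.
have [Zb nb _] := hb; have [fb nlb _] := lift2P Zb.
have Wlb : Wp (lift2 b) by exact: fix2_Wp.
have Wgw : Wp (galB g w) by exact: Wp_gal.
have h1 : Wm (galB g w / w - 1).
 have w0 : w != 0 by clo.
 have -> : galB g w / w - 1 = (galB g (w - 1) - (w - 1)) * w^-1.
  by rewrite rmorphB rmorph1 mulrBl [(w - 1) * _]mulrBl divff //; ring.
 apply: WmMr => //; apply: WmB => //; exact: Wm_gal.
exists (r * (galB g w / w)); split.
- by apply: WpM => //; exact: WpM.
- have -> : r * (galB g w / w) - lift2 b = (r - lift2 b) * (galB g w / w) + lift2 b * (galB g w / w - 1) by ring.
 by apply: WmD; [apply: WmMr => //; exact: WpM|exact: WmMl].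
- rewrite rmorphM er; have w0 : w != 0 by rewrite -pnorm_eq0 nw.
 by field.
Qed.

End Period.

Context (a : galois S -> C) (a_ok : lt_iso a).
Local Notation L g := (lift2 (a g)).

(** * The cyclotomic character, the Galois cocycle of the period, and p-adic powers under
    morphisms *)

Section Characters.
Implicit Types (y z : B) (g h : galois S).

Lemma gal_comp g h : exists gh : galois S,
 (forall x : C, galC gh x = galC g (galC h x)) /\ (forall x, galB gh x = galB g (galB h x)).
Proof.
pose gC : {rmorphism C -> C} := galC g \o galC h.
pose gB : {rmorphism B -> B} := galB g \o galB h.
have h1 (x : C) : `|gC x| = `|x| by rewrite !galC_norm.
have h2 (x : K) : gC (iC x) = iC x by rewrite /= !galC_fix.
have h3 (y : C) : exists x, gC x = y.
 by have [x1 <-] := galC_surj g y; have [x2 <-] := galC_surj h x1; exists x2.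
have h4 x : `|gB x| = `|x| by rewrite !galB_norm.
have h5 x : W x -> forall n, tcoord (res (gB x)) n = gC (tcoord (res x) n).
 by move=> nx n; rewrite /gB /gC /= !galB_res ?galB_norm.
by exists (Galois h1 h2 h3 h4 h5).
Qed.

Lemma cong_nat n (m m' : nat) : cong n (m%:R : K) m'%:R <-> m = m' %[mod p ^ n].
Proof.
wlog le : m m' / (m' <= m)%N.
 move=> h; case/orP: (leq_total m' m) => le; first by clo.
 by split=> [/congS/(h _ _ le)//|e]; apply: congS; apply/(h _ _ le).
have -> : (m = m' %[mod p ^ n]) <-> (p ^ n %| m - m')%N by rewrite -eqn_mod_dvd //; split=> [->|/eqP].
rewrite /cong -natrB //; split; last exact: pnorm_dvd.
move: (m - m')%N => k nk; case: (posnP k) => [->//|k0].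
have [k' ck ek] := pfactor_coprime p_prime k0.
apply: contraTT nk => nd; rewrite -ltNge ek natrM pnormM natrX pnorm_pow.
rewrite pnorm_coprime ?mul1r; last by rewrite -prime_coprime.
rewrite ltf_pV2 ?posrE ?exprn_gt0 // ltr_eXn2l ?pr_gt1 // ltnNge.
by apply: contra nd => nl; rewrite ek dvdn_mull // dvdn_exp2l.
Qed.

Lemma eps_prim n : (p ^ n).-primitive_root (zeta n).
Proof.
have pn0 : (0 < p ^ n)%N by [].
have [m hm dm] := prim_order_exists pn0 (tcoord_epsX n).
have /(dvdn_pfactor _ _ p_prime)[k kn ek] := dm.
move: kn; rewrite leq_eqVlt => /orP[/eqP kn|kn]; first by rewrite kn in ek; rewrite -ek.
exfalso; case: n {pn0 dm} hm kn => // n hm kn.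
case: eps_ok => _; apply; have <- : zeta n.+1 ^+ (p ^ n) = zeta 1.
 by rewrite -(tcoord_iter eps n 1) add1n.
by apply/eqP; rewrite -(prim_order_dvd hm) ek dvdn_exp2l.
Qed.

(** g sends the primitive root zeta_n to a power with exponent m_n, and these exponents are
    compatible modulo p^n, so they converge. *)
Lemma cyclo_ex g : exists c, is_cyclo eps g c.
Proof.
have /choice[m hm] n : exists m, galC g (zeta n) = zeta n ^+ m.
 have e1 : galC g (zeta n) ^+ (p ^ n) = 1 by rewrite -rmorphXn tcoord_epsX rmorph1.
 by have [i ->] := prim_rootP (eps_prim n) e1; exists i.
have mS n : m n.+1 = m n %[mod p ^ n].
 apply/eqP; rewrite -(eq_prim_root_expr (eps_prim n)) -hm -(tcoord_compat eps n) rmorphXn hm.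
 by rewrite -!exprM mulnC.
have [|c [_ hc]] := @padic_lim K (fun n => (m n)%:R).
 by move=> n; apply/cong_nat.
exists c; split.
 have m1 : ~~ (p %| m 1)%N.
  apply/negP => dm; have := hm 1%N; have : zeta 1 ^+ m 1 = 1.
   by apply/eqP; rewrite -(prim_order_dvd (eps_prim 1)) expn1.
  by move=> -> /eqP; rewrite fmorph_eq1 => /eqP; case: eps_ok.
 have n1 : `|((m 1)%:R : K)| = 1 by exact: pnorm_coprime.
 rewrite -n1; apply: pnorm_close; rewrite n1; apply: le_lt_trans pinv_lt1.
 by rewrite -ppow1; exact: hc.
move=> n k hk; have : cong n (k%:R : K) (m n)%:R by apply: congT (hc n); exact: congS.
move/cong_nat => e; rewrite hm; apply/eqP; rewrite (eq_prim_root_expr (eps_prim n)) e //.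
Qed.

(** What is retained of f_gamma(pi): its functional equation and its reduction to 1. By rigidity
    these properties determine it. *)
Definition is_yf g y := [/\ Wp y, Wm (y - 1) & fr2 y = eA1 g * y].

Lemma yf_ex g c : is_cyclo eps g c -> exists y, is_yf g y.
Proof.
move=> gc; have [r hr [_ _ _ e]] := f_spec gc; exists (1 + pe * r).
have Wr := Rp_Wp hr.
have Wpe : Wp pe by [].
split=> //; first by apply: WpD; [exact: Wp1|exact: WpM].
by rewrite addrAC subrr add0r; apply: WmMr => //; exact: Wm_pe.
Qed.

(** The difference x - x' is x'(y' - 1) - x(y - 1), a phi^2-fixed element of the ideal. *)
Lemma fix2_Wm_eq x x' y y' : fr2 x = x -> fr (fr x') = x' -> Wp x -> Wp x' ->
 Wm (y - 1) -> Wm (y' - 1) -> x * y = x' * y' -> x = x'.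
Proof.
move=> fx fx' Wx Wx' hy hy' e; apply/eqP; rewrite -subr_eq0; apply/eqP.
apply: Wm_fix0; last by rewrite !rmorphB fx fx'.
have -> : x - x' = x' * (y' - 1) - x * (y - 1) by rewrite !mulrBr e; ring.
by apply: WmB; apply: WmMl.
Qed.

(** g(X) and y X satisfy the same equation for phi^2, because [eA1 g] is g(Q2)/Q2; their quotient is
    therefore fixed by phi^2. *)
Lemma gal_period X g y : `|X| = 1 -> fr2 X = eQ2 * X -> is_yf g y ->
 exists2 al, [/\ fr2 al = al, `|al| = 1 & Wp al] & galB g X = al * y * X.
Proof.
move=> nX fX [Wy hy fy]; have [WV ry] := Wm_unit Wy hy.
have X0 : X != 0 by clo.
have ny : `|y| = 1 by apply: norm1_res; [exact: Wp_le1|rewrite -tnorm_eq0 ry oner_eq0].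
have y0 : y != 0 by clo.
pose al := galB g X / (y * X).
have fal : fr2 al = al.
 rewrite /al !fmorph_div !rmorphM !frob_gal fX fy rmorphM gal_eQ2 -/(eA1 g).
 have Q0 : eQ2 != 0 by clo.
 have A0 : eA1 g != 0.
  by rewrite /eA1 mulf_neq0 ?invr_neq0 // !fmorph_eq0 norm1N0 ?egs_norm.
 by field; rewrite Q0 A0 y0 X0.
have nal : `|al| = 1 by rewrite pnormM pnormV pnormM galB_norm ny nX mulr1 invr1 mulr1.
exists al; last by rewrite /al; field; rewrite y0 X0.
by split=> //; apply: fix2_Wp => //; rewrite nal.
Qed.

Lemma lift_a g : [/\ fr2 (L g) = L g, W (L g),
 theta (L g) = a g & Wp (L g)].
Proof.
have [h _ _] := a_ok; have [Za _] := h g; have [h1 h2 h3] := lift2P Za.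
by split=> //; exact: fix2_Wp.
Qed.

Lemma lift_a_norm g : `|L g| = 1.
Proof.
have [h _ _] := a_ok; have [_ na] := h g; have [h1 h2 h3 h4] := lift_a g.
apply/eqP; rewrite eq_le h2 leNgt; apply/negP => lt.
have lt' : `|L g| <= p%:R ^- 1 by apply: B_disc; rewrite ppow0.
have h' : `|theta (L g)| <= p%:R ^- 1 by exact: theta_norm.
by move: h'; rewrite h3 na ppow1 leNgt pinv_lt1.
Qed.

Lemma lift_a_comp g h (gh : galois S) : (forall x : C, galC gh x = galC g (galC h x)) ->
 L gh = L g * galB g (L h).
Proof.
move=> e; have [ha hm _] := a_ok; have [f1 n1 t1 W1] := lift_a g; have [f2 n2 t2 W2] := lift_a h.
apply: lift2E; first by case: (ha gh).
- by rewrite !rmorphM f1 !frob_gal f2.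
- by apply: W_M; rewrite ?galB_norm.
- by rewrite thetaM ?theta_gal ?t1 ?t2 ?(hm _ _ _ e) //; exact: Wp_gal.
Qed.

(* Multiplying the period by z changes its cocycle by gz/z; Hilbert 90 for the quadratic
  extension turns the cocycle of the period into the given a *)
Lemma X_ex : exists X, [/\ `|X| = 1, fr2 X = eQ2 * X &
 forall g y, is_yf g y -> galB g X = L g * y * X].
Proof.
have [X0 [nX0 WX0 fX0 hX0]] := lt_period_ex.
have X00 : X0 != 0 by clo.
have /choice[A hA] g : exists al, [/\ fr2 al = al, `|al| = 1, Wp al &
  forall y, is_yf g y -> galB g X0 = al * y * X0].
 have [c gc] := cyclo_ex g; have [y hy] := yf_ex gc.
 have [al [h1 h2 h3] h4] := gal_period nX0 fX0 hy; exists al; split=> // y' hy'.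
 have [al' [k1 k2 k3] k4] := gal_period nX0 fX0 hy'; rewrite k4; congr (_ * _ * _).
 apply: (fix2_Wm_eq k1 h1 k3 h3 (y := y') (y' := y)); [by case: hy'|by case: hy|].
 by apply: (mulIf X00); rewrite -k4 -h4.
have AG2 g : fixesQp2 g -> A g = L g.
 move=> g2; have [_ _ /(_ g g2) chi] := a_ok; have [r [Wr hr er]] := hX0 _ _ chi.
 have [c gc] := cyclo_ex g; have [y hy] := yf_ex gc; have [h1 h2 h3 /(_ y hy) h4] := hA g.
 have [l1 l2 l3 l4] := lift_a g; have [Wy hy1 _] := hy.
 apply/eqP; rewrite -subr_eq0; apply/eqP; apply: Wm_fix0; last by rewrite !rmorphB h1 l1.
 have er' : r = A g * y by apply: (mulIf X00); rewrite -h4.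
 have -> : A g - L g = (r - L g) - A g * (y - 1) by rewrite er'; ring.
 by apply: WmB => //; exact: WmMl.
have A0 g : A g != 0 by rewrite norm1N0; case: (hA g).
have Acomp g h (gh : galois S) : (forall x : C, galC gh x = galC g (galC h x)) -> (forall x, galB gh x = galB g (galB h x)) ->
  A gh = A g * galB g (A h).
 move=> eC eB; have [c1 gc1] := cyclo_ex g; have [y1 hy1] := yf_ex gc1.
 have [c2 gc2] := cyclo_ex h; have [y2 hy2] := yf_ex gc2.
 have [c3 gc3] := cyclo_ex gh; have [y3 hy3] := yf_ex gc3.
 have [h1 h2 h3 /(_ _ hy1) h4] := hA g; have [k1 k2 k3 /(_ _ hy2) k4] := hA h.
 have [l1 l2 l3 /(_ _ hy3) l4] := hA gh.
 have [Wy1 m1 _] := hy1; have [Wy2 m2 _] := hy2; have [Wy3 m3 _] := hy3.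
 apply: (fix2_Wm_eq l1 _ l3 _ (y := y3) (y' := y1 * galB g y2)) => //.
 - by rewrite !rmorphM h1 !frob_gal k1.
 - by apply: WpM => //; exact: Wp_gal.
 - have -> : y1 * galB g y2 - 1 = y1 * galB g (y2 - 1) + (y1 - 1) by ring.
  by apply: WmD => //; apply: WmMl => //; exact: Wm_gal.
 apply: (mulIf X00); rewrite -l4 eB k4 !rmorphM /= h4; ring.
have main : exists2 z, z != 0 /\ fr2 z = z & forall g, A g * galB g z = L g * z.
 have [all2|/existsNP[g0 /negP n0]] := pselect (forall g, fixesQp2 g).
  by exists 1; rewrite ?oner_eq0 ?rmorph1 // => g; rewrite !rmorph1 AG2.
 pose c0 := lift2 (a g0) / A g0.
 have fc0 : fr2 c0 = c0.
  by rewrite /c0 !fmorph_div; case: (hA g0) => -> _ _ _; case: (lift_a g0) => ->.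
 have nG g h (gh : galois S) : ~~ fixesQp2 g -> ~~ fixesQp2 h -> (forall x : C, galC gh x = galC g (galC h x)) -> fixesQp2 gh.
  move=> ng nh e; apply/fixesQp2P; rewrite e (gal_sd h) (negPf nh) rmorphN.
  by rewrite (gal_sd g) (negPf ng) opprK.
 have rel g h : ~~ fixesQp2 g -> ~~ fixesQp2 h ->
   L g * fr (L h) = A g * fr (A h).
  move=> ng nh; have [gh [eC eB]] := gal_comp g h.
  have := AG2 gh (nG _ _ _ ng nh eC); rewrite (Acomp _ _ _ eC eB) (lift_a_comp eC).
  rewrite !(gal_fix2) ?(negPf ng) //; first by case: (lift_a h).
  by case: (hA h).
 have l0 g : L g != 0 by rewrite norm1N0 // lift_a_norm.
 have ratio g : ~~ fixesQp2 g -> L g = c0 * A g.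
  move=> ng; apply: (mulIf (_ : fr (lift2 (a g0)) != 0)); first by rewrite fmorph_eq0.
  have := rel _ _ n0 n0 => e0; rewrite rel // /c0.
  have : fr (A g0) = lift2 (a g0) * fr (lift2 (a g0)) / A g0 by rewrite e0 mulrAC divff ?mul1r.
  by move=> ->; field.
 have c0c : c0 * fr c0 = 1.
  rewrite /c0 fmorph_div mulrACA -invfM rel // divff // mulf_neq0 // fmorph_eq0 //.
 have c00 : c0 != 0 by apply: contra_eq_neq c0c => ->; rewrite mul0r eq_sym oner_eq0.
 (* The usual solution 1 + c_0^-1 of phi(z) = c_0 z vanishes when c_0 = -1, in which case the square
    root of d is a solution. *)
 have [z [z0 fz zc]] : exists z, [/\ z != 0, fr2 z = z & fr z = c0 * z].
  have [s2 fs ns ts s0] := sdBP.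
  have [e|ne] := eqVneq c0 (-1).
   by exists sdB; rewrite e mulN1r fs rmorphN fs opprK.
  exists (1 + c0^-1); split.
  - by apply: contraNneq ne => e; rewrite -[c0]invrK -[c0^-1](addKr 1) e addr0 invrN invr1.
  - by rewrite !rmorphD !rmorph1 !fmorphV fc0.
  - have -> : fr (1 + c0^-1) = 1 + c0.
    rewrite rmorphD rmorph1 fmorphV; congr (_ + _); apply: (mulIf (_ : fr c0 != 0)).
     by rewrite fmorph_eq0.
    by rewrite c0c mulVf // fmorph_eq0.
   by rewrite mulrDr mulr1 divff // addrC.
 exists z => // g; rewrite gal_fix2 //; case: ifPn => g2; first by rewrite AG2.
 by rewrite zc (ratio g g2); ring.
have [z [z0 fz] hz] := main; have [k [l nz]] := unit_scale z0.
have [u gu nu] : exists2 u : B, (forall f : {rmorphism B -> B}, f u = u) & `|u * z| = 1.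
 exists (p%:R ^+ k / p%:R ^+ l); last by rewrite mulrAC.
 by move=> f; rewrite fmorph_div !rmorphXn rmorph_nat.
exists (u * z * X0); split.
- by rewrite pnormM nX0 mulr1.
- by rewrite !rmorphM !gu fz fX0; ring.
move=> g y hy; have [h1 h2 h3 /(_ y hy) h4] := hA g.
rewrite !rmorphM gu h4.
have -> : u * galB g z * (A g * y * X0) = u * (A g * galB g z) * y * X0 by ring.
by rewrite hz; ring.
Qed.

(** f is only asked to respect approximations by natural powers, since theta is a homomorphism on a
    subring only. *)
Lemma zpow_fun (F F' : padic) (f : F -> F') x (u : K) (iF : {rmorphism K -> F}) (iF' : {rmorphism K -> F'}) :
 isometric iF -> isometric iF' -> W u ->
 near1 x -> near1 (f x) ->
 (forall n (m : nat), cong n (zpow x (iF u)) (x ^+ m) -> cong n (f (zpow x (iF u))) (f x ^+ m)) ->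
 f (zpow x (iF u)) = zpow (f x) (iF' u).
Proof.
move=> nF nF' nu nx nfx h; apply: cong_eq => n.
have [N1 h1] := zpowP n (zint_morph nF nu) nx; have [N2 h2] := zpowP n (zint_morph nF' nu) nfx.
have [m hm] := Qp_zint nu (maxn N1 N2).
have c1 : cong N1 (iF u) m%:R.
 by rewrite /cong -(rmorph_nat iF) -rmorphB nF; exact: cong_le (leq_maxl _ _) hm.
have c2 : cong N2 (iF' u) m%:R.
 by rewrite /cong -(rmorph_nat iF') -rmorphB nF'; exact: cong_le (leq_maxr _ _) hm.
by apply: congT (h n m (h1 m c1)) (congS (h2 m c2)).
Qed.

Lemma near1_morph (F F' : padic) (f : {rmorphism F -> F'}) x :
 isometric f -> near1 x -> near1 (f x).
Proof. by move=> nf nx; rewrite -(rmorph1 f) -rmorphB nf. Qed.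

Lemma zpow_endo (f : {rmorphism B -> B}) x (u : K) : isometric f ->
 W u -> near1 x -> f (zpow x (iB u)) = zpow (f x) (iB u).
Proof.
move=> nf nu nx; apply: zpow_fun => //; try exact: QpBt_norm; first exact: near1_morph.
by move=> n m h; rewrite /cong -rmorphXn -rmorphB nf.
Qed.

Lemma zpow_QpBt (x u : K) : W u -> near1 x -> iB (zpow x u) = zpow (iB x) (iB u).
Proof.
move=> nu nx; apply: (@zpow_fun K B iB x u idfun iB) => //; try exact: QpBt_norm.
 by apply: near1_morph => //; exact: QpBt_norm.
by move=> n m h; rewrite /cong -rmorphXn -rmorphB QpBt_norm.
Qed.

Lemma Wp_zpow x (u : K) : Wp x -> W u -> near1 x -> Wp (zpow x (iB u)).
Proof.
move=> Wx nu nx; apply: Wp_closed => n; have [N h] := zpowP n (zint_QpBt nu) nx.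
by have [m /h hm] := zint_QpBt nu N; exists (x ^+ m); split; [exact: WpX|].
Qed.

Lemma near1_theta (x : B) : Wp x -> near1 x -> near1 (theta x).
Proof.
move=> Wx nx; rewrite -theta1 -thetaB //.
by rewrite -ppow1; apply: theta_norm; [apply: WpB => //; exact: Wp1|rewrite ppow1].
Qed.

Lemma theta_zpow x (u : K) : Wp x -> W u -> near1 x ->
 theta (zpow x (iB u)) = zpow (theta x) (iC u).
Proof.
move=> Wx nu nx; apply: zpow_fun => //; [exact: QpBt_norm|exact: QpCp_norm|exact: near1_theta|].
by move=> n m h; rewrite -thetaX //; apply: theta_cong => //; [exact: Wp_zpow|exact: WpX].
Qed.

Lemma theta_Xz (x : B) (n : int) : Wp x -> Wp x^-1 -> x != 0 -> theta (x ^ n) = theta x ^ n.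
Proof.
move=> Wx WV x0; case: n => n; first exact: thetaX.
have tV : theta x^-1 = (theta x)^-1.
 have e : theta x * theta x^-1 = 1 by rewrite -thetaM // divff // theta1.
 have t0 : theta x != 0 by apply: contra_eq_neq e => ->; rewrite mul0r eq_sym oner_eq0.
 by apply: (mulfI t0); rewrite e divff.
by rewrite !NegzE -!exprnN -!exprVn thetaX // tV.
Qed.

Lemma zpow1 (F : padic) (s : F) : zpow 1 s = 1.
Proof.
apply: ulimP; apply: padic_tends => n; exists 1%N => -[//|m] _.
rewrite big_ord_recl /= mulr1 /gbinom big_ord0 divr1 big1 ?addr0 //.
by move=> i _; rewrite subrr expr0n mulr0.
Qed.

End Characters.

(** * The period F, its equation for phi^2, and its Galois cocycle *)

Section Basis.
Context (j : int) (u : K) (u_int : W u).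
Implicit Types (g h : galois S).

Lemma Adag_near1 (x m y : B) : Rp m -> Adag y -> x = 1 + p%:R * m * y -> Adag (zpow x (iB u)).
Proof. by move=> hm hy ->; exact: Adag_zpow. Qed.

Definition q_ju : B := eQ2 ^ j * zpow eQr (iB u).

(** Since Q2 - Q^p is p times a power series and 1/Q^p is overconvergent, the u-th power of Q2/Q^p
    is overconvergent as well. *)
Lemma eQr_split : exists2 m, Rp m & eQr = 1 + p%:R * m * (eQ ^+ p)^-1.
Proof.
have RQ : Rp eQ by [].
have RQ2 : Rp eQ2 by exact: Rp_fr.
have e0 : eQ ^+ p != 0 by rewrite expf_neq0 // norm1N0 // eQ_norm.
have [m hm em] : exists2 m, Rp m & eQ2 - eQ ^+ p = p%:R ^+ 1 * m.
 apply: Rp_div; first by apply: RpB => //; exact: RpX.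
 by apply: frob_cong; rewrite eQ_norm.
exists m => //; rewrite -[p%:R]expr1 -em /eQr; field; exact: e0.
Qed.

Lemma eva_zQr : eva (robba_pow (rQ2 / rQ ^+ p) u) (zpow eQr (iB u)).
Proof.
apply: robba_pow_eva => //; [exact: eva_rQr|exact: eQr_near1|].
have [m hm e] := eQr_split; apply: (Adag_near1 hm _ e).
rewrite -exprVn; apply: Adag_X; exact: Rp_Adag_inv.
Qed.

Lemma eva_q : eva (rQ2 ^ j * robba_pow (rQ2 / rQ ^+ p) u) q_ju.
Proof.
have [h1 h2] := Adag_unit (Rp_fr eQ_PS) eQ2_norm.
apply: eva_M => //; last exact: eva_zQr.
by apply: eva_expz => //; [exact: eva_rQ2|rewrite norm1N0 ?eQ2_norm].
Qed.

Definition is_yg g y := [/\ Wp y, Wm (y - 1), near1 y & fr2 y = eA2 g * y].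

Lemma fg_eval g c : is_cyclo eps g c -> exists y z, [/\ is_yf g y, is_yg g z
 & eva (f_ c ^ j * robba_pow (g_ c) u) (y ^ j * zpow z (iB u))].
Proof.
move=> gc; have [r hr [h1 h2 h3 e]] := f_spec gc.
have [s hs [k1 k2 k3 e']] := g_spec gc.
have Wpe : Wp pe by [].
have [Wr Ws] := (Rp_Wp hr, Rp_Wp hs).
have n1 : near1 (1 + p%:R * (pe * s)).
 rewrite addrAC subrr add0r pnormM pnorm_p ler_piMr ?pinv_ge0 // Wp_le1 //; exact: WpM.
exists (1 + pe * r), (1 + p%:R * (pe * s)); split.
- split=> //; first by apply: WpD; [exact: Wp1|exact: WpM].
 by rewrite addrAC subrr add0r; apply: WmMr => //; exact: Wm_pe.
- split=> //; first by apply: WpD; [exact: Wp1|apply: WpM; [exact: Wp_nat|exact: WpM]].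
 rewrite addrAC subrr add0r; apply: WmMl => //.
 by apply: WmMr => //; exact: Wm_pe.
apply: eva_M => //.
 by apply: eva_expz => //; case: h2.
apply: robba_pow_eva => //.
have hy : Adag (pe * s) by clo.
by apply: (@Adag_near1 _ 1 (pe * s)) => //; rewrite mulr1.
Qed.

Section Period.
Context (X : B) (nX : `|X| = 1) (fX : fr2 X = eQ2 * X)
 (gX : forall g y, is_yf g y -> galB g X = L g * y * X).

Lemma X_neq0 : X != 0. Proof. exact: norm1N0. Qed.

Lemma yf_norm g y : is_yf g y -> [/\ `|y| = 1, y != 0 & Wp y^-1].
Proof.
move=> [Wy hy _]; have [WV ry] := Wm_unit Wy hy.
have ny : `|y| = 1 by apply: norm1_res; [exact: Wp_le1|rewrite -tnorm_eq0 ry oner_eq0].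
by split=> //; exact: norm1N0.
Qed.

(** phi(pi) / (X phi(X)) is fixed by phi, hence a constant of Q_p and invariant under g. Comparing
    the action of g on both parts gives phi(g(pi)/pi) as the norm times factors reducing to 1, while
    g(pi)/pi reduces to c; rigidity turns this into an equality. *)
Lemma cyclo_norm_lift g c : is_cyclo eps g c -> iB c = L g * fr (L g).
Proof.
move=> gc; have [y hy] := yf_ex gc; have [f1 n1 t1 W1] := lift_a g.
have [ny y0 WV] := yf_norm hy; have [Wy my _] := hy; have X0 := X_neq0.
have fX0 : fr X != 0 by rewrite fmorph_eq0.
pose ka := fr pe / (X * fr X).
have fka : fr ka = ka.
 rewrite /ka fmorph_div rmorphM fX.
 have -> : fr2 pe = eQ2 * fr pe by rewrite /eQ2 fmorph_div divfK // fmorph_eq0.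
 have Q0 : eQ2 != 0 by clo.
 by field; rewrite fX0 X0 Q0.
have [k ek] := frob_fix fka.
have gka : galB g ka = ka by rewrite ek (isom_QpBt _ (galB_norm g)).
have egp : galB g pe = egs g * pe by rewrite divfK // pe_neq0.
have e : fr (egs g) = L g * fr (L g) * (y * fr y).
 have p0 : fr pe != 0 by rewrite fmorph_eq0.
 have := gka; rewrite /ka fmorph_div rmorphM /= -!frob_gal egp (gX hy) !rmorphM.
 have l0 : L g != 0 by rewrite norm1N0 // lift_a_norm.
 move=> h; have {h} := congr1 (fun z => z * (L g * y * X * (fr (L g) * fr y * fr X)) / fr pe) h.
 rewrite divfK; last by rewrite !mulf_neq0 // !fmorph_eq0.
 by rewrite mulfK // => ->; field; rewrite p0 fX0 X0.
have [_ [r hr er]] := egs_const gc.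
have fc : fr (iB c) = iB c by exact: iB_fr.
have Wc : Wp (iB c) by apply: Wp_QpBt; case: gc => ->.
have Wff : Wp (L g * fr (L g)) by clo.
apply/eqP; rewrite -subr_eq0; apply/eqP; apply: Wm_fix0; last first.
 by rewrite !rmorphB !fc !rmorphM f1.
have -> : iB c - L g * fr (L g) = L g * fr (L g) * (y * fr y - 1) - fr pe * fr r.
 have : iB c = fr (egs g) - fr pe * fr r by rewrite er rmorphD rmorphM fc addrK.
 by move=> ->; rewrite e; ring.
apply: WmB; last first.
 by apply: WmMr; [apply: Wp_frob; exact: Rp_Wp hr|apply: Wm_frob; exact: Wm_pe].
apply: WmMl => //; have -> : y * fr y - 1 = y * fr (y - 1) + (y - 1) by rewrite rmorphB; ring.
by apply: WmD => //; apply: WmMl => //; exact: Wm_frob.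
Qed.

Definition h0 : B := X / frobV X ^+ p.

Lemma frV2X : fr2 (frobV X) = eQ * frobV X.
Proof. by rewrite frobVK -[fr X]frobKV fX frobVM /eQ2 frobKV. Qed.

Lemma h0_near1 : near1 h0.
Proof.
have nV : `|frobV X| = 1 by rewrite frobV_norm.
apply: near1_div; first by rewrite pnormX nV expr1n.
by rewrite -{1}[X]frobVK; apply: frob_cong; rewrite nV.
Qed.

Lemma fr2_h0 : fr2 h0 = eQr * h0.
Proof.
rewrite /h0 /eQr !fmorph_div !rmorphXn frV2X fX exprMn.
have V0 : frobV X ^+ p != 0 by rewrite expf_neq0 // norm1N0 // frobV_norm.
have Q0 : eQ ^+ p != 0 by rewrite expf_neq0 // norm1N0 // eQ_norm.
by field; rewrite V0 Q0.
Qed.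

Lemma frobV_fix2 x : fr2 x = x -> frobV x = fr x.
Proof. by move=> e; rewrite -{1}e frobKV. Qed.

(** Directly, g acts through y / phi^-1(y)^p instead of z. Both satisfy the equation with factor
    [eA2] and reduce to 1, so they are equal by rigidity. *)
Lemma gal_h0 g z : is_yg g z ->
 galB g h0 = L g / fr (L g) ^+ p * z * h0.
Proof.
move=> [Wz mz nz fz]; have [c gc] := cyclo_ex g; have [y hy] := yf_ex gc.
have [ny y0 WV] := yf_norm hy; have [Wy my fy] := hy.
have [f1 n1 t1 W1] := lift_a g.
have l0 : L g != 0 by rewrite norm1N0 // lift_a_norm.
have V0 : frobV X != 0 by rewrite norm1N0 // frobV_norm.
have y'0 : frobV y != 0 by rewrite norm1N0 // frobV_norm.
have e1 : galB g h0 = L g / fr (L g) ^+ p * (y / frobV y ^+ p) * h0.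
 rewrite /h0 fmorph_div rmorphXn /= -frobV_gal (gX hy) !frobVM (frobV_fix2 f1) !exprMn.
 have [a1 a2 a3] : [/\ fr (L g) ^+ p != 0, frobV y ^+ p != 0 & frobV X ^+ p != 0].
  by rewrite !expf_neq0 // fmorph_eq0.
 by field; rewrite a1 a2 a3.
rewrite e1; congr (_ * _ * _).
have [WzV rz] := Wm_unit Wz mz.
have z0 : z != 0 by apply: contra_eq_neq rz => ->; rewrite res0 tnorm0 eq_sym oner_eq0.
set w := y / frobV y ^+ p.
have WyV : Wp (frobV y ^+ p)^-1 by rewrite -exprVn -frobVV; apply: WpX; exact: Wp_frobV.
have Ww : Wp w by exact: WpM.
have myV : Wm (frobV y - 1) by rewrite -frobV1 -frobVN -frobVD; exact: Wm_frobV.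
have Wfy : Wp (frobV y) by exact: Wp_frobV.
have myp n : Wm (frobV y ^+ n - 1).
 elim: n => [|n IH]; first by rewrite expr0 subrr -(subrr pe); apply: WmB; exact: Wm_pe.
 have -> : frobV y ^+ n.+1 - 1 = frobV y * (frobV y ^+ n - 1) + (frobV y - 1) by rewrite exprS; ring.
 by apply: WmD => //; exact: WmMl.
have mw : Wm (w - 1).
 have -> : w - 1 = ((y - 1) - (frobV y ^+ p - 1)) * (frobV y ^+ p)^-1.
  by rewrite /w; field; rewrite expf_neq0.
 by apply: WmMr => //; exact: WmB.
have w0 : w != 0 by rewrite mulf_neq0 // invr_neq0 // expf_neq0.
have ew : fr2 w = eA2 g * w.
 rewrite /w fmorph_div fmorph_div !rmorphXn fy.
 have -> : fr2 (frobV y) = fr (egs g) / egs g * frobV y.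
  rewrite frobVK -[fr y]frobKV fy frobVM /eA1 frobVM frobVV !frobKV //.
 have s0 : egs g != 0 by rewrite norm1N0 // egs_norm.
 rewrite /eA2; move: (eA1 g) (egs g) s0 => A s s0; rewrite exprMn !expr_div_n.
 have [a1 a2 a3] : [/\ s ^+ p != 0, fr s ^+ p != 0 & frobV y ^+ p != 0].
  by rewrite !expf_neq0 // fmorph_eq0.
 by field; rewrite a1 a2 a3.
have A0 : eA2 g != 0.
 have s0 : egs g != 0 by rewrite norm1N0 // egs_norm.
 by rewrite /eA2 /eA1; apply: mulf_neq0; [apply: mulf_neq0|apply: expf_neq0; apply: mulf_neq0];
  rewrite ?invr_neq0 ?fmorph_eq0.
clearbody w.
have k1 : fr2 (w / z) = w / z by rewrite !fmorph_div ew fz; field; rewrite A0 z0.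
have Wk : Wp (w / z) by exact: WpM.
suff : w / z = 1 by move/(congr1 (fun x => x * z)); rewrite divfK // mul1r.
apply: (fix2_Wm_eq k1 _ Wk Wp1 mz mw) => //; first by rewrite !rmorph1.
by rewrite divfK // mul1r.
Qed.

Definition F_ju : B := X ^ j * zpow h0 (iB u).

Lemma F_norm : `|F_ju| = 1.
Proof.
rewrite pnormM zpow_norm ?mulr1; [|exact: zint_QpBt|exact: h0_near1].
by case: j => n; rewrite ?NegzE -?exprnN ?pnormV pnormX nX expr1n ?invr1.
Qed.

Lemma fr2_F : fr2 F_ju = q_ju * F_ju.
Proof.
have nh := h0_near1; have nf := @frob_norm.
have nfh : near1 (fr h0) by exact: near1_morph.
rewrite /F_ju !rmorphM !(zpow_endo (@frob_norm _ _ S)) // fr2_h0 zpowM //; [|exact: zint_QpBt|exact: eQr_near1].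
rewrite !fmorphXz fX /q_ju; rewrite exprMz_comm ?unitfE ?norm1N0 //; last exact: mulrC.
by ring.
Qed.

Lemma near1_ratio g : near1 (L g / fr (L g) ^+ p).
Proof.
have [f1 n1 t1 W1] := lift_a g; have n2 := lift_a_norm g.
apply: near1_div; first by rewrite pnormX frob_norm n2 expr1n.
by rewrite -{1}f1; apply: frob_cong; rewrite frob_norm n2.
Qed.

Lemma gal_F g y z : is_yf g y -> is_yg g z -> galB g F_ju =
 L g ^ j * zpow (L g / fr (L g) ^+ p) (iB u) * (y ^ j * zpow z (iB u)) * F_ju.
Proof.
move=> hy hz; have nh := h0_near1; have nr := near1_ratio g; have [Wz mz nz fz] := hz.
have zu := zint_QpBt u_int.
have [ny y0 WV] := yf_norm hy.
have l0 : L g != 0 by rewrite norm1N0 // lift_a_norm.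
rewrite /F_ju rmorphM /= (zpow_endo (galB_norm g)) // (gal_h0 hz) zpowM //; last exact: near1M.
rewrite zpowM // fmorphXz (gX hy) !exprMz_comm ?unitfE ?mulf_neq0 ?X_neq0 //; try exact: mulrC.
ring.
Qed.

End Period.
End Basis.

(** * The matrices of phi and Gamma in the basis of periods *)

Section BasisEquations.
Context (j : int) (u : K) (u_int : W u).
Local Notation t := sdB.
Local Notation rho := (rho_ d sd a j (j%:~R + p.+1%:R * u)).
Implicit Types (g h : galois S).
Context (X : B) (nX : `|X| = 1) (fX : fr2 X = eQ2 * X)
 (gX : forall g y, is_yf g y -> galB g X = L g * y * X).
Local Notation F := (F_ju j u X).
Local Notation q := (q_ju j u).

Definition om g : B := teich (res (L g)).

Lemma om_spec g : [/\ near1 (L g / om g), fr (om g) = om g ^+ p,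
 om g ^+ (p ^ 2 - 1) = 1, om g != 0 & Wp (om g)].
Proof.
have [f1 n1 t1 W1] := lift_a g; have n2 := lift_a_norm g.
have rp : res (L g) ^+ (p ^ 2) = res (L g) by rewrite -[in RHS]f1 exprM !frob_res ?frob_norm.
have ro : `|om g| = 1.
 apply: teich_norm; apply/eqP => r0; have := (res_eq0 n1).1 r0; rewrite n2 ltxx //.
have o0 : om g != 0 by clo.
split=> //.
- by apply: near1_div => //; apply/res_cong; rewrite ?ro // res_teich.
- by rewrite /om frob_teich teichX.
- apply: (mulIf o0); rewrite mul1r -exprSr /om -teichX.
 by congr teich; rewrite -[in RHS]rp; congr (_ ^+ _); have := expn_gt0 p 2; rewrite p_gt0 /=; lia.
- by apply: Wp_teich; exact: Wp_res.
Qed.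

(** The lift to W(tilt) of eta(a(g)): as x = omega(x) <x>, the exponent j + (p+1)u gives omega^j
    <x>^(j+(p+1)u) = x^j (<x>^(p+1))^u. *)
Definition etaB g : B := L g ^ j * zpow ((L g / om g) ^+ p.+1) (iB u).

Lemma fix2_unit_Wp x : fr2 x = x -> `|x| = 1 -> Wp x /\ Wp x^-1.
Proof. by move=> fx nx; split; apply: fix2_Wp; rewrite ?fmorphV ?fx ?pnormV ?nx ?invr1. Qed.

Lemma etaB_spec g : [/\ fr2 (etaB g) = etaB g, Wp (etaB g) &
 theta (etaB g) = Defs.eta j (j%:~R + p.+1%:R * u) (a g)].
Proof.
have [f1 n1 t1 W1] := lift_a g.
have n2 : `|L g| = 1 by exact: lift_a_norm.
have [nL fo o1 o0 Wo] := om_spec g.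
have l0 : L g != 0 by exact: norm1N0.
have fo2 : fr2 (om g) = om g.
 rewrite fo rmorphXn fo -exprM mulnn; have q0 : (0 < p ^ 2)%N by rewrite expn_gt0 prime_gt0.
 by rewrite -[(p ^ 2)%N](@subnK 1) // exprD o1 mul1r expr1.
have no : `|om g| = 1.
 have := congr1 (fun x : B => `|x|) o1; rewrite pnormX pnorm1 => /eqP.
 rewrite pexpr_eq1 ?pnorm_ge0 // => [/eqP //|].
 by have := q_gt; have := p_gt1; lia.
have [WL WLV] := fix2_unit_Wp f1 n2; have [_ WoV] := fix2_unit_Wp fo2 no.
have nLp : near1 ((L g / om g) ^+ p.+1) by exact: near1X.
have nf := @frob_norm.
have WLo : Wp (L g / om g) by exact: WpM.
have WLX : Wp (L g ^ j) by case: (j) => n; rewrite ?NegzE -?exprnN -?exprVn; exact: WpX.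
have WZ : Wp (zpow ((L g / om g) ^+ p.+1) (iB u)) by apply: Wp_zpow => //; exact: WpX.
split; [|exact: WpM|].
 rewrite /etaB !rmorphM !fmorphXz f1 !(zpow_endo (@frob_norm _ _ S)) //; last exact: near1_morph.
 by rewrite !rmorphXn !fmorph_div f1 fo2.
rewrite /etaB thetaM // theta_Xz // t1 theta_zpow //; last exact: WpX.
rewrite thetaX //.
have ta : theta (om g) != 0.
 apply/eqP => h; have := congr1 (fun x : B => theta x) o1; rewrite thetaX // h theta1 expr0n.
 case: eqP => [e _|_ /esym/eqP]; last by rewrite oner_eq0.
 by have := q_gt; have := p_gt1; lia.
have tLo : theta (L g / om g) = a g / theta (om g).
 by apply: (mulIf ta); rewrite -thetaM // !divfK.
have ntLo : near1 (a g / theta (om g)) by rewrite -tLo; exact: near1_theta.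
have oa : omega (a g) = theta (om g).
 by apply: omegaP => //; rewrite -thetaX // o1 theta1.
rewrite tLo /Defs.eta /angle oa; have zu : zint (iC u) by apply: zint_morph => // x; exact: QpCp_norm.
rewrite rmorphD rmorphM rmorph_int rmorph_nat zpowz //; last by apply: zintM => //; exact: zint_nat.
rewrite zpow_natM // mulrA; congr (_ * _).
have a0 : a g != 0.
 by have [ha _ _] := a_ok; have [_ na] := ha g; rewrite -pnorm_eq0 na oner_eq0.
rewrite -exprMz_comm ?unitfE ?mulf_neq0 ?invr_neq0 //; last exact: mulrC.
by rewrite mulrC divfK.
Qed.

(** Otherwise sd would be in Q_p, so its lift, an element of W(tilt) fixed by phi, would equal its
    opposite. *)
Lemma sd_coords (y z y' z' : K) : iC y + iC z * sd = iC y' + iC z' * sd -> y = y' /\ z = z'.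
Proof.
move=> e; have zz : z = z'.
 apply/eqP; rewrite -subr_eq0; apply/eqP; apply: contrapT => /eqP z0.
 have es : sd = iC ((y' - y) / (z - z')).
  rewrite fmorph_div !rmorphB; apply: (mulIf (_ : iC z - iC z' != 0)); first by rewrite -rmorphB fmorph_eq0.
  rewrite divfK; last by rewrite -rmorphB fmorph_eq0.
  have -> : iC y' - iC y = iC y' + iC z' * sd - iC y - iC z' * sd by ring.
  by rewrite -e; ring.
 have [s2 fs ns ts s0] := sdBP; set s := (y' - y) / (z - z') in es.
 have Wt : Wp t by apply: fix2_Wp => //; rewrite fs rmorphN fs opprK.
 have n1 : W s by rewrite -(QpCp_norm) -es -ts; exact: theta_le1.
 have et : t = iB s.
  apply: theta_fix2_inj; rewrite ?iB_fr ?QpBt_norm ?ts ?theta_QpBt //.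
  by rewrite fs rmorphN fs opprK.
 have : t + t = 0 by rewrite -[X in X + _]opprK -fs et iB_fr addNr.
 rewrite -mulr2n -mulr_natl => /eqP; rewrite mulf_eq0 (negPf s0) orbF.
 by apply/negP; exact: two_neq0.
by split=> //; apply: (fmorph_inj iC); apply: (addIr (iC z * sd)); rewrite e zz.
Qed.

Lemma rho_mx g : exists y z : K, etaB g = iB y + iB z * t /\
 rho g = if fixesQp2 g then mx2 y (d * z) z y else mx2 y (- (d * z)) z (- y).
Proof.
have [fe We te] := etaB_spec g; have [y [z eyz]] := fix2_coords fe.
have [s2 fs ns ts s0] := sdBP.
have th_yz : Defs.eta j (j%:~R + p.+1%:R * u) (a g) = iC y + iC z * sd.
 (* theta is defined on integral Witt vectors, whereas the coordinates y and z are not known to be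
    integral; a power of p is inserted and cancelled. *)
 have [k hk] : exists k, `|p%:R ^+ k * y| <= 1 /\ W (p%:R ^+ k * z).
  have [k1 h1] := F_scale y; have [k2 h2] := F_scale z; exists (k1 + k2)%N.
  have np n : W (p%:R ^+ n : K) by rewrite pnorm_pow; exact: ppow_le1.
  split; first by rewrite addnC exprD -mulrA; apply: W_M.
  by rewrite exprD -mulrA; apply: W_M.
 have [hy hz] := hk; have Wt : Wp t by apply: fix2_Wp => //; rewrite fs rmorphN fs opprK.
 apply: (mulfI (_ : (p%:R ^+ k : C) != 0)); first exact: pX_neq0.
 rewrite -te mulrDr mulrA -(theta_nat p) -thetaX; last exact: Wp_nat.
 rewrite -thetaM //; last by apply: WpX; exact: Wp_nat.
 have -> : p%:R ^+ k * etaB g = iB (p%:R ^+ k * y) + iB (p%:R ^+ k * z) * t.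
  by rewrite eyz !rmorphM rmorphXn rmorph_nat; ring.
 have [Wy Wz] : Wp (iB (p%:R ^+ k * y)) /\ Wp (iB (p%:R ^+ k * z)) by split; exact: Wp_QpBt.
 rewrite thetaD //; last exact: WpM.
 rewrite thetaM // !theta_QpBt // ts thetaX; last exact: Wp_nat.
 by rewrite theta_nat !rmorphM !rmorphXn !rmorph_nat.
exists y, z; split=> //; rewrite /rho_ /to_GL2 th_yz.
have ec : sqrt_coords sd (iC y + iC z * sd) = (y, z).
 rewrite /sqrt_coords; apply: xget_unique => //= -[y' z'] /= /sd_coords[-> ->] //.
by rewrite ec; case: (fixesQp2 g).
Qed.

(** The columns are the vectors (v0, v1) for which (v0 + v1 t, v0 - v1 t) is (phi(F), 0) and (0, F),
    where t is the square root of d. *)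
Definition bmx : 'M[B]_2 := mx2 (fr F / 2%:R) (F / 2%:R) (fr F / (2%:R * t)) (- (F / (2%:R * t))).

Lemma frob_bmx : map_mx fr bmx = bmx *m mx2 0 1 q 0.
Proof.
have [s2 fs ns ts s0] := sdBP.
have eF : fr2 F = q * F by exact: fr2_F.
rewrite /bmx map_mx2 mx2_mul !mulr0 !mulr1 !add0r !addr0; move: F q eF => F0 q0 eF.
rewrite !rmorphN !fmorph_div !rmorphM !rmorph_nat fs eF; congr mx2.
- by rewrite -mulrA mulrC.
- by rewrite !mulrN invrN mulrN mulNr -mulrA mulrC.
- by rewrite !mulrN invrN mulrN opprK.
Qed.

(** [rho] multiplies v0 + v1 t by eta and v0 - v1 t by its conjugate; for g not fixing Q_{p^2}, the
    twist in [rho] compensates g(t) = -t. As s is fixed by phi, the conjugate of the relation for F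
    is the one needed for phi(F). *)
Lemma rho_bmx g (m s : B) : galB g F = L g ^ j * zpow (L g / fr (L g) ^+ p) (iB u) * m * F ->
 fr s = s -> fr (etaB g) * (L g ^ j * zpow (L g / fr (L g) ^+ p) (iB u)) = s ->
 map_mx iB (rho g) *m map_mx (galB g) bmx = bmx *m mx2 (s * fr m) 0 0 (s * m).
Proof.
move=> gF fs e; have [s2 ft ns ts t0] := sdBP.
have [y [z [ee er]]] := rho_mx g; set G := L g ^ j * _ in gF e.
have eb : fr (etaB g) = iB y - iB z * t by rewrite ee rmorphD rmorphM !iB_fr ft mulrN.
have e1 : (iB y - iB z * t) * G = s by rewrite -eb.
have e2 : (iB y + iB z * t) * fr G = s.
 by rewrite -fs -e eb (rmorphM fr) rmorphB (rmorphM fr (iB z)) !iB_fr ft mulrN opprK.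
have n2 : (2%:R : B) != 0 by exact: two_neq0.
have gfF : galB g (fr F) = fr G * fr m * fr F by rewrite -frob_gal gF !(rmorphM fr).
have gt : galB g t = if fixesQp2 g then t else - t by rewrite gal_sdB ft.
rewrite er /bmx; clearbody G; move: gF gfF e1 e2 {e eb ee er}.
move: (fr F) (fr G) (fr m); move: F => F0 F' G' m' gF gfF e1 e2.
rewrite !map_mx2 rmorphN !fmorph_div !(rmorphM (galB g)) !rmorph_nat gF gfF gt.
have -> : s * m' = (iB y + iB z * t) * G' * m' by rewrite e2.
have -> : s * m = (iB y - iB z * t) * G * m by rewrite e1.
by case: ifP => _; rewrite map_mx2 !mx2_mul ?rmorphN !rmorphM -s2 /=; congr mx2; field; rewrite ?oppr_eq0 ?n2 t0.
Qed.

(** The identity that fixes the weight. The j-th powers give the norm c^j. In the u-th powers,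
    sigma(<x>)^(p+1) times x / sigma(x)^p is <x> sigma(<x>), because the roots of unity cancel by
    omega^(p^2) = omega, and this is the angle of c. *)
Lemma chi_angle g (c : K) : is_cyclo eps g c ->
 fr (etaB g) * (L g ^ j * zpow (L g / fr (L g) ^+ p) (iB u)) = iB (c ^ j * zpow (angle c) u).
Proof.
move=> gc; have eL : iB c = L g * fr (L g) by exact: (cyclo_norm_lift nX fX gX gc).
have [f1 n1 t1 W1] := lift_a g.
have n2 : `|L g| = 1 by exact: lift_a_norm.
have [nL fo o1 o0 Wo] := om_spec g.
have l0 : L g != 0 by exact: norm1N0.
have nLp : near1 ((L g / om g) ^+ p.+1) by exact: near1X.
have nr : near1 (L g / fr (L g) ^+ p) by exact: (near1_ratio g).
have nf := @frob_norm.
have nc : `|c| = 1 by case: gc.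
have op : fr (om g ^+ p.+1) = om g ^+ p.+1.
 rewrite rmorphXn fo -exprM mulnS -mulnn in o1 *.
 have -> : (p + p * p = (p * p - 1) + p.+1)%N by have := p_gt0; lia.
 by rewrite exprD mulnn o1 mul1r.
have [w ew] := frob_fix op.
have w0 : w != 0 by rewrite -(fmorph_eq0 iB) -ew expf_neq0.
have fl0 : fr (L g) != 0 by rewrite fmorph_eq0.
have ecw : iB (c / w) = L g / om g * fr (L g / om g).
 rewrite !fmorph_div eL -ew fo exprS; have op0 : om g ^+ p != 0 by rewrite expf_neq0.
 by field; rewrite op0 o0.
have n1' : near1 (fr (L g / om g)) by exact: near1_morph.
have ncw : near1 (c / w).
 by rewrite -(QpBt_norm) rmorphB rmorph1 ecw; apply: near1M.
have oc : omega c = w.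
 apply: omegaP => //; apply: (fmorph_inj iB); rewrite rmorphXn -ew rmorph1 -exprM mulnC exprM o1 expr1n //.
have c0 : c != 0 by rewrite -pnorm_eq0 nc oner_eq0.
have zu : zint (iB u) by exact: zint_QpBt.
rewrite /angle oc (rmorphM iB) zpow_QpBt // ecw /etaB (rmorphM fr (L g ^ j)) fmorphXz (zpow_endo (@frob_norm _ _ S)) //.
have -> : iB (c ^ j) = L g ^ j * fr (L g) ^ j.
 by rewrite fmorphXz eL exprMz_comm ?unitfE //; exact: mulrC.
rewrite mulrACA [fr (L g) ^ j * _]mulrC -zpowM //; last by apply: near1_morph.
congr (_ * zpow _ _); rewrite rmorphXn !fmorph_div fo expr_div_n.
have -> : (om g ^+ p) ^+ p.+1 = om g ^+ p.+1 by rewrite -[RHS]op rmorphXn fo.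
rewrite !exprS; have op0 : om g ^+ p != 0 by rewrite expf_neq0.
have flp0 : fr (L g) ^+ p != 0 by rewrite expf_neq0.
by field; rewrite op0 o0 flp0.
Qed.

Lemma gam_bmx g c : is_cyclo eps g c ->
 exists A : 'M[B]_2, (forall i k, eva (pg_gam (D_ j u) c i k) (A i k)) /\
  map_mx iB (rho g) *m map_mx (galB g) bmx = bmx *m A.
Proof.
move=> gc; have [y [z [hy hz ev]]] := fg_eval j u_int gc.
pose m := y ^ j * zpow z (iB u); pose s := iB (c ^ j * zpow (angle c) u).
exists (mx2 (s * fr m) 0 0 (s * m)); split; last first.
 apply: rho_bmx; [exact: (gal_F j u_int nX gX hy hz)|exact: iB_fr|exact: chi_angle].
have ns : W (c ^ j * zpow (angle c) u).
 rewrite -(QpBt_norm) -(chi_angle gc) pnormM frob_norm.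
 have nz : near1 (L g / fr (L g) ^+ p) by exact: (near1_ratio g).
 have n2 : `|L g| = 1 by exact: lift_a_norm.
 have [_ We _] := etaB_spec g.
 have -> : `|L g ^ j * zpow (L g / fr (L g) ^+ p) (iB u)| = 1; last by rewrite mulr1; exact: Wp_le1.
 rewrite pnormM zpow_norm ?mulr1; [|exact: zint_QpBt|by []].
 by case: (j) => n; rewrite ?NegzE -?exprnN ?pnormV pnormX n2 expr1n ?invr1.
pose proof (eva_const ns) as es.
move=> i k; rewrite /D_ /= !mxE; case: (i == 0); case: (k == 0).
- by apply: eva_M => //; exact: eva_phi.
- exact: eva_0.
- exact: eva_0.
- by apply: eva_M.
Qed.

Lemma phi_bmx : exists A : 'M[B]_2, (forall i k, eva (pg_phi (D_ j u) i k) (A i k)) /\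
  map_mx fr bmx = bmx *m A.
Proof.
exists (mx2 0 1 q 0); split; last exact: frob_bmx.
move=> i k; rewrite /D_ /= !mxE; case: (i == 0); case: (k == 0).
- exact: eva_0.
- exact: eva_1.
- exact: eva_q.
- exact: eva_0.
Qed.

(** For g in the kernel of the cyclotomic character, g fixes pi, so the factors y and z reduce to 1
    and are fixed by phi^2, hence equal to 1. *)
Lemma inv_bmx g : fixes_cyclo g ->
 map_mx iB (rho g) *m map_mx (galB g) bmx = bmx.
Proof.
move=> ge; have gc : is_cyclo eps g 1.
 split; first exact: pnorm1.
 move=> n m hm; rewrite ge; have /cong_nat/eqP h : cong n (m%:R : K) 1%:R by apply: congS; rewrite mulr1n.
 by apply/eqP; rewrite -{1}[zeta n]expr1 eq_sym (eq_prim_root_expr (eps_prim n)).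
have [y [z [hy hz _]]] := fg_eval j u_int gc.
have ge1 : galB g pe = pe.
 rewrite gal_pe /pi_eps; congr (teich _ - 1); apply: tcoordP => n.
 by rewrite tcoord_gt ge.
have egs1 : egs g = 1 by rewrite /egs ge1 divff // pe_neq0.
have A1 : eA1 g = 1 by rewrite /eA1 egs1 !rmorph1 divr1.
have A2 : eA2 g = 1 by rewrite /eA2 A1 egs1 rmorph1 divr1 expr1n mulr1.
have one x : Wm (x - 1) -> fr2 x = x -> x = 1.
 move=> h e; apply/eqP; rewrite -subr_eq0; apply/eqP; apply: Wm_fix0 => //.
 by rewrite !rmorphB !rmorph1 e.
have y1 : y = 1 by case: hy => Wy my; rewrite A1 mul1r; exact: one.
have z1 : z = 1 by case: hz => Wz mz nz; rewrite A2 mul1r; exact: one.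
rewrite (rho_bmx (gal_F j u_int nX gX hy hz) _ (chi_angle gc)); last exact: iB_fr.
have o1 : omega (1 : K) = 1 by apply: omegaP; rewrite ?expr1n // divr1 subrr pnorm0 pinv_ge0.
rewrite y1 z1 /angle o1 divr1 !(zpow1, exp1rz, mulr1, rmorph1).
by rewrite /bmx mx2_mul !mulr0 !mulr1 !addr0 !add0r.
Qed.

End BasisEquations.

(** * The periods form a basis of D^dagger(V) over E^dagger *)

Section MainTheorem.
Context (j : int) (u : K) (u_int : W u).
Local Notation t := sdB.
Local Notation rho := (rho_ d sd a j (j%:~R + p.+1%:R * u)).
Context (X : B) (nX : `|X| = 1) (fX : fr2 X = eQ2 * X).
Context (gX : forall g y, is_yf g y -> galB g X = L g * y * X).
Local Notation F := (F_ju j u X).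
Local Notation q := (q_ju j u).
Local Notation b := (bmx j u X).

(** The inverse of q is q for the parameters -j and -u, which gives its overconvergence without a
    separate argument. *)
Lemma q_spec : [/\ AA q, LG q, AA q^-1, LG q^-1 & `|q| = 1].
Proof.
have [_ h1] := eva_q j u_int.
have nF : `|F| = 1 by exact: F_norm.
have eF : fr2 F = q * F by exact: fr2_F.
have nq : `|q| = 1.
 by have := congr1 (@pnorm _ _ B) eF; rewrite !frob_norm pnormM nF mulr1.
have n1 : near1 eQr by exact: eQr_near1.
have u_int' : W (- u) by rewrite pnormN.
have eqV : q^-1 = q_ju (- j) (- u).
 have nq0 := norm1N0 nq; apply: (mulfI nq0); rewrite divff // /q_ju mulrACA -expfzDr ?subrr ?expr0z ?mul1r.
  rewrite -zpowD ?rmorphN ?subrr //; try exact: zint_QpBt.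
   have e0 : zpow eQr 0%:R = eQr ^+ 0 by exact: zpow_nat.
   by rewrite expr0 mulr0n in e0.
  by rewrite -rmorphN; exact: zint_QpBt.
 by apply: norm1N0; exact: eQ2_norm.
have [_ h2] := eva_q (- j) u_int'; rewrite -eqV in h2.
by split=> //; [exact: AA_Adag|exact: LG_Adag|exact: AA_Adag|exact: LG_Adag].
Qed.

Lemma fr_q_spec x : AA x -> LG x -> AA (fr x) /\ LG (fr x).
Proof.
move=> h1 h2; split; first exact: AA_fr.
apply: LG_Adag; apply: (Adag_endo pe_endo_frob); exact: AA_LG_Adag.
Qed.

Lemma bmx_mul (x0 x1 v0 v1 : B) : (fr F / 2%:R * x0 + F / 2%:R * x1 = v0 /\
 fr F / (2%:R * t) * x0 + - (F / (2%:R * t)) * x1 = v1) <-> (x0 = (v0 + t * v1) / fr F /\ x1 = (v0 - t * v1) / F).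
Proof.
have [_ _ _ _ t0] := sdBP; have two0 : (2%:R : B) != 0 by exact: two_neq0.
have F0 : F != 0 by apply: norm1N0; exact: F_norm.
have fF0 : fr F != 0 by rewrite fmorph_eq0.
move: (fr F) F t fF0 F0 t0 => g f s g0 f0 s0.
by split=> [[<- <-]|[-> ->]]; split; field; rewrite ?f0 ?g0 ?s0 ?two0.
Qed.

Lemma bmx_col (x v : 'cV[B]_2) : b *m x = v <->
 (x 0 0 = (v 0 0 + t * v 1 0) / fr F /\ x 1 0 = (v 0 0 - t * v 1 0) / F).
Proof.
have e i : (b *m x) i 0 = b i 0 * x 0 0 + b i 1 * x 1 0.
 by rewrite mxE big_ord_recl big_ord1; congr (_ + b i _ * x _ 0); exact/val_inj.
rewrite -bmx_mul; split=> [<-|[h1 h2]]; first by rewrite !e !mxE.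
apply/colP => i; rewrite e !mxE; have [->|->] : i = 0 \/ i = 1 by case: i => -[|[|]] // hi; [left|right]; exact/val_inj.
 exact: h1.
exact: h2.
Qed.

(** Each entry is F or phi(F) times a factor fixed by phi^2, so it is a period for q or phi(q). *)
Lemma Bdag_bmx i k : Bdag eps (b i k).
Proof.
have [h1 h2 h3 h4 nq] := q_spec; have [hf1 hf2] := fr_q_spec h1 h2.
have nfq : `|fr q| = 1 by rewrite frob_norm.
have eF : fr2 F = q * F by exact: fr2_F.
have efF : fr2 (fr F) = fr q * fr F by rewrite eF rmorphM.
have [_ ft _ _ _] := sdBP; have fft : fr2 t = t by rewrite ft rmorphN ft opprK.
have f2 : fr (2%:R : B) = 2%:R by exact: rmorph_nat.
rewrite !mxE; move: q h1 h2 nq hf1 hf2 nfq eF efF => r {h3 h4} h1 h2 nq hf1 hf2 nfq.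
move: F => G eF efF; case: (i == 0); case: (k == 0).
- by apply: (period_Bdag hf1 hf2 nfq); rewrite !(rmorphM fr) /= !fmorphV /= !f2 efF mulrA.
- by apply: (period_Bdag h1 h2 nq); rewrite !(rmorphM fr) /= !fmorphV /= !f2 eF mulrA.
- by apply: (period_Bdag hf1 hf2 nfq); rewrite !(rmorphM fr) /= !fmorphV /= !(rmorphM fr) /= !f2 fft efF mulrA.
- apply: (period_Bdag h1 h2 nq).
 by rewrite !rmorphN !(rmorphM fr) /= !fmorphV /= !(rmorphM fr) /= !f2 fft eF mulrN mulrA.
Qed.

Lemma is_DV_bmx : is_DV_in_basis eps rho b (D_ j u).
Proof.
have [hq1 hq2 hq3 hq4 nq] := q_spec; have [_ ft nt _ t0] := sdBP.
have fft : fr2 t = t by rewrite ft rmorphN ft opprK.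
have nF : `|F| = 1 by exact: F_norm.
have eF : fr2 F = q * F by exact: fr2_F.
have F0 : F != 0 by exact: norm1N0.
split.
- move=> i; split=> [k|g hg]; first by rewrite mxE; exact: Bdag_bmx.
 by rewrite map_col !colE mulmxA (inv_bmx j u_int nX fX gX hg).
- move=> v [hv fv].
 pose x : 'cV[B]_2 := \col_i if i == 0 then (v 0 0 + t * v 1 0) / fr F else (v 0 0 - t * v 1 0) / F.
 have bx : b *m x = v by apply/bmx_col; rewrite !mxE.
 have ux y : v = b *m y -> x = y.
  move=> /esym/bmx_col[h1 h2]; apply/colP => i; rewrite mxE.
  have [->|->] : i = 0 \/ i = 1 by case: i => -[|[|]] // hi; [left|right]; exact/val_inj.
   by rewrite h1.
  by rewrite h2.
 exists x; split; last by move=> y [_]; exact: ux.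
 split=> // i.
 (* The basis is invariant under g, so the coordinates of an invariant vector are invariant by their
    uniqueness. *)
 have fx g : fixes_cyclo g -> forall i, galB g (x i 0) = x i 0.
  move=> hg k; have : x = map_mx (galB g) x.
   apply: ux; rewrite -[LHS](fv g hg) -bx map_mxM mulmxA.
   by rewrite (inv_bmx j u_int nX fX gX hg).
  have e2 : map_mx (galB g) x k 0 = galB g (x k 0) by rewrite [LHS]mxE.
  by move=> /colP/(_ k) e; exact: (esym (etrans e e2)).
 have [k0 hk0] := Bdag_regular (hv 0); have [k1 hk1] := Bdag_regular (hv 1).
 pose k := maxn k0 k1.
 have r0 := hk0 k (leq_maxl _ _); have r1 := hk1 k (leq_maxr _ _).
 have r1' : AA 1 by exact: AA_1.
 have rt : regular t.
  by apply: (@regular_period 1) => //; rewrite ?pnorm1 ?mul1r //; apply: LG_Wp => //; exact: Wp1.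
 have rtN : regular (- t).
  apply: (@regular_period 1) => //; rewrite ?pnorm1 ?pnormN ?mul1r //.
   by apply: LG_Wp => //; exact: Wp1.
  by rewrite !rmorphN fft.
 (* The inverse of the period satisfies phi^2(F^-1) = q^-1 F^-1, so the same criterion applies to
    it. *)
 have rF : regular F^-1.
  apply: (regular_period hq3 hq4); rewrite ?pnormV ?nq ?nF ?invr1 //.
  by rewrite !fmorphV eF invfM.
 have rfF : regular (fr F)^-1.
  have [a1 a2] := fr_q_spec hq3 hq4.
  apply: (regular_period a1 a2); rewrite ?frob_norm ?pnormV ?frob_norm ?nq ?nF ?invr1 //.
  by rewrite !fmorphV eF (rmorphM fr) invfM.
 have rx : regular (p%:R ^+ k * x i 0).
  rewrite mxE; case: (i == 0).
   have -> : p%:R ^+ k * ((v 0 0 + t * v 1 0) / fr F) = (p%:R ^+ k * v 0 0 + t * (p%:R ^+ k * v 1 0)) * (fr F)^-1 by ring.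
   by apply: regular_M => //; apply: regular_D => //; exact: regular_M.
  have -> : p%:R ^+ k * ((v 0 0 - t * v 1 0) / F) = (p%:R ^+ k * v 0 0 + (- t) * (p%:R ^+ k * v 1 0)) * F^-1 by ring.
  by apply: regular_M => //; apply: regular_D => //; exact: regular_M.
 have [g hg|f hf] := regular_fixed rx.
  by rewrite rmorphM rmorphXn rmorph_nat fx.
 by rewrite -(pX_iB k (x i 0)); exact: Edag_scale hf.
- have [A [hA eA]] := phi_bmx j u_int nX fX; exists A; split=> // i k; exact: eva_Edag.
- move=> g c gc; have [A [hA eA]] := gam_bmx j u_int nX fX gX gc.
 by exists A; split=> // i k; exact: eva_Edag.
Qed.

End MainTheorem.

End PhiGammaModules.

Theorem theorem4p3 (R : realType) (p : nat) (p_prime : prime p)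
    (S : padicSetup R p) (eps : tilt S) (eps_ok : is_eps eps)
    (d : Qp S) (sd : Cp S) (d_ok : Zp2_sqrt d sd)
    (a : galois S -> Cp S) (a_ok : lt_iso a)
    (j : int) (u : Qp S) (u_int : pnorm u <= 1) :
  is_DV eps (rho_ d sd a j (j%:~R + p.+1%:R * u)) (D_ j u).
Proof.
have [X [nX fX gX]] := X_ex p_prime eps_ok d_ok a_ok.
exists (bmx d sd j u X), (D_ j u); split; last exact: pg_iso_refl.
exact: (is_DV_bmx p_prime).
Qed.
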